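(* Let $G\in\mathcal{G}_{dis}$ (possibly generated by a non-compact family), and write $\mathcal{J}=\mathcal{J}_G$, $\hat{\mathcal{J}}=\hat{\mathcal{J}}_G$. Then the following hold. 1. $\infty\in F(G)$ (thus $\mathcal{J}=\hat{\mathcal{J}}$), and the connected component $F_\infty(G)$ of $F(G)$ containing $\infty$ is simply connected. Furthermore, the element $J_{\max}=J_{\max}(G)\in\mathcal{J}$ containing $\partial F_\infty(G)$ is the unique element of $\mathcal{J}$ satisfying $J\leq J_{\max}$ for each $J\in\mathcal{J}$. 2. There exists a unique element $J_{\min}=J_{\min}(G)\in\mathcal{J}$ such that $J_{\min}\leq J$ for each $J\in\mathcal{J}$. Furthermore, let $D$ be the unbounded component of $\mathbb{C}\setminus J_{\min}$. Then $P^{\ast}(G)\subset\hat{K}(G)\subset\mathbb{C}\setminus D$ and $\partial\hat{K}(G)\subset J_{\min}$. 3. If $G$ is generated by a family $\{h_\lambda\}_{\lambda\in\Lambda}$, then there exist two elements $\lambda_1,\lambda_2\in\Lambda$ satisfying: (a) there exist two elements $J_1,J_2\in\mathcal{J}$ with $J_1\neq J_2$ such that $J(h_{\lambda_i})\subset J_i$ for each $i=1,2$; (b) $J(h_{\lambda_1})\cap J_{\min}=\emptyset$; (c) for each $n\in\mathbb{N}$, $h_{\lambda_1}^{-n}(J(h_{\lambda_2}))\cap J(h_{\lambda_2})=\emptyset$ and $h_{\lambda_2}^{-n}(J(h_{\lambda_1}))\cap J(h_{\lambda_1})=\emptyset$; and (d) $h_{\lambda_1}$ has an attracting fixed point $z_1$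 in $\mathbb{C}$, $\mathrm{int}(K(h_{\lambda_1}))$ consists of only one immediate attracting basin for $z_1$, and $K(h_{\lambda_2})\subset\mathrm{int}(K(h_{\lambda_1}))$. Furthermore, $z_1\in\mathrm{int}(K(h_{\lambda_2}))$. 4. For each $g\in G$ with $J(g)\cap J_{\min}=\emptyset$, $g$ has an attracting fixed point $z_g$ in $\mathbb{C}$, $\mathrm{int}(K(g))$ consists of only one immediate attracting basin for $z_g$, and $J_{\min}\subset\mathrm{int}(K(g))$. Note that it is not necessarily true that $z_g=z_f$ when $g,f\in G$ are such that $J(g)\cap J_{\min}=\emptyset$ and $J(f)\cap J_{\min}=\emptyset$. 5. $\mathrm{int}(\hat{K}(G))\neq\emptyset$. Moreover, (a) $\mathbb{C}\setminus J_{\min}$ is disconnected, $\sharp J\geq2$ for each $J\in\hat{\mathcal{J}}$, and (b) for each $g\in G$ with $J(g)\cap J_{\min}=\emptyset$, we have $J_{\min}<g^{\ast}(J_{\min})$, $g^{-1}(J(G))\cap J_{\min}=\emptyset$, $g(\hat{K}(G)\cup J_{\min})\subset\mathrm{int}(\hat{K}(G))$, and the unique attracting fixed point $z_g$ of $g$ in $\mathbb{C}$ belongs to $\mathrm{int}(\hat{K}(G))$. 6. Let $\mathcal{A}$ be the set of all doubly connected components of $F(G)$. Then $\bigcup_{A\in\mathcal{A}}A\subset\mathbb{C}$ and $(\mathcal{A},\leq)$ is totally ordered.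
   Context: $\hat{\mathbb{C}}$ is the Riemann sphere. A polynomial semigroup is a semigroup, under composition, generated by a non-empty family of non-constant polynomial maps $\hat{\mathbb{C}}\to\hat{\mathbb{C}}$. The Fatou set $F(G)$ is the set of $z\in\hat{\mathbb{C}}$ having a neighborhood on which $G$ is a normal family; the Julia set is $J(G)=\hat{\mathbb{C}}\setminus F(G)$; for a single map $g$, $J(g)=J(\langle g\rangle)$, where $\langle g\rangle$ is the semigroup generated by $g$. $CV(g)$ is the set of critical values of $g:\hat{\mathbb{C}}\to\hat{\mathbb{C}}$, $P(G)=\overline{\bigcup_{g\in G}CV(g)}$ (closure in $\hat{\mathbb{C}}$), and $P^{\ast}(G)=P(G)\setminus\{\infty\}$. $\mathcal{G}$ is the set of all polynomial semigroups $G$ such that each element of $G$ has degree at least two and $P^{\ast}(G)$ is bounded in $\mathbb{C}$; $\mathcal{G}_{dis}$ is the set of $G\in\mathcal{G}$ with $J(G)$ disconnected. $\hat{\mathcal{J}}_G$ is the set of all connected components of $J(G)$, and $\mathcal{J}_G$ is the set of those contained in $\mathbb{C}$. Surrounding order: for connected sets $K_1,K_2\subset\mathbb{C}$, $K_1\leq K_2$ means that $K_1=K_2$ or $K_1$ is included in a bounded component of $\mathbb{C}\setminus K_2$; $K_1<K_2$ means $K_1\leq K_2$ and $K_1\neq K_2$. For $G\in\mathcal{G}$, $g\in G$ and a connected component $J$ of $J(G)$, the set $g^{-1}(J)$ is connected, and $g^{\ast}(J)$ denotes the connected component of $J(G)$ containing $g^{-1}(J)$. $\hat{K}(G)=\{z\in\mathbb{C}\mid\bigcup_{g\in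 G}\{g(z)\}\text{ is bounded in }\mathbb{C}\}$ is the smallest filled-in Julia set, and $K(g)=\hat{K}(\langle g\rangle)$ for a polynomial $g$. $\mathrm{int}$ denotes the set of interior points. $\sharp$ denotes cardinality. $h^{-n}$ denotes the preimage under the $n$-th iterate $h^n$. A domain in $\hat{\mathbb{C}}$ is doubly connected if its complement in $\hat{\mathbb{C}}$ has exactly two connected components. *)

(* Defs.v *)
From HB Require Import structures.
From mathcomp Require Import all_boot all_order all_algebra.
From mathcomp Require Import complex.
From mathcomp Require Import all_classical all_reals all_analysis.

Set Implicit Arguments.
Unset Strict Implicit.
Unset Printing Implicit Defensive.

Import Order.TTheory GRing.Theory Num.Theory numFieldNormedType.Exports.

Local Open Scope classical_set_scope.
Local Open Scope card_scope.
Local Open Scope ring_scope.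

(* Giving R[i] the type numClosedFieldType (rather than Type) is what makes   *)
(* the norm topology of numFieldNormedType available on it.                   *)
Definition Cplx (R : realType) : numClosedFieldType := R[i].

(* The Riemann sphere: Some z is the finite point z, None the point oo.       *)
Notation sphere R := (one_point_compactification (Cplx R)).

Definition infty {R : realType} : sphere R := None.

Section Topology.
Variable T : topologicalType.

Definition boundary (A : set T) : set T := closure A `\` A°.

Definition components (A : set T) : set (set T) :=
  [set connected_component A x | x in A].

Definition doubly_connected (U : set T) : Prop :=
  [/\ open U, connected U & components (~` U) #= `I_2].

Definition path_in (R : realType) (U : set T) (f : R -> T) : Prop :=
  {within `[0, 1]%classic, continuous f} /\ f @` `[0, 1]%classic `<=` U.

Definition null_homotopic_in (R : realType) (U : set T) (f : R -> T) : Prop :=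
  exists H : R * R -> T,
    [/\ {within `[0, 1]%classic `*` `[0, 1]%classic, continuous H},
        H @` (`[0, 1]%classic `*` `[0, 1]%classic) `<=` U,
        {in `[0, 1], forall t, H (0, t) = f t /\ H (1, t) = f 0} &
        {in `[0, 1], forall s, H (s, 0) = f 0 /\ H (s, 1) = f 0}].

Definition simply_connected (R : realType) (U : set T) : Prop :=
  [/\ U !=set0,
      (forall x y, U x -> U y ->
         exists f : R -> T, [/\ path_in U f, f 0 = x & f 1 = y]) &
      (forall f : R -> T, path_in U f -> f 0 = f 1 -> null_homotopic_in U f)].

End Topology.

Definition totally_ordered (T : Type) (A : set T) (le : T -> T -> Prop) : Prop :=
  [/\ (forall x, A x -> le x x),
      (forall x y, A x -> A y -> le x y -> le y x -> x = y),
      (forall x y z, A x -> A y -> A z -> le x y -> le y z -> le x z) &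
      total_on A le].

Section PolynomialSemigroups.
Variable R : realType.
Local Notation C := (Cplx R).
Implicit Types (p g : {poly C}) (G A : set {poly C}).

(* A subset of the plane, seen as a subset of the sphere.                     *)
Definition emb (K : set C) : set (sphere R) := Some @` K.

Definition finite_part (K : set (sphere R)) : set C := Some @^-1` K.

(* The map of the sphere induced by a non-constant polynomial.                *)
Definition sphere_map p (z : sphere R) : sphere R :=
  if z is Some c then Some p.[c] else infty.

Definition degree p : nat := (size p).-1.

(* Semigroups of polynomial maps are represented as sets of polynomials: a    *)
(* polynomial over C is determined by the map it induces, and \Po is          *)
(* composition of maps.                                                       *)
Definition generated A : set {poly C} :=
  smallest [set M | forall p q, M p -> M q -> M (p \Po q)] A.

Definition polynomial_semigroup G : Prop :=
  exists A, [/\ A !=set0, (forall p, A p -> (1 <= degree p)%N) & G = generated A].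

Definition chordal (z w : sphere R) : C :=
  match z, w with
  | Some a, Some b =>
      `|a - b| / (sqrtC (1 + `|a| ^+ 2) * sqrtC (1 + `|b| ^+ 2))
  | Some a, None | None, Some a => (sqrtC (1 + `|a| ^+ 2))^-1
  | None, None => 0
  end.

Definition locally_uniformly_cvg (U : set (sphere R))
    (f : nat -> sphere R -> sphere R) (l : sphere R -> sphere R) : Prop :=
  forall z, U z -> exists2 V, nbhs z V &
    forall e : C, 0 < e -> \forall n \near \oo,
      forall w, (U `&` V) w -> chordal (f n w) (l w) < e.

Definition normal_family (U : set (sphere R))
    (F : set (sphere R -> sphere R)) : Prop :=
  forall f : nat -> sphere R -> sphere R, (forall n, F (f n)) ->
    exists phi : nat -> nat, {homo phi : m n / (m < n)%N} /\
      exists l, locally_uniformly_cvg U (fun n => f (phi n)) l.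

Definition fatou_set G : set (sphere R) :=
  [set z | exists2 U, open_nbhs z U & normal_family U (sphere_map @` G)].

Definition julia_set G : set (sphere R) := ~` fatou_set G.

Definition julia1 g : set (sphere R) := julia_set (generated [set g]).

(* In the coordinate 1/z, a polynomial of degree d >= 1 has the form          *)
(* c w^d + O(w^(d+1)), c != 0, at infinity: its derivative vanishes there iff *)
(* d >= 2.                                                                    *)
Definition critical_points g : set (sphere R) :=
  [set z | if z is Some c then g^`().[c] = 0 else (2 <= degree g)%N].

Definition critical_values g : set (sphere R) :=
  sphere_map g @` critical_points g.

Definition postcritical G : set (sphere R) :=
  closure (\bigcup_(g in G) critical_values g).

Definition finite_postcritical G : set C := finite_part (postcritical G).

Definition classG G : Prop :=
  [/\ polynomial_semigroup G, (forall g, G g -> (2 <= degree g)%N) &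
      bounded_set (finite_postcritical G)].

Definition classGdis G : Prop := classG G /\ ~ connected (julia_set G).

Definition Jhat G : set (set (sphere R)) := components (julia_set G).

Definition Jset G : set (set C) := [set K | Jhat G (emb K)].

Definition surr_le (K1 K2 : set C) : Prop :=
  K1 = K2 \/
  exists B, [/\ components (~` K2) B, bounded_set B & K1 `<=` B].

Definition surr_lt (K1 K2 : set C) : Prop := surr_le K1 K2 /\ K1 <> K2.

Definition is_greatest_component G (K : set C) : Prop :=
  Jset G K /\ forall J, Jset G J -> surr_le J K.

Definition is_least_component G (K : set C) : Prop :=
  Jset G K /\ forall J, Jset G J -> surr_le K J.

(* K is g^*(J). *)
Definition is_pullback_component G g (J K : set (sphere R)) : Prop :=
  Jhat G K /\ sphere_map g @^-1` J `<=` K.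

Definition Finfty G : set (sphere R) := connected_component (fatou_set G) infty.

Definition Khat G : set C := [set z | bounded_set [set g.[z] | g in G]].

Definition filled_julia g : set C := Khat (generated [set g]).

Definition attracting_fixed_point g (z : C) : Prop :=
  g.[z] = z /\ `|g^`().[z]| < 1.

Definition immediate_basin g (z : C) : set C :=
  connected_component
    [set w | iter n (fun x => g.[x]) w @[n --> \oo] --> z] z.

Definition doubly_connected_fatou_components G : set (set (sphere R)) :=
  [set U | components (fatou_set G) U /\ doubly_connected U].

End PolynomialSemigroups.

(* Main.v *)
Require Import Defs.
From HB Require Import structures.
From mathcomp Require Import all_boot all_order all_algebra.
From mathcomp Require Import complex.
From mathcomp Require Import all_classical all_reals all_analysis.
From mathcomp Require Import ring lra zify separable cyclic cyclotomic.

Set Implicit Arguments.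
Unset Strict Implicit.
Unset Printing Implicit Defensive.

Import Order.TTheory GRing.Theory Num.Theory numFieldNormedType.Exports.

Local Open Scope classical_set_scope.
Local Open Scope card_scope.
Local Open Scope ring_scope.

(* The proof works with the compact sets pc h w = w^-1(K(h)), where h is in G and w is in G or the
   identity. Since P*(G) is bounded, these sets and their boundaries are connected; two of them
   with disjoint boundaries are nested, and all of them contain P*(G); their boundaries are dense
   in J(G). If infinity were in J(G), a separation of J(G) would give two families of boundaries
   whose rates of growth under iteration contradict Harnack's inequality. J_min is the component
   of a boundary point of the smallest filled-in Julia set. If J(g) misses J_min, then g maps some
   pc g w into its interior; this yields the attracting fixed point, and the fact that no Fatou
   component of g escapes its basin follows by perturbing g along an orbit. The domain of infinity
   is simply connected because its complement is connected, which is proved with square grids. *)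

(** All maps are polynomials, so the analysis stays algebraic: the maximum principle and open
    mapping come from local factorizations, Cauchy estimates and the Poisson kernel from sums over
    roots of unity. Montel's theorem is replaced by [equicont_avoid]: where g avoids J(h), Harnack's
    inequality for log|h^n o g| controls g. Boundedness of P*(G) enters through connected
    lemniscates: above all critical values a separation of a sublevel set of |Q| would propagate
    upwards until it separates a large disc. The obstacle is that an infinite family has no common
    escape radius, so infinity might be a limit of J(G). To exclude this, one fixed g is iterated
    after arbitrary words w. Points on the side of infinity grow at a rate independent of w; points
    very close to the connected set [pc g w], which is not small because it contains P*(G), grow at
    a rate as small as desired; one application of g relates two such points. J_min must also be
    shown not to be a single point: otherwise all elements are monomials around it, and the radii of
    circles contained in J(G) become dense. *)

Section ConnectedSets.
Variable T : topologicalType.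
Implicit Types A U V B : set T.

(** * Connectedness and compactness in general topological spaces *)

Lemma disjI A B : (forall x, A x -> B x -> False) -> A `&` B = set0.
Proof. by move=> h; apply/seteqP; split=> // x [Ax]; exact: h. Qed.

Lemma disjE A B x : A `&` B = set0 -> A x -> B x -> False.
Proof. by move=> E Ax Bx; rewrite -[False]/(set0 x) -E. Qed.

Lemma connected_open_split A U V : connected A -> open U -> open V ->
 A `<=` U `|` V -> (forall x, A x -> U x -> V x -> False) -> A `&` U !=set0 -> A `<=` U.
Proof.
move=> cA oU oV AUV I AU; have -> : A = A `&` U; last by move=> x [].
apply/esym/cA => //; first by exists U.
exists (~` V); first exact: open_closedC.
apply/seteqP; split=> x [Ax h]; split=> //; first exact: I Ax h.
by have [] := AUV _ Ax.
Qed.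

Lemma connected_closed_split A U V : connected A -> closed U -> closed V ->
 A `<=` U `|` V -> (forall x, A x -> U x -> V x -> False) -> A `&` U !=set0 -> A `<=` U.
Proof.
move=> cA cU cV AUV I [x [Ax Ux]].
have : A `<=` ~` V; last by move=> h y Ay; have [|/(h y Ay)] := AUV _ Ay.
apply: (@connected_open_split _ _ (~` U)) => //; [exact: closed_openC|exact: closed_openC| | |].
- by move=> y Ay; have [Uy|?] := pselect (U y); [left=> /(I _ Ay Uy)|right].
- by move=> y /AUV[].
by exists x; split=> // /(I _ Ax Ux).
Qed.

Lemma connected_clopen U : connected [set: T] -> open U -> closed U -> U !=set0 -> [set: T] `<=` U.
Proof.
move=> cT oU cU [x Ux]; apply: (connected_open_split cT oU (closed_openC cU)) => //; last by exists x.
by move=> y _; have [?|?] := pselect (U y); [left|right].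
Qed.

Lemma open_frontier U y : connected [set: T] -> open U -> U !=set0 -> ~ U y ->
 exists2 x, closure U x & ~ U x.
Proof.
move=> cT oU U0 nUy; apply: contrapT => no; apply: nUy; apply: (connected_clopen cT oU _ U0) => // x clx.
by apply: contrapT => nx; apply: no; exists x.
Qed.

Lemma not_connected_open A : ~ connected A -> exists U V,
 [/\ open U, open V, A `<=` U `|` V, (forall x, A x -> U x -> V x -> False) &
   A `&` U !=set0 /\ A `&` V !=set0].
Proof.
move=> /connectedPn[E [Ene AE [/disjE s1 /disjE s2]]].
have sub := @subset_closure T; exists (~` closure (E true)), (~` closure (E false)).
split; [exact/closed_openC/closed_closure|exact/closed_openC/closed_closure|..].
- by move=> x; rewrite AE => -[] Ex; [left=> /(s2 _ Ex)|right=> /s1-/(_ Ex)].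
- by move=> x; rewrite AE => -[/sub|/sub].
split; [have [x Ex] := Ene false|have [x Ex] := Ene true]; exists x; rewrite AE.
 by split; [left|move=> /(s2 _ Ex)].
by split; [right|move=> /s1-/(_ Ex)].
Qed.

Lemma not_connected_closed A : closed A -> ~ connected A -> exists U V,
 [/\ closed U, closed V, A = U `|` V, U `&` V = set0 & U !=set0 /\ V !=set0].
Proof.
move=> cA /not_connected_open[U [V [oU oV AUV I [[x [Ax Ux]] [y [Ay Vy]]]]]].
exists (A `&` ~` V), (A `&` ~` U).
split; [by apply: closedI => //; exact: open_closedC|by apply: closedI => //; exact: open_closedC|..].
- apply/seteqP; split=> [z Az|z [[]|[]]//].
  by have [h|h] := AUV _ Az; [left|right]; split=> // /(I _ Az); apply.
- by apply: disjI => z [Az nV] [_ nU]; case: (AUV _ Az).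
by split; [exists x|exists y]; split=> // /(I _); apply.
Qed.

(** The interior and the exterior of [A] are open and leave out only the boundary. Most later
    inclusions of a connected set in a filled-in piece are obtained this way. *)
Lemma boundary_crossing A B : connected B -> B `&` A !=set0 ->
 B `&` boundary A = set0 -> B `<=` A°.
Proof.
move=> cB BA BdA; have I x : B x -> closure A x -> A° x.
 move=> Bx cAx; apply: contrapT => nAx.
 by apply: disjE BdA Bx _.
apply: (@connected_open_split _ _ (~` closure A)) => //.
- exact: open_interior.
- exact/closed_openC/closed_closure.
- by move=> x Bx; have [/(I _ Bx)|] := pselect (closure A x); [left|right].
- by move=> x _ /interior_subset Ax; apply; apply: subset_closure.
by case: BA => x [Bx Ax]; exists x; split=> //; apply: I => //; apply: subset_closure.
Qed.

Lemma boundaryE A : closed A -> boundary A = A `\` A°.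
Proof. by move=> cA; rewrite /boundary -(closure_id A).1. Qed.

Lemma closed_boundary A : closed (boundary A).
Proof.
rewrite /boundary setDE; apply: closedI; first exact: closed_closure.
exact/open_closedC/open_interior.
Qed.

Lemma connected_IVT (R : realType) (f : T -> R) A a b t : connected A ->
 continuous f -> A a -> A b -> f a <= t -> t <= f b -> exists2 x, A x & f x = t.
Proof.
move=> cA cf Aa Ab fat tfb; apply: contrapT => no.
have ne x : A x -> f x != t by move=> Ax; apply/eqP => fx; apply: no; exists x.
have : A `<=` f @^-1` [set y | y < t].
 apply: (@connected_open_split _ _ (f @^-1` [set y | t < y])) => //.
 - by apply: open_comp => [x _|]; [exact: cf|exact: open_lt].
 - by apply: open_comp => [x _|]; [exact: cf|exact: open_gt].
 - by move=> x /ne; rewrite neq_lt => /orP[]; [left|right].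
 - by move=> x _ /= /lt_trans h /h; rewrite ltxx.
 by exists a; split=> //=; rewrite lt_neqAle ne.
by move=> /(_ _ Ab)/=; rewrite ltNge tfb.
Qed.

(** Compactness of [K 0] in its near-covering form, with the filter at infinity as parameter: each
    point of [K 0] lies in [O] or has a neighbourhood that misses some [K m], hence all later
    ones. *)
Lemma nested_compact_subset (K : nat -> set T) O : hausdorff_space T ->
 (forall n, compact (K n)) -> (forall n, K n.+1 `<=` K n) -> open O ->
 \bigcap_n K n `<=` O -> exists n, forall m, (n <= m)%N -> K m `<=` O.
Proof.
move=> hT cK dK oO sO.
have dKn n m : (n <= m)%N -> K m `<=` K n.
 elim: m => [|m IH]; first by rewrite leqn0 => /eqP ->.
 rewrite leq_eqVlt => /orP[/eqP -> //|]; rewrite ltnS => /IH h.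
 exact: subset_trans (dK m) h.
have /compact_near_coveringP cov := cK 0%N.
have [|n _ nP] := cov nat \oo (fun n x => ~ K n x \/ O x) _ _.
 move=> x K0x; have [Ox|nOx] := pselect (O x).
  exists (O, setT); first by split=> /=; [exact: open_nbhs_nbhs|exact: filterT].
  by move=> [y n] [/= Oy _]; right.
 have [m nKm] : exists m, ~ K m x.
  by apply/existsNP => h; apply: nOx; apply: sO => m _; apply: h.
 exists (~` K m, [set n | (m <= n)%N]).
  split=> /=; last by exists m.
  by apply: open_nbhs_nbhs; split=> //; exact: closed_openC (compact_closed hT (cK m)).
 by move=> [y n] [/= nKy mn]; left=> Kny; apply: nKy; apply: dKn mn _ Kny.
exists n => m nm x Kmx.
have K0x : K 0%N x by apply: dKn Kmx.
by have [|] := nP m nm x K0x.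
Qed.
End ConnectedSets.

(** * Components and quasi-components of a compact Hausdorff space *)

Section QuasiComponents.
Variables (R : realType) (T : topologicalType).
Hypotheses (hT : hausdorff_space T) (cT : compact [set: T]).
Implicit Types A B F J U V : set T.

Lemma separate_closed A B : closed A -> closed B -> A `&` B = set0 ->
 exists U V, [/\ open U, open V, A `<=` U, B `<=` V & U `&` V = set0].
Proof. by apply: (@normal_openP R T).1; exact: compact_normal. Qed.

(* The intersection of the relatively clopen sets containing x is connected. *)
Lemma component_nbhd J x N : closed J -> J x -> open N -> connected_component J x `<=` N ->
 exists F1 F2, [/\ closed F1, closed F2, J = F1 `|` F2, F1 `&` F2 = set0 & F2 x /\ F2 `<=` N].
Proof.
move=> clJ Jx oN JN; pose clop F := [/\ closed F, F `<=` J, closed (J `\` F) & F x].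
have clopI F F' : clop F -> clop F' -> clop (F `&` F').
 move=> [a b c d] [a' b' c' d']; split; [exact: closedI|by move=> z [/b]| |by []].
 by rewrite setDIr; exact: closedU.
have clopJ : clop J by split=> //; rewrite setDv; exact: closed0.
pose Q : set T := [set z | forall F, clop F -> F z].
have clQ : closed Q by apply: (@closed_bigI _ _ clop id) => F [].
have QJ : Q `<=` J by move=> z /(_ J clopJ).
have Qx : Q x by move=> F [].
have claim O : open O -> Q `<=` O -> exists2 F, clop F & F `<=` O.
 move=> oO QO; apply: contrapT => no; pose Z := J `\` O.
 have cZ : compact Z.
  by apply: subclosed_compact cT _ => //; rewrite /Z setDE; apply: closedI => //; exact: open_closedC.
 (* If no relatively clopen set around [x] fits in [O], the traces of these sets on the compact [Z]
    form a filter base; a cluster point lies in every clopen set, hence in [Q], yet outside [O]. *)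
 have FF : ProperFilter (filter_from clop (fun F => F `&` Z)).
  apply: filter_from_proper; last first.
   move=> F cF; apply: contrapT => h; apply: no; exists F => // z Fz; apply: contrapT => nz; apply: h.
   by exists z; split=> //; split=> //; have [_ + _ _] := cF; apply.
  apply: filter_from_filter; first by exists J.
  move=> F F' cF cF'; exists (F `&` F'); first exact: clopI.
  by move=> z [[Fz F'z] Zz].
 have [|p [[Jp nOp] cp]] := cZ _ FF; first by exists J => // z [].
 apply: nOp; apply: QO => F cF; have [clF _ _ _] := cF; rewrite (closure_id F).1// => B /cp.
 by move=> /(_ (F `&` Z))[|z [[Fz _] Bz]]; [exists F|exists z].
suff cQ : connected Q.
 have [|F [a b c d] FN] := claim N oN; first by move=> z Qz; apply/JN/(connected_component_max Qx QJ cQ).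
 by exists (J `\` F), F; split=> //; [rewrite setUC setDUK|rewrite setIC setDIK].
apply: contrapT => /(not_connected_closed clQ)[U [V [cU cV QUV UV0 [U0 V0]]]].
have [U' [V' [oU oV UU VV UV']]] := separate_closed cU cV UV0.
(* A clopen set contained in the disjoint union of [A] and [B] stays clopen when cut down to [A], so
   [Q] cannot reach [B]. *)
have key A B : open A -> open B -> Q `<=` A `|` B -> A `&` B = set0 -> A x -> Q `<=` A.
 move=> oA oB QAB AB0 Ax; have [F [clF FJ clJF Fx] FAB] := claim _ (openU oA oB) QAB.
 move=> z Qz; suff /Qz[] : clop (F `&` A) by [].
 have E1 : F `&` A = F `&` ~` B.
  apply/seteqP; split=> w [Fw]; first by move=> Aw; split=> // Bw; have : set0 w by rewrite -AB0.
  by move=> nB; split=> //; case: (FAB w Fw).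
 split=> //; [|by move=> w [/FJ]|].
  by rewrite E1; apply: closedI => //; exact: open_closedC.
 rewrite setDIr; apply: closedU => //.
 have -> : J `\` A = J `&` ~` A by rewrite setDE.
 by apply: closedI => //; exact: open_closedC.
have QUV' : Q `<=` U' `|` V' by rewrite QUV; exact: setUSS.
have := Qx; rewrite QUV => -[/UU Ux|/VV Vx].
 have [v Vv] := V0; have : set0 v; last by [].
 by rewrite -UV'; split; [apply: (key U' V') => //; rewrite QUV; right|exact: VV].
have [u Uu] := U0; have : set0 u; last by [].
rewrite -UV'; split; first exact: UU.
by apply: (key V' U') => //; [rewrite setUC|rewrite setIC|rewrite QUV; left].
Qed.

Lemma quasi_component J x y : closed J -> J x -> J y -> ~ connected_component J x y ->
 exists F1 F2, [/\ closed F1, closed F2, J = F1 `|` F2, F1 `&` F2 = set0 & F1 x /\ F2 y].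
Proof.
move=> clJ Jx Jy nxy; have oy : open (~` [set y]).
 by apply: closed_openC; apply: accessible_closed_set1; exact: hausdorff_accessible.
have [|F1 [F2 [c1 c2 JE F0 [F2x F2y]]]] := component_nbhd clJ Jx oy.
 by move=> z cz zy; apply: nxy; rewrite -zy.
exists F2, F1; split=> //; [by rewrite setUC|by rewrite setIC|split=> //].
by move: Jy; rewrite JE => -[//|h]; case: (F2y _ h).
Qed.

End QuasiComponents.

Section ComponentNeighbourhoods.
Variable T : topologicalType.
Implicit Types A U V : set T.

Lemma connected_add_limit A p : connected A -> closure A p -> connected (A `|` [set p]).
Proof.
move=> cA clp; apply: contrapT => /not_connected_open[U [V [oU oV AUV I [AU AV]]]].
have main U' V' : open U' -> open V' -> A `|` [set p] `<=` U' `|` V' ->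
  (forall x, (A `|` [set p]) x -> U' x -> V' x -> False) -> U' p -> (A `|` [set p]) `&` V' !=set0 -> False.
 move=> oU' oV' sub dis U'p [v [Av V'v]].
 have [u [Au U'u]] := clp U' (open_nbhs_nbhs (conj oU' U'p)).
 apply: (dis v) => //; case: Av => [|->//]; apply: (connected_open_split cA oU' oV').
 - by move=> z Az; apply: sub; left.
 - by move=> z Az; apply: dis; left.
 - by exists u.
have [Up|Vp] := AUV p (or_intror erefl); first exact: (main U V).
by apply: (main V U) => // [|x Ax Vx Ux]; [rewrite (setUC V)|exact: I Ax Ux Vx].
Qed.

End ComponentNeighbourhoods.

(** * Discrete plane topology: crossing parity and the runs of a filled set of cells *)

Section RunGraph.
Implicit Types (a b p q : int * int) (x y i j l r : int) (Y : int * int -> Prop) (f : int -> int -> bool).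

Definition adj8 a b := [/\ a.1 <= b.1 + 1, b.1 <= a.1 + 1, a.2 <= b.2 + 1 & b.2 <= a.2 + 1].

Definition adj4 p q := p.1 = q.1 /\ (p.2 = q.2 + 1 \/ q.2 = p.2 + 1) \/
 p.2 = q.2 /\ (p.1 = q.1 + 1 \/ q.1 = p.1 + 1).

(* The step from a to b crosses the vertical half line above (x, y), taken
  between the columns x and x + 1. *)
Definition cross x y a b : bool :=
 [&& a.1 == x, b.1 == x + 1 & y < a.2] || [&& b.1 == x, a.1 == x + 1 & y < b.2].

(** The last argument carries the parity of the crossings of every half line; for a closed path it
    is the winding number modulo 2. Paths may step diagonally ([adj8]), dually to the edge steps
    [adj4] by which the outside spreads. *)
Inductive cpath Y : int * int -> int * int -> (int -> int -> bool) -> Prop :=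
| cpath_nil a : Y a -> cpath Y a a (fun _ _ => false)
| cpath_cons a b c f : Y a -> adj8 a b -> cpath Y b c f -> cpath Y a c (fun x y => cross x y a b (+) f x y).

Lemma cpath_mem Y a b f : cpath Y a b f -> Y a /\ Y b.
Proof. by elim=> // {}a {}b c g Ya _ _ []. Qed.

Lemma cpath_sub Y Y' a b f : (forall p, Y p -> Y' p) -> cpath Y a b f -> cpath Y' a b f.
Proof. by move=> YY; elim=> [p /YY|p q c g /YY Yp pq _]; [exact: cpath_nil|exact: cpath_cons]. Qed.

Lemma cpath_trans Y a b c f g : cpath Y a b f -> cpath Y b c g ->
 exists2 h, cpath Y a c h & forall x y, h x y = f x y (+) g x y.
Proof.
move=> ab; elim: ab g => [p Yp g pc|p q d h Yp pq _ IH g dc]; first by exists g.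
have [k qk kE] := IH g dc; exists (fun x y => cross x y p q (+) k x y).
 exact: cpath_cons.
by move=> x y; rewrite kE addbA.
Qed.

(** The half lines above (x, y) and (x, y + 1) differ only in the cell (x, y + 1), which the path
    avoids. *)
Lemma cpath_up Y a b f x y : cpath Y a b f -> ~ Y (x, y + 1) -> f x y = f x (y + 1).
Proof.
move=> + nY; elim=> [//|p q c g Yp pq qc ->]; congr (_ (+) _).
have [Yq _] := cpath_mem qc.
have pn : p <> (x, y + 1) by move=> E; apply: nY; rewrite -E.
have qn : q <> (x, y + 1) by move=> E; apply: nY; rewrite -E.
case: p q pn qn {Yp Yq qc pq} => [p1 p2] [q1 q2] pn qn; rewrite /cross /=.
have {}pn : p1 <> x \/ p2 <> y + 1 by have [E1|?] := eqVneq p1 x; [right=> E; apply: pn; rewrite E1 E|left; apply/eqP].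
have {}qn : q1 <> x \/ q2 <> y + 1 by have [E1|?] := eqVneq q1 x; [right=> E; apply: qn; rewrite E1 E|left; apply/eqP].
lia.
Qed.

(** A step that crosses exactly one of the two half lines enters or leaves the part of column x + 1
    above height y, so the parities telescope to the end points. A diagonal step cannot slip past,
    because the cells at height y are excluded. *)
Lemma cpath_right Y a b f x y : cpath Y a b f -> ~ Y (x, y) -> ~ Y (x + 1, y) ->
 f x y (+) f (x + 1) y = ((a.1 == x + 1) && (y < a.2)) (+) ((b.1 == x + 1) && (y < b.2)).
Proof.
move=> + nY nY'; elim=> [p _|p q c g Yp pq qc IH]; first by rewrite !addbb.
have [Yq _] := cpath_mem qc.
have ne (o o' : int * int) : Y o -> ~ Y o' -> o.1 <> o'.1 \/ o.2 <> o'.2.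
 case: o o' => [d1 d2] [e1 e2] Yo Yo' /=; have [E|?] := eqVneq d1 e1; last by left; apply/eqP.
 by right=> E'; apply: Yo'; rewrite -E -E'.
have step : cross x y p q (+) cross (x + 1) y p q =
  ((p.1 == x + 1) && (y < p.2)) (+) ((q.1 == x + 1) && (y < q.2)).
 have := ne _ _ Yp nY; have := ne _ _ Yp nY'; have := ne _ _ Yq nY; have := ne _ _ Yq nY'.
 move: pq; rewrite /adj8 /cross; case: p q {Yp Yq qc IH} => [p1 p2] [q1 q2] /= [] a1 a2 a3 a4 b1 b2 b3 b4.
 move: a1 a2 a3 a4 b1 b2 b3 b4; clear.
 case: (ltP y p2) => y1; case: (ltP y q2) => y2; rewrite ?andbT ?andbF ?orbF ?orFb.
 - by case: (eqVneq p1 x) => e1; case: (eqVneq p1 (x + 1)) => e2; lia.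
 - by case: (eqVneq p1 x) => e1; case: (eqVneq p1 (x + 1)) => e2; lia.
 - by case: (eqVneq p1 x) => e1; case: (eqVneq p1 (x + 1)) => e2; lia.
 - by [].
have -> : cross x y p q (+) g x y (+) (cross (x + 1) y p q (+) g (x + 1) y) =
  (cross x y p q (+) cross (x + 1) y p q) (+) (g x y (+) g (x + 1) y).
 by case: (cross x y p q); case: (cross (x + 1) y p q); case: (g x y); case: (g (x + 1) y).
by rewrite step IH; case: (_ && _); case: (_ && _); case: (_ && _).
Qed.

Lemma cpath_no_cross Y a b f x y : cpath Y a b f -> (forall y', y < y' -> ~ Y (x, y')) -> f x y = false.
Proof.
move=> + nY; elim=> [//|p q c g Yp pq qc ->]; rewrite addbF; apply/negbTE/negP.
have [Yq _] := cpath_mem qc.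
case: p q Yp Yq {pq qc} => [p1 p2] [q1 q2] Yp Yq; rewrite /cross /= => /orP[] /and3P[/eqP E _ h].
 by apply: (nY p2 h); rewrite -E.
by apply: (nY q2 h); rewrite -E.
Qed.

Lemma cpath_below Y a b f x y : cpath Y a b f -> (forall p, Y p -> y < p.2) ->
 f x y = (a.1 <= x) (+) (b.1 <= x).
Proof.
move=> + hY; elim=> [p _|p q c g Yp pq qc ->]; first by rewrite addbb.
have [/hY hq _] := cpath_mem qc; have hp := hY p Yp.
have -> : cross x y p q = (p.1 <= x) (+) (q.1 <= x).
 move: pq hp hq; rewrite /adj8 /cross; case: p q {Yp qc} => [p1 p2] [q1 q2] /= [] *; lia.
by rewrite -addbA addKb.
Qed.

Lemma cpath_row Y l (k : nat) j : (forall i, l <= i <= l + k%:Z -> Y (i, j)) ->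
 exists2 f, cpath Y (l, j) (l + k%:Z, j) f &
  forall x y, f x y = [&& l <= x, x < l + k%:Z & y < j].
Proof.
elim: k l => [|k IH] l hY.
 exists (fun _ _ => false); first by rewrite addr0; apply: cpath_nil; apply: hY; rewrite lexx addr0 lexx.
 by move=> x y; lia.
have [|f pf fE] := IH (l + 1); first by move=> i hi; apply: hY; lia.
exists (fun x y => cross x y (l, j) (l + 1, j) (+) f x y).
 apply: cpath_cons; first by apply: hY; lia.
  by rewrite /adj8 /=; split; lia.
 by have -> : l + k.+1%:Z = l + 1 + k%:Z by lia.
by move=> x y; rewrite fE /cross /=; lia.
Qed.

Lemma cpath_sym Y a b f : cpath Y a b f -> exists g, cpath Y b a g.
Proof.
elim=> [p Yp|p q c g Yp pq qc [h ch]]; first by exists (fun _ _ => false); exact: cpath_nil.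
have [Yq _] := cpath_mem qc; have qp : adj8 q p by move: pq; rewrite /adj8 => -[].
have [k ck _] := cpath_trans ch (cpath_cons Yq qp (cpath_nil Yp)).
by exists k.
Qed.

Section Filled.
Variables (F : int * int -> Prop) (n : int).

Definition far p := (n < `|p.1|) || (n < `|p.2|).

(** Far cells seed the exterior, so that [inside] is [F] with its bounded holes filled. *)
Inductive outside : int * int -> Prop :=
| outside_far p : far p -> outside p
| outside_step p q : outside p -> adj4 p q -> ~ F q -> outside q.

Definition inside p := ~ outside p.

Hypothesis F_near : forall p, F p -> ~~ far p.

Lemma F_inside p : F p -> inside p.
Proof. by move=> Fp op; case: op Fp => {p} [p fp /F_near|p q _ _]; [rewrite fp|]. Qed.

Lemma inside_near p : inside p -> ~~ far p.
Proof. by move=> ip; apply/negP => fp; apply: ip; exact: outside_far. Qed.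

(** Discrete winding number argument: the parity vanishes at far cells and does not change along an
    [adj4] step between two outside cells, neither of which the path visits. *)
Lemma closed_parity Y a f : (forall p, Y p -> inside p) -> cpath Y a a f ->
 forall p, outside p -> f p.1 p.2 = false.
Proof.
move=> YI pf p; elim=> {p} [[x y]|p q op IH pq Fq].
 rewrite /far /= => hxy.
 have notY i j : far (i, j) -> ~ Y (i, j) by move=> fij /YI/inside_near; rewrite fij.
 have [xn|xn] := boolP (n < `|x|).
  by apply: (cpath_no_cross pf) => y' _; apply: notY; rewrite /far /= xn.
 have {xn}yn : n < `|y| by move: hxy; rewrite (negPf xn).
 have [y0|y0] := leP 0 y.
  apply: (cpath_no_cross pf) => y' yy'; apply: notY; rewrite /far /=; apply/orP; right; lia.
 rewrite (cpath_below x pf) ?addbb// => -[i j] /YI/inside_near; rewrite /far /= => h; lia.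
have oq : outside q := outside_step op pq Fq.
have nY o : outside o -> ~ Y o by move=> oo /YI; exact.
rewrite -IH; case: p q op oq pq {Fq IH} => [p1 p2] [q1 q2] op oq; rewrite /adj4 /=.
case=> [[E [E'|E']]|[E [E'|E']]]; subst.
- by rewrite (cpath_up pf)//; exact: nY.
- by rewrite -(cpath_up pf)//; exact: nY.
- have := cpath_right pf (nY _ oq) (nY _ op); rewrite addbb.
 by case: (f q1 q2); case: (f (q1 + 1) q2).
- have := cpath_right pf (nY _ op) (nY _ oq); rewrite addbb.
 by case: (f p1 q2); case: (f (p1 + 1) q2).
Qed.

(* A run (l, r, j) is a maximal row of inside cells (l, j), ..., (r, j). *)
Definition isrun (s : int * int * int) :=
 [/\ s.1.1 <= s.1.2, forall i, s.1.1 <= i <= s.1.2 -> inside (i, s.2),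
   ~ inside (s.1.1 - 1, s.2) & ~ inside (s.1.2 + 1, s.2)].

Definition inrun (s : int * int * int) p := s.1.1 <= p.1 <= s.1.2 /\ p.2 = s.2.

Definition touch (s t : int * int * int) :=
 [/\ s.1.1 <= t.1.2 + 1, t.1.1 <= s.1.2 + 1, s.2 <= t.2 + 1 & t.2 <= s.2 + 1].

Lemma touchC s t : touch s t -> touch t s.
Proof. by move=> []. Qed.

Lemma run_exists p : inside p -> exists2 s, isrun s & inrun s p.
Proof.
case: p => [i j] ij.
have right (k : nat) i' : (forall h, i <= h <= i' -> inside (h, j)) -> i <= i' -> n <= i' + k%:Z ->
  exists r, [/\ i <= r, (forall h, i <= h <= r -> inside (h, j)) & ~ inside (r + 1, j)].
 elim: k i' => [|k IH] i' hi ii nk.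
  by exists i'; split=> // /inside_near; rewrite /far /=; lia.
 have [ni|ni] := pselect (inside (i' + 1, j)); last by exists i'; split.
 apply: (IH (i' + 1)); [|lia|lia] => h hh; have [->//|ne] := eqVneq h (i' + 1).
 by apply: hi; lia.
have left (k : nat) i' : (forall h, i' <= h <= i -> inside (h, j)) -> i' <= i -> i' - k%:Z <= - n ->
  exists l, [/\ l <= i, (forall h, l <= h <= i -> inside (h, j)) & ~ inside (l - 1, j)].
 elim: k i' => [|k IH] i' hi ii nk.
  by exists i'; split=> // /inside_near; rewrite /far /=; lia.
 have [ni|ni] := pselect (inside (i' - 1, j)); last by exists i'; split.
 apply: (IH (i' - 1)); [|lia|lia] => h hh; have [->//|ne] := eqVneq h (i' - 1).
 by apply: hi; lia.
have one h : i <= h <= i -> inside (h, j) by move=> hh; have -> : h = i by lia.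
have [r [ir hr nr]] := right (absz (n - i)%R) i one (lexx i) ltac:(lia).
have [l [li hl nl]] := left (absz (n + i)%R) i one (lexx i) ltac:(lia).
exists (l, r, j); last by split=> //=; rewrite li ir.
split=> //=; [lia|move=> h hh]; have [ih|ih] := leP i h; [apply: hr|apply: hl]; lia.
Qed.

Lemma run_touch_row s t : isrun s -> isrun t -> touch s t -> s.2 = t.2 -> s = t.
Proof.
case: s t => [[l r] j] [[l' r'] j'] [lr hs nl nr] [lr' ht nl' nr'] [/= t1 t2 _ _] E; subst j'.
rewrite /= in lr hs nl nr lr' ht nl' nr'.
have no i : ~ inside (i, j) -> ~~ (l <= i <= r) /\ ~~ (l' <= i <= r').
 by move=> ni; split; apply/negP => h; apply: ni; [exact: hs|exact: ht].
have [_ a1] := no _ nl; have [_ a2] := no _ nr; have [a3 _] := no _ nl'; have [a4 _] := no _ nr'.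
by congr (_, _, _); lia.
Qed.

Lemma run_cpath s Y p q : isrun s -> (forall o, inrun s o -> Y o) -> inrun s p -> inrun s q ->
 exists f, cpath Y p q f.
Proof.
case: s p q => [[l r] j] [p1 p2] [q1 q2] _ hY [/= hp E1] [/= hq E2]; subst p2 q2.
have main u v : l <= u -> u <= v -> v <= r -> exists f, cpath Y (u, j) (v, j) f.
 move=> lu uv vr; have [|f pf _] := @cpath_row Y u (absz (v - u)%R) j.
  by move=> i hi; apply: hY; split=> //=; lia.
 by exists f; move: pf; have -> : u + (absz (v - u)%R)%:Z = v by lia.
have [pq|qp] := leP p1 q1; first by apply: main; lia.
by have [f /cpath_sym] : exists f, cpath Y (q1, j) (p1, j) f by apply: main; lia.
Qed.

Lemma touch_adj s t : isrun s -> isrun t -> touch s t -> exists p q, [/\ inrun s p, inrun t q & adj8 p q].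
Proof.
case: s t => [[l r] j] [[l' r'] j'] [/= lr _ _ _] [/= lr' _ _ _] [/= t1 t2 t3 t4].
have [h|h] := leP l l'.
 have [h'|h'] := leP l' r; first by exists (l', j), (l', j'); split; split=> //=; lia.
 by exists (r, j), (l', j'); split; split=> //=; lia.
have [h'|h'] := leP l r'; first by exists (l, j), (l, j'); split; split=> //=; lia.
by exists (l, j), (r', j'); split; split=> //=; lia.
Qed.

(* The runs u and v below s are separated by an outside cell q, so that no
  chain of inside cells can join them without passing through s. *)
Lemma no_bridge s u v Y p q g : isrun s -> isrun u -> isrun v -> touch s u -> touch s v ->
 u.2 + 1 = s.2 -> v.2 = u.2 -> u.1.2 < v.1.1 -> (forall o, Y o -> inside o) ->
 (forall o, Y o -> o.2 <= s.2) -> (forall o, Y o -> ~ inrun s o) ->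
 inrun v p -> inrun u q -> (forall o, inrun u o -> Y o) -> (forall o, inrun v o -> Y o) ->
 cpath Y p q g -> False.
Proof.
case: s u v => [[l r] j] [[ul ur] uj] [[vl vr] vj] rs ru rv su sv /= Ej Ev uv YI Yj Ys vp uq uY vY pq.
have [/= lr hs nl nr] := rs; have [/= ulr hu nul nur] := ru; have [/= vlr hv nvl nvr] := rv.
subst vj; have [/= s1 s2 s3 s4] := su; have [/= s5 s6 s7 s8] := sv.
have gap : ~ inside (ur + 1, uj) by [].
have ur1 : ur + 1 < vl.
 rewrite ltNge; apply/negP => h; have E : vl = ur + 1 by lia.
 by apply: gap; rewrite -E; apply: hv; rewrite lexx.
pose Y' o := Y o \/ inrun (l, r, j) o.
have Y'I o : Y' o -> inside o by case=> [/YI//|]; case: o => [d1 d2] [/= ho ->]; exact: hs.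
have in1 : inrun (ul, ur, uj) (ur, uj) by split=> //=; lia.
have in2 : inrun (vl, vr, uj) (vl, uj) by split=> //=; lia.
have [g1 p1] := run_cpath rv vY in2 vp; have [g2 p2] := run_cpath ru uY uq in1.
have [h1 q1 _] := cpath_trans p1 pq; have [h2 q2 _] := cpath_trans q1 p2.
have q2' := cpath_sub (fun o Yo => or_introl Yo : Y' o) q2.
pose x := ur + 1; pose k := absz (vl - 1 - x)%R.
have [|f pf fE] := @cpath_row Y' x k j; first by move=> i hi; right; split=> //=; lia.
have Ek : x + k%:Z = vl - 1 by lia.
have Yv : Y' (vl, uj) by left; exact: vY.
have Yl : Y' (vl - 1, j) by right; split=> //=; lia.
have a1 : adj8 (vl - 1, j) (vl, uj) by split=> /=; lia.
rewrite Ek in pf fE.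
have [f2 pf2 f2E] := cpath_trans pf (cpath_cons Yl a1 q2').
have a2 : adj8 (ur, uj) (x, j) by split=> /=; lia.
have Yu : Y' (ur, uj) by left; exact: uY.
have [f3 pf3 f3E] := cpath_trans pf2 (cpath_cons Yu a2 (cpath_nil (cpath_mem pf2).1)).
(* The loop starts in [s] above the gap, follows row [j], goes down to [v], back through [Y] to [u]
   and up again. It crosses the half line above the outside cell (x, uj) exactly once, since cells
   of [Y] do not rise above row [j] and avoid [s]. *)
have := closed_parity Y'I pf3 (p := (x, uj)); rewrite /= f3E f2E fE.
have -> : h2 x uj = false.
 apply: (cpath_no_cross q2) => y' yy' Yx; have := Yj _ Yx; rewrite /= => yj.
 by apply: (Ys _ Yx); split=> //=; lia.
move=> H; have {H} := H (contrapT gap); rewrite /cross /=.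
have xE : x = ur + 1 by [].
clearbody k; clearbody x; move: xE Ek s1 s2 s3 s4 s5 s6 uv ur1 Ej; clear; lia.
Qed.

Lemma inrun_inside s p : isrun s -> inrun s p -> inside p.
Proof. by case: s p => [[l r] j] [p1 p2] [/= _ h _ _] [/= hp ->]; exact: h. Qed.

Lemma run_nonempty s : isrun s -> inrun s (s.1.1, s.2).
Proof. by case: s => [[l r] j] [/= lr _ _ _]; split; rewrite //= lexx. Qed.

Lemma inrun_inj s t p : isrun s -> isrun t -> inrun s p -> inrun t p -> s = t.
Proof.
move=> rs rt; case: s t p rs rt => [[l r] j] [[l' r'] j'] [p1 p2] rs rt [/= h1 E1] [/= h2 E2].
by apply: run_touch_row => //=; [split=> /=; lia|rewrite -E1 E2].
Qed.

Lemma max_row (s : nat -> int * int * int) (m : nat) :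
 exists2 k, (k <= m)%N & forall i : nat, (i <= m)%N -> (s i).2 <= (s k).2.
Proof.
elim: m => [|m [k km hk]]; first by exists 0%N => // i; rewrite leqn0 => /eqP->.
have [h|h] := leP (s m.+1).2 (s k).2.
 exists k; first exact: leqW.
 by move=> i; rewrite leq_eqVlt => /orP[/eqP->//|]; rewrite ltnS; exact: hk.
exists m.+1 => // i; rewrite leq_eqVlt => /orP[/eqP->//|]; rewrite ltnS => /hk hi.
exact: le_trans hi (ltW h).
Qed.

(** A run that touches the highest one and differs from it lies in the row just below. The two
    neighbours of [s 0] in the cycle are thus separated runs of one row, joined by the rest of the
    cycle without passing [s 0], which [no_bridge] excludes. *)
Lemma top_cycle_absurd (s : nat -> int * int * int) (m : nat) : (2 <= m)%N ->
 (forall k : nat, (k <= m)%N -> isrun (s k)) -> (forall k : nat, (k < m)%N -> touch (s k) (s k.+1)) ->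
 touch (s m) (s 0%N) -> (forall i k : nat, (i < k)%N -> (k <= m)%N -> s i <> s k) ->
 (forall k : nat, (k <= m)%N -> (s k).2 <= (s 0%N).2) -> False.
Proof.
move=> m2 hr ht htm hd hj; have m1 : (1 <= m)%N by exact: ltnW.
have r0 := hr 0%N (leq0n m); have r1 := hr 1%N m1; have rm := hr m (leqnn m).
have t01 := ht 0%N m1; have t0m := touchC htm.
have row k : (0 < k)%N -> (k <= m)%N -> touch (s 0%N) (s k) -> (s k).2 + 1 = (s 0%N).2.
 move=> k0 km t0k; have := hj k km; have ne := hd 0%N k k0 km.
 have : (s 0%N).2 <> (s k).2 by move=> E; apply: ne; exact: (run_touch_row r0 (hr k km) t0k E).
 by move: t0k => [_ _ h1 h2]; lia.
have j1 := row 1%N (ltn0Sn 0) m1 t01; have jm := row m m1 (leqnn m) t0m.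
have ne1m := hd 1%N m m2 (leqnn m).
have jE : (s m).2 = (s 1%N).2 by lia.
pose Y p := exists k : nat, [/\ (0 < k)%N, (k <= m)%N & inrun (s k) p].
have Yrun k o : (0 < k)%N -> (k <= m)%N -> inrun (s k) o -> Y o by move=> k0 km ko; exists k.
pose q := ((s 1%N).1.1, (s 1%N).2); have q1 : inrun (s 1%N) q by exact: run_nonempty.
have chain k : (0 < k)%N -> (k <= m)%N -> forall p, inrun (s k) p -> exists f, cpath Y p q f.
 elim: k => [//|[|k] IH] _ km p kp.
  by apply: (run_cpath r1) => // o; exact: Yrun.
 have rk := hr _ (ltnW km); have rk1 := hr _ km.
 have [a [b [ka kb ab]]] := touch_adj rk rk1 (ht k.+1 km).
 have [f pf] := IH isT (ltnW km) a ka.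
 have [g pg] := run_cpath rk1 (fun o => @Yrun _ o (ltn0Sn _) km) kp kb.
 have ba : adj8 b a by move: ab => [].
 have [h ph _] := cpath_trans pg (cpath_cons (Yrun _ _ (ltn0Sn _) km kb) ba pf).
 by exists h.
have YI o : Y o -> inside o by move=> [k [_ km ko]]; exact: inrun_inside (hr k km) ko.
have Yj o : Y o -> o.2 <= (s 0%N).2 by move=> [k [_ km [_ ->]]]; exact: hj.
have Ys o : Y o -> ~ inrun (s 0%N) o.
 by move=> [k [k0 km ko]] so; exact: (hd 0%N k k0 km (inrun_inj r0 (hr k km) so ko)).
pose p := ((s m).1.1, (s m).2); have pm : inrun (s m) p by exact: run_nonempty.
have [g pg] := chain m m1 (leqnn m) p pm; have [g' pg'] := cpath_sym pg.
have disj : (s 1%N).1.2 < (s m).1.1 \/ (s m).1.2 < (s 1%N).1.1.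
 have nt : ~ touch (s 1%N) (s m) by move=> t1m; apply: ne1m; exact: (run_touch_row r1 rm t1m (esym jE)).
 have [?|h1] := ltP (s 1%N).1.2 (s m).1.1; first by left.
 have [?|h2] := ltP (s m).1.2 (s 1%N).1.1; first by right.
 by case: nt; split; lia.
have Y1 o : inrun (s 1%N) o -> Y o by exact: Yrun.
have Ym o : inrun (s m) o -> Y o by exact: Yrun.
case: disj => d.
 exact: (no_bridge r0 r1 rm t01 t0m j1 jE d YI Yj Ys pm q1 Y1 Ym pg).
exact: (no_bridge r0 rm r1 t0m t01 jm (esym jE) d YI Yj Ys q1 pm Ym Y1 pg').
Qed.

(** Rotating the cycle puts a highest run first. *)
Lemma cycle_absurd (s : nat -> int * int * int) (m : nat) : (2 <= m)%N ->
 (forall k : nat, (k <= m)%N -> isrun (s k)) -> (forall k : nat, (k < m)%N -> touch (s k) (s k.+1)) ->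
 touch (s m) (s 0%N) -> (forall i k : nat, (i < k)%N -> (k <= m)%N -> s i <> s k) -> False.
Proof.
move=> m2 hr ht htm hd; have [k0 k0m hk0] := max_row s m.
pose ix k := if (k0 + k <= m)%N then (k0 + k)%N else (k0 + k - m.+1)%N.
have ixa k : (k0 + k <= m)%N -> ix k = (k0 + k)%N by rewrite /ix => ->.
have ixb k : (m < k0 + k)%N -> ix k = (k0 + k - m.+1)%N by rewrite /ix ltnNge => /negbTE ->.
have ixm k : (k <= m)%N -> (ix k <= m)%N.
 by move=> km; have [h|h] := leqP (k0 + k) m; [rewrite ixa|rewrite ixb//; lia].
have ix0 : ix 0%N = k0 by rewrite ixa addn0.
have tc k : (k < m)%N -> touch (s (ix k)) (s (ix k.+1)).
 move=> km; have [h|[h|h]] : (k0 + k < m \/ k0 + k = m \/ m < k0 + k)%N by lia.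
 - by rewrite (ixa k (ltnW h)) (ixa k.+1) addnS; [exact: ht|].
 - by rewrite (ixa k) ?h// (ixb k.+1) addnS h ?subnn.
 - have -> : ix k = (k0 + k - m.+1)%N by apply: ixb.
  have -> : ix k.+1 = (k0 + k - m.+1).+1 by rewrite ixb addnS; lia.
  by apply: ht; lia.
apply: (@top_cycle_absurd (s \o ix) m m2) => /=.
- by move=> k /ixm; exact: hr.
- exact: tc.
- have [h|h] : (k0 = 0 \/ 0 < k0)%N by lia.
  have -> : ix m = m by rewrite ixa h.
  by rewrite ix0 h.
 have -> : ix m = k0.-1 by rewrite ixb; lia.
 rewrite ix0; have := ht k0.-1; rewrite prednK//; apply; lia.
- move=> i k ik km; have [h|[h|h]] : (ix i < ix k \/ ix k < ix i \/ ix i = ix k)%N by lia.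
 + by apply: hd => //; exact: ixm.
 + by move=> E; apply: (hd _ _ h) => //; apply: ixm; lia.
 + move: h; have [h1|h1] := leqP (k0 + i) m; have [h2|h2] := leqP (k0 + k) m.
  * by rewrite (ixa i h1) (ixa k h2); lia.
  * by rewrite (ixa i h1) (ixb k h2); lia.
  * lia.
  * by rewrite (ixb i h1) (ixb k h2); lia.
- by move=> k /ixm km; rewrite ix0; exact: hk0.
Qed.

(* The touching graph of the runs is a forest. *)
Lemma run_walk_absurd (m : nat) (s : nat -> int * int * int) : (2 <= m)%N ->
 (forall k : nat, (k <= m)%N -> isrun (s k)) -> (forall k : nat, (k < m)%N -> touch (s k) (s k.+1)) ->
 (forall k : nat, (k < m)%N -> s k <> s k.+1) -> (forall k : nat, (k.+2 <= m)%N -> s k <> s k.+2) ->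
 touch (s m) (s 0%N) -> False.
Proof.
elim/ltn_ind: m s => m IH s m2 hr ht h1 h2 htm.
(* If [s i] = [s k] with k at least i + 3, then the run before [s k] touches [s i] and closes a
   shorter walk. Equalities at distance one or two are excluded by hypothesis, so the walk is a
   simple cycle. *)
have short (i k : nat) : (i.+2 <= k)%N -> (k <= m)%N -> (k - i < m)%N -> touch (s k) (s i) -> False.
 move=> ik km kim tki; apply: (IH (k - i)%N kim (fun h => s (i + h)%N)); first by lia.
 - by move=> h hk; apply: hr; lia.
 - by move=> h hk; rewrite addnS; apply: ht; lia.
 - by move=> h hk; rewrite addnS; apply: h1; lia.
 - by move=> h hk; rewrite !addnS; apply: h2; lia.
 - by rewrite subnKC ?addn0//; lia.
apply: (cycle_absurd m2 hr ht htm) => i k ik km E.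
have [e|[e|e]] : (k = i.+1 \/ k = i.+2 \/ i.+3 <= k)%N by lia.
- by apply: (h1 i); [lia|rewrite -e].
- by apply: (h2 i); [lia|rewrite -e].
- apply: (short i k.-1); [lia|lia|lia|].
 by rewrite E; have := ht k.-1 ltac:(lia); rewrite prednK//; lia.
Qed.
End Filled.
End RunGraph.

Section Development.
Variable R : realType.
Local Notation C := (Cplx R).
Local Notation Re := (@complex.Re R).
Local Notation Im := (@complex.Im R).
Implicit Types (z c : C) (r s t e M : R).

(** * The real-valued modulus and the topology of the plane *)

Section Modulus.
Lemma lerF (x y : R) : (y < x -> False) -> x <= y.
Proof. by move=> h; rewrite leNgt; apply/negP. Qed.

Implicit Types (w a b : C) (x y : R).

(** The norm [|z|] is an element of [C]; its real value is what linear and nonlinear arithmetic can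
    handle, and [rc] leads back. *)
Definition abs (z : C) : R := Re `|z|.
Definition rc (x : R) : C := (x%:C)%C.

Lemma normE z : `|z| = rc (abs z).
Proof. by rewrite /abs /rc RRe_real// normr_real. Qed.

Lemma rc_inj : injective rc. Proof. exact: complexI. Qed.
Lemma rcD x y : rc (x + y) = rc x + rc y. Proof. exact: rmorphD. Qed.
Lemma rcB x y : rc (x - y) = rc x - rc y. Proof. exact: rmorphB. Qed.
Lemma rcN x : rc (- x) = - rc x. Proof. exact: rmorphN. Qed.
Lemma rcM x y : rc (x * y) = rc x * rc y. Proof. exact: rmorphM. Qed.
Lemma rcV x : rc x^-1 = (rc x)^-1. Proof. exact: fmorphV. Qed.
Lemma rc0 : rc 0 = 0. Proof. exact: rmorph0. Qed.
Lemma rc1 : rc 1 = 1. Proof. exact: rmorph1. Qed.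
Lemma rcX x n : rc (x ^+ n) = rc x ^+ n. Proof. exact: rmorphXn. Qed.
Lemma rc_nat n : rc n%:R = n%:R. Proof. exact: rmorph_nat. Qed.
Lemma rc_le x y : (rc x <= rc y) = (x <= y). Proof. exact: lecR. Qed.
Lemma rc_lt x y : (rc x < rc y) = (x < y). Proof. exact: ltcR. Qed.

Lemma abs_ge0 z : 0 <= abs z.
Proof. by rewrite -rc_le -normE rc0 normr_ge0. Qed.
Lemma abs0 : abs 0 = 0.
Proof. by apply: rc_inj; rewrite -normE normr0 rc0. Qed.
Lemma abs1 : abs 1 = 1.
Proof. by apply: rc_inj; rewrite -normE normr1 rc1. Qed.
Lemma absM z w : abs (z * w) = abs z * abs w.
Proof. by apply: rc_inj; rewrite -normE normrM rcM !normE. Qed.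
Lemma absN z : abs (- z) = abs z.
Proof. by apply: rc_inj; rewrite -!normE normrN. Qed.
Lemma absX z n : abs (z ^+ n) = abs z ^+ n.
Proof. by apply: rc_inj; rewrite -normE normrX rcX normE. Qed.
Lemma absV z : abs z^-1 = (abs z)^-1.
Proof. by apply: rc_inj; rewrite -normE normfV rcV normE. Qed.
Lemma abs_div z w : abs (z / w) = abs z / abs w.
Proof. by rewrite absM absV. Qed.
Lemma absD z w : abs (z + w) <= abs z + abs w.
Proof. by rewrite -rc_le rcD -!normE ler_normD. Qed.
Lemma abs_eq0 z : (abs z == 0) = (z == 0).
Proof. by rewrite -(inj_eq rc_inj) -normE rc0 normr_eq0. Qed.
Lemma abs_gt0 z : (0 < abs z) = (z != 0).
Proof. by rewrite lt_neqAle abs_ge0 andbT eq_sym abs_eq0. Qed.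
Lemma absB z w : abs (z - w) = abs (w - z).
Proof. by rewrite -absN opprB. Qed.
Lemma absBD z w : abs (z - w) <= abs z + abs w.
Proof. by rewrite (le_trans (absD _ _))// absN. Qed.
Lemma abs_tri a z w : abs (z - w) <= abs (z - a) + abs (a - w).
Proof. by rewrite (le_trans _ (absD _ _))// addrA subrK. Qed.
Lemma abs_lip z w : abs z <= abs w + abs (z - w).
Proof. by rewrite (le_trans _ (absD _ _))// addrC subrK. Qed.
Lemma abs_rc x : abs (rc x) = `|x|.
Proof. by apply: rc_inj; rewrite -normE /rc normc_def/= expr0n addr0 sqrtr_sqr. Qed.
Lemma abs_rcE x : 0 <= x -> abs (rc x) = x.
Proof. by rewrite abs_rc; exact: ger0_norm. Qed.

Lemma abs_sum I (r : seq I) (Q : pred I) (F : I -> C) :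
 abs (\sum_(i <- r | Q i) F i) <= \sum_(i <- r | Q i) abs (F i).
Proof.
elim/big_rec2: _ => [|i x y _ h]; first by rewrite abs0.
by rewrite (le_trans (absD _ _))// lerD2l.
Qed.
Lemma abs_prod I (r : seq I) (Q : pred I) (F : I -> C) :
 abs (\prod_(i <- r | Q i) F i) = \prod_(i <- r | Q i) abs (F i).
Proof. by apply: (big_morph abs absM abs1). Qed.
Lemma absE z : abs z = Num.sqrt (Re z ^+ 2 + Im z ^+ 2).
Proof. by apply: rc_inj; rewrite -normE normc_def. Qed.

Lemma nRe_le_abs z : `|Re z| <= abs z.
Proof. by rewrite absE -sqrtr_sqr ler_wsqrtr// lerDl sqr_ge0. Qed.
Lemma nIm_le_abs z : `|Im z| <= abs z.
Proof. by rewrite absE -sqrtr_sqr ler_wsqrtr// lerDr sqr_ge0. Qed.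
Lemma ReD z w : Re (z + w) = Re z + Re w.
Proof. by case: z w => ? ? []. Qed.
Lemma ImD z w : Im (z + w) = Im z + Im w.
Proof. by case: z w => ? ? []. Qed.
Lemma ReN z : Re (- z) = - Re z. Proof. by case: z. Qed.
Lemma ImN z : Im (- z) = - Im z. Proof. by case: z. Qed.

Definition disc (a : C) (r : R) : set C := [set z | abs (z - a) < r].
Definition cdisc (a : C) (r : R) : set C := [set z | abs (z - a) <= r].

Lemma ball_disc a r : ball a (rc r) = disc a r.
Proof.
rewrite -ball_normE; apply/seteqP; split=> z /=; rewrite /disc/= normE rc_lt absB//.
Qed.

Lemma nbhsC a (A : set C) : nbhs a A <-> exists2 r, 0 < r & disc a r `<=` A.
Proof.
split=> [/nbhs_ballP[e /= e0 sA]|[r r0 sA]].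
 have er : e = rc (Re e) by rewrite /rc RRe_real// gtr0_real.
 exists (Re e); first by rewrite -rc_lt rc0 -er.
 by rewrite -ball_disc -er.
by apply/nbhs_ballP; exists (rc r) => /=; [rewrite -rc0 rc_lt|rewrite ball_disc].
Qed.

Lemma nbhs_disc a r : 0 < r -> nbhs a (disc a r).
Proof. by move=> r0; apply/nbhsC; exists r. Qed.

Lemma disc_center a r : 0 < r -> disc a r a.
Proof. by rewrite /disc/= subrr abs0. Qed.

Lemma sub_disc_cdisc a r s : r <= s -> disc a r `<=` cdisc a s.
Proof. by move=> rs z /ltW zr; apply: le_trans rs. Qed.

Lemma openPC (A : set C) :
 open A <-> forall a, A a -> exists2 r, 0 < r & disc a r `<=` A.
Proof.
rewrite openE; split=> h a Aa; first exact/nbhsC/(h a Aa).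
exact/nbhsC/(h a Aa).
Qed.

Lemma interiorPC (A : set C) z : A° z <-> exists2 r, 0 < r & disc z r `<=` A.
Proof. exact: nbhsC. Qed.

Lemma open_disc a r : open (disc a r).
Proof.
apply/openPC => z zr; exists (r - abs (z - a)); first by rewrite subr_gt0.
move=> w /= wz; rewrite /disc/=; have := abs_tri z w a.
by move: wz; rewrite /disc/=; lra.
Qed.

Lemma continuousRP (T : topologicalType) (f : T -> R) (x : T) :
 {for x, continuous f} <-> forall e, 0 < e -> nbhs x [set y | `|f y - f x| < e].
Proof.
split=> [fx e e0|h A /nbhs_ballP[e /= e0 sA]].
 have fe : nbhs x (f @^-1` ball (f x) e) by exact: fx (nbhsx_ballx (f x) e e0).
 by apply: (filterS _ fe) => y; rewrite /= -ball_normE/= distrC.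
apply: (filterS _ (h e e0)) => y /= yx; apply: sA.
by rewrite -ball_normE/= distrC.
Qed.

Lemma abs_continuous : continuous abs.
Proof.
move=> a; apply/continuousRP => e e0; apply/nbhsC; exists e => // z /= ze.
have := abs_lip a z; have := abs_lip z a; rewrite ltr_norml.
by move: ze; rewrite /disc/= (absB a z); lra.
Qed.

Lemma closed_cdisc a r : closed (cdisc a r).
Proof.
have -> : cdisc a r = ~` [set z | r < abs (z - a)].
 by apply/seteqP; split=> z; rewrite /cdisc/= leNgt => /negP.
apply/open_closedC/openPC => z /= zr; exists (abs (z - a) - r).
 by rewrite subr_gt0.
move=> w /=; rewrite /disc/= => wz; have := abs_tri w z a.
by rewrite (absB z w); lra.
Qed.

Lemma continuousCP (T : topologicalType) (f : T -> C) (x : T) :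
 {for x, continuous f} <-> forall e, 0 < e -> nbhs x (f @^-1` disc (f x) e).
Proof.
split=> [fx e e0|h A /nbhsC[e e0 sA]]; first exact: fx (nbhs_disc _ e0).
by apply: (filterS _ (h e e0)) => y; exact: sA.
Qed.

Definition mkC (x : R * R) : C := Complex x.1 x.2.

Lemma abs_Complex x y : abs (Complex x y) <= `|x| + `|y|.
Proof.
rewrite absE/= -[leRHS]ger0_norm ?addr_ge0// -sqrtr_sqr ler_wsqrtr//.
by rewrite -(real_normK (num_real x)) -(real_normK (num_real y));
 have := normr_ge0 x; have := normr_ge0 y; nra.
Qed.

Lemma mkC_continuous : continuous mkC.
Proof.
move=> x; apply/continuousCP => e e0.
have e2 : 0 < e / 2 by rewrite divr_gt0.
exists (ball x.1 (e / 2), ball x.2 (e / 2)).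
 by split; apply: nbhsx_ballx.
move=> [y1 y2] [/=]; rewrite -!ball_normE/= /disc/= /mkC/= => h1 h2.
have -> : Complex y1 y2 - Complex x.1 x.2 = Complex (y1 - x.1) (y2 - x.2) by [].
rewrite (le_lt_trans (abs_Complex _ _))//.
by rewrite distrC in h1; rewrite distrC in h2; lra.
Qed.

Lemma rc_continuous : continuous rc.
Proof.
move=> x; apply/continuousCP => e e0.
apply: filterS (nbhsx_ballx x e e0) => y; rewrite -ball_normE/= => h.
by rewrite /disc/= -rcB abs_rc distrC.
Qed.

Lemma compact_cdisc a r : compact (cdisc a r).
Proof.
pose I (x : R) : set R := `[x - `|r|, x + `|r|]%classic.
apply: (@subclosed_compact _ _ (mkC @` (I (Re a) `*` I (Im a)))).
- exact: closed_cdisc.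
- apply: continuous_compact.
  exact/continuous_subspaceT/mkC_continuous.
 by apply: compact_setX; apply: segment_compact.
move=> z; rewrite /cdisc/= => zr; exists (Re z, Im z); last by case: z {zr}.
have rr : abs (z - a) <= `|r| by rewrite (le_trans zr)// ler_norm.
split; rewrite /I/= in_itv/= -ler_distl -?ReN -?ImN -?ReD -?ImD.
 exact: le_trans (nRe_le_abs _) rr.
exact: le_trans (nIm_le_abs _) rr.
Qed.

Lemma hausdorffC : hausdorff_space C.
Proof. exact: norm_hausdorff. Qed.

Lemma bounded_setC (A : set C) :
 bounded_set A <-> exists M, forall z, A z -> abs z <= M.
Proof.
split=> [|[M AM]].
 move=> [M [Mr h]]; exists (Re M + 1) => z Az.
 have := h (rc (Re M + 1)).
 have MM : M = rc (Re M) by rewrite /rc RRe_real.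
 rewrite [X in X < _]MM rc_lt ltrDl ltr01 => /(_ isT _ Az)/=.
 by rewrite normE rc_le.
exists (rc M); split=> [|x Mx z /AM zM]; first by rewrite complex_real.
by rewrite /= normE (le_trans _ (ltW Mx))// rc_le.
Qed.

Lemma compactC (A : set C) :
 compact A <-> closed A /\ exists M, forall z, A z -> abs z <= M.
Proof.
split=> [cA|[cA [M AM]]].
 split; first exact: compact_closed hausdorffC cA.
 have [[z0 Az0]|nA] := pselect (A !=set0); last first.
  by exists 0 => z Az; case: nA; exists z.
 have [c _ cM] := compact_EVT_max (ex_intro _ _ Az0) cA
  (continuous_subspaceT abs_continuous).
 by exists (abs c) => z Az; apply: cM; rewrite inE.
have sub : A `<=` cdisc 0 M by move=> z Az; rewrite /cdisc/= subr0; apply: AM.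
exact: subclosed_compact cA (@compact_cdisc 0 M) sub.
Qed.

Lemma horner_continuousC (p : {poly C}) : continuous (fun z : C => p.[z]).
Proof.
move=> z; elim/poly_ind: p => [|p c IH].
 have -> : (fun z : C => (0 : {poly C}).[z]) = cst 0 by apply/funext => w; rewrite horner0.
 exact: cst_continuous.
have -> : (fun z : C => (p * 'X + c%:P).[z]) = (fun z => p.[z] * z + c).
 by apply/funext => w; rewrite hornerMXaddC.
have idz : (fun w : C => w) @ z --> z by exact: cvg_id.
exact: (cvgD (cvgM IH idz) (cvg_cst c)).
Qed.

Lemma horner_within (p : {poly C}) (A : set C) : {within A, continuous (fun z : C => p.[z])}.
Proof. by apply: continuous_subspaceT; exact: horner_continuousC. Qed.

Lemma connected_horner (p : {poly C}) (A : set C) : connected A -> connected [set p.[z] | z in A].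
Proof. by move=> cA; apply: connected_continuous_connected => //; exact: horner_within. Qed.

Lemma compact_horner (p : {poly C}) (A : set C) : compact A -> compact [set p.[z] | z in A].
Proof. by move=> cA; apply: continuous_compact => //; exact: horner_within. Qed.

Lemma horner_near (p : {poly C}) a e : 0 < e -> exists2 d, 0 < d &
 forall z, abs (z - a) < d -> abs (p.[z] - p.[a]) < e.
Proof.
move=> e0; have /nbhsC[d d0 h] := @horner_continuousC p a _ (nbhs_disc _ e0).
by exists d.
Qed.

Lemma abs_horner_continuous (p : {poly C}) : continuous (fun z : C => abs p.[z]).
Proof.
move=> z; apply: (@continuous_comp _ _ _ (fun z : C => p.[z]) abs).
 exact: horner_continuousC.
exact: abs_continuous.
Qed.

Lemma separate_compactC (A B : set C) : compact A -> closed B -> A `&` B = set0 ->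
 exists U V, [/\ open U, open V, A `<=` U, B `<=` V & U `&` V = set0].
Proof.
move=> cA cB AB0; have [clA [M hM]] := (compactC A).1 cA.
have AK : A `<=` (cdisc 0 (M + 1))°.
 move=> z /hM zM; apply/interiorPC; exists 1 => // w; rewrite /disc /cdisc /= subr0 => wz.
 by have := abs_lip w z; lra.
have nB : set_nbhs A (~` B).
 move=> z Az; apply: open_nbhs_nbhs; split; first exact: closed_openC.
 by move=> Bz; exact: disjE AB0 Az Bz.
have [W AW clW] := compact_normal_local hausdorffC (@compact_cdisc 0 (M + 1)) AK clA nB.
have [W' [oW' AW' W'W]] := (set_nbhsP _ _).1 AW; exists W', (~` closure W); split=> //.
- exact/closed_openC/closed_closure.
- by move=> z Bz /clW; exact.
- by apply: disjI => z /W'W Wz; apply; exact: subset_closure.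
Qed.

Lemma connected_nestedC (K : nat -> set C) :
 (forall n, compact (K n)) -> (forall n, K n.+1 `<=` K n) ->
 (forall n, connected (K n)) -> connected (\bigcap_n K n).
Proof.
move=> cK dK conK; set Z := \bigcap_n K n.
have clK n : closed (K n) by apply: compact_closed hausdorffC _.
have clZ : closed Z by apply: closed_bigI => ? _.
apply: contrapT => /(not_connected_closed clZ)[U [V [cU cV ZUV UV0 [Une Vne]]]].
have kU : compact U.
 by apply: subclosed_compact cU (cK 0%N) _ => u Uu; have : Z u by [rewrite ZUV; left]; exact.
have [W1 [W2 [oO1 oO2 UO1 VO2 W12]]] := separate_compactC kU cV UV0.
have [n nP] : exists n, forall m, (n <= m)%N -> K m `<=` W1 `|` W2.
 apply: (nested_compact_subset hausdorffC cK dK (openU oO1 oO2)).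
 by rewrite -/Z ZUV; apply: setUSS.
have ZK m : Z `<=` K m by apply: bigcap_inf.
have : K n `<=` W1.
 apply: (@connected_open_split _ _ _ W2) => //; first exact: nP.
  by move=> x _; exact: (disjE W12).
 by case: Une => u Uu; exists u; split; [apply: ZK; rewrite ZUV; left|exact: UO1].
case: Vne => v Vv /(_ v).
have Kv : K n v by apply: ZK; rewrite ZUV; right.
by move=> /(_ Kv) W1v; exact: disjE W12 W1v (VO2 _ Vv).
Qed.

Lemma compact_abs_min (A : set C) (f : C -> R) : A !=set0 -> compact A ->
 continuous f -> exists2 c, A c & forall z, A z -> f c <= f z.
Proof.
move=> A0 cA cf; have [c cP h] := compact_EVT_min A0 cA (continuous_subspaceT cf).
by exists c => [|z Az]; [rewrite inE in cP|apply: h; rewrite inE].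
Qed.

Lemma compact_abs_max (A : set C) (f : C -> R) : A !=set0 -> compact A ->
 continuous f -> exists2 c, A c & forall z, A z -> f z <= f c.
Proof.
move=> A0 cA cf; have [c cP h] := compact_EVT_max A0 cA (continuous_subspaceT cf).
by exists c => [|z Az]; [rewrite inE in cP|apply: h; rewrite inE].
Qed.

Lemma closurePC (A : set C) z :
 closure A z <-> forall e, 0 < e -> exists2 w, A w & abs (w - z) < e.
Proof.
split=> [cAz e e0|h B /nbhsC[e e0 sB]].
 by have [w [Aw wz]] := cAz _ (nbhs_disc z e0); exists w.
by have [w Aw wz] := h e e0; exists w; split=> //; apply: sB.
Qed.

(* Sequences indexed by an increasing map [f] are what [normal_family] asks for. *)
Lemma bounded_subsequence (u : nat -> C) M : (forall n, abs (u n) <= M) ->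
 exists2 f : nat -> nat, {homo f : m n / (m < n)%N} &
 exists l, forall e, 0 < e -> exists N, forall n, (N <= n)%N -> abs (u (f n) - l) < e.
Proof.
move=> uM.
have sub (v : nat -> R) : (forall n, `|v n| <= M) -> exists2 f : nat -> nat,
  {homo f : m n / (m < n)%N} & exists l, forall e, 0 < e ->
  exists N, forall n, (N <= n)%N -> `|v (f n) - l| < e.
 move=> vM; have [|f fi /cvg_ex[l vl]] := @bolzano_weierstrass R v.
  by exists M; split=> [|x Mx n _ /=]; [exact: num_real|rewrite (le_trans (vM n))// ltW].
 exists f => [m n mn|].
  by have := fi m n; have := fi n m; rewrite leEnat; lia.
 exists l => e e0; have /cvgrPdist_lt/(_ e e0)[N _ NP] := vl.
 by exists N => n Nn; rewrite distrC; apply: NP.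
have [f fi [x fx]] := sub (fun n => Re (u n))
 (fun n => le_trans (nRe_le_abs _) (uM n)).
have [g gi [y gy]] := sub (fun n => Im (u (f n)))
 (fun n => le_trans (nIm_le_abs _) (uM _)).
have gn n : (n <= g n)%N by elim: n => // n IH; have := gi n n.+1 (ltnSn n); lia.
exists (f \o g); first by move=> m n mn; apply/fi/gi.
exists (Complex x y) => e e0; have e2 : 0 < e / 2 by rewrite divr_gt0.
have [N NP] := fx _ e2; have [N' NP'] := gy _ e2.
exists (maxn N N') => n; rewrite geq_max => /andP[Nn N'n].
have -> : u ((f \o g) n) - Complex x y =
  Complex (Re (u (f (g n))) - x) (Im (u (f (g n))) - y).
 by rewrite /=; case: (u _).
rewrite (le_lt_trans (abs_Complex _ _))//.
have := NP (g n) (leq_trans Nn (gn n)); have := NP' n N'n; lra.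
Qed.

Lemma star_connected (A : set C) a :
 (forall z t, A z -> 0 <= t -> t <= 1 -> A (a + rc t * (z - a))) -> connected A.
Proof.
move=> star; have [A0|/set0P nA] := eqVneq A set0.
 by rewrite A0; apply: connected0.
pose seg z : set C := (fun t => a + rc t * (z - a)) @` `[0, 1]%classic.
have -> : A = \bigcup_(z in A) seg z.
 apply/seteqP; split=> [z Az|w [z Az [t /=]]].
  by exists z => //; exists 1; [rewrite /= in_itv/= ler01 lexx|rewrite rc1 mul1r addrC subrK].
 by rewrite in_itv/= => /andP[t0 t1] <-; apply: star.
apply: bigcup_connected.
 exists a => z _; exists 0; first by rewrite /= in_itv/= lexx ler01.
 by rewrite rc0 mul0r addr0.
move=> z Az; apply: connected_continuous_connected; first exact: segment_connected.
apply: continuous_subspaceT => t; apply: cvgD; first exact: cvg_cst.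
by apply: cvgM; [exact: rc_continuous|exact: cvg_cst].
Qed.

Definition convexC K := forall u v t, K u -> K v -> 0 <= t <= 1 -> K (u + rc t * (v - u)).

Lemma convex_disc z r : convexC (disc z r).
Proof.
move=> u v t hu hv /andP[t0 t1]; rewrite /disc /=.
have -> : u + rc t * (v - u) - z = rc (1 - t) * (u - z) + rc t * (v - z) by rewrite rcB rc1; ring.
apply: le_lt_trans (absD _ _) _; rewrite !absM !abs_rc (ger0_norm t0) ger0_norm ?subr_ge0//.
rewrite /disc /= in hu hv; have [->|tn] := eqVneq t 0; first by rewrite subr0 mul1r mul0r addr0.
have tp : 0 < t by rewrite lt_neqAle eq_sym tn.
have t1' : 0 <= 1 - t by rewrite subr_ge0.
have h1 : t * abs (v - z) < t * r by rewrite ltr_pM2l.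
have h2 := ler_wpM2l t1' (ltW hu).
by move: h1 h2; clear; lra.
Qed.

Lemma connected_disc a r : connected (disc a r).
Proof.
apply: (@star_connected _ a) => z t; rewrite /disc/= => zr t0 t1.
rewrite addrC addrA addNr add0r absM abs_rcE//.
by have := abs_ge0 (z - a); nra.
Qed.

Lemma connected_cdisc a r : connected (cdisc a r).
Proof.
apply: (@star_connected _ a) => z t; rewrite /cdisc/= => zr t0 t1.
rewrite addrC addrA addNr add0r absM abs_rcE//.
by have := abs_ge0 (z - a); nra.
Qed.

Definition circle (r : R) : set C := [set z | abs z = r].

Lemma connected_circle r : 0 <= r -> connected (circle r).
Proof.
move=> r0; pose f t : C := rc r * (rc (cos t) + Complex 0 1 * rc (sin t)).
have fE t : f t = Complex (r * cos t) (r * sin t).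
 by rewrite /f /rc /=; congr Complex; ring.
have -> : circle r = f @` setT.
 apply/seteqP; split=> [z zr|_ [t _ <-]]; last first.
  by rewrite fE /circle /= absE /= !exprMn -mulrDr cos2Dsin2 mulr1 sqrtr_sqr ger0_norm.
 have [r00|rn] := eqVneq r 0.
  by exists 0 => //; rewrite /f r00 rc0 mul0r; apply/esym/eqP; rewrite -abs_eq0 zr r00.
 pose x := Re z / r; have x1 : -1 <= x <= 1.
  rewrite -ler_norml normrM normfV (ger0_norm r0) ler_pdivrMr ?mul1r ?lt_neqAle 1?eq_sym ?rn//.
  by rewrite -zr; exact: nRe_le_abs.
 have cx : r * cos (acos x) = Re z by rewrite acosK ?in_itv// mulrC divfK.
 have sx : r * sin (acos x) = `|Im z|.
  rewrite sin_acos// -{1}(ger0_norm r0) -!sqrtr_sqr -sqrtrM ?sqr_ge0//; congr Num.sqrt.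
  have := congr1 (fun s => s ^+ 2) zr; rewrite /= absE sqr_sqrtr ?addr_ge0 ?sqr_ge0// => E.
  have -> : Im z ^+ 2 = r ^+ 2 - Re z ^+ 2 by rewrite -E; ring.
  by rewrite /x; field.
 exists (if 0 <= Im z then acos x else - acos x) => //; rewrite fE.
 by case: leP => y0; [rewrite cx sx ger0_norm//|rewrite cosN sinN mulrN cx sx ltr0_norm// opprK]; case: (z).
apply: connected_continuous_connected; first by apply/connected_intervalP => x y _ _ z _.
apply: continuous_subspaceT => t; apply: cvgM; first exact: cvg_cst.
apply: cvgD; first by apply: continuous_comp; [exact: continuous_cos|exact: rc_continuous].
apply: cvgM; first exact: cvg_cst.
by apply: continuous_comp; [exact: continuous_sin|exact: rc_continuous].
Qed.

Lemma connected_exterior r : 0 <= r -> connected [set z : C | r < abs z].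
Proof.
move=> r0.
have -> : [set z : C | r < abs z] =
  \bigcup_(s in [set s | r < s]) (circle s `|` rc @` [set t | r < t]).
 apply/seteqP; split=> [z /= rz|z [s /= rs [|[t /= rt <-]]]].
 - by exists (abs z) => //; left.
 - by move=> ->.
 - by rewrite abs_rc gtr0_norm// (le_lt_trans r0).
apply: bigcup_connected.
 exists (rc (r + 1)) => s rs; right; exists (r + 1) => //=; lra.
move=> s /= rs; apply: connectedU.
- exists (rc s); split; last by exists s.
 by rewrite /circle/= abs_rc gtr0_norm// (le_lt_trans r0).
- by apply: connected_circle; rewrite (le_trans r0)// ltW.
apply: connected_continuous_connected; last exact/continuous_subspaceT/rc_continuous.
have -> : [set t : R | r < t] = `]r, +oo[%classic.
 by apply/seteqP; split=> t /=; rewrite in_itv/= andbT.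
exact/connected_intervalP/interval_is_interval.
Qed.

End Modulus.

(** * Local behaviour of polynomials: open mapping, maximum principle, growth *)

Section PolynomialLocal.
Implicit Types (w a b : C) (x y : R) (p q Q : {poly C}).

Definition nonconstant p := (1 < size p)%N.

Lemma nonconstantB p c : nonconstant p -> nonconstant (p - c%:P).
Proof.
by move=> sp; rewrite /nonconstant size_polyDl// size_polyN (leq_ltn_trans (size_polyC_leq1 _)).
Qed.

Lemma local_factor p a : nonconstant p -> exists m u,
 [/\ (0 < m)%N, u.[a] != 0 & forall z, p.[z] = p.[a] + u.[z] * (z - a) ^+ m].
Proof.
move=> sp; have q0 : p - p.[a]%:P != 0.
 by rewrite -size_poly_gt0 (leq_trans _ (nonconstantB p.[a] sp)).
have [m [u ua pE]] := multiplicity_XsubC (p - p.[a]%:P) a.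
rewrite q0/= in ua.
exists m, u; split=> // [|z].
 case: m pE => // pE.
 by move: ua; rewrite rootE; have := congr1 (horner^~ a) pE; rewrite /= expr0 mulr1 !hornerE subrr => <-; rewrite eqxx.
have := congr1 (horner^~ z) pE; rewrite /= hornerM hornerD hornerN hornerC.
by rewrite horner_exp hornerXsubC => <-; rewrite addrC subrK.
Qed.

(** With p(z) = p(a) + u(z) (z - a)^m and u(a) nonzero, take for z - a an m-th root of t y / u(a):
    the values of p near a move in any prescribed direction. Increase and decrease of |p|, hence the
    maximum principle, follow without integration. *)
Lemma local_direction p a (y : C) e : nonconstant p -> y != 0 -> 0 < e ->
 exists z t, [/\ abs (z - a) < e, 0 < t, t <= 1 &
  abs (p.[z] - (p.[a] + rc t * y)) <= t * abs y / 2].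
Proof.
move=> sp y0 e0; have [m [u [m0 ua pE]]] := local_factor a sp.
have ay : 0 < abs y by rewrite abs_gt0.
have au : 0 < abs u.[a] by rewrite abs_gt0.
have [d d0 ud] := horner_near u a (divr_gt0 au (ltr0n _ 2)).
pose f := Num.min d e; have f0 : 0 < f by rewrite lt_min d0.
pose K := abs y / abs u.[a]; have K0 : 0 < K by rewrite divr_gt0.
pose t := Num.min 1 (f ^+ m / (2 * K)).
have fm : 0 < f ^+ m by rewrite exprn_gt0.
have t0 : 0 < t by rewrite lt_min ltr01 divr_gt0// mulr_gt0.
have t1 : t <= 1 by rewrite ge_min lexx.
have tK : t * K < f ^+ m.
 have : t <= f ^+ m / (2 * K) by rewrite ge_min lexx orbT.
 by rewrite ler_pdivlMr ?(mulr_gt0 (ltr0n _ 2) K0)// => h; have := mulr_gt0 t0 K0; lra.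
pose w : C := m.-root (rc t * y / u.[a]).
have wm : w ^+ m = rc t * y / u.[a] by rewrite rootCK.
have aw : abs w < f.
 rewrite -(ltr_pXn2r m0) ?nnegrE ?abs_ge0 ?(ltW f0)// -absX wm.
 by rewrite abs_div absM abs_rc gtr0_norm// -mulrA.
move: aw; rewrite lt_min => /andP[wd we].
exists (a + w), t; split=> //; first by rewrite addrC addKr.
rewrite pE (addrC a) addrK wm.
have -> : p.[a] + u.[w + a] * (rc t * y / u.[a]) - (p.[a] + rc t * y) =
  (u.[w + a] - u.[a]) * (rc t * y / u.[a]) by field.
rewrite absM abs_div absM abs_rc gtr0_norm//.
have := ud (w + a); rewrite addrK => /(_ wd) h.
have -> : t * abs y / 2 = abs u.[a] / 2 * (t * abs y / abs u.[a]) by field; rewrite gt_eqF.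
by rewrite ler_wpM2r ?(ltW h)// divr_ge0 ?mulr_ge0 ?ltW.
Qed.

Lemma abs_increase p a e : nonconstant p -> 0 < e ->
 exists2 z, abs (z - a) < e & abs p.[a] < abs p.[z].
Proof.
move=> sp e0; have [pa|pa] := eqVneq p.[a] 0.
 have [z [t [ze t0 t1 h]]] := local_direction a sp (oner_neq0 C) e0.
 exists z => //; rewrite pa abs0 abs_gt0; apply/eqP => pz.
 by move: h; rewrite pz pa add0r add0r absN mulr1 abs_rc abs1 gtr0_norm//; lra.
have [z [t [ze t0 t1 h]]] := local_direction a sp pa e0; exists z => //.
have ap : 0 < abs p.[a] by rewrite abs_gt0.
have := abs_lip (p.[a] + rc t * p.[a]) p.[z]; rewrite absB.
have -> : p.[a] + rc t * p.[a] = rc (1 + t) * p.[a] by rewrite rcD rc1 mulrDl mul1r.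
move: h; have -> : p.[a] + rc t * p.[a] = rc (1 + t) * p.[a] by rewrite rcD rc1 mulrDl mul1r.
rewrite absM abs_rc gtr0_norm; last lra.
nra.
Qed.

Lemma abs_decrease p a e : nonconstant p -> 0 < e -> p.[a] != 0 ->
 exists2 z, abs (z - a) < e & abs p.[z] < abs p.[a].
Proof.
move=> sp e0 pa; have npa : - p.[a] != 0 by rewrite oppr_eq0.
have [z [t [ze t0 t1]]] := local_direction a sp npa e0.
have -> : p.[a] + rc t * - p.[a] = rc (1 - t) * p.[a] by rewrite rcB rc1 mulrBl mul1r mulrN.
rewrite absN => h; exists z => //.
have ap : 0 < abs p.[a] by rewrite abs_gt0.
have := abs_lip p.[z] (rc (1 - t) * p.[a]).
rewrite absM abs_rcE; last lra.
nra.
Qed.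

(** On a small circle around a the distance of p to p(a) is at least some k > 0. For w within k/2 of
    p(a) the minimum of |p - w| over the closed disc is attained inside, and it is zero because |p -
    w| could be decreased otherwise. *)
Lemma horner_open_mapping p a e : nonconstant p -> 0 < e -> exists2 d, 0 < d &
 forall w, abs (w - p.[a]) < d -> exists2 z, abs (z - a) < e & p.[z] = w.
Proof.
move=> sp e0; have [m [u [m0 ua pE]]] := local_factor a sp.
have au : 0 < abs u.[a] by rewrite abs_gt0.
have [d d0 ud'] := horner_near u a au.
have ud z : abs (z - a) < d -> u.[z] != 0.
 by move=> /ud'; apply: contraTneq => ->; rewrite sub0r absN ltxx.
pose r := Num.min d e / 2.
have r0 : 0 < r by rewrite divr_gt0// lt_min d0.
have rd : r < d.
 have : Num.min d e <= d by rewrite ge_min lexx.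
 by rewrite /r; lra.
have re : r < e.
 have : Num.min d e <= e by rewrite ge_min lexx orbT.
 by rewrite /r; lra.
pose S : set C := [set z | abs (z - a) = r].
have cS : compact S.
 apply: (subclosed_compact _ (@compact_cdisc a r)); last by move=> z; rewrite /cdisc/= => ->.
 have -> : S = cdisc a r `&` ~` disc a r.
  apply/seteqP; split=> z; rewrite /S /cdisc /disc/=.
   by move=> ->; split=> //; rewrite ltxx.
  move=> [h1 /negP].
  rewrite -leNgt => h2; apply/eqP; rewrite eq_le h1//.
 by apply: closedI; [exact: closed_cdisc|exact/open_closedC/open_disc].
have S0 : S !=set0.
 by exists (a + rc r); rewrite /S/= addrC addKr abs_rc gtr0_norm.
have [c Sc cmin] := compact_abs_min S0 cS (@abs_horner_continuous (p - p.[a]%:P)).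
pose k := abs (p - p.[a]%:P).[c].
have k0 : 0 < k.
 rewrite /k abs_gt0 hornerD hornerN hornerC pE addrAC subrr add0r mulf_neq0//.
  by apply: ud; rewrite Sc.
 by rewrite expf_neq0// -abs_gt0 Sc.
exists (k / 2); first by rewrite divr_gt0.
move=> w wk; have cD : cdisc a r !=set0 by exists a; rewrite /cdisc/= subrr abs0 ltW.
have [z0 Dz0 zmin] := compact_abs_min cD (@compact_cdisc a r)
 (@abs_horner_continuous (p - w%:P)).
have Da : cdisc a r a by rewrite /cdisc/= subrr abs0 ltW.
have hz0 : abs (p.[z0] - w) < k / 2.
 by have := zmin a Da; rewrite !hornerE (absB p.[a]); lra.
have z0r : abs (z0 - a) < r.
 rewrite lt_neqAle Dz0 andbT; apply/eqP => Sz0.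
 have := cmin z0 Sz0; rewrite -/k hornerD hornerN hornerC.
 by have := abs_tri w p.[z0] p.[a]; lra.
exists z0; first by rewrite (lt_trans z0r).
apply/eqP; rewrite -subr_eq0; apply/negP => /negP nz.
have nz' : (p - w%:P).[z0] != 0 by rewrite hornerD hornerN hornerC.
have rz : 0 < r - abs (z0 - a) by rewrite subr_gt0.
have [z zz0] := abs_decrease (nonconstantB w sp) rz nz'.
apply/negP; rewrite -leNgt; apply: zmin.
by rewrite /cdisc/=; have := abs_tri z0 z a; lra.
Qed.

Lemma open_horner_image p (U : set C) : nonconstant p -> open U ->
 open [set p.[z] | z in U].
Proof.
move=> sp /openPC oU; apply/openPC => _ [a Ua <-].
have [e e0 eU] := oU a Ua; have [d d0 h] := horner_open_mapping a sp e0.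
by exists d => // w /h[z za <-]; exists z => //; apply: eU.
Qed.

Lemma maximum_principle p (K : set C) M : compact K ->
 (forall z, boundary K z -> abs p.[z] <= M) -> forall z, K z -> abs p.[z] <= M.
Proof.
move=> cK bM z Kz; have clK : closed K by have /compactC[] := cK.
have nX : nonconstant ('X : {poly C}) by rewrite /nonconstant size_polyX.
have K0 : K !=set0 by exists z.
have maxb q : nonconstant q -> exists2 c, boundary K c & forall z, K z -> abs q.[z] <= abs q.[c].
 move=> sq; have [c Kc cmax] := compact_abs_max K0 cK (@abs_horner_continuous q).
 exists c => //; rewrite boundaryE//; split=> // /interiorPC[r r0 rK].
 have [w wc] := abs_increase c sq r0.
 by apply/negP; rewrite -leNgt; apply/cmax/rK.
have [sp|] := boolP (nonconstant p).
 by have [c bc cmax] := maxb p sp; exact: le_trans (cmax z Kz) (bM c bc).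
rewrite /nonconstant -leqNgt => /size1_polyC pc.
have [c bc _] := maxb _ nX.
by have := bM c bc; rewrite pc !hornerC.
Qed.

Lemma minimum_principle p (K : set C) m : nonconstant p -> compact K ->
 (forall z, K z -> p.[z] != 0) ->
 (forall z, boundary K z -> m <= abs p.[z]) -> forall z, K z -> m <= abs p.[z].
Proof.
move=> sp cK nz bM z Kz; have clK : closed K by have /compactC[] := cK.
have K0 : K !=set0 by exists z.
have [c Kc cmin] := compact_abs_min K0 cK (@abs_horner_continuous p).
apply: le_trans (cmin z Kz); apply: bM; rewrite boundaryE//; split=> //.
move=> /interiorPC[r r0 rK]; have [w wc] := abs_decrease sp r0 (nz c Kc).
by apply/negP; rewrite -leNgt; apply/cmin/rK.
Qed.

Lemma horner_prod_XsubC (rs : seq C) c z :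
 (c *: \prod_(a <- rs) ('X - a%:P)).[z] = c * \prod_(a <- rs) (z - a).
Proof.
rewrite hornerZ; congr (_ * _); elim: rs => [|a rs IH]; first by rewrite !big_nil hornerC.
by rewrite !big_cons hornerM IH hornerXsubC.
Qed.

Lemma roots_factor p : p != 0 -> exists rs : seq C,
 [/\ size rs = (size p).-1, (forall z, (z \in rs) = root p z) &
   forall z, p.[z] = lead_coef p * \prod_(a <- rs) (z - a)].
Proof.
move=> p0; have [rs prs] := closed_field_poly_normal p; exists rs; split.
- by rewrite [in RHS]prs size_scale ?lead_coef_eq0// size_prod_XsubC.
- by move=> z; rewrite {1}prs rootZ ?lead_coef_eq0// root_prod_XsubC.
- by move=> z; rewrite {1}prs horner_prod_XsubC.
Qed.

Lemma horner_growth_lower p : p != 0 -> exists2 k, 0 < k & exists2 r, 1 <= r &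
 forall z, r <= abs z -> k * abs z ^+ (size p).-1 <= abs p.[z].
Proof.
move=> p0; have [rs [srs _ pE]] := roots_factor p0.
have l0 : 0 < abs (lead_coef p) by rewrite abs_gt0 lead_coef_eq0.
exists (abs (lead_coef p) * (2^-1) ^+ (size p).-1).
 by rewrite mulr_gt0// exprn_gt0// invr_gt0.
exists (1 + 2 * \sum_(a <- rs) abs a).
 by rewrite lerDl mulr_ge0// sumr_ge0// => *; exact: abs_ge0.
move=> z zr; rewrite pE absM -mulrA ler_pM2l// -exprMn -srs abs_prod.
have h a : a \in rs -> 2^-1 * abs z <= abs (z - a).
 move=> ars; have : abs a <= \sum_(a <- rs) abs a.
  rewrite (big_rem a)//= lerDl sumr_ge0// => *; exact: abs_ge0.
 have := abs_lip z a; have := abs_ge0 a; lra.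
elim: rs h {srs pE zr} => [|a rs IH] h; first by rewrite big_nil expr0.
rewrite big_cons exprS ler_pM ?exprn_ge0 ?mulr_ge0 ?abs_ge0 ?invr_ge0//.
 by apply: h; rewrite mem_head.
by apply: IH => b brs; apply: h; rewrite in_cons brs orbT.
Qed.

Lemma horner_growth_upper p : exists2 k, 1 <= k &
 forall z B, 1 <= B -> abs z <= B -> abs p.[z] <= k * B ^+ (size p).-1.
Proof.
exists (1 + \sum_(i < size p) abs p`_i).
 by rewrite lerDl sumr_ge0// => *; exact: abs_ge0.
move=> z B B1 zB; rewrite horner_coef (le_trans (abs_sum _ _ _))//.
rewrite mulrDl mul1r ler_wpDl ?exprn_ge0 ?(le_trans ler01)// mulr_suml.
apply: ler_sum => i _; rewrite absM absX ler_wpM2l ?abs_ge0//.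
apply: (@le_trans _ _ (B ^+ i)); first by rewrite lerXn2r ?nnegrE ?abs_ge0// (le_trans ler01).
by rewrite ler_weXn2l// -ltnS prednK ?ltn_ord// (leq_ltn_trans _ (ltn_ord i)).
Qed.

Lemma horner_unbounded p B : nonconstant p -> exists2 r, 1 <= r &
 forall z, r <= abs z -> B <= abs p.[z].
Proof.
move=> sp; have p0 : p != 0 by rewrite -size_poly_gt0 (leq_trans _ sp).
have [k k0 [r r1 h]] := horner_growth_lower p0.
exists (r + `|B| / k); first by rewrite ler_wpDr// divr_ge0// ltW.
move=> z zr; have zr' : r <= abs z by rewrite (le_trans _ zr)// lerDl divr_ge0// ltW.
apply: le_trans (h z zr'); have z1 : 1 <= abs z by apply: le_trans zr'.
have : abs z <= abs z ^+ (size p).-1.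
 by rewrite -[leLHS]expr1 ler_weXn2l// -ltnS prednK// (leq_trans _ sp).
have Bz : `|B| / k <= abs z by lra.
rewrite ler_pdivrMr// in Bz; have := ler_norm B; nra.
Qed.

Lemma sublevel_bounded p t : nonconstant p -> exists M, forall z, abs p.[z] <= t -> abs z <= M.
Proof.
move=> sp; have [r _ h] := horner_unbounded (t + 1) sp; exists r => z zt.
by apply: lerF => /ltW/h; lra.
Qed.

Lemma closed_sublevel p t : closed [set z : C | abs p.[z] <= t].
Proof.
by apply: (@closed_comp _ _ (fun z : C => abs p.[z]) [set x | x <= t]) => [z _|];
 [exact: abs_horner_continuous|exact: closed_le].
Qed.

Lemma closed_superlevel p t : closed [set z : C | t <= abs p.[z]].
Proof.
by apply: (@closed_comp _ _ (fun z : C => abs p.[z]) [set x | t <= x]) => [z _|];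
 [exact: abs_horner_continuous|exact: closed_ge].
Qed.

Lemma open_sublevel p t : open [set z : C | abs p.[z] < t].
Proof.
by apply: (@open_comp _ _ (fun z : C => abs p.[z]) [set x | x < t]) => [z _|];
 [exact: abs_horner_continuous|exact: open_lt].
Qed.

Lemma open_superlevel p t : open [set z : C | t < abs p.[z]].
Proof.
by apply: (@open_comp _ _ (fun z : C => abs p.[z]) [set x | t < x]) => [z _|];
 [exact: abs_horner_continuous|exact: open_gt].
Qed.

Lemma boundary_cdisc a r z : boundary (cdisc a r) z -> abs (z - a) = r.
Proof.
rewrite (boundaryE (@closed_cdisc a r)) => -[zr zi]; apply/eqP; rewrite eq_le zr/= leNgt.
apply/negP => h; apply: zi; apply/interiorPC; exists (r - abs (z - a)); first by rewrite subr_gt0.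
by move=> w; rewrite /disc/cdisc/= => wz; have := abs_tri z w a; lra.
Qed.

(** The difference quotient at v is a polynomial, so its bound on the circle of radius r about v
    extends to the disc by the maximum principle; for |u - v| > r the estimate is trivial. *)
Lemma horner_lipschitz Q a r B : 0 < r ->
 (forall z, abs (z - a) < 2 * r -> abs Q.[z] <= B) ->
 forall u v, abs (u - a) < r -> abs (v - a) < r ->
 abs (Q.[u] - Q.[v]) <= 4 * B / r * abs (u - v).
Proof.
move=> r0 QB u v ua va; have [Qu Qv] : abs Q.[u] <= B /\ abs Q.[v] <= B by split; apply: QB; lra.
have B0 := le_trans (abs_ge0 _) Qu; have uv0 := abs_ge0 (u - v).
have [uv|uv] := leP (abs (u - v)) r; last first.
 by apply: le_trans (absBD _ _) _; rewrite mulrAC ler_pdivlMr//; nra.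
have /factor_theorem[P PE] : root (Q - Q.[v]%:P) v by rewrite rootE !hornerE subrr.
have key z : Q.[z] - Q.[v] = P.[z] * (z - v) by have := congr1 (horner^~ z) PE; rewrite !hornerE.
have Pu : abs P.[u] <= 2 * B / r.
 apply: (maximum_principle (@compact_cdisc v r)) uv => z /boundary_cdisc zr.
 rewrite ler_pdivlMr// -zr -absM -key; apply: le_trans (absBD _ _) _.
 by have : abs Q.[z] <= B; [apply: QB; have := abs_tri v z a; lra|lra].
rewrite key absM; apply: ler_wpM2r => //; apply: le_trans Pu _.
by rewrite ler_pM2r ?invr_gt0//; lra.
Qed.

(** [horner_lipschitz] applied to p minus its linear part, which equals (q(z) - q(c)) (z - c) with q
    the difference quotient at c. *)
Lemma horner_linear_approx p c e : 0 < e -> exists2 d, 0 < d & forall u v,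
 abs (u - c) < d -> abs (v - c) < d ->
 abs (p.[u] - p.[v] - (u - v) * p^`().[c]) <= e * abs (u - v).
Proof.
move=> e0; have /factor_theorem[q qE] : root (p - p.[c]%:P) c by rewrite rootE !hornerE subrr.
have -> : p^`().[c] = q.[c].
 have := congr1 (fun f : {poly C} => f^`().[c]) qE.
 by rewrite derivB derivC subr0 derivM derivXsubC !hornerE subrr => ->; ring.
have e8 : 0 < e / 8 by rewrite divr_gt0.
have [d d0 hd] := horner_near q c e8; have d2 : 0 < d / 2 by rewrite divr_gt0.
exists (d / 2) => // u v uc vc; pose Q := p - q.[c] *: 'X - (p.[c] - q.[c] * c)%:P.
have := @horner_lipschitz Q c (d / 2) (e * (d / 2) / 4) d2 _ u v uc vc.
have -> : Q.[u] - Q.[v] = p.[u] - p.[v] - (u - v) * q.[c] by rewrite /Q !hornerE; ring.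
have -> : 4 * (e * (d / 2) / 4) / (d / 2) = e by field; rewrite gt_eqF.
apply=> z zc; have -> : Q.[z] = (q.[z] - q.[c]) * (z - c).
 by have := congr1 (horner^~ z) qE; rewrite /Q !hornerE mulrBl => <-; ring.
rewrite absM; have := hd z ltac:(lra); have := abs_ge0 (z - c); have := abs_ge0 (q.[z] - q.[c]); nra.
Qed.

Lemma horner_locally_injective p c : p^`().[c] != 0 -> exists2 d, 0 < d &
 forall u v, abs (u - c) < d -> abs (v - c) < d -> p.[u] = p.[v] -> u = v.
Proof.
move=> pc; have ap : 0 < abs p^`().[c] by rewrite abs_gt0.
have [d d0 h] := horner_linear_approx p c (divr_gt0 ap (ltr0n _ 2)).
exists d => // u v ud vd puv; apply/eqP; rewrite -subr_eq0 -abs_eq0.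
have := h u v ud vd; rewrite puv subrr sub0r absN absM => {}h.
by rewrite eq_le abs_ge0 andbT; have := abs_ge0 (u - v); nra.
Qed.

End PolynomialLocal.

(** * A mountain pass argument for the sublevel sets of |Q| *)

Section MountainPass.
Variables (Q : {poly C}) (E : set C) (L s d : R).
Hypothesis Qnc : nonconstant Q.
Hypothesis oE : open E.
Hypothesis Ls : L <= s.
Hypothesis s0 : 0 <= s.
Hypothesis sd : s < d.
Hypothesis clE : forall t, t < d -> closed (E `&` [set z | abs Q.[z] <= t]).
Hypothesis nocrit : forall c, E c -> s < abs Q.[c] -> abs Q.[c] < d -> Q^`().[c] != 0.
Let f z := abs Q.[z].
Let Y t : set C := [set z | [/\ E z, L <= f z & f z <= t]].
Let W t : set C := [set z | [/\ E z, L <= f z & f z < t]].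

Let Ysub t t' : t <= t' -> Y t `<=` Y t'.
Proof. by move=> tt z [Ez Lz zt]; split=> //; apply: le_trans tt. Qed.

Let Yclosed t : t < d -> closed (Y t).
Proof.
move=> td.
have -> : Y t = (E `&` [set z | abs Q.[z] <= t]) `&` [set z | L <= abs Q.[z]].
 by apply/seteqP; split=> z; [case|case=> [[]]].
by apply: closedI; [exact: clE|exact: closed_superlevel].
Qed.

Let Ycompact t : t < d -> compact (Y t).
Proof.
move=> td; apply/compactC; split; first exact: Yclosed.
by have [M h] := sublevel_bounded t Qnc; exists M => z [_ _]; apply: h.
Qed.

Variables U V : set C.
(** A separation of X that extends the given separation U, V of [Y s]. The aim is to carry it from
    the level s up to the level d, between which no critical value modulus lies. *)
Let sep X P P' := [/\ open P, open P', X `<=` P `|` P', (forall x, X x -> P x -> P' x -> False) &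
 (forall x, Y s x -> U x -> P x) /\ (forall x, Y s x -> V x -> P' x)].
Hypothesis UV : sep (Y s) U V.

Let sep_closed X P P' : closed X -> sep X P P' -> closed (X `&` P) /\ closed (X `&` P').
Proof.
move=> cX [oP oP' XP PP' _]; split.
 have -> : X `&` P = X `&` ~` P'; last by apply: closedI => //; exact: open_closedC.
 by apply/seteqP; split=> x [Xx Px]; split=> //; [exact: PP' Px|case: (XP x Xx)].
have -> : X `&` P' = X `&` ~` P; last by apply: closedI => //; exact: open_closedC.
by apply/seteqP; split=> x [Xx Px]; split=> //; [move=> h; exact: PP' h Px|case: (XP x Xx)].
Qed.

(* A piece of [Y t] away from [Y s] would contain a positive minimum of |Q|. *)
Let piece t O : s <= t -> t < d -> open O -> closed (Y t `&` O) -> (forall x, Y s x -> ~ O x) ->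
 forall x, Y t x -> ~ O x.
Proof.
move=> st td oO cO YO x Yx Ox; have YOn : Y t `&` O !=set0 by exists x.
have [z0 [[Ez0 Lz0 z0t] Oz0] zmin] := compact_abs_min YOn
 (subclosed_compact cO (Ycompact td) (@subIsetl _ _ _)) (@abs_horner_continuous Q).
have sz0 : s < f z0 by rewrite ltNge; apply/negP => h; exact: YO Oz0.
have /openPC/(_ z0)[] : open (O `&` E `&` [set z | s < abs Q.[z]]).
 by apply: openI; [exact: openI|exact: open_superlevel].
 by [].
move=> r r0 hr; have Q0 : Q.[z0] != 0 by rewrite -abs_gt0; apply: le_lt_trans sz0.
have [w wz0 fw] := abs_decrease Qnc r0 Q0; have [[Ow Ew] sw] := hr w wz0.
have Yw : Y t w by split=> //; [exact: le_trans Ls (ltW sw)|exact: le_trans (ltW fw) z0t].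
by have := zmin w (conj Yw Ow); rewrite leNgt fw.
Qed.

(** Where two separations disagree there would be a relatively clopen piece away from [Y s], which
    [piece] excludes. *)
Let consistent t t' A B A' B' : s <= t -> t <= t' -> t' < d -> sep (Y t) A B -> sep (Y t') A' B' ->
 forall x, Y t x -> ~ (A x /\ B' x) /\ ~ (B x /\ A' x).
Proof.
move=> st tt' t'd S S' x Yx; have td : t < d by apply: le_lt_trans t'd.
have [cA cB] := sep_closed (Yclosed td) S; have [cA' cB'] := sep_closed (Yclosed t'd) S'.
move: S S' => [oA oB YAB AB [UA VB]] [oA' oB' YAB' AB' [UA' VB']].
have cl O O' : closed (Y t `&` O) -> closed (Y t' `&` O') -> closed (Y t `&` (O `&` O')).
 move=> c c'; have -> : Y t `&` (O `&` O') = (Y t `&` O) `&` (Y t' `&` O'); last exact: closedI.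
 by apply/seteqP; split=> y [y1 [y2 y3]]; [split; split=> //; exact: Ysub tt' _ _|case: y1].
have YsUV y : Y s y -> [/\ Y t y, Y t' y & U y \/ V y].
 by move=> Yy; have [_ _ /(_ y Yy)] := UV; split=> //; apply: Ysub Yy => //; exact: le_trans tt'.
split; apply: (piece st td _ (cl _ _ _ _) _ Yx) => //; try exact: openI.
 by move=> y Yy [Ay By']; have [Y1 Y2 [Uy|Vy]] := YsUV y Yy; [apply: AB' (UA' y Yy Uy) By'|apply: AB Ay (VB y Yy Vy)].
by move=> y Yy [By Ay']; have [Y1 Y2 [Uy|Vy]] := YsUV y Yy; [apply: AB (UA y Yy Uy) By|apply: AB' Ay' (VB' y Yy Vy)].
Qed.

(** Separations at different levels below tau agree where both apply, so their restrictions to |Q| <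
    t glue. *)
Let splitting tau : s < tau -> tau <= d ->
 (forall t, s <= t -> t < tau -> exists A B, sep (Y t) A B) -> exists A B, sep (W tau) A B.
Proof.
move=> stau taud gd.
pose part (pr : set C -> set C -> set C) := [set x | exists t A B,
 [/\ s <= t, t < tau, sep (Y t) A B, pr A B x & f x < t]].
have opart pr : (forall A B, open A -> open B -> open (pr A B)) -> open (part pr).
 move=> opr; apply/openPC => x [t [A [B [st tt S px xt]]]]; have [oA oB _ _ _] := S.
 have /openPC/(_ x)[] : open (pr A B `&` [set z | abs Q.[z] < t]).
  by apply: openI; [exact: opr|exact: open_sublevel].
  by [].
 by move=> r r0 hr; exists r => // y /hr[py yt]; exists t, A, B.
have loc x : W tau x -> exists t A B, [/\ s <= t, t < tau, sep (Y t) A B, Y t x & f x < t].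
 move=> [Ex Lx xt]; have mt : Num.max s (f x) < tau by rewrite gt_max stau.
 have h1 : s <= Num.max s (f x) by rewrite le_max lexx.
 have h2 : f x <= Num.max s (f x) by rewrite le_max lexx orbT.
 have st : s <= (Num.max s (f x) + tau) / 2 by lra.
 have [A [B S]] := gd _ st ltac:(lra); exists ((Num.max s (f x) + tau) / 2), A, B.
 by split=> //; [lra|split=> //; lra|lra].
exists (part (fun A B => A)), (part (fun A B => B)); split.
- exact: opart.
- exact: opart.
- move=> x /loc[t [A [B [st tt S Yx xt]]]]; have [_ _ /(_ x Yx) [h|h] _ _] := S.
  by left; exists t, A, B.
 by right; exists t, A, B.
- move=> x [Ex Lx _] [t [A [B [st tt S Ax xt]]]] [t' [A' [B' [st' tt' S' Bx xt']]]].
 have [h|/ltW h] := leP t t'.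
  have Yx : Y t x by split=> //; exact: ltW.
  by case: (consistent st h (lt_le_trans tt' taud) S S' Yx).1.
 have Yx : Y t' x by split=> //; exact: ltW.
 by case: (consistent st' h (lt_le_trans tt taud) S' S Yx).2.
by split=> x Yx xx; have Wx : W tau x by [case: Yx => ? ? h; split=> //; exact: le_lt_trans stau];
 have [t [A [B [st tt S Yt xt]]]] := loc x Wx; exists t, A, B; split=> //;
 have [_ _ _ _ [UA VB]] := S; [exact: UA|exact: VB].
Qed.

(** Disjoint neighbourhoods of the two compact halves of [Y t] still cover the sublevel sets
    slightly above t. *)
Let good_open t A B : s <= t -> t < d -> sep (Y t) A B ->
 exists2 t', t < t' /\ t' < d & exists A B, sep (Y t') A B.
Proof.
move=> st td S; have [cA cB] := sep_closed (Yclosed td) S; have [oA oB YAB AB [UA VB]] := S.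
have AB0 : (Y t `&` A) `&` (Y t `&` B) = set0.
 by apply: disjI => x [Yx Ax] [_ Bx]; exact: AB Bx.
have [W1 [W2 [oW1 oW2 AW BW W12]]] :=
 separate_compactC (subclosed_compact cA (Ycompact td) (@subIsetl _ _ _)) cB AB0.
(* The levels t + k n decrease to t, starting from the midpoint of t and d. *)
pose k n := (d - t) / n.+2%:R.
have k0 n : 0 < k n by rewrite divr_gt0// subr_gt0.
have kd n : t + k n < d.
 have : k n <= (d - t) / 2; last by lra.
 by rewrite ler_pM2l ?subr_gt0// lef_pV2 ?posrE ?ltr0n// ler_nat.
have kS n : k n.+1 <= k n by rewrite ler_pM2l ?subr_gt0// lef_pV2 ?posrE ?ltr0n// ler_nat.
have [|n nP] := nested_compact_subset (@hausdorffC)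
 (fun n => Ycompact (kd n)) (fun n => Ysub (lerD (lexx t) (kS n))) (openU oW1 oW2).
 move=> z zK; have : Y t z; last by move=> Yz; case: (YAB z Yz) => h; [left; exact: AW|right; exact: BW].
 have [Ez Lz _] := zK 0%N I; split=> //; apply: lerF => tz.
 have e0 : 0 < (f z - t) / (d - t) by rewrite divr_gt0 ?subr_gt0.
 have [n hn] := ltr_add_invr e0; have [_ _] := zK n I; rewrite /k.
 rewrite add0r ltr_pdivlMr ?subr_gt0// in hn.
 have : (d - t) / n.+2%:R <= n.+1%:R^-1 * (d - t).
  by rewrite mulrC ler_pM2r ?subr_gt0// lef_pV2 ?posrE ?ltr0n// ler_nat.
 move=> h1 h2; have := le_lt_trans h1 hn; by rewrite ltrBrDl ltNge h2.
exists (t + k n); first by rewrite ltrDl k0 kd.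
have sub x : Y s x -> Y t x by exact: Ysub.
exists W1, W2; split=> //; first exact: nP (leqnn n).
 by move=> x _; exact: (disjE W12).
by split=> x Yx h; [apply: AW; split; [exact: sub|exact: UA]|apply: BW; split; [exact: sub|exact: VB]].
Qed.

(** Near the noncritical point c the map Q is injective and open, and the values close to Q(c) of
    modulus below |Q(c)| form an intersection of two discs. A separation of [G] would be carried to
    this convex set. *)
Let local_sublevel c N : Q^`().[c] != 0 -> Q.[c] != 0 -> 0 < N -> exists G : set C,
 [/\ connected G, G `<=` [set z | abs (z - c) < N /\ f z < f c] &
 exists2 r, 0 < r & forall z, abs (z - c) < r -> f z < f c -> G z].
Proof.
move=> Qc Qc0 N0; have [e e0 inj] := horner_locally_injective Qc.
pose e' := Num.min e N; have e'0 : 0 < e' by rewrite lt_min e0.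
have [k k0 onto] := horner_open_mapping c Qnc e'0.
pose H : set C := [set w | abs (w - Q.[c]) < k /\ abs w < f c].
pose G : set C := [set z | abs (z - c) < e' /\ H Q.[z]].
have oH : open H.
 have -> : H = disc Q.[c] k `&` [set w | abs ('X : {poly C}).[w] < f c].
  by apply/seteqP; split=> w; rewrite /H /disc/= hornerX.
 by apply: openI; [exact: open_disc|exact: open_sublevel].
have oG : open G.
 have -> : G = disc c e' `&` (fun z => Q.[z]) @^-1` H by [].
 by apply: openI; [exact: open_disc|apply: open_comp => // z _; exact: horner_continuousC].
have conv u v (t : R) : H u -> H v -> 0 <= t -> t <= 1 -> H (u + rc t * (v - u)).
 move=> [u1 u2] [v1 v2] t0 t1.
 split; first by apply: convex_disc => //; rewrite t0.
 by have := @convex_disc 0 (f c) u v t; rewrite /disc /= !subr0 t0; exact.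
have cH : connected H.
 have [H0|/set0P[u Hu]] := eqVneq H set0; first by rewrite H0; exact: connected0.
 by apply: (@star_connected _ u) => z t Hz; apply: conv.
have onH w : H w -> exists2 z, G z & Q.[z] = w.
 by move=> Hw; have [z zc zw] := onto w Hw.1; exists z => //; split=> //; rewrite zw.
have injG u v : G u -> G v -> Q.[u] = Q.[v] -> u = v.
 move=> [u1 _] [v1 _]; move: u1 v1; rewrite !lt_min => /andP[? _] /andP[? _]; exact: inj.
exists G; split.
- apply: contrapT => /not_connected_open[X [Z [oX oZ GXZ GXZ0 [[x [Gx Xx]] [z [Gz Zz]]]]]].
 have : H `<=` [set Q.[z] | z in G `&` X].
  apply: (@connected_open_split _ _ _ [set Q.[z] | z in G `&` Z]) => //.
  - by apply: open_horner_image => //; apply: openI.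
  - by apply: open_horner_image => //; apply: openI.
  - move=> w /onH[y Gy <-]; have [h|h] := GXZ y Gy; [left|right]; by exists y.
  - move=> w _ [y1 [Gy1 Xy1] <-] [y2 [Gy2 Zy2] /injG y21].
   have {}y21 := y21 Gy2 Gy1; rewrite y21 in Zy2.
   exact: GXZ0 Gy1 Xy1 Zy2.
  by exists Q.[x]; split; [case: Gx|exists x].
 move=> /(_ Q.[z]) -[|y [Gy Xy] /injG yz]; first by case: Gz.
 have {}yz := yz Gy Gz; rewrite yz in Xy.
 exact: GXZ0 Gz Xy Zz.
- move=> z [zc [_ fz]]; split=> //; move: zc; rewrite lt_min => /andP[] //.
have [r r0 hr] := horner_near Q c k0.
exists (Num.min r e'); first by rewrite lt_min r0.
by move=> z; rewrite lt_min => /andP[zr ze] fz; split=> //; split=> //; apply: hr.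
Qed.

(** The closures of the two halves of [W tau] separate [Y tau]. They cover it because |Q| can be
    decreased near any point of level tau, and they could meet only at such a point, where the
    connected local sublevel set would join the halves. *)
Let good_closed tau : s < tau -> tau < d -> (exists A B, sep (W tau) A B) ->
 exists A B, sep (Y tau) A B.
Proof.
move=> stau taud [A [B [oA oB cov AB [UA VB]]]].
have lim X x : closure (W tau `&` X) x -> Y tau x.
 move=> clx; have /closure_id-> := Yclosed taud; apply: closureS clx => y [[Ey Ly yt] _].
 by split=> //; exact: ltW.
have clo X X' x : open X' -> (forall y, W tau y -> X y -> X' y -> False) ->
  closure (W tau `&` X) x -> ~ X' x.
 by move=> oX' XX' clx X'x; have [y [[Wy Xy] X'y]] := clx _ (open_nbhs_nbhs (conj oX' X'x)); exact: XX' Xy X'y.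
have BA y : W tau y -> B y -> A y -> False by move=> Wy By Ay; exact: AB By.
have WY x : Y s x -> W tau x by case=> ? ? h; split=> //; exact: le_lt_trans stau.
have dis x : closure (W tau `&` A) x -> closure (W tau `&` B) x -> False.
 move=> clA clB; have [Ex Lx] := lim _ _ clA; rewrite le_eqVlt => /orP[/eqP xt|xt]; last first.
  have [h|h] := cov x (And3 Ex Lx xt); [exact: clo oA BA clB h|exact: clo oB AB clA h].
 have sx : s < f x by rewrite xt.
 have Qx0 : Q.[x] != 0 by rewrite -abs_gt0; apply: le_lt_trans sx.
 have Qx : Q^`().[x] != 0 by apply: nocrit; rewrite // -/(f x) xt.
 have /openPC/(_ x)[] : open (E `&` [set z | s < abs Q.[z]]) by apply: openI => //; exact: open_superlevel.
  by [].
 move=> N N0 hN; have [G [cG GN [r r0 Gr]]] := local_sublevel Qx Qx0 N0.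
 have GW y : G y -> W tau y.
  by move=> /GN[yx fy]; have [Ey sy] := hN y yx; split=> //; [exact: le_trans Ls (ltW sy)|rewrite -xt].
 have meet X : closure (W tau `&` X) x -> exists2 y, G y & X y.
  move=> /closurePC/(_ r r0)[y [[Ey Ly yt] Xy] yx]; exists y => //; apply: Gr => //.
  by rewrite xt.
 have [y Gy Ay] := meet A clA; have [u Gu Bu] := meet B clB.
 suff : G `<=` A by move=> /(_ u Gu) Au; exact: AB (GW u Gu) Au Bu.
 apply: (connected_open_split cG oA oB); first by move=> z /GW/cov.
  by move=> z /GW Wz Az Bz; exact: AB Bz.
 by exists y.
have cover x : Y tau x -> closure (W tau `&` A) x \/ closure (W tau `&` B) x.
 move=> [Ex Lx]; rewrite le_eqVlt => /orP[/eqP xt|xt]; last first.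
  have Wx : W tau x by [].
  by have [h|h] := cov x Wx; [left|right]; apply: subset_closure.
 apply: contrapT => /not_orP[nA nB].
 have /openPC/(_ x)[] : open (~` closure (W tau `&` A) `&` ~` closure (W tau `&` B) `&` E `&` [set z | s < abs Q.[z]]).
  apply: openI; last exact: open_superlevel.
  by apply: openI => //; apply: openI; exact/closed_openC/closed_closure.
  by split=> //=; rewrite -/(f x) xt.
 move=> r r0 hr; have Qx0 : Q.[x] != 0 by rewrite -abs_gt0 -/(f x) xt; apply: le_lt_trans stau.
 have [w wx fw] := abs_decrease Qnc r0 Qx0; have [[[nAw nBw] Ew] sw] := hr w wx.
 have Ww : W tau w by split=> //; [exact: le_trans Ls (ltW sw)|rewrite -xt].
 by have [h|h] := cov w Ww; [apply: nAw|apply: nBw]; apply: subset_closure.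
exists (~` closure (W tau `&` B)), (~` closure (W tau `&` A)); split.
- exact/closed_openC/closed_closure.
- exact/closed_openC/closed_closure.
- by move=> x /cover[h|h]; [left=> /(dis x h)|right=> h'; exact: dis h' h].
- by move=> x /cover[h|h] h1 h2; [exact: h2|exact: h1].
split=> x Yx h h'; [apply: (dis x _ h')|apply: (dis x h')]; apply: subset_closure.
 by split; [exact: WY|exact: UA].
by split; [exact: WY|exact: VB].
Qed.

Let mountain_pass : exists A B, sep (W d) A B.
Proof.
apply: splitting => // t st td; apply: contrapT => ngt.
(* The supremum of the levels that can be separated is itself such a level by [good_closed], and
   then [good_open] exceeds it. *)
pose T := [set t | [/\ s <= t, t < d & exists A B, sep (Y t) A B]].
have down u v : u <= v -> (exists A B, sep (Y v) A B) -> exists A B, sep (Y u) A B.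
 move=> uv [A [B [oA oB YAB AB h]]]; exists A, B; split=> // x Yx.
  exact: YAB (Ysub uv Yx).
 exact: AB (Ysub uv Yx).
have Tt x : T x -> x <= t.
 by move=> [sx xd gx]; apply: lerF => tx; apply: ngt; exact: down (ltW tx) gx.
have Ts : T s by split=> //; exists U, V.
have hs : has_sup T by split; [exists s|exists t => x /Tt].
have stau : s <= sup T by apply: ub_le_sup => //; case: hs.
have taut : sup T <= t by apply: ge_sup => //; exists s.
have taud : sup T < d by apply: le_lt_trans td.
have [A [B gAB]] : exists A B, sep (Y (sup T)) A B.
 move: stau; rewrite le_eqVlt => /orP[/eqP <-|stau]; first by exists U, V.
 apply: good_closed => //; apply: splitting => //; first exact: ltW.
 move=> u su ut; have [v [sv vd gv] uv] := sup_adherent (eps := sup T - u) ltac:(by rewrite subr_gt0) hs.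
 by apply: down gv; move: uv; lra.
have [t' [taut' t'd] gt'] := good_open stau taud gAB.
have : t' <= sup T by apply: ub_le_sup; [case: hs|split=> //; exact: le_trans (ltW taut')].
by rewrite leNgt taut'.
Qed.

Lemma separated_absurd D : connected D -> Y s `<=` D -> D `<=` W d ->
 (exists2 x, Y s x & U x) -> (exists2 x, Y s x & V x) -> False.
Proof.
move=> cD YD DW [x Yx Ux] [y Yy Vy]; have [A [B [oA oB cov AB [UA VB]]]] := mountain_pass.
have : D `<=` A; last by move=> /(_ y (YD y Yy)) Ay; exact: AB (DW y (YD y Yy)) Ay (VB y Yy Vy).
apply: (connected_open_split cD oA oB); first by move=> z /DW/cov.
 by move=> z /DW Wz Az Bz; exact: AB Bz.
by exists x; split; [exact: YD|exact: UA].
Qed.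

End MountainPass.

(** * Connectedness of lemniscates and of their level curves *)

Section Lemniscates.
Implicit Types (w a b : C) (x y : R) (p q Q : {poly C}).

Lemma level_connected Q (E : set C) L s d D : nonconstant Q -> open E ->
 L <= s -> 0 <= s -> s < d ->
 (forall t, t < d -> closed (E `&` [set z | abs Q.[z] <= t])) ->
 (forall c, E c -> s < abs Q.[c] -> abs Q.[c] < d -> Q^`().[c] != 0) ->
 connected D -> [set z | [/\ E z, L <= abs Q.[z] & abs Q.[z] <= s]] `<=` D ->
 D `<=` [set z | [/\ E z, L <= abs Q.[z] & abs Q.[z] < d]] ->
 connected [set z | [/\ E z, L <= abs Q.[z] & abs Q.[z] <= s]].
Proof.
move=> sQ oE Ls s0 sd clE nc cD YD DE; apply: contrapT.
move=> /not_connected_open[U [V [oU oV YUV UV0 [[x [Yx Ux]] [y [Yy Vy]]]]]].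
apply: (separated_absurd sQ oE Ls s0 sd clE nc _ cD YD DE (ex_intro2 _ _ x Yx Ux) (ex_intro2 _ _ y Yy Vy)).
split; [exact: oU|exact: oV|exact: YUV|exact: UV0|by split].
Qed.

(** A disc around the lemniscate is connected and lies below some level d; since all critical values
    have modulus below M, a separation at level M would propagate to this disc. *)
Lemma connected_lemniscate Q M : nonconstant Q -> 0 < M ->
 (forall c, Q^`().[c] = 0 -> abs Q.[c] < M) ->
 connected [set z : C | abs Q.[z] <= M].
Proof.
move=> sQ M0 crit; have [B hB] := sublevel_bounded M sQ.
have [k k1 hk] := horner_growth_upper Q.
have D0 : cdisc 0 `|B| (0 : C) by rewrite /cdisc/= subrr abs0.
have [c _ cmax] := compact_abs_max (ex_intro _ _ D0) (@compact_cdisc 0 `|B|)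
 (@abs_horner_continuous Q).
have -> : [set z : C | abs Q.[z] <= M] =
  [set z : C | [/\ setT z, 0 <= abs Q.[z] & abs Q.[z] <= M]].
 by apply/seteqP; split=> z; [split=> //; exact: abs_ge0|case].
apply: (@level_connected _ setT 0 M (M + abs Q.[c] + 1) (cdisc 0 `|B|)) => //.
- exact: openT.
- exact: ltW.
- exact: ltW.
- by have := abs_ge0 Q.[c]; lra.
- by move=> t _; rewrite setTI; exact: closed_sublevel.
- by move=> b _ Mb _; apply/eqP => /crit; lra.
- exact: connected_cdisc.
- by move=> z [_ _ /hB]; rewrite /cdisc/= subr0 => /le_trans; apply; exact: ler_norm.
by move=> z /cmax zc; split=> //; [exact: abs_ge0|lra].
Qed.

Lemma connected_level Q M : nonconstant Q -> 0 < M ->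
 (forall c, Q^`().[c] = 0 -> abs Q.[c] < M) ->
 connected [set z : C | abs Q.[z] = M].
Proof.
move=> sQ M0 crit; have [r r1 hr] := horner_unbounded (M + 1) sQ.
have r0 : 0 <= r by lra.
(* A piece of [D] away from the outer circle would contain a maximum point of |Q| near which |Q|
   increases without leaving the piece. So [D] is connected and can serve as the upper set in
   [level_connected]. *)
pose D := cdisc 0 r `&` [set z : C | M <= abs Q.[z]].
have clD : closed D by apply: closedI; [exact: closed_cdisc|exact: closed_superlevel].
have circD : circle r `<=` D.
 move=> z zr; split; first by rewrite /cdisc/= subr0 zr.
 by rewrite /=; have := hr z; rewrite zr lexx => /(_ isT); lra.
have cD : connected D.
 apply: contrapT => /(not_connected_closed clD)[U [V [cU cV DUV UV0 [U0 V0]]]].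
 have key (X Z : set C) : closed X -> closed Z -> D = X `|` Z -> X `&` Z = set0 -> Z !=set0 ->
   X (rc r) -> False.
  move=> {U V cU cV DUV UV0 U0 V0} cU cV DUV UV0 V0 Xr.
  have cirU : circle r `<=` X.
   apply: (connected_closed_split (connected_circle r0) cU cV); first by rewrite -DUV.
    by move=> x _; exact: (disjE UV0).
   by exists (rc r); rewrite /circle/= abs_rcE.
  have cptV : compact Z.
   apply: (subclosed_compact cV (@compact_cdisc 0 r)) => v Zv.
   have Dv : D v by rewrite DUV; right.
   by case: Dv.
  have [v Zv vmax] := compact_abs_max V0 cptV (@abs_horner_continuous Q).
  have nU : (~` X) v by move=> Xv; exact: disjE UV0 Xv Zv.
  have [vr Mv] : D v by rewrite DUV; right.
  have vr' : abs (v - 0) < r.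
   rewrite lt_neqAle vr andbT subr0; apply/eqP => h; exact/nU/cirU.
  have /openPC/(_ v)[] : open (~` X `&` disc 0 r).
   by apply: openI; [exact: closed_openC|exact: open_disc].
   by [].
  move=> e e0 he; have [w wv fw] := abs_increase v sQ e0.
  have [nUw wr] := he w wv.
  have : D w by split; [exact: ltW|exact: le_trans (ltW fw)].
  by rewrite DUV => -[//|/vmax]; rewrite leNgt fw.
 have : D (rc r) by apply: circD; rewrite /circle/= abs_rcE.
 rewrite DUV => -[|]; first exact: (key U V).
 by apply: (key V U); rewrite // 1?setUC 1?setIC.
have D0 : D !=set0 by exists (rc r); apply: circD; rewrite /circle/= abs_rcE.
have Dsub : D `<=` cdisc 0 r by move=> z [].
have [c _ cmax] := compact_abs_max D0 (subclosed_compact clD (@compact_cdisc 0 r) Dsub)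
 (@abs_horner_continuous Q).
have -> : [set z : C | abs Q.[z] = M] =
  [set z : C | [/\ setT z, M <= abs Q.[z] & abs Q.[z] <= M]].
 apply/seteqP; split=> z /= => [->|[_ h1 h2]]; first by rewrite lexx.
 by apply/eqP; rewrite eq_le h1 h2.
apply: (@level_connected _ setT M M (M + abs Q.[c] + 1) D) => //.
- exact: openT.
- exact: ltW.
- by have := abs_ge0 Q.[c]; lra.
- by move=> t _; rewrite setTI; exact: closed_sublevel.
- by move=> b _ Mb _; apply/eqP => /crit; lra.
- move=> z [_ h1 h2]; split=> //; rewrite /cdisc/= subr0; apply: lerF => /ltW/hr; lra.
by move=> z Dz; split=> //; [case: Dz|have := cmax z Dz; lra].
Qed.

Lemma finite_root_isolated Q a : Q != 0 ->
 exists2 r, 0 < r & forall z, abs (z - a) < r -> Q.[z] = 0 -> z = a.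
Proof.
move=> Q0; have [rs [_ rsE _]] := roots_factor Q0.
exists (\big[Num.min/1]_(b <- rs | b != a) abs (b - a)).
 apply: (big_ind (fun x : R => 0 < x)) => //; first by move=> x y x0 y0; rewrite lt_min x0.
 by move=> b ba; rewrite abs_gt0 subr_eq0.
move=> z zr Qz; apply/eqP; apply: contraLR zr => za; rewrite -leNgt.
have : z \in rs by rewrite rsE; apply/rootP.
elim: rs {rsE} => // b rs IH; rewrite in_cons big_cons => /orP[/eqP <-|/IH h].
 by rewrite za ge_min lexx.
by case: ifP => // _; rewrite ge_min h orbT.
Qed.

(** The zeros of Q in E form the sublevel set at height 0, which is connected by [level_connected]
    and has isolated points. *)
Lemma lemniscate_component_inj Q d (E : set C) (x y : C) : nonconstant Q -> 0 < d ->
 open E -> connected E -> E `<=` [set z | abs Q.[z] < d] ->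
 (forall t, t < d -> closed (E `&` [set z | abs Q.[z] <= t])) ->
 (forall c, E c -> Q^`().[c] != 0) ->
 E x -> E y -> Q.[x] = 0 -> Q.[y] = 0 -> x = y.
Proof.
move=> sQ d0 oE cE Ed clE nc Ex Ey Qx Qy.
have Q0 : Q != 0 by rewrite -size_poly_gt0 (leq_trans _ sQ).
have cY : connected [set z | [/\ E z, 0 <= abs Q.[z] & abs Q.[z] <= 0]].
 apply: (@level_connected _ E 0 0 d E) => //.
 - by move=> c Ec _ _; apply: nc.
 - by move=> z [].
 by move=> z Ez; split=> //; [exact: abs_ge0|exact: Ed].
have Yz z : [set z | [/\ E z, 0 <= abs Q.[z] & abs Q.[z] <= 0]] z -> Q.[z] = 0.
 by move=> [_ h1 h2]; apply/eqP; rewrite -abs_eq0 eq_le h1 h2.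
have [r r0 hr] := finite_root_isolated x Q0.
have : [set z | [/\ E z, 0 <= abs Q.[z] & abs Q.[z] <= 0]] `<=` disc x r.
 apply: (@connected_open_split _ _ _ (~` cdisc x (r / 2))) => //.
 - exact: open_disc.
 - exact/closed_openC/closed_cdisc.
 - move=> z Hz; have [zx|zx] := ltP (abs (z - x)) r; first by left.
  by right; rewrite /cdisc/= => h; lra.
 - move=> z /Yz Qz zr h; apply: h.
  by rewrite (hr z zr Qz) /cdisc/= subrr abs0 ltW// divr_gt0.
 exists x; split; first by split=> //; rewrite Qx abs0.
 exact: disc_center.
move=> /(_ y) h; apply/esym/hr => //; apply: h.
by split=> //; rewrite Qy abs0.
Qed.

End Lemniscates.

(** * Finite Fourier analysis: Cauchy estimates and the expansion of ln|1 - w| *)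

Section Fourier.
Implicit Types (w a : C) (x y : R) (p q Q : {poly C}).

Lemma cReM z w : Re (z * w) = Re z * Re w - Im z * Im w.
Proof. by case: z w => ? ? []. Qed.
Lemma cImM z w : Im (z * w) = Re z * Im w + Im z * Re w.
Proof. by case: z w => ? ? []. Qed.
Lemma Re_rc x : Re (rc x) = x. Proof. by []. Qed.
Lemma Im_rc x : Im (rc x) = 0. Proof. by []. Qed.
Lemma Re_sum I (rs : seq I) (F : I -> C) :
 Re (\sum_(i <- rs) F i) = \sum_(i <- rs) Re (F i).
Proof. by elim: rs => [|i rs IH]; rewrite ?big_nil// !big_cons ReD IH. Qed.

Lemma exists_prim_root N : (0 < N)%N -> exists w : C, N.-primitive_root w.
Proof.
move=> N0; pose p : {poly C} := 'X^N - 1.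
have [r Dp] := closed_field_poly_normal p.
rewrite (monicP _) ?monicXnsubC // scale1r in Dp.
have rn1 : all N.-unity_root r by apply/allP => z; rewrite -root_prod_XsubC -Dp.
have sz_r : (N < (size r).+1)%N by rewrite -(size_prod_XsubC r id) -Dp size_XnsubC.
have [|z] := hasP (has_prim_root N0 rn1 _ sz_r); last by exists z.
by rewrite -separable_prod_XsubC -Dp separable_Xn_sub_1 // pnatr_eq0 -lt0n.
Qed.

Lemma sum_prim_root w N k : N.-primitive_root w ->
 \sum_(j < N) (w ^+ k) ^+ j = if (N %| k)%N then N%:R else 0.
Proof.
move=> wN; rewrite (prim_order_dvd wN); case: eqP => [->|/eqP wk].
 by under eq_bigr do rewrite expr1n; rewrite sumr_const card_ord.
apply/eqP; have : (w ^+ k - 1) * \sum_(j < N) (w ^+ k) ^+ j = 0.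
 by rewrite -subrX1 -exprM mulnC exprM (prim_expr_order wN) expr1n subrr.
by move/eqP; rewrite mulf_eq0 subr_eq0 (negPf wk).
Qed.

Lemma abs_prim_root w N : N.-primitive_root w -> abs w = 1.
Proof.
move=> wN; have N0 := prim_order_gt0 wN.
apply/eqP; rewrite -(@eqrXn2 _ N)// ?abs_ge0// expr1n -absX.
by rewrite (prim_expr_order wN) abs1.
Qed.

Lemma dvdn_lt2 N k : (0 < k)%N -> (k < 2 * N)%N -> (N %| k)%N = (k == N).
Proof.
move=> k0 k2; apply/idP/eqP => [/dvdnP[q kq]|->//].
by rewrite kq in k0 k2 *; move: k0 k2; case: q {kq} => [|[|q]]; nia.
Qed.

(** Cauchy's estimate by averaging over the N-th roots of unity; N exceeds deg Q + k, so no other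
    coefficient is aliased onto the k-th. *)
Lemma coef_bound Q k r B : 0 < r ->
 (forall z, abs z = r -> abs Q.[z] <= B) -> abs Q`_k * r ^+ k <= B.
Proof.
move=> r0 QB; pose N := (size Q + k).+1.
have [w wN] := exists_prim_root (ltn0Sn (size Q + k)); rewrite -/N in wN.
have aw := abs_prim_root wN.
have E : \sum_(j < N) Q.[rc r * w ^+ j] * (w ^+ (N - k)) ^+ j = N%:R * (Q`_k * rc r ^+ k).
 have F (j l : nat) : (rc r * w ^+ j) ^+ l * (w ^+ (N - k)) ^+ j =
   rc r ^+ l * (w ^+ (l + (N - k))) ^+ j.
  by rewrite exprMn -mulrA -!exprM -exprD mulnDl (mulnC j l).
 transitivity (\sum_(j < N) \sum_(l < N) Q`_l * (rc r ^+ l * (w ^+ (l + (N - k))) ^+ j)).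
  apply: eq_bigr => j _; rewrite (@horner_coef_wide _ N) ?mulr_suml; last by rewrite /N; lia.
  by apply: eq_bigr => l _; rewrite -mulrA F.
 rewrite exchange_big /=.
 under eq_bigr => l _ do rewrite -!mulr_sumr sum_prim_root//.
 have kN : (k < N)%N by rewrite /N; lia.
 rewrite (bigD1 (Ordinal kN))//= big1 ?addr0; last first.
  move=> l /eqP lk; rewrite dvdn_lt2; [|by have := ltn_ord l; lia..].
  case: eqP => [h|]; last by rewrite !mulr0.
  by case: lk; apply/val_inj => /=; have := ltn_ord l; lia.
 by rewrite subnKC ?dvdnn 1?ltnW// mulrC; ring.
have : abs (\sum_(j < N) Q.[rc r * w ^+ j] * (w ^+ (N - k)) ^+ j) <= N%:R * B.
 rewrite (le_trans (abs_sum _ _ _))//.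
 apply: (@le_trans _ _ (\sum_(j < N) B)); last by rewrite sumr_const card_ord mulr_natl.
 apply: ler_sum => j _; rewrite absM !absX aw !expr1n mulr1; apply: QB.
 by rewrite absM absX aw expr1n mulr1 abs_rc gtr0_norm.
rewrite E absM absM absX abs_rc (gtr0_norm r0).
have -> : abs N%:R = N%:R by rewrite -rc_nat abs_rcE.
by rewrite ler_pM2l// ltr0n.
Qed.

Definition shift_poly a p := p \Po ('X + a%:P).

Lemma horner_shift a p z : (shift_poly a p).[z] = p.[z + a].
Proof. by rewrite horner_comp hornerD hornerX hornerC. Qed.

Lemma shift_coef0 a p : (shift_poly a p)`_0 = p.[a].
Proof. by rewrite -horner_coef0 horner_shift add0r. Qed.

Lemma shift_coef1 a p : (shift_poly a p)`_1 = p^`().[a].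
Proof.
have := coef_deriv (shift_poly a p) 0; rewrite mulr1n => <-.
rewrite -horner_coef0 deriv_comp hornerM horner_comp !hornerE.
by rewrite derivD derivX derivC addr0 !hornerE.
Qed.

Lemma taylor_coef_bound Q a k r B : 0 < r ->
 (forall z, abs (z - a) < r -> abs Q.[z] <= B) ->
 abs (shift_poly a Q)`_k <= B / r ^+ k.
Proof.
move=> r0 QB; have QB' z : abs (z - a) <= r -> abs Q.[z] <= B.
 move=> zr; apply: (@closed_sublevel Q B); apply/closurePC => e e0; pose t := Num.min 1 (e / (2 * r)).
 have t0 : 0 < t by rewrite lt_min ltr01 divr_gt0// mulr_gt0.
 have t1 : t <= 1 by rewrite ge_min lexx.
 have te : t * (2 * r) <= e by rewrite -ler_pdivlMr ?mulr_gt0// ge_min lexx orbT.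
 have za := abs_ge0 (z - a); exists (a + rc (1 - t) * (z - a)).
  by apply: QB; rewrite addrAC subrr add0r absM abs_rcE; [nra|lra].
 rewrite (_ : _ - z = - (rc t * (z - a))); last by rewrite rcB rc1; ring.
 by rewrite absN absM abs_rcE ?ltW//; nra.
rewrite ler_pdivlMr ?exprn_gt0//; apply: coef_bound => // z zr.
by rewrite horner_shift; apply: QB'; rewrite addrK zr.
Qed.

Lemma deriv_bound Q a r B : 0 < r ->
 (forall z, abs (z - a) < r -> abs Q.[z] <= B) -> abs Q^`().[a] <= B / r.
Proof.
by move=> r0 QB; rewrite -shift_coef1 -[in leRHS](expr1 r); apply: taylor_coef_bound.
Qed.

Lemma geometric_sum_le x n : 0 <= x -> x <= 2^-1 -> \sum_(i < n) x ^+ i <= 2.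
Proof.
move=> x0 x2; have [->|n0] := eqVneq n 0%N; first by rewrite big_ord0.
have : (1 - x) * \sum_(i < n) x ^+ i = 1 - x ^+ n by rewrite -opprB mulNr -subrX1 opprB.
have : 0 <= x ^+ n by rewrite exprn_ge0.
have : 0 <= \sum_(i < n) x ^+ i by apply: sumr_ge0 => i _; rewrite exprn_ge0.
nra.
Qed.

(** Along t in [0, 1] the function ln|1 - t w|^2 plus twice the truncated series has derivative -2
    Re(w (t w)^n / (1 - t w)), and the mean value theorem turns this into the error bound. *)
Lemma ln_abs_expansion w n b : abs w <= b -> b < 1 ->
 `|ln (abs (1 - w)) + \sum_(i < n) Re (w ^+ i.+1) / i.+1%:R| <= b ^+ n.+1 / (1 - b).
Proof.
move=> wb b1; have b0 : 0 <= b by apply: le_trans wb; exact: abs_ge0.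
pose x := Re w; pose y := Im w.
pose g : {poly R} := (x ^+ 2 + y ^+ 2) *: 'X^2 - (2 * x) *: 'X + 1%:P.
pose P : {poly R} := \sum_(i < n) (Re (w ^+ i.+1) / i.+1%:R) *: 'X^(i.+1).
have gE t : g.[t] = (1 - x * t) ^+ 2 + (y * t) ^+ 2.
 by rewrite /g hornerD hornerD hornerN !hornerZ hornerXn hornerX hornerC; ring.
have g'E t : g^`().[t] = - (2 * x * (1 - x * t)) + 2 * y ^+ 2 * t.
 rewrite /g derivD derivB !derivZ derivXn derivX derivC addr0.
 by rewrite hornerD hornerN !hornerZ hornerMn hornerXn hornerC /= expr1; ring.
have PE t : P.[t] = \sum_(i < n) (Re (w ^+ i.+1) / i.+1%:R) * t ^+ i.+1.
 by rewrite /P horner_sum; apply: eq_bigr => i _; rewrite !hornerE.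
have P'E t : P^`().[t] = \sum_(i < n) Re (w ^+ i.+1) * t ^+ i.
 rewrite /P linear_sum horner_sum; apply: eq_bigr => i _ /=.
 rewrite derivZ derivXn hornerZ hornerMn hornerXn /= -[t ^+ i *+ _]mulr_natr.
 by rewrite mulrA mulrAC divfK ?pnatr_eq0.
pose u t : C := 1 - rc t * w.
have uE t : abs (u t) ^+ 2 = g.[t].
 rewrite absE sqr_sqrtr ?addr_ge0 ?sqr_ge0// gE /u ReD ImD ReN ImN cReM cImM Re_rc Im_rc.
 by rewrite -/x -/y -rc1 Re_rc Im_rc; ring.
have u_ge t : 0 <= t -> t <= 1 -> 1 - b <= abs (u t).
 move=> t0 t1; have := abs_lip 1 (rc t * w); rewrite -/(u t) abs1 absM abs_rcE//.
 have := abs_ge0 w; nra.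
have gpos t : 0 <= t -> t <= 1 -> 0 < g.[t].
 by move=> t0 t1; rewrite -uE exprn_gt0// (lt_le_trans _ (u_ge t t0 t1))// subr_gt0.
pose F t : R := ln g.[t] + 2 * P.[t].
pose dF t : R := g.[t]^-1 * g^`().[t] + 2 * P^`().[t].
have isF t : 0 <= t -> t <= 1 -> is_derive t 1 F (dF t).
 move=> t0 t1.
 have hg : is_derive t 1 (horner g) g^`().[t].
  by apply: DeriveDef; [exact: derivable_horner|rewrite -derive1E -derivE].
 have hP : is_derive t 1 (horner P) P^`().[t].
  by apply: DeriveDef; [exact: derivable_horner|rewrite -derive1E -derivE].
 have hl : is_derive g.[t] 1 (@ln R) g.[t]^-1 by apply: is_derive1_ln; exact: gpos.
 have h1 : is_derive t 1 (@ln R \o horner g) (g.[t]^-1 * g^`().[t]).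
  exact: is_derive1_comp.
 have h2 : is_derive t 1 (2 *: horner P) (2 *: P^`().[t]) by apply: is_deriveZ.
 exact: is_deriveD h1 h2.
have cF : {within `[0, 1], continuous F}.
 apply: derivable_within_continuous => t; rewrite in_itv/= => /andP[t0 t1].
 by apply: ex_derive; apply: isF.
have [t tt FE] := @MVT R F dF 0 1 ltr01 (fun t h => isF t
  (ltac:(by move: h; rewrite in_itv/= => /andP[/ltW]))
  (ltac:(by move: h; rewrite in_itv/= => /andP[_ /ltW]))) cF.
move: tt; rewrite in_itv/= => /andP[/ltW t0 /ltW t1].
have F0 : F 0 = 0.
 rewrite /F gE PE !mulr0 subr0 expr1n expr0n/= addr0 ln1 add0r big1 ?mulr0//.
 by move=> i _; rewrite expr0n mulr0.
have F1 : F 1 = 2 * (ln (abs (1 - w)) + \sum_(i < n) Re (w ^+ i.+1) / i.+1%:R).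
 rewrite /F -uE /u rc1 mul1r lnXn; last first.
  by have := u_ge 1 ler01 (lexx 1); rewrite /u rc1 mul1r; lra.
 rewrite PE mulrDr -(mulr_natl (ln _)); congr (_ + 2 * _).
 by apply: eq_bigr => i _; rewrite expr1n mulr1.
have u0 : u t != 0.
 by rewrite -abs_gt0 (lt_le_trans _ (u_ge t t0 t1))// subr_gt0.
have dFE : dF t = - 2 * Re (w * (rc t * w) ^+ n / u t).
 pose q := w / u t; have qu : w = q * u t by rewrite /q divfK.
 have E1 : g.[t]^-1 * g^`().[t] = - 2 * Re q.
  have E0 (v : C) : 0 < (1 - Re v * t) ^+ 2 + (Im v * t) ^+ 2 ->
   ((1 - Re v * t) ^+ 2 + (Im v * t) ^+ 2)^-1 *
    (- (2 * Re v * (1 - Re v * t)) + 2 * Im v ^+ 2 * t) =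
   - 2 * Re (v / (1 - rc t * v)).
   by case: v => a c /= h; field; rewrite gt_eqF//; lra.
  by rewrite gE g'E; apply: E0; rewrite -gE; exact: gpos.
 have E2 : P^`().[t] = Re (q * (1 - (rc t * w) ^+ n)).
  have -> : q * (1 - (rc t * w) ^+ n) = \sum_(i < n) w ^+ i.+1 * rc t ^+ i.
   have : (1 - (rc t * w) ^+ n) = u t * \sum_(i < n) (rc t * w) ^+ i.
    by rewrite -opprB subrX1 -mulNr opprB.
   move=> ->; rewrite mulrA -qu mulr_sumr; apply: eq_bigr => i _.
   by rewrite exprMn exprS mulrCA mulrA [RHS]mulrC mulrA.
  rewrite Re_sum P'E; apply: eq_bigr => i _.
  by rewrite -rcX cReM Re_rc Im_rc mulr0 subr0.
 rewrite /dF E1 E2 mulrBr mulr1 ReD ReN.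
 have -> : w * (rc t * w) ^+ n / u t = q * (rc t * w) ^+ n by rewrite /q; ring.
 ring.
have : `|dF t| <= 2 * (b ^+ n.+1 / (1 - b)).
 rewrite dFE normrM normrN (ger0_norm (ler0n _ 2)) ler_wpM2l//.
 rewrite (le_trans (nRe_le_abs _))// abs_div absM absX absM abs_rc (ger0_norm t0).
 rewrite exprS ler_pM ?invr_ge0 ?mulr_ge0 ?abs_ge0 ?exprn_ge0 ?mulr_ge0 ?abs_ge0//.
  rewrite ler_pM ?abs_ge0 ?exprn_ge0 ?mulr_ge0 ?abs_ge0// lerXn2r ?nnegrE ?mulr_ge0 ?abs_ge0//.
  by have := abs_ge0 w; nra.
 by rewrite lef_pV2 ?posrE ?subr_gt0 ?abs_gt0// u_ge.
move: FE; rewrite F0 F1 !subr0 mulr1 => <-.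
by rewrite normrM (ger0_norm (ler0n _ 2)) ler_pM2l.
Qed.

End Fourier.

(** * Harnack's inequality from a discrete Poisson kernel, and growth estimates *)

Section Harnack.
Implicit Types (w a b u : C) (x y : R) (p q Q : {poly C}).

Definition cj z : C := Complex (Re z) (- Im z).

Lemma cjM z w : cj (z * w) = cj z * cj w.
Proof. by case: z w => x y [x' y']; rewrite /cj /=; congr Complex; ring. Qed.

Lemma mul_cj z : z * cj z = rc (abs z ^+ 2).
Proof.
rewrite absE sqr_sqrtr ?addr_ge0 ?sqr_ge0//.
by apply/eqP; rewrite eq_complex cReM cImM /=; apply/andP; split; apply/eqP; ring.
Qed.

Lemma cj_unit u : abs u = 1 -> u * cj u = 1.
Proof.
by move=> u1; rewrite mul_cj u1 expr1n rc1.
Qed.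

Lemma fourier_pair w N a z l m : N.-primitive_root w -> (0 < l)%N -> (0 < m)%N ->
 (l + m < N)%N ->
 \sum_(j < N) Re (a * w ^+ (j * l)) * Re (z * w ^+ (j * (N - m))) =
 if l == m then N%:R / 2 * Re (a * z) else 0.
Proof.
move=> wN l0 m0 lmN; have aw := abs_prim_root wN.
have cw j : cj (w ^+ (j * (N - m))) = w ^+ (j * m).
 have u1 : abs (w ^+ (j * (N - m))) = 1 by rewrite absX aw expr1n.
 have nz : w ^+ (j * (N - m)) != 0 by rewrite -abs_gt0 u1.
 apply: (mulfI nz); rewrite cj_unit// -exprD -mulnDr subnK; last by lia.
 by rewrite mulnC exprM (prim_expr_order wN) expr1n.
have E (A B : C) : Re A * Re B = (Re (A * B) + Re (A * cj B)) / 2.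
 by rewrite !cReM /=; field.
rewrite (eq_bigr (fun j : 'I_N =>
 (Re (a * z * (w ^+ (l + (N - m))) ^+ j) +
  Re (a * cj z * (w ^+ (l + m)) ^+ j)) / 2)); last first.
 move=> j _; have E2 k1 k2 : (w ^+ (k1 + k2)) ^+ j = w ^+ (j * k1) * w ^+ (j * k2).
  by rewrite -exprM mulnC mulnDr exprD.
 by rewrite E cjM cw !E2; congr ((Re _ + Re _) / 2); ring.
rewrite -mulr_suml big_split /= -!Re_sum -!mulr_sumr !sum_prim_root//.
have -> : (N %| l + m)%N = false by apply/negbTE; rewrite gtnNdvd//; lia.
rewrite dvdn_lt2; [|lia..].
have -> : (l + (N - m) == N)%N = (l == m) by apply/eqP/eqP; lia.
rewrite mulr0 addr0; case: ifP => _; last by rewrite mulr0 /= mul0r.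
by rewrite -rc_nat cReM Re_rc Im_rc; ring.
Qed.

Lemma exists_small_power x K e : 0 <= x -> x < 1 -> 0 < e -> exists n, K * x ^+ n < e.
Proof.
move=> x0 x1 e0; have [K0|K0] := leP K 0.
 by exists 0%N; rewrite mulr1 (le_lt_trans K0).
have h : x ^+ n @[n --> \oo] --> (0 : R) by apply: cvg_expr; rewrite ger0_norm.
have /cvgrPdist_lt /(_ (e / K) (divr_gt0 e0 K0)) := h.
move=> [n _ hn]; exists n; have := hn n (leqnn n).
by rewrite /= sub0r normrN ger0_norm ?exprn_ge0// ltr_pdivlMr// mulrC.
Qed.

Lemma exists_uniform_lt1 (bs : seq C) : (forall b, b \in bs -> abs b < 1) ->
 exists2 B : R, 0 <= B < 1 & forall b, b \in bs -> abs b <= B.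
Proof.
elim: bs => [|b bs IH] h; first by exists 0; rewrite ?lexx ?ltr01.
have [|B /andP[B0 B1] hB] := IH; first by move=> b' ?; apply: h; rewrite in_cons orbC; apply/orP; left.
exists (Num.max B (abs b)); first by rewrite le_max B0 gt_max B1 h// mem_head.
by move=> b'; rewrite in_cons => /orP[/eqP->|/hB]; rewrite le_max ?lexx ?orbT// => ->.
Qed.

(** [Lf] truncates the series of -ln|1 - b|. [DD] is the Poisson kernel at z, truncated at order n
    and sampled at the (2n + 1)-th roots of unity; the exponent N - m stands for the conjugate of
    w^m. *)
Local Definition Lf n b := \sum_(l < n) Re (b ^+ l.+1) / l.+1%:R : R.
Local Definition DD w n z j := 1 + 2 * \sum_(m < n) Re (z ^+ m.+1 * w ^+ (j * ((n + n).+1 - m.+1))) : R.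

(** Poisson's formula is exact here: the sums l + m of frequencies are at most 2n, below the number
    of nodes. *)
Local Lemma factor_sum w n b z : (n + n).+1.-primitive_root w ->
 \sum_(j < (n + n).+1) DD w n z j * Lf n (b * w ^+ j) = (n + n).+1%:R * Lf n (b * z).
Proof.
move=> wN; pose s (l j : nat) : R := Re (b ^+ l.+1 * w ^+ (j * l.+1)).
pose r (m j : nat) : R := Re (z ^+ m.+1 * w ^+ (j * ((n + n).+1 - m.+1))).
have s0 l : (l < n)%N -> \sum_(j < (n + n).+1) s l j = 0.
 move=> ln; rewrite /s -Re_sum -mulr_sumr.
 under eq_bigr do rewrite mulnC exprM.
 by rewrite sum_prim_root// gtnNdvd ?mulr0//; lia.
have sr (l m : 'I_n) : \sum_(j < (n + n).+1) s l j * r m j =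
  if l == m then (n + n).+1%:R / 2 * Re ((b * z) ^+ l.+1) else 0.
 have ln := ltn_ord l; have mn := ltn_ord m.
 rewrite fourier_pair//; last by lia.
 rewrite eqSS -val_eqE; case: eqP => [->|//]; by rewrite exprMn.
transitivity (\sum_(l < n) (l.+1%:R)^-1 * (\sum_(j < (n + n).+1) s l j +
  2 * \sum_(m < n) \sum_(j < (n + n).+1) s l j * r m j)).
 rewrite (eq_bigr (fun j : 'I_(n + n).+1 => \sum_(l < n) (l.+1%:R)^-1 * (s l j +
   2 * \sum_(m < n) s l j * r m j))); last first.
  move=> j _; rewrite /DD /Lf mulr_sumr; apply: eq_bigr => l _.
  by rewrite -mulr_sumr exprMn -exprM /s; ring.
 rewrite exchange_big /=; apply: eq_bigr => l _.
 rewrite -mulr_sumr; congr (_ * _); rewrite big_split /=; congr (_ + _).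
 by rewrite -mulr_sumr exchange_big.
rewrite /Lf mulr_sumr; apply: eq_bigr => l _; rewrite s0 ?ltn_ord// add0r.
rewrite (bigD1 l)//= sr eqxx big1; last by move=> m ml; rewrite sr eq_sym (negPf ml).
rewrite addr0; set A := Re _; have : l.+1%:R != 0 :> R by rewrite pnatr_eq0.
by set L := l.+1%:R; set N := _.+1%:R => L0; field.
Qed.

(** All zeros lie outside the closed unit disc and ln|q| is nonnegative on the circle, so the value
    at z is a Poisson average of nonnegative numbers. For |z| <= 1/4 the kernel is at most 1 + 2
    (1/4 + 1/16 + ...) = 5/3. *)
Lemma harnack_unit (bs : seq C) c B z : 0 <= B -> B < 1 -> (forall b, b \in bs -> abs b <= B) ->
 (forall u, abs u = 1 -> 1 <= abs (c * \prod_(b <- bs) (1 - b * u))) -> abs z <= 4^-1 ->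
 ln (abs (c * \prod_(b <- bs) (1 - b * z))) <= 5 / 3 * ln (abs c).
Proof.
move=> B0 B1 bB q1 z4.
have c0 : c != 0.
 by apply/eqP => c0; have := q1 1 (abs1); rewrite c0 mul0r abs0 ler10.
have f0 b u : b \in bs -> abs u <= 1 -> 0 < abs (1 - b * u).
 move=> bbs u1; have := abs_lip 1 (b * u); rewrite abs1 absM => h.
 have := bB b bbs; have := abs_ge0 b; have := abs_ge0 u; nra.
have lnE u : abs u <= 1 -> ln (abs (c * \prod_(b <- bs) (1 - b * u))) =
  ln (abs c) + \sum_(b <- bs) ln (abs (1 - b * u)).
 move=> u1; have : forall b, b \in bs -> 0 < abs (1 - b * u) by move=> b hb; exact: f0.
 rewrite absM; elim: (bs) => [|b bs' IH] h; first by rewrite !big_nil abs1 mulr1 addr0.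
 have hb' b' : b' \in bs' -> 0 < abs (1 - b' * u) by move=> hb; apply: h; rewrite in_cons hb orbT.
 have pp : 0 < abs (\prod_(b' <- bs') (1 - b' * u)).
  by rewrite abs_prod big_seq; apply: prodr_gt0 => b' ?; exact: hb'.
 have hb : 0 < abs (1 - b * u) by apply: h; rewrite mem_head.
 have ac : 0 < abs c by rewrite abs_gt0.
 rewrite !big_cons absM mulrCA lnM ?posrE// ?mulr_gt0// IH//; ring.
pose k : R := (size bs)%:R.
apply: lerF => lt.
move: lt; set v := ln (abs (c * _)); set v0 := ln (abs c) => lt.
(* The order n is so large that the accumulated truncation errors, at most 5 k ep, stay below the
   supposed excess. *)
have [n] := @exists_small_power B (5 * k * B / (1 - B)) (v - 5 / 3 * v0) B0 B1 ltac:(lra).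
apply/negP; rewrite -leNgt; pose N := (n + n).+1; pose ep := B ^+ n.+1 / (1 - B).
have epE : 5 * k * B / (1 - B) * B ^+ n = 5 * k * ep by rewrite /ep exprS; ring.
have ep0 : 0 <= ep by rewrite divr_ge0 ?exprn_ge0// subr_ge0 ltW.
have [w wN] := exists_prim_root (ltn0Sn (n + n)); rewrite -/N in wN.
have aw := abs_prim_root wN.
pose x (j : nat) := ln (abs (c * \prod_(b <- bs) (1 - b * w ^+ j))).
have awj j : abs (w ^+ j) = 1 by rewrite absX aw expr1n.
have x0 j : 0 <= x j by rewrite ln_ge0// q1.
have N0 : 0 < N%:R :> R by rewrite ltr0n.
have Dle j : `|DD w n z j| <= 5 / 3.
 rewrite /DD (le_trans (ler_normD _ _))// normr1 normrM (ger0_norm (ler0n _ 2)).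
 have : `|\sum_(m < n) Re (z ^+ m.+1 * w ^+ (j * ((n + n).+1 - m.+1)))| <= 1 / 3.
  apply: (le_trans (ler_norm_sum _ _ _)).
  apply: (@le_trans _ _ (\sum_(m < n) 4^-1 * 4^-1 ^+ m)).
   apply: ler_sum => m _; apply: le_trans (nRe_le_abs _) _.
   rewrite absM awj mulr1 absX -exprS.
   by apply: lerXn2r; rewrite ?nnegrE ?abs_ge0 ?invr_ge0.
  rewrite -mulr_sumr; have : (1 - 4^-1) * \sum_(i < n) (4^-1 : R) ^+ i = 1 - 4^-1 ^+ n.
   by rewrite -opprB mulNr -subrX1 opprB.
  have : 0 <= (4^-1 : R) ^+ n by rewrite exprn_ge0.
  lra.
 lra.
pose y (u : C) := v0 - \sum_(b <- bs) Lf n (b * u).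
have yx u : abs u <= 1 -> `|ln (abs (c * \prod_(b <- bs) (1 - b * u))) - y u| <= k * ep.
 move=> u1; rewrite lnE// /y -/v0.
 have -> : v0 + \sum_(b <- bs) ln (abs (1 - b * u)) - (v0 - \sum_(b <- bs) Lf n (b * u)) =
   \sum_(b <- bs) (ln (abs (1 - b * u)) + Lf n (b * u)) by rewrite big_split /=; ring.
 have : forall b, b \in bs -> `|ln (abs (1 - b * u)) + Lf n (b * u)| <= ep.
  move=> b hb; apply: ln_abs_expansion => //; rewrite absM.
  by have := bB b hb; have := abs_ge0 b; have := abs_ge0 u; nra.
 rewrite /k; elim: (bs) => [|b bs' IH] h; first by rewrite big_nil normr0 mul0r.
 rewrite big_cons (le_trans (ler_normD _ _))//= -natr1 mulrDl mul1r addrC lerD//.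
  by apply: IH => b' hb; apply: h; rewrite in_cons hb orbT.
 by apply: h; rewrite mem_head.
have sumD : forall z', abs z' <= 1 ->
  \sum_(j < N) DD w n z' j * y (w ^+ j) = N%:R * y z'.
 move=> z' z1; rewrite /y (eq_bigr (fun j : 'I_N => DD w n z' j * v0 -
  \sum_(b <- bs) DD w n z' j * Lf n (b * w ^+ j))); last first.
  by move=> j _; rewrite mulrBr mulr_sumr.
 rewrite sumrB exchange_big /= mulrBr mulr_sumr; congr (_ - _); last first.
  by apply: eq_bigr => b _; exact: factor_sum.
 rewrite -mulr_suml; congr (_ * _); rewrite /DD big_split /= sumr_const card_ord.
 rewrite -mulr_sumr exchange_big /= big1 ?mulr0 ?addr0// => m _.
 rewrite -Re_sum -mulr_sumr; under eq_bigr do rewrite mulnC exprM.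
 by rewrite sum_prim_root// gtnNdvd ?mulr0//; have := ltn_ord m; rewrite /N; lia.
have D0 j : DD w n 0 j = 1.
 by rewrite /DD big1 ?mulr0 ?addr0// => m _; rewrite expr0n mul0r.
have y0 : y 0 = v0.
 rewrite /y big1 ?subr0// => b _; rewrite /Lf big1// => l _.
 by rewrite mulr0 expr0n mul0r.
have S1 : \sum_(j < N) DD w n z j * x j <= 5 / 3 * \sum_(j < N) x j.
 rewrite mulr_sumr; apply: ler_sum => j _; apply: ler_wpM2r => //.
 exact: le_trans (ler_norm _) (Dle j).
have S2 : \sum_(j < N) x j <= N%:R * (v0 + k * ep).
 have -> : N%:R * (v0 + k * ep) = \sum_(j < N) (y (w ^+ j) + k * ep).
  have H0 : \sum_(j < N) y (w ^+ j) = N%:R * v0.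
   rewrite -{1}y0 -sumD ?abs0//; apply: eq_bigr => j _.
   by rewrite D0 mul1r.
  by rewrite big_split /= H0 sumr_const card_ord mulrDr !mulr_natl.
 apply: ler_sum => j _; have := yx (w ^+ j); rewrite awj lexx => /(_ isT).
 by rewrite ler_norml -/(x j); move: (x j) (y _) (k * ep); clear; move=> *; lra.
have S3 : N%:R * (y z - 5 / 3 * (k * ep)) <= \sum_(j < N) DD w n z j * x j.
 have -> : N%:R * (y z - 5 / 3 * (k * ep)) =
   \sum_(j < N) (DD w n z j * y (w ^+ j) - 5 / 3 * (k * ep)).
  rewrite sumrB sumr_const card_ord -mulr_natl mulrBr sumD//; move: z4; clear; move=> *; lra.
 apply: ler_sum => j _; have := yx (w ^+ j); rewrite awj lexx => /(_ isT).
 rewrite -/(x j) => h; have h2 := Dle j.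
 have : `|DD w n z j * (x j - y (w ^+ j))| <= 5 / 3 * (k * ep) by rewrite normrM ler_pM.
 rewrite mulrBr ler_norml; move: (_ * y _) (_ * x j) (k * ep); clear; move=> *; lra.
have S4 : N%:R * (y z - 5 / 3 * (k * ep)) <= N%:R * (5 / 3 * (v0 + k * ep)).
 by apply: (le_trans S3); apply: (le_trans S1); rewrite mulrCA ler_wpM2l.
rewrite ler_pM2l// in S4.
have := yx z (le_trans z4 _); rewrite -/v ler_norml invf_le1// ler1n => /(_ isT)/andP[_ h].
have kep : 0 <= k * ep by rewrite mulr_ge0.
rewrite epE -(mulrA 5 k); move: h S4 kep; move: (k * ep) (y z) (v) (v0); clear; move=> *; lra.
Qed.

Lemma harnack Q a r m z : 0 < r -> 0 < m -> (forall u, abs (u - a) <= r -> m <= abs Q.[u]) ->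
 abs (z - a) <= r / 4 -> ln (abs Q.[z] / m) <= 5 / 3 * ln (abs Q.[a] / m).
Proof.
move=> r0 m0 Qm za.
have Q0 : Q != 0.
 apply/eqP => Q0; have := Qm a; rewrite Q0 subrr abs0 horner0 abs0 => /(_ (ltW r0)); lra.
have [rs [_ rsE QE]] := roots_factor Q0.
have far u : u \in rs -> r < abs (u - a).
 move=> urs; rewrite ltNge; apply/negP => /Qm; move: urs; rewrite rsE => /rootP->.
 by rewrite abs0; lra.
pose bs := [seq rc r / (u - a) | u <- rs].
have rr : rc r != 0 by rewrite -rc0 (inj_eq (@rc_inj)) gt_eqF.
have bs1 b : b \in bs -> abs b < 1.
 case/mapP => u urs ->; rewrite abs_div abs_rc gtr0_norm// ltr_pdivrMr ?mul1r ?far//.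
 exact: lt_trans r0 (far u urs).
have [B /andP[B0 B1] hB] := exists_uniform_lt1 bs1.
pose c := rc m^-1 * Q.[a].
have cE u : rc m^-1 * Q.[a + rc r * u] = c * \prod_(b <- bs) (1 - b * u).
 rewrite /c !QE /bs big_map -!mulrA -big_split /=; congr (_ * (_ * _)).
 rewrite !big_seq; apply: eq_bigr => v vrs.
 have v0 : v - a != 0 by rewrite -abs_gt0 (lt_trans r0)// far.
 by field.
have h := @harnack_unit bs c B (rc r^-1 * (z - a)) B0 B1 hB.
have mE (v : C) : abs (rc m^-1 * v) = abs v / m.
 by rewrite absM abs_rc gtr0_norm ?invr_gt0// mulrC.
move: h; rewrite -cE mulrA -rcM divff ?gt_eqF// rc1 mul1r (addrC a) subrK.
rewrite /c !mE; apply.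
 move=> u u1; rewrite -cE mE ler_pdivlMr// mul1r; apply: Qm.
 by rewrite (addrC a) addrK absM abs_rc u1 mulr1 gtr0_norm.
by rewrite absM abs_rc gtr0_norm ?invr_gt0// mulrC ler_pdivrMr//; lra.
Qed.

Lemma harnack_center Q a r m z : 0 < r -> 0 < m ->
 (forall u, abs (u - a) <= r -> m <= abs Q.[u]) ->
 abs (z - a) <= r / 8 -> ln (abs Q.[a] / m) <= 5 / 3 * ln (abs Q.[z] / m).
Proof.
move=> r0 m0 Qm za; apply: (@harnack Q z (r / 2)) => //; first by rewrite divr_gt0.
 by move=> u uz; apply: Qm; have := abs_tri z u a; lra.
by rewrite absB; lra.
Qed.

Let ln_le_pow x y : 1 <= x -> 0 < y -> ln x <= 5 / 3 * ln y -> x <= y ^+ 5.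
Proof.
move=> x1 y0 h; have x0 : 0 < x by lra.
apply: (@le_trans _ _ (x ^+ 3)); first by rewrite ler_eXnr.
have x3 : x ^+ 3 \is Num.pos by rewrite posrE exprn_gt0.
have y5 : y ^+ 5 \is Num.pos by rewrite posrE exprn_gt0.
rewrite -ler_ln//.
have -> : ln (x ^+ 3) = ln x *+ 3 by exact: lnXn.
have -> : ln (y ^+ 5) = ln y *+ 5 by exact: lnXn.
by move: h; move: (ln x) (ln y) => p q h; lra.
Qed.

(** Exponentiated form with an integer exponent: if x >= 1 and ln x <= 5/3 ln y, then x <= x^3 <=
    y^5. Integer exponents combine easily with the powers deg(h)^n that occur under iteration. *)
Lemma harnack_pow Q a r m z : 0 < r -> 0 < m ->
 (forall u, abs (u - a) <= r -> m <= abs Q.[u]) -> abs (z - a) <= r / 8 ->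
 abs Q.[z] / m <= (abs Q.[a] / m) ^+ 5 /\ abs Q.[a] / m <= (abs Q.[z] / m) ^+ 5.
Proof.
move=> r0 m0 Qm za.
have ge u : abs (u - a) <= r -> 1 <= abs Q.[u] / m.
 by move=> ua; rewrite ler_pdivlMr// mul1r Qm.
have ga : 1 <= abs Q.[a] / m by apply: ge; rewrite subrr abs0 ltW.
have gz : 1 <= abs Q.[z] / m by apply: ge; lra.
split; apply: ln_le_pow => //; try by apply: lt_le_trans ltr01 _.
 by apply: harnack Qm _ => //; lra.
exact: harnack_center Qm za.
Qed.

(* Circular projection about [s] replaces [K] by a segment of the positive axis, *)
(* and [u |-> u + u^-1] turns the exterior of that segment into the unit disc.   *)
Lemma connected_growth Q (K : set C) (s : C) (m e h : R) : connected K ->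
 (forall z, K z -> abs Q.[z] <= m) ->
 (exists2 z, K z & abs (z - s) <= e ^+ 2) -> (exists2 z, K z & h ^+ 2 <= abs (z - s)) ->
 0 <= e -> e < h -> abs Q.[s] <= m * ((h + e) / (h - e)) ^+ (size Q).-1.
Proof.
move=> cK Km [z1 Kz1 z1e] [z2 Kz2 z2h] e0 eh.
have h0 : 0 < h by lra.
have m0 : 0 <= m by apply: le_trans (Km _ Kz1); exact: abs_ge0.
have rat0 : 0 < (h + e) / (h - e) by rewrite divr_gt0//; lra.
have [->|Q0] := eqVneq Q 0.
 by rewrite horner0 abs0 mulr_ge0// exprn_ge0// ltW.
have [rs [srs _ QE]] := roots_factor Q0; set c := lead_coef Q in QE.
have seg x : e ^+ 2 <= x -> x <= h ^+ 2 -> abs c * \prod_(a <- rs) `|x - abs (a - s)| <= m.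
 move=> ex xh.
 have cf : continuous (fun z : C => abs (z - s)).
  move=> z; apply: (@continuous_comp _ _ _ (fun z : C => z - s) abs); last exact: abs_continuous.
  by apply: continuousD; [exact: id|exact: cst_continuous].
 have [z Kz zx] := connected_IVT cK cf Kz1 Kz2 (le_trans z1e ex) (le_trans xh z2h).
 apply: le_trans (Km _ Kz); rewrite QE absM abs_prod ler_wpM2l ?abs_ge0//.
 apply: ler_prod => a _; rewrite normr_ge0/= -zx.
 have := abs_lip (z - s) (a - s); have := abs_lip (a - s) (z - s).
 rewrite !opprB !addrA !subrK (absB a z) ler_norml; lra.
pose l := (h ^+ 2 - e ^+ 2) / 2; pose mid := (h ^+ 2 + e ^+ 2) / 2.
have l0 : 0 <= l by rewrite /l; nra.
(* u times the value of x - |a - s| at x = l (u + 1/u) / 2 + mid. On |u| = 1 this x is l Re u + mid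
   and stays in the segment from e^2 to h^2. *)
pose fac a : {poly C} := rc (l / 2) *: 'X^2 + rc (mid - abs (a - s)) *: 'X + (rc (l / 2))%:P.
pose P : {poly C} := c *: \prod_(a <- rs) fac a.
have PE u : P.[u] = c * \prod_(a <- rs)
  (rc (l / 2) * u ^+ 2 + rc (mid - abs (a - s)) * u + rc (l / 2)).
 rewrite /P hornerZ; congr (_ * _); elim: (rs) => [|a rs' IH]; first by rewrite !big_nil hornerC.
 by rewrite !big_cons hornerM IH /fac !hornerE.
have unit u : abs u = 1 -> abs P.[u] <= m.
 move=> u1; have uu := cj_unit u1.
 have rE a : rc (l / 2) * u ^+ 2 + rc (mid - abs (a - s)) * u + rc (l / 2) =
   u * rc (l * Re u + mid - abs (a - s)).
  have -> : rc (l / 2) * u ^+ 2 + rc (mid - abs (a - s)) * u + rc (l / 2) =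
   u * (rc (l / 2) * (u + cj u) + rc (mid - abs (a - s))).
   by rewrite -{2}[rc (l / 2)]mulr1 -{1}uu; ring.
  have -> : u + cj u = rc (2 * Re u).
   case: (u) => x y; rewrite /cj/=; apply/eqP; rewrite eq_complex ReD ImD /=.
   by apply/andP; split; apply/eqP; ring.
  by rewrite -rcM -rcD; congr (u * rc _); field.
 rewrite PE absM abs_prod; under eq_bigr do rewrite rE absM u1 mul1r abs_rc.
 have := nRe_le_abs u; rewrite u1 ler_norml => /andP[ua ub].
 by apply: seg; rewrite /l /mid in l0 *; nra.
(* The point of the disc that u -> l (u + 1/u) / 2 + mid sends to 0, which is the circular
   projection of [s] itself. *)
pose u0 := - ((h - e) / (h + e)).
have he0 : h + e != 0 by lra.
have he1 : h - e != 0 by lra.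
have u01 : `|u0| <= 1.
 rewrite normrN ger0_norm ?divr_ge0; [|lra..].
 by rewrite ler_pdivrMr; lra.
have := @maximum_principle P (cdisc 0 1) m (@compact_cdisc 0 1).
move=> /(_ _ (rc u0)); rewrite /cdisc/= subr0 abs_rc => /(_ _ u01).
have -> : abs P.[rc u0] = abs Q.[s] * `|u0| ^+ (size Q).-1.
 rewrite PE QE !absM -mulrA; congr (_ * _); rewrite -srs.
 elim: (rs) => [|a rs' IH]; first by rewrite !big_nil mulr1.
 rewrite !big_cons [LHS]absM IH [abs (_ * _)]absM /=.
 set A := abs (rc (l / 2) * _ + _ + _).
 have -> : A = abs (s - a) * `|u0|; last by rewrite exprS; ring.
 rewrite /A -!rcX -!rcM -!rcD abs_rc (absB s) -[abs (a - s)]ger0_norm ?abs_ge0// -normrM.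
 rewrite -[RHS]normrN; congr (`| _ |); rewrite ger0_norm ?abs_ge0//.
 rewrite /l /mid /u0; by field.
move=> H.
have {}H : abs Q.[s] * `|u0| ^+ (size Q).-1 <= m.
 apply: H => z bz; apply: unit; have := boundary_cdisc bz.
 by rewrite subr0.
have -> : (h + e) / (h - e) = `|u0|^-1.
 by rewrite normrN ger0_norm ?divr_ge0 ?invf_div//; lra.
rewrite exprVn ler_pdivlMr// exprn_gt0// normr_gt0 oppr_eq0 mulf_neq0// invr_neq0//.
Qed.

(** Each factor |u - a| with |a| <= |u| grows by at least (x + 1) / 2 when u moves to x u: the
    difference of the squares is an explicit sum of nonnegative terms. *)
Lemma radial_growth Q u x : (forall a, root Q a -> abs a <= abs u) -> 1 <= x ->
 ((x + 1) / 2) ^+ (size Q).-1 * abs Q.[u] <= abs Q.[rc x * u].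
Proof.
move=> Qu x1; have [->|Q0] := eqVneq Q 0; first by rewrite !horner0 abs0 mulr0.
have [rs [srs rsE QE]] := roots_factor Q0.
have key a : abs a <= abs u -> (x + 1) / 2 * abs (u - a) <= abs (rc x * u - a).
 move=> au; have h0 : 0 <= (x + 1) / 2 by lra.
 rewrite -(@ler_pXn2r _ 2)// ?nnegrE ?(mulr_ge0 h0 (abs_ge0 _)) ?abs_ge0//.
 have : abs a ^+ 2 <= abs u ^+ 2 by rewrite lerXn2r ?nnegrE ?abs_ge0.
 rewrite exprMn !absE !sqr_sqrtr ?addr_ge0 ?sqr_ge0// !ReD !ImD !ReN !ImN !cReM !cImM Re_rc Im_rc.
 case: a {au} => a b; case: u {Qu} => p q /= H; rewrite !mul0r subr0 addr0 -subr_ge0.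
 have -> : (x * p - a) ^+ 2 + (x * q - b) ^+ 2 - ((x + 1) / 2) ^+ 2 * ((p - a) ^+ 2 + (q - b) ^+ 2) =
  ((x + 1) * (x - 1) / 2) * (p ^+ 2 + q ^+ 2 - (a ^+ 2 + b ^+ 2)) +
  ((x - 1) / 2) ^+ 2 * ((p + a) ^+ 2 + (q + b) ^+ 2) by field.
 apply: addr_ge0; apply: mulr_ge0; rewrite ?sqr_ge0 ?(addr_ge0 (sqr_ge0 _) (sqr_ge0 _))//.
  by rewrite divr_ge0 ?mulr_ge0//; lra.
 by rewrite subr_ge0.
rewrite !QE !absM mulrCA ler_wpM2l ?abs_ge0// -srs !abs_prod.
have : forall a, a \in rs -> abs a <= abs u by move=> a; rewrite rsE => /Qu.
elim: (rs) => [|a rs' IH] h; first by rewrite !big_nil mulr1.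
rewrite !big_cons exprS mulrACA ler_pM ?mulr_ge0 ?abs_ge0 ?exprn_ge0 ?prodr_ge0//; try lra.
- by move=> *; exact: abs_ge0.
- by apply: key; apply: h; rewrite mem_head.
- by apply: IH => a' ha; apply: h; rewrite in_cons ha orbT.
Qed.

End Harnack.

Local Notation S := (sphere R).

(** * The chordal metric, equicontinuity and filled-in Julia sets *)

Section Sphere.
Implicit Types (w a b u : C) (x y o : S) (p q g h Q : {poly C}) (G : set {poly C}).

Definition sq a : R := Num.sqrt (1 + abs a ^+ 2).
Definition dst x y : R := Re (chordal x y).

Lemma sqE a : sq a ^+ 2 = 1 + abs a ^+ 2.
Proof. by rewrite sqr_sqrtr// addr_ge0// sqr_ge0. Qed.

Lemma sq_ge1 a : 1 <= sq a.
Proof. by rewrite -[leLHS]sqrtr1 ler_wsqrtr// lerDl sqr_ge0. Qed.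

Lemma abs_le_sq a : abs a <= sq a.
Proof.
rewrite -(@ler_pXn2r _ 2)// ?nnegrE ?abs_ge0 ?(le_trans ler01 (sq_ge1 a))//.
by rewrite sqE lerDr.
Qed.

Lemma sq_le a : sq a <= 1 + abs a.
Proof.
rewrite -(@ler_pXn2r _ 2)// ?nnegrE ?addr_ge0 ?abs_ge0 ?(le_trans ler01 (sq_ge1 a))//.
by rewrite sqE; have := abs_ge0 a; nra.
Qed.

Lemma sq_gt0 a : 0 < sq a. Proof. exact: lt_le_trans ltr01 (sq_ge1 a). Qed.

Lemma sqrtC_sq a : sqrtC (1 + `|a| ^+ 2) = rc (sq a).
Proof.
rewrite normE -rc1 -rcX -rcD -sqE rcX sqrCK// -rc0 rc_le ltW// sq_gt0//.
Qed.

Lemma chordalE x y : chordal x y = rc (dst x y).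
Proof.
rewrite /dst; case: x y => [a|] [b|] //=.
- by rewrite !sqrtC_sq normE -rcM -rcV -rcM.
- by rewrite sqrtC_sq -rcV.
- by rewrite sqrtC_sq -rcV.
Qed.

Lemma dstE a b : dst (Some a) (Some b) = abs (a - b) / (sq a * sq b).
Proof. by rewrite /dst /= !sqrtC_sq normE -rcM -rcV -rcM. Qed.
Lemma dst_inf a : dst (Some a) infty = (sq a)^-1.
Proof. by rewrite /dst /= sqrtC_sq -rcV. Qed.
Lemma dst_inf' a : dst infty (Some a) = (sq a)^-1.
Proof. by rewrite /dst /= sqrtC_sq -rcV. Qed.
Lemma dst_infinf : dst infty infty = 0. Proof. by []. Qed.

Lemma dst_sym x y : dst x y = dst y x.
Proof.
case: x y => [a|] [b|] //; rewrite ?dst_inf ?dst_inf'//.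
by rewrite !dstE absB (mulrC (sq a)).
Qed.

Lemma sq_lip a b : sq b <= abs (a - b) + sq a.
Proof.
have s0 := ltW (sq_gt0 a); have t0 := abs_ge0 (a - b).
rewrite -(@ler_pXn2r _ 2)// ?nnegrE ?addr_ge0 ?(ltW (sq_gt0 b))//.
have := sqE a; have := sqE b; have := abs_le_sq a; have := abs_lip b a; rewrite absB.
have := abs_ge0 b; have := abs_ge0 a; move: t0 s0.
move: (abs a) (abs b) (sq a) (sq b) (abs (a - b)); clear; move=> A B sA sB t.
by move=> *; nra.
Qed.

Let abs_cross a b : abs (1 + cj a * b) <= sq a * sq b.
Proof.
have s0 := ltW (sq_gt0 a); have t0 := ltW (sq_gt0 b).
rewrite -(@ler_pXn2r _ 2)// ?nnegrE ?mulr_ge0 ?abs_ge0//.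
rewrite exprMn !sqE !absE !sqr_sqrtr ?addr_ge0 ?sqr_ge0// ReD ImD cReM cImM /=.
case: a {s0} => p q; case: b {t0} => u v /=; rewrite -subr_ge0.
have -> : (1 + (p ^+ 2 + q ^+ 2)) * (1 + (u ^+ 2 + v ^+ 2)) -
  ((1 + (p * u - - q * v)) ^+ 2 + (0 + (p * v + - q * u)) ^+ 2) =
  (p - u) ^+ 2 + (q - v) ^+ 2 by ring.
by rewrite addr_ge0 ?sqr_ge0.
Qed.

(** At finite points the inequality comes from (a - c) (1 + |b|^2) = (a - b) (1 + b' c) + (b - c) (1
    + b' a), with b' the conjugate of b, and from the Cauchy-Schwarz bound [abs_cross]. *)
Lemma dst_tri y x o : dst x o <= dst x y + dst y o.
Proof.
case: x y o => [a|] [b|] [c|]; rewrite ?dstE ?dst_inf ?dst_inf' ?dst_infinf ?addr0 ?add0r//.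
- have [[sa sb] sc] := (sq_gt0 a, sq_gt0 b, sq_gt0 c).
 have E : (a - c) * rc (sq b ^+ 2) = (a - b) * (1 + cj b * c) + (b - c) * (1 + cj b * a).
  by rewrite sqE rcD rc1 -mul_cj; ring.
 have : abs (a - c) * sq b ^+ 2 <= abs (a - b) * (sq b * sq c) + abs (b - c) * (sq b * sq a).
  rewrite -[sq b ^+ 2]ger0_norm ?sqr_ge0// -abs_rc -absM E (le_trans (absD _ _))//.
  by rewrite !absM lerD// ler_wpM2l ?abs_ge0// abs_cross.
 move: sa sb sc; move: (abs (a - c)) (abs (a - b)) (abs (b - c)) (sq a) (sq b) (sq c).
 clear=> X Y Z A B D A0 B0 D0 H.
 have -> : X / (A * D) = X * B ^+ 2 / (A * D * B ^+ 2) by field; rewrite !gt_eqF.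
 have -> : Y / (A * B) + Z / (B * D) = (Y * (B * D) + Z * (B * A)) / (A * D * B ^+ 2).
  by field; rewrite !gt_eqF.
 by rewrite ler_pM2r// invr_gt0 !mulr_gt0// exprn_gt0.
- have [sa sb] := (sq_gt0 a, sq_gt0 b); have := sq_lip a b.
 move: sa sb; move: (abs (a - b)) (sq a) (sq b); clear=> X A B A0 B0 H.
 have -> : X / (A * B) + B^-1 = (X + A) / (A * B) by field; rewrite !gt_eqF.
 have -> : A^-1 = B / (A * B) by field; rewrite !gt_eqF.
 by rewrite ler_pM2r// invr_gt0 mulr_gt0.
- have [sa sc] := (sq_gt0 a, sq_gt0 c).
 have : abs (a - c) <= sq a + sq c.
  by rewrite (le_trans (absBD _ _))// lerD ?abs_le_sq.
 move: sa sc; move: (abs (a - c)) (sq a) (sq c); clear=> X A B A0 B0 H.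
 have -> : A^-1 + B^-1 = (A + B) / (A * B) by field; rewrite !gt_eqF.
 by rewrite ler_pM2r// invr_gt0 mulr_gt0.
- have [sb sc] := (sq_gt0 b, sq_gt0 c); have := sq_lip c b; rewrite absB.
 move: sb sc; move: (abs (b - c)) (sq b) (sq c); clear=> X B D B0 D0 H.
 have -> : B^-1 + X / (B * D) = (X + D) / (B * D) by field; rewrite !gt_eqF.
 have -> : D^-1 = B / (B * D) by field; rewrite !gt_eqF.
 by rewrite ler_pM2r// invr_gt0 mulr_gt0.
- by rewrite -mulr2n mulrn_wge0// invr_ge0 ltW// sq_gt0.
Qed.

Lemma dst_chain5 x1 x2 x3 x4 x5 x6 e : dst x1 x2 < e / 5 -> dst x2 x3 < e / 5 ->
 dst x3 x4 < e / 5 -> dst x4 x5 < e / 5 -> dst x5 x6 < e / 5 -> dst x1 x6 < e.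
Proof.
have := dst_tri x2 x1 x6; have := dst_tri x3 x2 x6.
have := dst_tri x4 x3 x6; have := dst_tri x5 x4 x6.
lra.
Qed.

Lemma dst_le_abs a b : dst (Some a) (Some b) <= abs (a - b).
Proof.
rewrite dstE ler_pdivrMr ?mulr_gt0 ?sq_gt0// ler_peMr ?abs_ge0//.
by rewrite mulr_ege1 ?sq_ge1.
Qed.

Lemma dst_inf_le a M : 0 < M -> M <= abs a -> dst (Some a) infty <= M^-1.
Proof.
move=> M0 Ma; rewrite dst_inf lef_pV2 ?posrE ?sq_gt0//.
exact: le_trans Ma (abs_le_sq a).
Qed.

Lemma dst_far a b M : 0 < M -> M <= abs a -> M <= abs b -> dst (Some a) (Some b) <= 2 / M.
Proof.
move=> M0 Ma Mb; apply: le_trans (dst_tri infty _ _) _.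
rewrite (dst_sym infty); have := dst_inf_le M0 Ma; have := dst_inf_le M0 Mb.
by move: (dst _ _) (dst _ _) M^-1; clear; move=> *; lra.
Qed.

Lemma dst_far_ge a b M : 0 <= M -> abs b <= M -> 2 * M + 1 <= abs a ->
 (2 * (1 + M))^-1 <= dst (Some a) (Some b).
Proof.
move=> M0 bM aM; rewrite dstE ler_pdivlMr ?mulr_gt0 ?sq_gt0//.
rewrite mulrC ler_pdivrMr; last by rewrite mulr_gt0//; lra.
have ab : abs a - M <= abs (a - b) by have := abs_lip a b; lra.
have := sq_le a; have := sq_le b; have := sq_gt0 a; have := sq_gt0 b; have := abs_ge0 b.
move: aM bM M0 ab; move: (abs a) (abs b) (sq a) (sq b) (abs (a - b)); clear.
move=> A B sA sB t H1 H2 H3 H4 H5 H6 H7 H8 H9.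
have : sA * sB <= (1 + A) * (1 + M) by rewrite ler_pM//; lra.
nra.
Qed.

Lemma nbhs_some a (A : set S) : nbhs (Some a : S) A <-> exists2 r, 0 < r &
 forall w, abs (w - a) < r -> A (Some w).
Proof. by split=> [/nbhsC[r r0 h]|[r r0 h]]; [exists r|apply/nbhsC; exists r]. Qed.

Lemma nbhs_infty (A : set S) : nbhs (infty : S) A <-> A infty /\ exists M,
 forall w, M < abs w -> A (Some w).
Proof.
split=> [[U [cU _] UA]|[Ai [M MA]]].
 split; first by apply: UA; right.
 have /compactC[_ [M UM]] := cU; exists M => w Mw; apply: UA; left; exists w => // Uw.
 by have := UM w Uw; lra.
exists (cdisc 0 `|M|); first by split; [exact: compact_cdisc|exact: closed_cdisc].
move=> [w [[v nv [<-]]|//]|[//|_]]; last exact: Ai.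
apply: MA; move: nv; rewrite /cdisc /= subr0 => /negP; rewrite -ltNge.
exact: le_lt_trans (ler_norm _).
Qed.

Lemma open_some a (A : set S) : open A -> A (Some a) ->
 exists2 r, 0 < r & forall w, abs (w - a) < r -> A (Some w).
Proof. by move=> oA Aa; apply/nbhs_some; exact: open_nbhs_nbhs. Qed.

Lemma open_infty (A : set S) : open A -> A infty -> exists M, forall w, M < abs w -> A (Some w).
Proof. by move=> oA Ai; have [] := (nbhs_infty A).1 (open_nbhs_nbhs (conj oA Ai)). Qed.

Lemma hausdorff_sphere : hausdorff_space S.
Proof.
apply: one_point_compactification_hausdorff; last exact: hausdorffC.
move=> a _; exists (cdisc a 1).
 rewrite withinET; apply/nbhsC; exists 1 => //; exact: sub_disc_cdisc.
by split; [exact: compact_cdisc|exact: closed_cdisc].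
Qed.

Lemma compact_sphere : compact [set: S].
Proof. exact: one_point_compactification_compact. Qed.

Lemma regular_sphere x (U : set S) : nbhs x U -> exists2 V, nbhs x V & compact V /\ V `<=` U.
Proof.
move=> xU; have reg : {for x, @regular_space S}.
 exact: compact_regular hausdorff_sphere compact_sphere filterT.
have [B xB BU] := reg U xU; exists (closure B); first exact: filterS (@subset_closure _ B) xB.
split=> //; apply: subclosed_compact compact_sphere _ => //; exact: closed_closure.
Qed.

Definition incr (f : nat -> nat) := {homo f : m n / (m < n)%N}.

Lemma incr_ge f n : incr f -> (n <= f n)%N.
Proof. by move=> fi; elim: n => // n IH; apply: leq_ltn_trans IH _; exact: fi. Qed.

Lemma incr_comp f k : incr f -> incr k -> incr (f \o k).
Proof. by move=> fi ki m n mn; apply/fi/ki. Qed.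

Lemma extract_infinite (P : nat -> Prop) : (forall N, exists2 n, (N <= n)%N & P n) ->
 exists2 f, incr f & forall n, P (f n).
Proof.
move=> inf; have [k kP] : exists k : nat -> nat, forall N, (N <= k N)%N /\ P (k N).
 have ex N : exists n, (N <= n)%N /\ P n by have [n ? ?] := inf N; exists n.
 by have [k] := choice ex; exists k.
pose f := fix f n := if n is n'.+1 then k (f n').+1 else k 0%N.
exists f; last by case=> [|n]; exact: (kP _).2.
apply: homo_ltn => [y x z|n]; first exact: ltn_trans.
exact: (kP (f n).+1).1.
Qed.

Definition dcvg (v : nat -> S) (l : S) := forall e, 0 < e -> exists N, forall n, (N <= n)%N -> dst (v n) l < e.

Lemma sphere_subsequence (v : nat -> S) : exists2 f, incr f & exists l, dcvg (v \o f) l.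
Proof.
have [[M inf]|bd] := pselect (exists M, forall N, exists2 n, (N <= n)%N &
  exists2 a, v n = Some a & abs a <= M).
 have [f fi fP] := extract_infinite inf.
 have [k kP] : exists k : nat -> C, forall n, v (f n) = Some (k n) /\ abs (k n) <= M.
  have ex n : exists a, v (f n) = Some a /\ abs a <= M by have [a ? ?] := fP n; exists a.
  by have [k] := choice ex; exists k.
 have [f' fi' [l hl]] := @bounded_subsequence k M (fun n => (kP n).2).
 exists (f \o f'); first exact: incr_comp.
 exists (Some l) => e /hl[N hN]; exists N => n /hN h /=.
 by rewrite (kP _).1; apply: le_lt_trans (dst_le_abs _ _) h.
exists id => //; exists infty => e e0.
have [N hN] : exists N, forall n, (N <= n)%N -> forall a, v n = Some a -> 2 / e < abs a.
 apply: contrapT => no; apply: bd; exists (2 / e) => N; apply: contrapT => no2.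
 apply: no; exists N => n Nn a va; rewrite ltNge; apply/negP => ha; apply: no2.
 by exists n => //; exists a.
exists N => n /hN /=; case: (v n) => [a|_]; last by rewrite dst_infinf.
move=> /(_ a erefl)/ltW h; have e2 : 0 < 2 / e by rewrite divr_gt0.
by apply: le_lt_trans (dst_inf_le e2 h) _; rewrite invf_div ltr_pdivrMr//; lra.
Qed.

(** The second hypothesis lets [P k] pass to sequences that are eventually drawn from a given one
    with indices no smaller; the diagonal is of this kind for every k. *)
Lemma diagonal_subsequence (P : nat -> (nat -> nat) -> Prop) :
 (forall k f, incr f -> exists2 f', incr f' & P k (f \o f')) ->
 (forall k f f', P k f -> (exists N, forall n, (N <= n)%N -> exists2 m, (n <= m)%N & f' n = f m) ->
   P k f') ->
 exists2 f, incr f & forall k, P k f.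
Proof.
move=> hex hext.
have [th thP] : exists th : nat * (nat -> nat) -> (nat -> nat), forall kf,
  incr kf.2 -> incr (th kf) /\ P kf.1 (kf.2 \o th kf).
 have ex (kf : nat * (nat -> nat)) : exists f', incr kf.2 -> incr f' /\ P kf.1 (kf.2 \o f').
  case: (pselect (incr kf.2)) => [/(hex kf.1)[f' ? ?]|?]; first by exists f'.
  by exists id.
 by have [th] := choice ex; exists th.
pose F := fix F n := if n is k.+1 then F k \o th (k, F k) else id.
have Fi n : incr (F n).
 by elim: n => [|n IH] //=; apply: incr_comp => //; exact: (thP (n, F n) IH).1.
have FP n : P n (F n.+1) := (thP (n, F n) (Fi n)).2.
have tail j n : (j <= n)%N -> forall m, exists2 m', (m <= m')%N & F n m = F j m'.
 elim: n => [|n IH]; first by rewrite leqn0 => /eqP-> m; exists m.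
 rewrite leq_eqVlt => /orP[/eqP-> m|/IH{}IH m]; first by exists m.
 have ti := (thP (n, F n) (Fi n)).1.
 have [m' mm' E] := IH (th (n, F n) m); exists m' => //.
 exact: leq_trans (incr_ge m ti) mm'.
exists (fun n => F n n).
 apply: homo_ltn => [y x z|n]; first exact: ltn_trans.
 apply: (Fi n); have ti := (thP (n, F n) (Fi n)).1.
 exact: incr_ge n.+1 ti.
by move=> k; apply: hext (FP k) _; exists k.+1 => n kn; have [m] := tail _ _ kn n; exists m.
Qed.

Definition ratpt (k : nat) : C :=
 if unpickle k is Some pq then Complex (ratr (pq : rat * rat).1) (ratr pq.2) else 0.

Lemma ratpt_dense a r : 0 < r -> exists k, abs (ratpt k - a) < r.
Proof.
move=> r0; case: a => x y.
have h (t : R) : exists p : rat, `|ratr p - t| < r / 2.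
 have [p] := @rat_in_itvoo R (t - r / 2) (t + r / 2) ltac:(lra).
 by rewrite in_itv/= => ?; exists p; rewrite ltr_norml; lra.
have [p hp] := h x; have [q hq] := h y; exists (pickle (p, q)).
rewrite /ratpt pickleK /=.
have -> : Complex (ratr p) (ratr q) - Complex x y = Complex (ratr p - x) (ratr q - y) :> C by [].
by apply: le_lt_trans (abs_Complex _ _) _; lra.
Qed.

Lemma ratpt_dense_sphere x (V : set S) : nbhs x V -> exists k, V (Some (ratpt k)).
Proof.
case: x => [a /nbhs_some[r r0 h]|/nbhs_infty[_ [M h]]].
 by have [k hk] := ratpt_dense a r0; exists k; exact: h.
have [k hk] := ratpt_dense (rc (`|M| + 1)) (ltr01 : 0 < 1 :> R); exists k; apply: h.
have := abs_lip (rc (`|M| + 1)) (ratpt k); rewrite abs_rc absB ger0_norm ?addr_ge0//.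
by have := ler_norm M; lra.
Qed.

(** A diagonal sequence converges at the points with rational coordinates; equicontinuity extends
    convergence to [U], and compact neighbourhoods make it locally uniform. *)
Lemma ascoli (U : set S) (f : nat -> S -> S) : open U ->
 (forall x, U x -> forall e, 0 < e -> exists2 V, nbhs x V &
  forall n y, V y -> dst (f n y) (f n x) < e) ->
 exists2 k, incr k & exists l, forall x, U x -> exists2 V, nbhs x V &
  forall e, 0 < e -> exists N, forall n, (N <= n)%N -> forall y, V y -> dst (f (k n) y) (l y) < e.
Proof.
move=> oU eq; pose P (j : nat) (k : nat -> nat) := exists l, dcvg (fun n => f (k n) (Some (ratpt j))) l.
have [k ki kP] : exists2 k, incr k & forall j, P j k.
 apply: diagonal_subsequence => [j k ki|j k k' [l kl] [N hN]].
  have [k' ki' [l hl]] := sphere_subsequence (fun n => f (k n) (Some (ratpt j))).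
  by exists k' => //; exists l.
 exists l => e /kl[N' hN']; exists (maxn N N') => n; rewrite geq_max => /andP[/hN[m nm ->] N'n].
 by apply: hN'; exact: leq_trans nm.
have cv x : U x -> exists l, dcvg (fun n => f (k n) x) l.
 move=> Ux; have [k' ki' [l hl]] := sphere_subsequence (fun n => f (k n) x).
 exists l => e e0; have e5 : 0 < e / 5 by rewrite divr_gt0.
 have [V xV VP] := eq x Ux _ e5; have [j Vj] := ratpt_dense_sphere xV.
 have [l' hl'] := kP j; have [N hN] := hl' _ e5; have [N' hN'] := hl _ e5.
 exists N => n Nn; pose m := maxn N N'.
 have h1 := hN' _ (leq_maxr N N'); rewrite -/m /= in h1.
 have h2 := hN (k' m) (leq_trans (leq_maxl N N') (incr_ge m ki')).
 have h3 := hN n Nn; have h4 := VP (k n) _ Vj; have h5 := VP (k (k' m)) _ Vj.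
 apply: dst_chain5 (_ : _ < e / 5) h3 _ h5 h1; first by rewrite dst_sym; exact: h4.
 by rewrite dst_sym.
have [l hl] : exists l : S -> S, forall x, U x -> dcvg (fun n => f (k n) x) (l x).
 have ex x : exists y, U x -> dcvg (fun n => f (k n) x) y.
  by case: (pselect (U x)) => [/cv[y]|]; [exists y|exists x].
 by have [l] := choice ex; exists l.
exists k => //; exists l => x Ux.
have [V xV [cV VU]] := regular_sphere (open_nbhs_nbhs (conj oU Ux)).
exists V => // e e0; have e5 : 0 < e / 5 by rewrite divr_gt0.
have := (compact_near_coveringP V).1 cV nat \oo (fun n y => dst (f (k n) y) (l y) < e) _.
case=> [y Vy|N _ hN]; last by exists N => n Nn y Vy; exact: hN.
have Uy := VU y Vy; have [W yW WP] := eq y Uy _ e5; have [N hN] := hl y Uy _ e5.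
exists (W `&` U, [set n | (N <= n)%N]) => /=.
 by split; [exact: filterI yW (open_nbhs_nbhs (conj oU Uy))|exists N].
move=> [y' n] /= [[Wy' Uy'] Nn]; have [N' hN'] := hl y' Uy' _ e5.
pose m := maxn N N'; have h1 := hN' m (leq_maxr _ _); have h2 := hN m (leq_maxl _ _).
have h3 := hN n Nn; have h4 := WP (k n) _ Wy'; have h5 := WP (k m) _ Wy'.
have h2' : dst (l y) (f (k m) y) < e / 5 by rewrite dst_sym.
have h5' : dst (f (k m) y) (f (k m) y') < e / 5 by rewrite dst_sym.
exact: dst_chain5 h4 h3 h2' h5' h1.
Qed.

Definition equicont_at G a := forall e, 0 < e -> exists2 d, 0 < d & forall g, G g ->
 forall w, abs (w - a) < d -> dst (Some g.[w]) (Some g.[a]) < e.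

Definition equicont_infty G := forall e, 0 < e -> exists M, forall g, G g ->
 forall w, M < abs w -> dst (Some g.[w]) infty < e.

Lemma normal_of_equicont G (U : set S) : open U ->
 (forall a, U (Some a) -> equicont_at G a) -> (U infty -> equicont_infty G) ->
 normal_family U (@sphere_map R @` G).
Proof.
move=> oU eqf eqi f fG; have [k ki [l hl]] : exists2 k, incr k & exists l, forall x, U x ->
  exists2 V, nbhs x V & forall e, 0 < e -> exists N, forall n, (N <= n)%N ->
  forall y, V y -> dst (f (k n) y) (l y) < e.
 apply: ascoli => // -[a|] Ux e e0.
  have [d d0 h] := eqf a Ux e e0.
  exists [set y | if y is Some w then abs (w - a) < d else False].
   by apply/nbhs_some; exists d.
  by move=> n [w|//] wd; have [g Gg <-] := fG n; exact: h.
 have [M h] := eqi Ux e e0.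
 exists [set y | if y is Some w then M < abs w else True].
  by apply/nbhs_infty; split => //; exists M.
 by move=> n [w|] wd; have [g Gg <-] := fG n; [exact: h|rewrite dst_infinf].
exists k; split=> //; exists l => x /hl[V xV h]; exists V => // e e0.
have er : e = rc (Re e) by rewrite /rc RRe_real// gtr0_real.
have e0' : 0 < Re e by move: e0; rewrite er -rc0 rc_lt.
have [N hN] := h _ e0'; exists N => // n /= Nn w [_ Vw].
by rewrite chordalE er rc_lt; exact: hN.
Qed.

Lemma fatou_of_equicont G a r : 0 < r -> (forall b, abs (b - a) < r -> equicont_at G b) ->
 fatou_set G (Some a).
Proof.
move=> r0 h; exists (emb (disc a r)); last first.
 apply: normal_of_equicont => [|b [w wb [<-]]|[w _ //]]; last exact: h.
 exact: one_point_compactification_open_some (@open_disc a r).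
split; first exact: one_point_compactification_open_some (@open_disc a r).
by exists a => //; exact: disc_center.
Qed.

Lemma fatou_infty_of_equicont G M : (forall b, M < abs b -> equicont_at G b) ->
 equicont_infty G -> fatou_set G infty.
Proof.
move=> h1 h2; pose U : set S := [set y | if y is Some w then M < abs w else True].
have oU : open U.
 rewrite openE => -[a /= Ma|_]; last by apply/nbhs_infty; split => //; exists M.
 apply/nbhs_some; exists (abs a - M); first by rewrite subr_gt0.
 by move=> w wa /=; have := abs_lip a w; rewrite absB; lra.
by exists U; [split|apply: normal_of_equicont].
Qed.

Lemma open_fatou G : open (fatou_set G).
Proof.
rewrite openE => x [U [oU Ux] nU]; rewrite /interior nbhsE.
by exists U; [split|move=> y Uy; exists U].
Qed.

Lemma fatou_mono G G' : G' `<=` G -> fatou_set G `<=` fatou_set G'.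
Proof.
move=> GG x [U xU nU]; exists U => // f fG; apply: nU => n.
by have [g /GG Gg <-] := fG n; exists g.
Qed.

Lemma horner_dst_continuous g a e : 0 < e -> exists2 d, 0 < d &
 forall w, abs (w - a) < d -> dst (Some g.[w]) (Some g.[a]) < e.
Proof.
move=> e0; have [d d0 h] := horner_near g a e0; exists d => // w /h.
exact: le_lt_trans (dst_le_abs _ _).
Qed.

(** A failure at scale e gives maps and points tending to a. Along a locally uniformly convergent
    subsequence all late maps are close to one fixed member, which is continuous at a. *)
Lemma equicont_of_fatou G a : fatou_set G (Some a) -> equicont_at G a.
Proof.
move=> [U [oU Ua] nU] e e0; apply: contrapT => no.
have bad n : exists gw : {poly C} * C, [/\ G gw.1, abs (gw.2 - a) < n.+1%:R^-1 &
  e <= dst (Some gw.1.[gw.2]) (Some gw.1.[a])].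
 apply: contrapT => no2; apply: no; exists n.+1%:R^-1; first by rewrite invr_gt0.
 move=> g Gg w wa; rewrite ltNge; apply/negP => h; apply: no2.
 by exists (g, w).
have [k kP] := choice bad.
have fG n : (@sphere_map R @` G) (sphere_map (k n).1) by exists (k n).1 => //; case: (kP n).
have [f [fi [l hl]]] := nU _ fG; have [V aV hV] := hl _ Ua.
have e5 : 0 < e / 5 by rewrite divr_gt0.
have [N _ hN] := hV (rc (e / 5)) ltac:(by rewrite -rc0 rc_lt).
have {}hN n w : (N <= n)%N -> U (Some w) -> V (Some w) ->
  dst (Some (k (f n)).1.[w]) (l (Some w)) < e / 5.
 by move=> Nn Uw Vw; have := hN n Nn (Some w) (conj Uw Vw); rewrite chordalE rc_lt.
have nUV : nbhs (Some a : S) (U `&` V) by exact: filterI (open_nbhs_nbhs (conj oU Ua)) aV.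
have [d d0 hd] := (nbhs_some _ _).1 nUV.
have [d' d0' hd'] := horner_dst_continuous (k (f N)).1 a e5.
have [N' hN'] : exists N', N'.+1%:R^-1 < Num.min d d'.
 have m0 : 0 < Num.min d d' by rewrite lt_min d0.
 have := archi_boundP (ltW (_ : 0 < (Num.min d d')^-1)); rewrite invr_gt0 => /(_ m0) h.
 exists (Num.bound (Num.min d d')^-1); rewrite -[ltRHS]invrK ltf_pV2 ?posrE ?invr_gt0//.
 by apply: lt_trans h _; rewrite ltr_nat.
pose n := maxn N N'; have Nn : (N <= n)%N := leq_maxl _ _.
have [Gg wa ge] := kP (f n); set w := (k (f n)).2 in wa ge.
have : abs (w - a) < Num.min d d'.
 apply: lt_trans wa _; apply: le_lt_trans hN'; rewrite lef_pV2 ?posrE// ler_nat ltnS.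
 exact: leq_trans (leq_maxr N N') (incr_ge n fi).
rewrite lt_min => /andP[wd wd'].
have [Uw Vw] := hd w wd; have [_ Va] := hd a ltac:(by rewrite subrr abs0).
have h1 := hN n w Nn Uw Vw; have h2 := hN N w (leqnn _) Uw Vw.
have h3 := hN n a Nn Ua Va; have h4 := hN N a (leqnn _) Ua Va; have h5 := hd' w wd'.
move: ge; apply/negP; rewrite -ltNge; rewrite dst_sym in h2; rewrite dst_sym in h3.
exact: dst_chain5 h1 h2 h5 h4 h3.
Qed.

(** Large values are chordally close to each other, and bounded families are handled by
    [horner_lipschitz]; so it suffices that bounded values stay bounded and large ones stay large on
    a fixed disc. *)
Lemma equicont_criterion G a r : 0 < r ->
 (forall T, exists B, forall g, G g -> abs g.[a] <= T ->
   forall z, abs (z - a) < r -> abs g.[z] <= B) ->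
 (forall B, exists T, forall g, G g -> T < abs g.[a] ->
   forall z, abs (z - a) < r -> B <= abs g.[z]) -> equicont_at G a.
Proof.
move=> r0 h1 h2 e e0; have [T hT] := h2 (4 / e); have [B hB] := h1 T.
pose B' := `|B| + 1; have B'0 : 0 < B' by rewrite ltr_wpDl.
exists (Num.min (r / 2) (e * r / (16 * B'))).
 by rewrite lt_min !divr_gt0 ?mulr_gt0.
move=> g Gg w; rewrite lt_min => /andP[wr]; rewrite ltr_pdivlMr ?mulr_gt0// => wB.
have aa : abs (a - a) < r / 2 by rewrite subrr abs0 divr_gt0.
have [ga|ga] := leP (abs g.[a]) T; last first.
 have e4 : 0 < 4 / e by rewrite divr_gt0.
 apply: le_lt_trans (@dst_far _ _ (4 / e) e4 (hT g Gg ga w _) (hT g Gg ga a _)) _; [lra|lra|].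
 have -> : 2 / (4 / e) = e / 2 by field; rewrite gt_eqF.
 by lra.
apply: le_lt_trans (dst_le_abs _ _) _.
have lip := @horner_lipschitz g a (r / 2) B' _ _ w a wr aa.
apply: le_lt_trans (lip _ _) _; first by rewrite divr_gt0.
 move=> z zr; apply: le_trans (hB g Gg ga z _) _; first by lra.
 by rewrite (le_trans (ler_norm _))// lerDl.
have -> : 4 * B' / (r / 2) * abs (w - a) = (abs (w - a) * (16 * B')) / r / 2.
 by field; rewrite gt_eqF.
rewrite ltr_pdivrMr// ltr_pdivrMr//; apply: lt_le_trans wB _.
by rewrite ler_pM2r//; lra.
Qed.

Lemma connected_emb (K : set C) : connected K -> connected (emb K).
Proof.
move=> cK; apply: connected_continuous_connected => //; apply: continuous_subspaceT.
exact: one_point_compactification_some_continuous.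
Qed.

Definition comp_closed G := forall p q, G p -> G q -> G (p \Po q).

Lemma generated_comp G : comp_closed (generated G).
Proof. by move=> p q Gp Gq N hN; apply: hN.1; [exact: (Gp _ hN)|exact: (Gq _ hN)]. Qed.

Lemma sub_generated G : G `<=` generated G.
Proof. by move=> p Gp N [_]; apply. Qed.

Lemma generated_ind G (P : set {poly C}) : G `<=` P -> comp_closed P -> generated G `<=` P.
Proof. by move=> GP PP p; apply; split. Qed.

Definition piter h n := iter n (fun q => h \Po q) 'X.

Arguments piter : simpl never.

Lemma piterS h n : piter h n.+1 = h \Po piter h n. Proof. by []. Qed.

Lemma piterD h m n : piter h (m + n) = piter h m \Po piter h n.
Proof.
elim: m => [|m IH]; first by rewrite comp_polyX.
by rewrite addSn !piterS IH comp_polyA.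
Qed.

Lemma piter1 h : piter h 1 = h. Proof. by rewrite piterS comp_polyXr. Qed.

Lemma piterSr h n : piter h n.+1 = piter h n \Po h.
Proof. by rewrite -addn1 piterD piter1. Qed.

Lemma horner_piterS h n z : (piter h n.+1).[z] = h.[(piter h n).[z]].
Proof. by rewrite piterS horner_comp. Qed.

Lemma horner_piterSr h n z : (piter h n.+1).[z] = (piter h n).[h.[z]].
Proof. by rewrite piterSr horner_comp. Qed.

Lemma horner_piterD h m n z : (piter h (m + n)).[z] = (piter h m).[(piter h n).[z]].
Proof. by rewrite piterD horner_comp. Qed.

Lemma horner_piter h n z : (piter h n).[z] = iter n (fun u => h.[u]) z.
Proof. by elim: n => [|n IH]; rewrite ?hornerX// horner_piterS IH. Qed.

Lemma generated1P h g : generated [set h] g <-> exists n, g = piter h n.+1.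
Proof.
split=> [|[n ->]].
 apply: (@generated_ind [set h] [set q | exists n, q = piter h n.+1]).
  by move=> _ ->; exists 0%N; rewrite piter1.
 by move=> p q [m ->] [n ->]; exists (m + n).+1; rewrite -piterD addSn addnS.
elim: n => [|n IH]; first by rewrite piter1; exact: sub_generated.
by rewrite piterS; apply: generated_comp => //; exact: sub_generated.
Qed.

Lemma generated1_sub G h : comp_closed G -> G h -> generated [set h] `<=` G.
Proof. by move=> cG Gh; apply: generated_ind => // _ ->. Qed.

Lemma piter_in G h n : comp_closed G -> G h -> G (piter h n.+1).
Proof. by move=> cG Gh; apply: generated1_sub cG Gh _ _; apply/generated1P; exists n. Qed.

Lemma degree_comp p q : degree (p \Po q) = (degree p * degree q)%N.
Proof. exact: size_comp_poly. Qed.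

Lemma degree_piter h n : degree (piter h n) = (degree h ^ n)%N.
Proof.
elim: n => [|n IH]; first by rewrite /degree size_polyX.
by rewrite piterS degree_comp IH expnS.
Qed.

Lemma degree_nonconstant g : (0 < degree g)%N -> nonconstant g.
Proof. by rewrite /degree /nonconstant; case: (size g) => [|[]]. Qed.

Lemma nonconstant_degree g : nonconstant g -> (0 < degree g)%N.
Proof. by rewrite /degree /nonconstant; case: (size g) => [|[]]. Qed.

Definition escape h M := 1 <= M /\ forall z, M <= abs z -> 2 * abs z <= abs h.[z].

Lemma escape_radius h : (2 <= degree h)%N -> exists M, escape h M.
Proof.
move=> d2; have h0 : h != 0 by apply: contraTneq d2 => ->; rewrite /degree size_poly0.
have [k k0 [r r1 hr]] := horner_growth_lower h0.
exists (Num.max r (2 / k)); split=> [|z]; first by rewrite le_max r1.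
rewrite ge_max => /andP[rz kz]; apply: le_trans (hr z rz).
have z1 : 1 <= abs z by exact: le_trans rz.
rewrite -/(degree h) -(subnK d2) exprD expr2.
have : 1 <= abs z ^+ (degree h - 2) by rewrite exprn_ege1.
move: kz; rewrite ler_pdivrMr//; move: z1 k0; move: (abs z) (_ ^+ _); clear=> A X A1 k0 H X1.
have h1 : 2 * A <= k * (A * A) by nra.
have : 0 <= k * (A * A) by nra.
nra.
Qed.

Lemma escape_iter h M z n k : escape h M -> M <= abs (piter h n).[z] ->
 2 ^+ k * abs (piter h n).[z] <= abs (piter h (k + n)).[z].
Proof.
move=> [M1 hM] Mz; elim: k => [|k IH]; first by rewrite expr0 mul1r.
have g1 : 1 <= (2 : R) ^+ k by rewrite exprn_ege1// ler1n.
have MM : M <= abs (piter h (k + n)).[z].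
 by apply: le_trans IH; apply: le_trans Mz _; rewrite ler_peMl ?abs_ge0.
rewrite addSn horner_piterS exprS -mulrA; apply: le_trans (hM _ MM).
by rewrite ler_pM2l.
Qed.

Lemma exists_pow2 B : exists k, forall n, (k <= n)%N -> B < (2 : R) ^+ n.
Proof.
have [k kB] : exists k, B < k%:R.
 have := archi_boundP (normr_ge0 B); exists (Num.bound `|B|).
 exact: le_lt_trans (ler_norm B) _.
exists k => n kn; apply: lt_le_trans kB _; rewrite -natrX ler_nat.
by apply: leq_trans kn (ltnW (ltn_expl _ _)).
Qed.

Lemma escape_far h M B z n0 : escape h M -> M <= abs (piter h n0).[z] ->
 exists N, forall n, (N <= n)%N -> B <= abs (piter h n).[z].
Proof.
move=> eM Mz; have [k hk] := exists_pow2 B; exists (k + n0)%N => n kn.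
rewrite -(subnK (leq_trans (leq_addl k n0) kn)).
apply: le_trans (escape_iter _ eM Mz).
have h1 : (k <= n - n0)%N by lia.
have := hk _ h1; have := eM.1; have : 1 <= (2 : R) ^+ (n - n0) by rewrite exprn_ege1// ler1n.
by move: Mz; move: (_ ^+ _) (abs _); clear; move=> *; nra.
Qed.

Lemma filled_juliaP h M z : escape h M ->
 filled_julia h z <-> forall n, abs (piter h n).[z] <= M.
Proof.
move=> eM; split=> [/bounded_setC[B hB] n|hM].
 apply: lerF => Mz; have [N hN] := escape_far (B + 1) eM (ltW Mz).
 have : abs (piter h N.+1).[z] <= B.
  by apply: hB; exists (piter h N.+1) => //; apply/generated1P; exists N.
 by have := hN N.+1 (leqnSn N); lra.
by apply/bounded_setC; exists M => _ [g /generated1P[n ->] <-]; exact: hM.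
Qed.

Lemma filled_julia_horner h z : (2 <= degree h)%N -> filled_julia h h.[z] <-> filled_julia h z.
Proof.
move=> d2; have [M eM] := escape_radius d2; split=> /(filled_juliaP _ eM) H.
 apply/(filled_juliaP _ eM) => -[|n]; last by rewrite horner_piterSr.
 rewrite hornerX; apply: lerF => Mz; have := H 0%N; rewrite hornerX.
 by have := eM.2 z (ltW Mz); have := eM.1; lra.
by apply/(filled_juliaP _ eM) => n; rewrite -horner_piterSr.
Qed.

Lemma filled_julia_piter h n z : (2 <= degree h)%N ->
 filled_julia h (piter h n).[z] <-> filled_julia h z.
Proof.
move=> d2; elim: n => [|n IH]; first by rewrite hornerX.
by rewrite horner_piterS filled_julia_horner.
Qed.

Lemma compact_filled_julia h : (2 <= degree h)%N -> compact (filled_julia h).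
Proof.
move=> d2; have [M eM] := escape_radius d2; apply/compactC; split; last first.
 by exists M => z /(filled_juliaP _ eM)/(_ 0%N); rewrite hornerX.
have -> : filled_julia h = \bigcap_n [set z | abs (piter h n).[z] <= M].
 by apply/seteqP; split=> z /=; [move=> /(filled_juliaP _ eM) H n _|move=> H; apply/(filled_juliaP _ eM) => n]; exact: H.
by apply: closed_bigI => n _; exact: closed_sublevel.
Qed.

Lemma closed_filled_julia h : (2 <= degree h)%N -> closed (filled_julia h).
Proof. by move=> /compact_filled_julia/compactC[]. Qed.

Lemma not_filled_far h z B : (2 <= degree h)%N -> ~ filled_julia h z ->
 exists N, forall n, (N <= n)%N -> B <= abs (piter h n).[z].
Proof.
move=> d2 nz; have [M eM] := escape_radius d2.
have [n0 hn0] : exists n, M < abs (piter h n).[z].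
 apply: contrapT => no; apply: nz; apply/(filled_juliaP _ eM) => n.
 by apply: lerF => ?; apply: no; exists n.
exact: escape_far eM (ltW hn0).
Qed.

Lemma uniform_escape h (K : set C) B : (2 <= degree h)%N -> compact K ->
 K `&` filled_julia h = set0 ->
 exists N, forall n, (N <= n)%N -> forall z, K z -> B <= abs (piter h n).[z].
Proof.
move=> d2 cK K0; have [M eM] := escape_radius d2.
have := (compact_near_coveringP K).1 cK nat \oo (fun n z => B <= abs (piter h n).[z]) _.
case=> [z Kz|N _ hN]; last by exists N => n Nn z Kz; exact: hN.
have nz := disjE K0 Kz.
have [n0 hn0] := not_filled_far (M + 1) d2 nz.
have {}hn0 : M < abs (piter h n0).[z] by have := hn0 n0 (leqnn _); lra.
have [k hk] := exists_pow2 B.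
exists ([set w | M < abs (piter h n0).[w]], [set n | (k + n0 <= n)%N]) => /=.
 split; last by exists (k + n0)%N.
 exact: open_nbhs_nbhs (conj (@open_superlevel (piter h n0) M) hn0).
move=> [w n] /= [Mw kn]; rewrite -(subnK (leq_trans (leq_addl k n0) kn)).
apply: le_trans (escape_iter _ eM (ltW Mw)).
have h1 : (k <= n - n0)%N by lia.
have := hk _ h1; have := eM.1; have : 1 <= (2 : R) ^+ (n - n0) by rewrite exprn_ege1// ler1n.
by move: Mw; move: (_ ^+ _) (abs _); clear; move=> *; nra.
Qed.

(** With [iter_lower] this compares |h^n(z)| with the power |z|^(d^n), d = deg h, the constants
    being inside the power. An inequality for h^n o g at two points thus yields one for g, uniformly
    in n. *)
Lemma iter_upper h : (2 <= degree h)%N -> exists2 A, 1 <= A & forall n B z, 1 <= B ->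
 abs z <= B -> abs (piter h n).[z] <= (A * B) ^+ (degree h ^ n).
Proof.
move=> d2; have [k k1 hk] := horner_growth_upper h; exists k => //.
elim=> [|n IH] B z B1 zB.
 by rewrite hornerX expn0 expr1 (le_trans zB)// ler_peMl// (le_trans ler01).
have kB : 1 <= k * B ^+ degree h by rewrite mulr_ege1// exprn_ege1.
rewrite horner_piterSr; apply: le_trans (IH _ _ kB (hk _ _ B1 zB)) _.
have k0 : 0 <= k by rewrite (le_trans ler01).
have B0 : 0 <= B by rewrite (le_trans ler01).
rewrite expnS exprM; apply: lerXn2r; rewrite ?nnegrE ?exprn_ge0 ?mulr_ge0 ?exprn_ge0//.
rewrite exprMn mulrA ler_wpM2r ?exprn_ge0// -expr2.
by rewrite ler_weXn2l.
Qed.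

Lemma iter_lower h : (2 <= degree h)%N -> exists c W : R, [/\ 0 < c, 1 <= W &
 forall n z, W <= abs z -> (c * abs z) ^+ (degree h ^ n) <= abs (piter h n).[z]].
Proof.
move=> d2; have h0 : h != 0 by apply: contraTneq d2 => ->; rewrite /degree size_poly0.
have [k k0 [r r1 hr]] := horner_growth_lower h0.
pose c := Num.min k 1; have c0 : 0 < c by rewrite lt_min k0 ltr01.
have c1 : c <= 1 by rewrite ge_min lexx orbT.
have W1 : 1 <= Num.max r c^-1 by rewrite le_max r1.
exists c, (Num.max r c^-1); split=> //; elim=> [|n IH] z zW.
 by rewrite hornerX expn0 expr1 ler_piMl ?abs_ge0.
move: (zW); rewrite ge_max => /andP[rz cz].
have z1 : 1 <= abs z by exact: le_trans rz.
have hz : c * abs z ^+ degree h <= abs h.[z].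
 by apply: le_trans (hr z rz); rewrite ler_wpM2r ?exprn_ge0 ?abs_ge0// ge_min lexx.
have zh : abs z <= abs h.[z].
 apply: le_trans hz; rewrite -[degree h]prednK; last by rewrite (leq_trans _ d2).
 rewrite exprSr mulrA ler_peMl ?abs_ge0//.
 have : abs z <= abs z ^+ (degree h).-1 by rewrite ler_eXnr// -ltnS prednK// (leq_trans _ d2).
 by move: cz; rewrite -[c^-1]mul1r ler_pdivrMr// mulrC; nra.
rewrite horner_piterSr; apply: le_trans (IH _ (le_trans zW zh)).
rewrite expnS exprM; apply: lerXn2r; rewrite ?nnegrE ?exprn_ge0 ?mulr_ge0 ?exprn_ge0 ?abs_ge0 ?(ltW c0)//.
apply: (@le_trans _ _ (c * (c * abs z ^+ degree h))); last by rewrite ler_pM2l.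
rewrite exprMn mulrA ler_wpM2r ?exprn_ge0 ?abs_ge0// -expr2.
by rewrite ler_wiXn2l// ltW.
Qed.

Lemma horner_image_dichotomy (K D : set C) g : connected D ->
 (forall z, D z -> ~ boundary K g.[z]) ->
 (forall z, D z -> K g.[z]) \/ (forall z, D z -> ~ K g.[z]).
Proof.
move=> cD av; have [[z0 Dz0 Kz0]|no] := pselect (exists2 z, D z & K g.[z]); last first.
 by right=> z Dz Kz; apply: no; exists z.
left=> z Dz; have cI : connected [set g.[z] | z in D].
 exact: connected_horner.
apply: interior_subset; apply: (@boundary_crossing _ K _ cI); last by exists z.
 by exists g.[z0]; split=> //; exists z0.
by apply/seteqP; split=> // _ [[w Dw <-]]; exact: av.
Qed.

(** Substitute for Montel's theorem. On the disc, g stays in K(h) and is bounded, or stays outside.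
    Then some h^n o g has modulus at least 1 on a smaller closed disc, Harnack's inequality compares
    its values, and taking deg(h)^n-th roots transfers the comparison to g with constants
    independent of n. *)
Lemma equicont_avoid G h a r : (2 <= degree h)%N -> 0 < r ->
 (forall g, G g -> forall z, abs (z - a) < r -> ~ boundary (filled_julia h) g.[z]) ->
 equicont_at G a.
Proof.
move=> d2 r0 av; have [M eM] := escape_radius d2.
have [A A1 hA] := iter_upper d2; have [c [W [c0 W1 hW]]] := iter_lower d2.
have dich g : G g -> (forall z, abs (z - a) < r -> filled_julia h g.[z]) \/
  (forall z, abs (z - a) < r -> ~ filled_julia h g.[z]).
 move=> Gg; apply: (@horner_image_dichotomy _ (disc a r)); last exact: av.
 exact: connected_disc.
have fM z : filled_julia h z -> abs z <= M.
 by move/(filled_juliaP _ eM)/(_ 0%N); rewrite hornerX.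
have aa : abs (a - a) < r by rewrite subrr abs0.
have key g : G g -> (forall z, abs (z - a) < r -> ~ filled_julia h g.[z]) ->
  forall z, abs (z - a) <= r / 2 / 8 -> exists n,
  abs (piter h n).[g.[z]] <= abs (piter h n).[g.[a]] ^+ 5 /\
  abs (piter h n).[g.[a]] <= abs (piter h n).[g.[z]] ^+ 5.
 move=> Gg esc z za; pose K := [set g.[z] | z in cdisc a (r / 2)].
 have cK : compact K.
  apply: continuous_compact; last exact: compact_cdisc.
  by exact: horner_within.
 have K0 : K `&` filled_julia h = set0.
  apply/seteqP; split=> // _ [[w wa <-]]; apply: esc.
  by move: wa; rewrite /cdisc /=; lra.
 have [n hn] := uniform_escape 1 d2 cK K0; exists n.
 have := @harnack_pow (piter h n \Po g) a (r / 2) 1 z.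
 rewrite !horner_comp !divr1; apply => //; first by rewrite divr_gt0.
 by move=> u ua; rewrite horner_comp; apply: hn => //; exists u.
have dn n : (0 < degree h ^ n)%N by rewrite expn_gt0 (leq_trans _ d2).
have A0 : 0 <= A by rewrite (le_trans ler01).
have cmp n X Y B : 1 <= B -> abs X <= B -> W <= abs Y ->
  abs (piter h n).[Y] <= abs (piter h n).[X] ^+ 5 -> c * abs Y <= (A * B) ^+ 5.
 move=> B1 XB WY H; have B0 : 0 <= B by rewrite (le_trans ler01).
 rewrite -(@ler_pXn2r _ (degree h ^ n))// ?nnegrE ?exprn_ge0 ?mulr_ge0 ?abs_ge0 ?(ltW c0)//.
 apply: le_trans (hW n Y WY) _; apply: le_trans H _.
 rewrite -exprM mulnC exprM; apply: lerXn2r; rewrite ?nnegrE ?exprn_ge0 ?mulr_ge0 ?abs_ge0//.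
 exact: hA.
apply: (@equicont_criterion _ _ (r / 2 / 8)); first by rewrite !divr_gt0.
 move=> T; pose T1 : R := `|T| + 1; have T11 : 1 <= T1 by rewrite lerDr.
 exists (Num.max M (Num.max W ((A * T1) ^+ 5 / c))) => g Gg gT z /ltW za.
 rewrite !le_max; have [inK|esc] := dich g Gg; first by rewrite (fM _ (inK z _))//; lra.
 have [zW|/ltW zW] := leP (abs g.[z]) W; first by rewrite orbT.
 have [n [h1 _]] := key g Gg esc z za; apply/orP; right; rewrite ler_pdivlMr// mulrC.
 apply: cmp h1 => //; apply: le_trans gT _; rewrite /T1.
 by have := ler_norm T; lra.
move=> B; pose B1 : R := `|B| + 1; have B11 : 1 <= B1 by rewrite lerDr.
exists (Num.max M (Num.max W ((A * B1) ^+ 5 / c))) => g Gg; rewrite !gt_max.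
move=> /and3P[gM /ltW gW]; rewrite ltr_pdivrMr// (mulrC (abs _)) => gB z /ltW za.
have [inK|esc] := dich g Gg; first by have := fM _ (inK a aa); rewrite leNgt gM.
have [n [_ h2]] := key g Gg esc z za; apply: lerF => zB.
have gzB : abs g.[z] <= B1 by rewrite /B1; have := ler_norm B; lra.
by have := cmp n g.[z] g.[a] B1 B11 gzB gW h2; rewrite leNgt gB.
Qed.

Lemma horner_surj g a : nonconstant g -> exists z, g.[z] = a.
Proof.
move=> ncg; have : size (g - a%:P) != 1%N.
 by rewrite size_polyDl ?size_polyN ?(leq_ltn_trans (size_polyC_leq1 _))//; rewrite gtn_eqF.
by move=> /closed_rootP[z]; rewrite rootE !hornerE subr_eq0 => /eqP; exists z.
Qed.

Lemma fixed_point_exists h : (2 <= degree h)%N -> exists z, h.[z] = z.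
Proof.
move=> d2; have nc : nonconstant (h - 'X).
 by move: d2; rewrite /degree /nonconstant => d2; rewrite size_polyDl ?size_polyN ?size_polyX; lia.
by have [z /eqP] := horner_surj 0 nc; rewrite !hornerE subr_eq0 => /eqP hz; exists z.
Qed.

Lemma filled_julia_fixed h z : h.[z] = z -> filled_julia h z.
Proof.
move=> hz; apply/bounded_setC; exists (abs z) => _ [g /generated1P[n ->] <-].
suff -> : (piter h n.+1).[z] = z by [].
by elim: n.+1 => [|m IH]; rewrite ?hornerX// horner_piterS IH.
Qed.

Lemma filled_julia_two h : (2 <= degree h)%N ->
 exists a b, [/\ filled_julia h a, filled_julia h b & a != b].
Proof.
move=> d2; have [p hp] := fixed_point_exists d2.
have /factor_theorem[q qE] : root (h - p%:P) p by rewrite rootE !hornerE hp subrr.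
have nq : nonconstant q.
 have : (2 < size (h - p%:P)%R)%N.
  have h3 : (2 < size h)%N by move: d2; rewrite /degree; case: (size h) => [|[|[|]]].
  by rewrite size_polyDl// size_polyN (leq_ltn_trans (size_polyC_leq1 _))// ltnW.
 by rewrite qE => h2; have := leq_trans h2 (size_polyMleq _ _); rewrite size_XsubC addn2.
have hE z : h.[z] = p + q.[z] * (z - p).
 by have := congr1 (horner^~ z) qE; rewrite !hornerE => <-; ring.
have [[x qx] [y qy]] := (horner_surj 0 nq, horner_surj 1 nq); exists x, y; split.
- by apply/(filled_julia_horner _ d2); rewrite hE qx mul0r addr0; exact: filled_julia_fixed.
- by apply: filled_julia_fixed; rewrite hE qy; ring.
- by apply/eqP => xy; move: qy; rewrite -xy qx => /esym/eqP; rewrite oner_eq0.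
Qed.

(* A value g(u) is far from one of two points p, q of K(h), and g - p and g - q have no
   zeros outside the disc of radius M. *)
Lemma equicont_infty_avoid G h M : (2 <= degree h)%N ->
 (forall g, G g -> nonconstant g) ->
 (forall g, G g -> forall z, M < abs z -> ~ boundary (filled_julia h) g.[z]) ->
 equicont_infty G.
Proof.
move=> d2 ncG av; have [Mh eM] := escape_radius d2; have [p [q [Kp Kq pq]]] := filled_julia_two d2.
pose M0 := `|M|; have M00 : 0 <= M0 by exact: normr_ge0.
have out g : G g -> forall z, M0 < abs z -> ~ filled_julia h g.[z].
 move=> Gg; have [inK|//] := @horner_image_dichotomy (filled_julia h) [set z | M0 < abs z] g
  (connected_exterior M00) (fun z zM => av g Gg z (le_lt_trans (ler_norm M) zM)).
 have [r r1 hr] := horner_unbounded (Mh + 1) (ncG g Gg).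
 pose u := rc (r + M0 + 1); have au : abs u = r + M0 + 1 by rewrite abs_rcE//; lra.
 have /(filled_juliaP _ eM)/(_ 0%N) := inK u ltac:(by rewrite /= au; lra).
 by rewrite hornerX; have := hr u ltac:(lra); lra.
move=> e e0; pose E := 2 / e; have E0 : 0 < E by rewrite divr_gt0.
pose d := abs (p - q); have d0 : 0 < d by rewrite abs_gt0 subr_eq0.
pose B := abs p + abs q; pose L := 4 * (E + B) / d.
have [p0 q0] := (abs_ge0 p, abs_ge0 q).
have L0 : 0 <= L by rewrite divr_ge0 ?mulr_ge0 ?addr_ge0// ltW.
pose r0 := M0 + 1; have r00 : 0 < r0 by rewrite ltr_wpDl.
exists (r0 * (1 + L)) => g Gg w wL; suff Eg : E <= abs g.[w].
 by apply: le_lt_trans (dst_inf_le E0 Eg) _; rewrite /E invf_div ltr_pdivrMr//; lra.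
have w0 : 0 < abs w by apply: le_lt_trans wL; rewrite mulr_ge0 ?ltW// ltr_wpDr.
pose l := abs w / r0; pose u := rc l^-1 * w.
have l1 : 1 + L < l by rewrite /l ltr_pdivlMr// mulrC.
have l0 : 0 < l by lra.
have wu : w = rc l * u by rewrite /u mulrA -rcM divff ?gt_eqF// rc1 mul1r.
have au : abs u = r0.
 by rewrite /u absM abs_rc gtr0_norm ?invr_gt0// /l invf_div mulrAC -mulrA divff ?mulr1// gt_eqF.
have key c : filled_julia h c -> d / 2 <= abs (g.[u] - c) -> E + B <= abs (g.[w] - c).
 move=> Kc dc; have rootsQ a : root (g - c%:P) a -> abs a <= abs u.
  rewrite rootE !hornerE subr_eq0 => /eqP ga; rewrite au; apply: lerF => aM.
  by apply: (out g Gg a); [rewrite /r0 in aM; lra|rewrite ga].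
 have l1' : 1 <= l by lra.
 have := radial_growth rootsQ l1'; rewrite -wu !hornerD !hornerN !hornerC; apply: le_trans.
 apply: (@le_trans _ _ ((l + 1) / 2 * (d / 2))).
  have Ld : L * d = 4 * (E + B) by rewrite /L divfK// gt_eqF.
  have := ler_wpM2r (ltW d0) (ltW l1); rewrite mulrDl mul1r Ld.
  by lra.
 apply: ler_pM => //; [by lra|by lra|].
 rewrite ler_eXnr//; [|by lra].
 by rewrite -subn1 subn_gt0; exact: nonconstantB c (ncG g Gg).
have := abs_lip g.[w]; have [h1|h1] : d / 2 <= abs (g.[u] - p) \/ d / 2 <= abs (g.[u] - q).
- have := abs_tri g.[u] p q; rewrite -/d (absB p g.[u]).
  by case: (leP (d / 2) (abs (g.[u] - p))); [left|right; lra].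
- by have := key p Kp h1; have := absBD g.[w] p; rewrite /B; lra.
- by have := key q Kq h1; have := absBD g.[w] q; rewrite /B; lra.
Qed.

(** Equicontinuity at z of the maps f o g, which are in G, passes to the maps f at g(z) because g is
    open. *)
Lemma fatou_horner G g z : comp_closed G -> G g -> nonconstant g ->
 fatou_set G (Some z) -> fatou_set G (Some g.[z]).
Proof.
move=> cG Gg ncg Fz; have oF : open (fatou_set G) by exact: open_fatou.
have [r r0 hr] := open_some oF Fz.
have [d d0 hd] := horner_open_mapping z ncg r0.
apply: (fatou_of_equicont d0) => b /hd[w wz <-] e e0.
have [d1 d10 hd1] := equicont_of_fatou (hr w wz) e0.
have [d2 d20 hd2] := horner_open_mapping w ncg d10; exists d2 => // f Gf v /hd2[v' v'w <-].
have := hd1 (f \Po g) (cG _ _ Gf Gg) v' v'w.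
by rewrite !horner_comp.
Qed.

Lemma julia_approx G h a r : (2 <= degree h)%N -> julia_set G (Some a) -> 0 < r ->
 exists g z, [/\ G g, abs (z - a) < r & boundary (filled_julia h) g.[z]].
Proof.
move=> d2 Ja r0; apply: contrapT => no; apply: Ja; apply: (fatou_of_equicont r0) => b ba.
have rb : 0 < r - abs (b - a) by rewrite subr_gt0.
apply: (equicont_avoid d2 rb) => g Gg z zb bd; apply: no; exists g, z; split=> //.
by have := abs_tri b z a; lra.
Qed.

Lemma julia_approx_infty G h M : (2 <= degree h)%N -> (forall g, G g -> nonconstant g) ->
 julia_set G infty ->
 exists g z, [/\ G g, M < abs z & boundary (filled_julia h) g.[z]].
Proof.
move=> d2 nc Ji; apply: contrapT => no; apply: Ji.
have av g : G g -> forall z, M < abs z -> ~ boundary (filled_julia h) g.[z].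
 by move=> Gg z zM bd; apply: no; exists g, z.
apply: (@fatou_infty_of_equicont _ M) => [b Mb|]; last exact: equicont_infty_avoid av.
have rb : 0 < abs b - M by rewrite subr_gt0.
apply: (equicont_avoid d2 rb) => g Gg z zb; apply: av => //.
by have := abs_lip b z; rewrite absB; lra.
Qed.

Lemma julia1E h : (2 <= degree h)%N -> julia1 h = emb (boundary (filled_julia h)).
Proof.
move=> d2; have [M eM] := escape_radius d2; have cK := closed_filled_julia d2.
have nc n : nonconstant (piter h n).
 by apply: degree_nonconstant; rewrite degree_piter expn_gt0 (leq_trans _ d2).
have bdP n z : boundary (filled_julia h) (piter h n).[z] -> boundary (filled_julia h) z.
 rewrite !(boundaryE cK) => -[/(filled_julia_piter n _ d2) Kz nz]; split; first exact: Kz.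
 move=> /interiorPC[r r0 hr]; apply: nz; apply/interiorPC.
 have [d d0 hd] := horner_open_mapping z (nc n) r0; exists d => // w /hd[y yz <-].
 exact/(filled_julia_piter n _ d2)/hr.
apply/seteqP; split=> [[a|] Jx|_ [a [cla nia] <-] Fa].
- exists a => //; apply: closed_boundary; apply/closurePC => r r0.
  have [_ [z [/generated1P[n ->] za /bdP bz]]] := julia_approx d2 Jx r0; by exists z.
- have ncG g : generated [set h] g -> nonconstant g by move=> /generated1P[n ->].
  have [_ [z [/generated1P[n ->] Mz /bdP]]] := julia_approx_infty M d2 ncG Jx.
  by rewrite (boundaryE cK) => -[/(filled_juliaP _ eM)/(_ 0%N)]; rewrite hornerX; lra.
have Ka : filled_julia h a by rewrite (closure_id (filled_julia h)).1.
have M0 : 0 <= M by have := eM.1; lra.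
have e0 : 0 < (2 * (1 + M))^-1 by rewrite invr_gt0 mulr_gt0//; lra.
have [d d0 hd] := equicont_of_fatou Fa e0; apply: nia; apply/interiorPC; exists d => // w wd.
apply: contrapT => nw; have [N hN] := not_filled_far (2 * M + 1) d2 nw.
have GN : generated [set h] (piter h N.+1) by apply/generated1P; exists N.
have := hd _ GN w wd; rewrite ltNge => /negP; apply.
apply: dst_far_ge => //; last exact: hN.
exact: (filled_juliaP _ eM).1.
Qed.

End Sphere.

Arguments piter h n : simpl never.

(** * Connected subsets of the sphere *)

Section SphereConnected.
Implicit Types (a b u v : C) (x y : S) (K : set C) (A U : set S).

Lemma open_emb K : open K -> open (emb K : set S).
Proof. exact: one_point_compactification_open_some. Qed.

Lemma compact_emb K : compact K -> compact (emb K : set S).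
Proof.
move=> cK; apply: continuous_compact => //; apply: continuous_subspaceT.
exact: one_point_compactification_some_continuous.
Qed.

Lemma closed_emb K : compact K -> closed (emb K : set S).
Proof. by move=> cK; apply: compact_closed; [exact: hausdorff_sphere|exact: compact_emb]. Qed.

Lemma embP K z : emb K (Some z) <-> K z.
Proof. by split=> [[w Kw [<-]]|Kz]; [|exists z]. Qed.

Lemma not_emb_infty K : ~ emb K (infty : S). Proof. by case. Qed.

Lemma exterior_infty_connected r : 0 <= r ->
 connected [set x : S | if x is Some z then r < abs z else True].
Proof.
move=> r0; have -> : [set x : S | if x is Some z then r < abs z else True] =
  emb [set z | r < abs z] `|` [set infty].
 apply/seteqP; split=> [[z|] h|x [[z h <-]|->]] //; first by left; exists z.
 by right.
apply: connected_add_limit.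
 exact: (connected_emb (connected_exterior r0)).
move=> B /nbhs_infty[_ [M hM]]; pose s := Num.max r M + 1.
have sr : r < s by rewrite ltr_pwDr// le_max lexx.
have sM : M < s by rewrite ltr_pwDr// le_max lexx orbT.
have as_ : abs (rc s) = s by rewrite abs_rcE// (le_trans r0)// ltW.
exists (Some (rc s)); split; last by apply: hM; rewrite as_.
by exists (rc s) => //=; rewrite as_.
Qed.

Lemma connected_sphere : connected [set: S].
Proof.
have -> : [set: S] = emb [set: C] `|` [set infty].
 by apply/seteqP; split=> // -[z|] _; [left; exists z|right].
apply: connected_add_limit.
 exact: (connected_emb (@star_connected _ 0 _)).
move=> B /nbhs_infty[_ [M hM]]; exists (Some (rc (`|M| + 1))); split; first by eexists.
apply: hM; rewrite abs_rcE ?addr_ge0//; have := ler_norm M; lra.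
Qed.

Lemma component_open_sphere U x : open U -> open (connected_component U x).
Proof.
rewrite !openE => oU y cy; have Uy := connected_component_sub cy.
have ext V : connected V -> V `<=` U -> V y -> nbhs y V -> nbhs y (connected_component U x).
 move=> cV VU Vy; apply: filterS => v Vv; apply: connected_component_trans cy _.
 exact: (connected_component_max Vy VU cV).
case: y cy Uy ext => [a|] cy Uy ext.
 have [r r0 hr] := (nbhs_some _ _).1 (oU _ Uy); apply: (ext (emb (disc a r))).
 - exact: (connected_emb (@connected_disc a r)).
 - by move=> _ [w wa <-]; exact: hr.
 - by exists a => //; exact: disc_center.
 - by apply/nbhs_some; exists r => // w wa; exists w.
have [Ui [M hM]] := (nbhs_infty _).1 (oU _ Uy).
apply: (ext _ (exterior_infty_connected (normr_ge0 M))).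
- by move=> [w|] //= wM; apply: hM; apply: le_lt_trans wM; exact: ler_norm.
- by [].
- by apply/nbhs_infty; split=> //; exists `|M|.
Qed.

Lemma component_closure_sphere U x y : open U -> closure (connected_component U x) y -> U y ->
 connected_component U x y.
Proof.
move=> oU cly Uy; have nb : nbhs y (connected_component U y).
 apply: open_nbhs_nbhs; split; first exact: component_open_sphere.
 exact: connected_component_refl.
have [v [xv yv]] := cly _ nb.
by apply: connected_component_trans xv _; exact: connected_component_sym.
Qed.

Lemma connected_avoid_emb K A : compact K -> connected A -> A `&` emb (boundary K) = set0 ->
 A `&` emb K !=set0 -> A `<=` emb K°.
Proof.
move=> cK cA AbK [x [Ax Kx]]; have clK : closed K by have /compactC[] := cK.
have oc : open (~` emb K : set S) by apply: closed_openC; exact: closed_emb.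
have KE u : K u -> A (Some u) -> K° u.
 move=> Ku Au; apply: contrapT => nu; have : (A `&` emb (boundary K)) (Some u).
  by split=> //; exists u => //; rewrite boundaryE.
 by rewrite AbK.
apply: (connected_open_split cA (open_emb (@open_interior _ K)) oc).
- move=> [u|] Au; last by right; case.
 have [Ku|nKu] := pselect (K u); last by right => -[v Kv [vu]]; apply: nKu; rewrite -vu.
 by left; exists u => //; exact: KE.
- move=> y Ay [u iu uy]; apply; exists u => //; exact: interior_subset iu.
- by case: Kx Ax => u Ku <- Au; exists (Some u); split=> //; exists u => //; exact: KE.
Qed.

Lemma radial_arith (A B X Y p z : R) : 1 + p <= A -> X <= Y -> 1 <= X -> B <= z + p -> 0 <= p ->
 Y * A <= B -> X <= z.
Proof. by move=> h1 h2 h3 h4 h5 h6; nra. Qed.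

(** The growth factor of [connected_growth] when its small radius parameter is h t / 4. *)
Lemma ratio_le (h t : R) : 0 < h -> 0 < t -> t <= 1 -> (h + h * (t / 4)) / (h - h * (t / 4)) <= 1 + t.
Proof.
move=> h0 t0 t1; have e : h - h * (t / 4) = h * (1 - t / 4) by ring.
have d0 : 0 < 1 - t / 4 by lra.
rewrite e ler_pdivrMr ?mulr_gt0//.
have : 1 + t / 4 <= (1 + t) * (1 - t / 4) by nra.
have -> : (1 + t) * (h * (1 - t / 4)) = h * ((1 + t) * (1 - t / 4)) by ring.
have -> : h + h * (t / 4) = h * (1 + t / 4) by ring.
by rewrite ler_pM2l.
Qed.

Lemma near_one_power N : exists x : R, [/\ 0 < x, x <= 1 & (1 + x) ^+ N <= 5 / 4].
Proof.
elim: N => [|N [x [x0 x1 hx]]].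
 by exists 1; split=> //; rewrite expr0; lra.
have cX : {for 1, continuous (fun y : R => y ^+ N.+1)} by exact: exprn_continuous.
have := (continuousRP _ _).1 cX (1 / 4) ltac:(lra).
move=> /nbhs_ballP[d /= d0 hd]; exists (Num.min 1 (d / 2)); split.
- by rewrite lt_min ltr01 divr_gt0.
- by rewrite ge_min lexx.
have : ball (1 : R) d (1 + Num.min 1 (d / 2)).
 rewrite -ball_normE /= opprD addrA subrr sub0r normrN ger0_norm ?le_min ?ler01 ?divr_ge0 ?(ltW d0)//.
 by rewrite gt_min; apply/orP; right; lra.
by move=> /hd /=; rewrite expr1n ltr_norml; lra.
Qed.

End SphereConnected.

(** * Complementary components in the plane and the surrounding order *)

Section PlaneComponents.
Implicit Types (a b u v : C) (K U : set C).

Lemma connected_embP K : connected (emb K : set S) <-> connected K.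
Proof.
split=> [cK|]; last exact: connected_emb.
apply: contrapT => /not_connected_open[U [V [oU oV KUV KUV0 [[u [Ku Uu]] [v [Kv Vv]]]]]].
have : emb K `<=` (emb U : set S).
 apply: (connected_open_split cK (open_emb oU) (open_emb oV)).
 - by move=> _ [z /KUV[Uz|Vz] <-]; [left|right]; exists z.
 - by move=> _ [z Kz <-] /embP Uz /embP; exact: KUV0 Kz Uz.
 - by exists (Some u); split; exists u.
move=> /(_ (Some v) (ex_intro2 _ _ v Kv erefl))/embP Uv.
exact: KUV0 Kv Uv Vv.
Qed.

Lemma component_openC U a : open U -> open (connected_component U a).
Proof.
move=> /openPC oU; apply/openPC => z cz; have [r r0 hr] := oU z (connected_component_sub cz).
exists r => // w wz; apply: connected_component_trans cz _.
apply: (@connected_component_max _ U (disc z r)) => //; first exact: disc_center.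
exact: connected_disc.
Qed.

(** The ray from z away from the origin avoids K. *)
Lemma unbounded_component K z : compact K -> (forall u, K u -> abs u <= abs z) -> ~ K z ->
 ~ bounded_set (connected_component (~` K) z).
Proof.
move=> cK Kz nz /bounded_setC[M hM].
pose A : set C := [set u | exists t : R, 0 <= t /\ u = z + rc t * (if z == 0 then 1 else z)].
have cA : connected A.
 apply: (@star_connected _ z) => _ t [t' [t0 ->]] t1 t2.
 exists (t * t'); split; first exact: mulr_ge0.
 by rewrite addrAC subrr add0r rcM mulrA.
have Az : A z by exists 0; rewrite rc0 mul0r addr0.
have AK : A `<=` ~` K.
 move=> _ [t [t0 ->]]; case: eqP => [z0|/eqP z0] Ku.
  move: (Kz _ Ku); rewrite z0 abs0 mulr1 add0r abs_rc => h.
  have {}h : t = 0 by apply/eqP; rewrite -normr_eq0 eq_le h normr_ge0.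
  by apply: nz; move: Ku; rewrite h rc0 mul0r addr0.
 have E : z + rc t * z = rc (1 + t) * z by rewrite rcD rc1; ring.
 move: (Kz _ Ku); rewrite E absM abs_rcE ?addr_ge0// => h.
 have az : 0 < abs z by rewrite abs_gt0.
 have t00 : t = 0 by nra.
 by apply: nz; move: Ku; rewrite t00 rc0 mul0r addr0.
have sub := connected_component_max Az AK cA.
set d := if z == 0 then 1 else z in A cA Az AK sub.
have d0 : 0 < abs d by rewrite abs_gt0 /d; case: (eqVneq z 0) => // _; exact: oner_neq0.
pose t := (`|M| + abs z + 1) / abs d.
have t0 : 0 <= t by rewrite divr_ge0 ?addr_ge0 ?abs_ge0.
have := hM (z + rc t * d) (sub _ (ex_intro _ t (conj t0 erefl))).
have := abs_lip (rc t * d) (z + rc t * d); rewrite opprD addrCA subrr addr0 absN.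
rewrite absM abs_rcE// /t divfK ?gt_eqF//.
by have := ler_norm M; lra.
Qed.

Lemma exterior_component K r a b : (forall u, K u -> abs u <= r) ->
 r < abs a -> r < abs b -> connected_component (~` K) a b.
Proof.
move=> Kr ra rb; have r' : `|Num.max 0 r| = Num.max 0 r by rewrite ger0_norm// le_max lexx.
have [r0|r0] := leP 0 r.
 apply: (@connected_component_max _ (~` K) [set z | r < abs z]) => //.
  by move=> z rz Kz; have := Kr z Kz; rewrite leNgt rz.
 exact: connected_exterior.
have K0 : K = set0 by apply/seteqP; split=> // u /Kr; have := abs_ge0 u; lra.
apply: (@connected_component_max _ (~` K) setT) => //; first by rewrite K0 => ? _ [].
exact: (@star_connected _ 0 _).
Qed.

Lemma unique_unbounded_component K : compact K -> exists D,
 (components (~` K) D /\ ~ bounded_set D) /\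
 forall D', components (~` K) D' /\ ~ bounded_set D' -> D' = D.
Proof.
move=> /compactC[_ [M hM]]; pose z := rc (`|M| + 1).
have az : M < abs z by rewrite abs_rcE ?addr_ge0//; have := ler_norm M; lra.
exists (connected_component (~` K) z); split; first split.
- by exists z => // /hM; rewrite leNgt az.
- move=> /bounded_setC[B hB]; have : abs (rc (`|M| + `|B| + 1)) <= B.
  apply/hB/(exterior_component hM az); rewrite abs_rcE ?addr_ge0//.
  by have := ler_norm M; have := normr_ge0 B; lra.
 by rewrite abs_rcE ?addr_ge0//; have := ler_norm B; have := normr_ge0 M; lra.
move=> _ [[x nKx <-] ub]; have [y cy My] : exists2 y, connected_component (~` K) x y & M < abs y.
 apply: contrapT => no; apply: ub; apply/bounded_setC; exists M => y cy.
 by apply: lerF => My; apply: no; exists y.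
apply: same_connected_component; apply: connected_component_trans cy _.
exact: exterior_component hM My az.
Qed.

Lemma surr_leI K1 K2 a : connected K1 -> K1 a -> K1 `&` K2 = set0 ->
 bounded_set (connected_component (~` K2) a) -> surr_le K1 K2.
Proof.
move=> cK Ka K0 bd; right; exists (connected_component (~` K2) a); split=> //.
 by exists a => // K2a; have : (K1 `&` K2) a by []; rewrite K0.
apply: connected_component_max => // z K1z K2z.
by have : (K1 `&` K2) z by []; rewrite K0.
Qed.

(** If no point of K2 were farther out, a point of K1 of largest modulus would lie in an unbounded
    complementary component of K2. Comparing moduli makes the order antisymmetric on nonempty
    compact sets. *)
Lemma surr_lt_far K1 K2 : compact K1 -> K1 !=set0 -> compact K2 -> surr_le K1 K2 -> K1 <> K2 ->
 exists2 z, K2 z & forall u, K1 u -> abs u < abs z.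
Proof.
move=> c1 n1 c2 [//|[B [[x nx xB] bB KB]]] _.
have [z1 Kz1 hz1] := compact_abs_max n1 c1 (@abs_continuous).
apply: contrapT => no.
have far u : K2 u -> abs u <= abs z1.
 move=> K2u; apply: lerF => h; apply: no; exists u => // v K1v.
 exact: le_lt_trans (hz1 v K1v) h.
have cz := KB z1 Kz1; rewrite -xB in cz.
apply: (unbounded_component c2 far (connected_component_sub cz)).
by rewrite -(same_connected_component cz) xB.
Qed.

Lemma surr_le_anti K1 K2 : compact K1 -> K1 !=set0 -> compact K2 -> K2 !=set0 ->
 surr_le K1 K2 -> surr_le K2 K1 -> K1 = K2.
Proof.
move=> c1 n1 c2 n2 h12 h21; apply: contrapT => ne.
have [z Kz hz] := surr_lt_far c1 n1 c2 h12 ne.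
have [y Ky hy] := surr_lt_far c2 n2 c1 h21 (fun h => ne (esym h)).
by have := lt_trans (hz y Ky) (hy z Kz); rewrite ltxx.
Qed.

End PlaneComponents.

(** * Limits, thickenings and Taylor tails *)

Section Vanishing.
Implicit Types (u v : nat -> R) (a x y : C) (B : R) (W : set C) (f : nat -> {poly C}).

Definition vanishing u := forall e, 0 < e -> exists N, forall n, (N <= n)%N -> u n < e.

Lemma vanishing_le u v : (forall n, u n <= v n) -> vanishing v -> vanishing u.
Proof. by move=> uv hv e /hv[N hN]; exists N => n /hN; exact: le_lt_trans. Qed.

Lemma vanishingD u v : vanishing u -> vanishing v -> vanishing (fun n => u n + v n).
Proof.
move=> hu hv e e0; have e2 : 0 < e / 2 by rewrite divr_gt0.
have [N hN] := hu _ e2; have [N' hN'] := hv _ e2; exists (maxn N N') => n.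
by rewrite geq_max => /andP[/hN + /hN']; lra.
Qed.

Lemma inv_lt_ex (d : R) : 0 < d -> exists N : nat, forall n : nat, (N <= n)%N -> n.+1%:R^-1 < d.
Proof.
move=> d0; have [N hN] := ltr_add_invr d0; exists N => n Nn; rewrite add0r in hN.
by apply: le_lt_trans hN; rewrite lef_pV2 ?posrE ?ltr0n// ler_nat ltnS.
Qed.

Lemma compact_fatten (K V : set C) : compact K -> open V -> K `<=` V ->
 exists2 r, 0 < r & forall z, K z -> disc z r `<=` V.
Proof.
move=> /compactC[clK [M hM]] oV KV; apply: contrapT => no.
have bad (n : nat) : exists p : C * C, [/\ K p.1, abs (p.2 - p.1) < n.+1%:R^-1 & ~ V p.2].
 apply: contrapT => no'; apply: no; exists n.+1%:R^-1; first by rewrite invr_gt0 ltr0n.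
 by move=> z Kz w wz; apply: contrapT => nV; apply: no'; exists (z, w).
have [p hp] := choice bad.
have [|h hi [l hl]] := @bounded_subsequence (fun n => (p n).1) M; first by move=> n; apply: hM; have [] := hp n.
have Kl : K l.
 apply/clK/closurePC => e /hl[N hN]; exists (p (h N)).1; [by have [] := hp (h N)|exact: hN].
have [r r0 hr] := (openPC _).1 oV l (KV l Kl); have r2 : 0 < r / 2 by rewrite divr_gt0.
have [N hN] := hl _ r2; have [N' hN'] := inv_lt_ex r2; pose n := maxn N N'.
have [_ h2 h3] := hp (h n); apply: h3; apply: hr; rewrite /disc /=.
apply: le_lt_trans (abs_tri (p (h n)).1 _ _) _; rewrite (splitr r).
apply: ltrD; last exact: hN (leq_maxl N N').
by apply: lt_trans h2 (hN' _ _); apply: leq_trans (incr_ge _ hi); exact: leq_maxr.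
Qed.

Lemma vanishing_small u B : 0 < B -> vanishing u -> exists n, u n < B.
Proof. by move=> B0 /(_ B B0)[N /(_ N (leqnn N))]; exists N. Qed.

Lemma taylor_tail (q : {poly C}) r B k z : 0 < r -> 0 <= B -> (forall i, abs q`_i <= B / r ^+ i) ->
 abs z <= r / 2 -> abs (q.[z] - \sum_(i < k) q`_i * z ^+ i) <= 2 * B * (abs z / r) ^+ k.
Proof.
move=> r0 B0 hq zr; pose n := size q; pose t := abs z / r.
have t0 : 0 <= t by rewrite divr_ge0// ?abs_ge0// ltW.
have t2 : t <= 2^-1 by rewrite ler_pdivrMr// mulrC.
rewrite (@horner_coef_wide _ (k + n) q) ?leq_addl// big_split_ord /= addrAC subrr add0r.
have term (i : nat) : abs (q`_i * z ^+ i) <= B * t ^+ i.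
 rewrite absM absX expr_div_n mulrCA mulrC.
 by apply: ler_wpM2l; [apply: exprn_ge0; exact: abs_ge0|exact: hq].
apply: le_trans (abs_sum _ _ _) _; apply: (@le_trans _ _ (\sum_(i < n) B * t ^+ k * t ^+ i)).
 by apply: ler_sum => i _; apply: le_trans (term _) _; rewrite exprD mulrA.
rewrite -mulr_sumr -/t (_ : 2 * B * t ^+ k = B * t ^+ k * 2); last by ring.
by apply: ler_wpM2l; [apply: mulr_ge0 => //; exact: exprn_ge0|exact: geometric_sum_le].
Qed.

End Vanishing.

(** * Attracting fixed points *)

Section Attracting.
Implicit Types (a p x y : C) (B : R) (W P : set C) (g : {poly C}).

Lemma deriv_piter_fixed g n a : g.[a] = a -> (piter g n)^`().[a] = g^`().[a] ^+ n.
Proof.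
move=> ga; elim: n => [|n IH]; first by rewrite /piter /= derivX hornerC.
by rewrite piterSr deriv_comp hornerM horner_comp ga IH exprSr.
Qed.

Lemma attracting_contraction g a : g.[a] = a -> abs g^`().[a] < 1 ->
 exists q s, [/\ 0 <= q, q < 1, 0 < s & forall z, abs (z - a) < s -> abs (g.[z] - a) <= q * abs (z - a)].
Proof.
move=> ga ga1; set l := abs g^`().[a] in ga1; have e0 : 0 < (1 - l) / 2 by rewrite divr_gt0// subr_gt0.
have [d d0 hd] := horner_linear_approx g a e0.
have l0 : 0 <= l by exact: abs_ge0.
exists ((1 + l) / 2), d; split=> //; [lra|lra|move=> z za].
have := hd z a za; rewrite subrr abs0 => /(_ d0); rewrite ga.
have := abs_lip (g.[z] - a) ((z - a) * g^`().[a]); rewrite absM -/l.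
by have := abs_ge0 (z - a); nra.
Qed.

Lemma contraction_piter g a q s z n : 0 <= q -> q < 1 ->
 (forall z, abs (z - a) < s -> abs (g.[z] - a) <= q * abs (z - a)) ->
 abs (z - a) < s -> abs ((piter g n).[z] - a) <= q ^+ n * abs (z - a).
Proof.
move=> q0 q1 h zs; elim: n => [|n IH]; first by rewrite /piter /= hornerX expr0 mul1r.
have qn : q ^+ n * abs (z - a) <= abs (z - a).
 by rewrite -[leRHS]mul1r; apply: ler_wpM2r; [exact: abs_ge0|apply: exprn_ile1 => //; exact: ltW].
rewrite horner_piterS; apply: le_trans (h _ _) _; first exact: le_lt_trans IH (le_lt_trans qn zs).
by rewrite exprS -mulrA; apply: ler_wpM2l.
Qed.

Lemma attracting_vanishing g a q s z n0 : 0 <= q -> q < 1 ->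
 (forall z, abs (z - a) < s -> abs (g.[z] - a) <= q * abs (z - a)) ->
 abs ((piter g n0).[z] - a) < s -> vanishing (fun n => abs ((piter g n).[z] - a)).
Proof.
move=> q0 q1 h zs e e0; have [k hk] := exists_small_power s q0 q1 e0.
exists (k + n0)%N => n kn; rewrite -(subnK (leq_trans (leq_addl k n0) kn)) horner_piterD.
apply: le_lt_trans (contraction_piter _ q0 q1 h zs) _; apply: le_lt_trans hk.
rewrite mulrC; apply: ler_pM => //; [exact: abs_ge0|exact: exprn_ge0|exact: ltW|].
by apply: ler_wiXn2l => //; [exact: ltW|rewrite leq_subRL ?(leq_trans (leq_addl k n0) kn)// addnC].
Qed.

(** An orbit that has come within s of a stays there, so the sets of points still at distance at
    least s after n steps decrease; their intersection is empty and compactness applies. *)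
Lemma attracting_uniform g a (L : set C) e : g.[a] = a -> abs g^`().[a] < 1 -> compact L -> 0 < e ->
 (forall z, L z -> vanishing (fun n => abs ((piter g n).[z] - a))) ->
 exists N, forall n, (N <= n)%N -> forall z, L z -> abs ((piter g n).[z] - a) < e.
Proof.
move=> ga ga1 cL e0 hL; have [q [t [q0 q1 t0 ht]]] := attracting_contraction ga ga1.
pose s := Num.min t e; have s0 : 0 < s by rewrite lt_min t0.
have [/= cL1 _] := (compactC _).1 cL.
have ht' z : abs (z - a) < s -> abs (g.[z] - a) <= q * abs (z - a).
 by rewrite lt_min => /andP[zt _]; exact: ht.
pose K n := L `&` [set z | s <= abs (piter g n - a%:P).[z]].
have [n hn] : exists n, forall m, (n <= m)%N -> K m `<=` set0.
 apply: (@nested_compact_subset C K set0 (@hausdorffC)) => [n|n z [Lz]||z Kz].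
 - apply/compactC; split; first by apply: closedI => //; exact: closed_superlevel.
  by have [_ [M hM]] := (compactC _).1 cL; exists M => z [/hM].
 - rewrite /= !hornerE => h; split=> //=; rewrite !hornerE; apply: lerF => h1.
  move: h; rewrite horner_piterS leNgt => /negP; apply; apply: le_lt_trans (ht' _ h1) (le_lt_trans _ h1).
  by rewrite -[leRHS]mul1r; apply: ler_wpM2r; [exact: abs_ge0|exact: ltW].
 - exact: open0.
 - have [n hn] := vanishing_small s0 (hL z (Kz 0%N I).1).
  by have [_] := Kz n I; rewrite /= !hornerE leNgt hn.
exists n => m nm z Lz; rewrite ltNge; apply/negP => h; apply: (hn m nm z); split=> //=.
by rewrite !hornerE; apply: le_trans h; rewrite ge_min lexx orbT.
Qed.
End Attracting.

(** * A lower bound for derivatives away from critical values *)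

Section KoebeBound.
Implicit Types (a x y : C) (d B : R) (W : set C) (g Q : {poly C}).

(* On the component of a critical value free sublevel set around x the
  polynomial is injective, so that (Q - 0) / (z - x) has no zero there. *)
Lemma noncritical_deriv_bound Q x d B : (2 <= degree Q)%N -> Q.[x] = 0 -> 0 < d -> 0 < B ->
 (forall c, Q^`().[c] = 0 -> d <= abs Q.[c]) -> (forall z, abs Q.[z] < d -> abs (z - x) <= B) ->
 d / 2 / B <= abs Q^`().[x].
Proof.
move=> dQ Qx d0 B0 hc hB.
have nQ : nonconstant Q by apply: degree_nonconstant; exact: ltnW.
pose U : set C := [set z | abs Q.[z] < d]; pose V := connected_component U x.
have Ux : U x by rewrite /U /= Qx abs0.
have oU : open U by exact: open_sublevel.
have oV : open V by exact: component_openC.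
have Vx : V x by exact: connected_component_refl.
have VU : V `<=` U by exact: connected_component_sub.
have clV t : t < d -> closed (V `&` [set z | abs Q.[z] <= t]).
 move=> td z clz; have Qz : abs Q.[z] <= t.
  by apply: (@closed_sublevel Q t); apply: closureS clz => w [].
 split=> //; have Uz : U z by rewrite /U /=; lra.
 have [r r0 hr] := (openPC _).1 oU z Uz; have [w [Vw _] wz] := (closurePC _ _).1 clz r r0.
 apply: connected_component_trans Vw _; apply: connected_component_sym.
 by apply: (@connected_component_max _ U (disc z r)) => //; [exact: disc_center|exact: connected_disc].
have nc c : V c -> Q^`().[c] != 0.
 by move=> /VU Uc; apply/eqP => /hc; rewrite leNgt => /negP; apply.
have inj y : V y -> Q.[y] = 0 -> y = x.
 by move=> Vy Qy; apply: (lemniscate_component_inj nQ d0 oV (@component_connected _ _ x) VU clV nc).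
have /factor_theorem[S QS] : root Q x by rewrite /root Qx.
have Sx : S.[x] = Q^`().[x] by rewrite QS derivM derivXsubC !hornerE subrr ?mulr0 ?add0r ?addr0 ?mulr1.
have S0 : S != 0 by apply: contraTneq nQ => S0; rewrite QS S0 mul0r /nonconstant size_poly0.
have nS : nonconstant S.
 by move: dQ; rewrite /degree QS size_Mmonic ?monicXsubC// size_XsubC addn2.
pose K := V `&` [set z | abs Q.[z] <= d / 2].
have d2 : d / 2 < d by lra.
have clK : closed K by exact: clV.
have cK : compact K.
 apply/compactC; split=> //; exists (B + abs x) => z [/VU/hB h _].
 by have := abs_lip z x; lra.
have Kx : K x by split=> //=; rewrite Qx abs0; lra.
(* S(x) = Q'(x). On the boundary of [K] one has |Q| >= d/2 and |z - x| <= B, which bounds |S| below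
   there. *)
rewrite -Sx; apply: (minimum_principle nS cK) => // [z [Vz _]|z].
 apply: contraTneq (nc z Vz) => Sz.
 have zx : z = x by apply: inj => //; rewrite QS hornerM Sz mul0r.
 by rewrite zx -Sx -zx Sz eqxx.
rewrite boundaryE// => -[[Vz Qz] niz].
have Qd : d / 2 <= abs Q.[z].
 apply: lerF => h; apply: niz.
 have oN : open (V `&` [set z | abs Q.[z] < d / 2]) by apply: openI => //; exact: open_sublevel.
 have : (V `&` [set z | abs Q.[z] < d / 2])° z by rewrite ((interior_id _).1 oN).
 by apply: interiorS => w [Vw Qw]; split=> //; exact: ltW.
have zB := hB z (VU z Vz).
rewrite ler_pdivrMr//; apply: le_trans Qd _; rewrite QS hornerM absM hornerXsubC.
by apply: ler_wpM2l => //; exact: abs_ge0.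
Qed.
End KoebeBound.

(** * Perturbed iteration along an orbit *)

Section Perturbation.
Variables (g : {poly C}) (x0 : C) (s M : R).
Implicit Types (a y : C) (T : set C).

(* The perturbed iteration contracts, by the factor 1 - s, towards the true
  orbit of x0 at each step. *)
Fixpoint perturbed n : {poly C} :=
 if n is k.+1 then (rc (1 - s) *: g + (rc s * (piter g k.+1).[x0])%:P) \Po perturbed k else 'X.

Lemma horner_perturbedS n z : (perturbed n.+1).[z] =
 rc (1 - s) * g.[(perturbed n).[z]] + rc s * (piter g n.+1).[x0].
Proof. by rewrite /= horner_comp !hornerE. Qed.

Lemma perturbed_orbit n : (perturbed n).[x0] = (piter g n).[x0].
Proof.
elim: n => [|n IH]; first by [].
by rewrite horner_perturbedS IH -horner_piterS -mulrDl -rcD subrK rc1 mul1r.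
Qed.

Lemma deriv_perturbedS n z : (perturbed n.+1)^`().[z] =
 rc (1 - s) * g^`().[(perturbed n).[z]] * (perturbed n)^`().[z].
Proof. by rewrite /= deriv_comp hornerM horner_comp derivD derivZ derivC addr0 hornerZ. Qed.

Lemma deriv_perturbed_orbit n : (perturbed n)^`().[x0] = rc (1 - s) ^+ n * (piter g n)^`().[x0].
Proof.
elim: n => [|n IH]; first by rewrite expr0 mul1r.
rewrite deriv_perturbedS IH perturbed_orbit piterS deriv_comp hornerM horner_comp exprS.
by rewrite !mulrA; congr (_ * _); rewrite mulrAC.
Qed.

Lemma degree_perturbed n : s < 1 -> (2 <= degree g)%N -> degree (perturbed n) = (degree g ^ n)%N.
Proof.
move=> s1 dg; elim: n => [|n IH]; first by rewrite /degree /= size_polyX.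
rewrite [perturbed n.+1]/= degree_comp IH expnS; congr (_ * _)%N; rewrite /degree.
have c0 : rc (1 - s) != 0 by rewrite -abs_gt0 abs_rc normr_gt0; lra.
rewrite size_polyDl ?size_scale// size_polyC.
by apply: leq_ltn_trans (leq_b1 _) _; exact: (degree_nonconstant (ltnW dg)).
Qed.

(** By the chain rule a critical point of the composition passes through a critical point of g at
    some stage, and all later stages preserve T. *)
Lemma perturbed_critical (T : set C) n z : s < 1 ->
 (forall c, g^`().[c] = 0 -> T c) ->
 (forall y k, T y -> T (rc (1 - s) * g.[y] + rc s * (piter g k.+1).[x0])) ->
 (perturbed n)^`().[z] = 0 -> T (perturbed n).[z].
Proof.
move=> s1 hc hT; elim: n => [|n IH].
 by rewrite /= derivX hornerC => /eqP; rewrite oner_eq0.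
have c0 : rc (1 - s) != 0 by rewrite -abs_gt0 abs_rc normr_gt0; lra.
rewrite deriv_perturbedS horner_perturbedS => /eqP; rewrite mulf_eq0 => /orP[|/eqP/IH]; last exact: hT.
by rewrite mulf_eq0 (negPf c0) => /eqP/hc; exact: hT.
Qed.

(** A step multiplies by 1 - s >= 3/4 and adds a term of size at most s M, while g at least doubles
    the modulus. *)
Lemma perturbed_escape n z : escape g M -> 0 <= s -> s <= 4^-1 ->
 (forall k, abs (piter g k).[x0] <= M) -> M < abs z -> abs z <= abs (perturbed n).[z].
Proof.
move=> [M1 eM] s0 s4 hM zM; elim: n => [|n IH]; first by rewrite /= hornerX.
apply: (le_trans IH); rewrite horner_perturbedS.
set y := (perturbed n).[z] in IH *; have yM : M <= abs y by apply: le_trans IH; exact: ltW.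
have := abs_lip (rc (1 - s) * g.[y]) (rc (1 - s) * g.[y] + rc s * (piter g n.+1).[x0]).
rewrite opprD addrA subrr add0r absN !absM !abs_rc !ger0_norm//; last by rewrite subr_ge0; lra.
have := eM y yM; have := hM n.+1.
move: (abs (_ + _)) (abs g.[y]) (abs (piter _ _).[_]) (abs y) yM M1 s0 s4 => u v w yy; clear; nra.
Qed.
End Perturbation.

(** * No interior point of K(g) escapes the attracting basin *)

Section Basin.
Implicit Types (a x y : C) (d B : R) (W : set C) (g Q : {poly C}).

Lemma uniform_vanishing (f : nat -> C -> R) (cs : seq C) e : 0 < e ->
 (forall c, c \in cs -> vanishing (fun n => f n c)) ->
 exists N, forall n, (N <= n)%N -> forall c, c \in cs -> f n c < e.
Proof.
move=> e0; elim: cs => [|c cs IH] h; first by exists 0%N.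
have [N hN] := IH (fun c' cc => h c' (@mem_behead _ (c :: cs) c' cc)).
have [N' hN'] := h c (mem_head _ _) e e0; exists (maxn N N') => n; rewrite geq_max => /andP[n1 n2] c'.
by rewrite inE => /orP[/eqP->|]; [exact: hN'|exact: hN].
Qed.

Lemma horner_lipschitz_ball Q B : exists2 L, 0 < L & forall u v, abs u < B -> abs v < B ->
 abs (Q.[u] - Q.[v]) <= L * abs (u - v).
Proof.
have [k k1 hk] := horner_growth_upper Q; pose B1 := `|B| + 1; have B10 : 0 < B1 by rewrite ltr_wpDl.
have B2 : 1 <= 2 * B1 by rewrite /B1; have := normr_ge0 B; lra.
have K0 : 0 < k * (2 * B1) ^+ (size Q).-1 by rewrite mulr_gt0 ?exprn_gt0//; lra.
exists (4 * (k * (2 * B1) ^+ (size Q).-1) / B1); first by rewrite divr_gt0// mulr_gt0.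
move=> u v uB vB; have BB : B <= B1 by rewrite /B1; have := ler_norm B; lra.
apply: (@horner_lipschitz Q 0) => //; rewrite ?subr0; try exact: lt_le_trans BB.
by move=> z; rewrite subr0 => zB; apply: hk => //; exact: ltW.
Qed.

Lemma piter_backward g W n z : (forall z, W g.[z] -> W z) -> W (piter g n).[z] -> W z.
Proof.
move=> h; elim: n z => [|n IH] z; first by rewrite /piter /= hornerX.
by rewrite horner_piterSr => /IH/h.
Qed.

(** Let x be an interior point of K(g) off W. The perturbed iterates keep the orbit of x, multiply
    the derivative of g^n at x by (1 - s)^n, and have all their critical values in a set T at
    distance d from that orbit. Cauchy's estimate makes their derivative at x tend to 0, while
    [noncritical_deriv_bound] keeps it away from 0. No classification of Fatou components is
    involved. *)
Lemma interior_filled_julia_basin g W a M : (2 <= degree g)%N -> escape g M -> open W -> W a ->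
 g.[a] = a -> abs g^`().[a] < 1 ->
 (forall c, g^`().[c] = 0 -> vanishing (fun n => abs ((piter g n).[c] - a))) ->
 (forall z, W g.[z] -> W z) -> (filled_julia g)° `<=` W.
Proof.
move=> dg eM oW Wa ga ga1 hcr hW x /interiorPC[r r0 hr]; apply: contrapT => nWx.
have M1 := eM.1; have xK : filled_julia g x by apply: hr; exact: disc_center.
have xM n : abs (piter g n).[x] <= M by exact: (filled_juliaP x eM).1.
have xW n : ~ W (piter g n).[x] by move=> /(piter_backward hW).
have [q [t [q0 q1 t0 ht]]] := attracting_contraction ga ga1.
have [rW rW0 hrW] := (openPC _).1 oW a Wa.
pose rho := Num.min t rW / 3.
have rho0 : 0 < rho by rewrite divr_gt0// lt_min t0.
have rhot : 3 * rho <= t by rewrite mulrC divfK// ge_min lexx.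
have rhoW : 3 * rho <= rW by rewrite mulrC divfK// ge_min lexx orbT.
have dg0 : g^`() != 0.
 apply/eqP => E; have := coef_deriv g (degree g).-1; rewrite E coef0 prednK ?(ltnW dg)//.
 move=> /esym/eqP; rewrite mulrn_eq0 => /orP[|]; first by rewrite eqn0Ngt (ltnW dg).
 rewrite -/(lead_coef g) lead_coef_eq0 => /eqP g0; move: dg; by rewrite g0 /degree size_poly0.
have [cs [_ csE _]] := roots_factor dg0.
have [k hk] : exists N, forall n, (N <= n)%N -> forall c, c \in cs -> abs ((piter g n).[c] - a) < rho.
 apply: uniform_vanishing => // c; rewrite csE => /rootP; exact: hcr.
have {}hk c : g^`().[c] = 0 -> abs ((piter g k).[c] - a) <= rho.
 by move=> c0; apply/ltW/hk => //; rewrite csE; apply/rootP.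
(* T contains the critical points of g, and g maps it into itself with the margin [eta]: contraction
   near a brings the k-th iterate of g(z) within q rho of a. *)
pose T : set C := [set z | abs ((piter g k).[z] - a) <= rho].
have npk : nonconstant (piter g k - a%:P).
 apply: nonconstantB; apply: degree_nonconstant; rewrite degree_piter expn_gt0; apply/orP; left; exact: ltnW.
have [B0 hB0] := sublevel_bounded rho npk.
have TB z : T z -> abs z <= B0 by move=> Tz; apply: hB0; rewrite !hornerE.
pose B := `|B0| + M + 2.
have [L L0 hL] := horner_lipschitz_ball (piter g k) B.
have B0B : B0 + 1 < B by rewrite /B; have := ler_norm B0; lra.
have MB : M + 1 < B by rewrite /B; have := normr_ge0 B0; lra.
have gT z : T z -> abs ((piter g k).[g.[z]] - a) <= q * rho.
 move=> Tz; rewrite -horner_piterSr horner_piterS; apply: le_trans (ht _ _) _.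
  by apply: le_lt_trans Tz _; lra.
 by apply: ler_wpM2l.
pose eta := Num.min 1 ((1 - q) * rho / L).
have eta0 : 0 < eta by rewrite lt_min ltr01 divr_gt0// mulr_gt0// subr_gt0.
have margin z w : T z -> abs (w - g.[z]) < eta -> T w.
 rewrite lt_min => Tz /andP[w1 w2]; have gz := gT z Tz.
 have gzT : T g.[z] by apply: le_trans gz _; rewrite -[leRHS]mul1r; apply: ler_wpM2r; exact: ltW.
 have gzB := TB _ gzT.
 have wB : abs w < B by have := abs_lip w g.[z]; lra.
 have gB : abs g.[z] < B by lra.
 have := hL _ _ wB gB; move: w2; rewrite ltr_pdivlMr// => w2 hh; rewrite /T /=.
 have := abs_tri (piter g k).[g.[z]] (piter g k).[w] a.
 by move: (abs (_ - _)) (abs (_ - _)) (abs (_ - _)) (abs (_ - _)) w2 hh gz => u1 u2 u3 u4; clear; nra.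
pose d := Num.min 1 (rho / L).
have d0 : 0 < d by rewrite lt_min ltr01 divr_gt0.
have far z n : T z -> d <= abs (z - (piter g n).[x]).
 move=> Tz; apply: lerF; rewrite lt_min => /andP[z1 z2].
 apply: (xW n); apply: (@piter_backward g W k) => //; apply: hrW; rewrite /disc /=.
 have zB : abs z < B by have := TB z Tz; lra.
 have xB : abs (piter g n).[x] < B by have := xM n; lra.
 have := hL _ _ xB zB; rewrite (absB _ z); move: z2; rewrite ltr_pdivlMr// => z2 hh.
 have := abs_tri (piter g k).[z] (piter g k).[(piter g n).[x]] a; rewrite /T /= in Tz.
 rewrite mulrC in z2; move: (le_lt_trans hh z2) Tz rhoW rho0; clear; lra.
(* The bound 1/4 serves [perturbed_escape]; the other one makes a perturbed step differ from g by
   less than [eta] on T. *)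
pose s := Num.min 4^-1 (eta / (2 * B)).
have B00 : 0 < B by rewrite /B; have := normr_ge0 B0; lra.
have s0 : 0 < s by rewrite lt_min invr_gt0 ltr0n /= divr_gt0// mulr_gt0.
have s4 : s <= 4^-1 by rewrite /s ge_min lexx.
have sB : s * (2 * B) <= eta by rewrite -ler_pdivlMr ?mulr_gt0// /s ge_min lexx orbT.
have s1 : s < 1 by lra.
have stepT y n : T y -> T (rc (1 - s) * g.[y] + rc s * (piter g n.+1).[x]).
 move=> Ty; apply: (margin y) => //.
 have -> : rc (1 - s) * g.[y] + rc s * (piter g n.+1).[x] - g.[y] = rc s * ((piter g n.+1).[x] - g.[y]).
  by rewrite rcB rc1; ring.
 have gzT : T g.[y] by apply: le_trans (gT y Ty) _; rewrite -[leRHS]mul1r; apply: ler_wpM2r; exact: ltW.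
 rewrite absM abs_rc gtr0_norm//; have := absBD (piter g n.+1).[x] g.[y].
 have := xM n.+1; have := TB _ gzT; move: (abs _) (abs _) (abs _) => u1 u2 u3.
 by move: sB s0 MB B0B; clear; nra.
have crT c : g^`().[c] = 0 -> T c by exact: hk.
have low n : d / 2 / (2 * B) <= abs (perturbed g x s n.+1)^`().[x].
 pose Q := perturbed g x s n.+1 - ((piter g n.+1).[x])%:P.
 have -> : (perturbed g x s n.+1)^`() = Q^`() by rewrite /Q derivB derivC subr0.
 have Qz z : Q.[z] = (perturbed g x s n.+1).[z] - (piter g n.+1).[x] by rewrite /Q hornerD hornerN hornerC.
 have dp := @degree_perturbed g x s n.+1 s1 dg.
 have dp2 : (2 <= degree g ^ n.+1)%N.
  by apply: (leq_trans dg); rewrite expnS leq_pmulr// expn_gt0 (ltnW dg).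
 apply: noncritical_deriv_bound => //.
 - rewrite /degree /Q size_polyDl -/(degree _) ?dp// size_polyN size_polyC.
  by apply: leq_ltn_trans (leq_b1 _) _; apply: degree_nonconstant; rewrite dp; exact: ltnW.
 - by rewrite Qz perturbed_orbit subrr.
 - by rewrite mulr_gt0.
 - move=> c; rewrite /Q derivB derivC subr0 => c0; rewrite -/Q Qz; apply: far.
  exact: perturbed_critical s1 crT stepT c0.
 - move=> z; rewrite Qz => zd; have zM : abs z <= M + 1.
   apply: lerF => zM; have Mz : M < abs z by lra.
   have := @perturbed_escape g x s M n.+1 z eM (ltW s0) s4 xM Mz.
   have := abs_lip (perturbed g x s n.+1).[z] (piter g n.+1).[x]; have := xM n.+1.
   by move: zd; rewrite lt_min => /andP[]; lra.
  by have := absBD z x; have := xM 0%N; rewrite /piter /= hornerX; lra.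
have up n : abs (perturbed g x s n)^`().[x] <= M / r * (1 - s) ^+ n.
 rewrite deriv_perturbed_orbit absM absX abs_rcE; last by lra.
 rewrite mulrC; apply: ler_wpM2r; first by apply: exprn_ge0; lra.
 by apply: deriv_bound => // z /hr zK; exact: (filled_juliaP z eM).1.
have s01 : 0 <= 1 - s by lra.
have s11 : 1 - s < 1 by lra.
have kap : 0 < d / 2 / (2 * B) by rewrite !divr_gt0// mulr_gt0.
have [n hn] := exists_small_power (M / r * (1 - s)) s01 s11 kap.
have := le_trans (low n) (up n.+1); rewrite exprS mulrA leNgt => /negP; exact.
Qed.
End Basin.

(** * Maps that send a bounded set into itself with a margin *)

Section Contraction.
Implicit Types (a p x y u v : C).
Variables (g : {poly C}) (A : set C) (d M : R).
Hypotheses (d0 : 0 < d) (AM : forall z, A z -> abs z <= M) (gA : forall z, A z -> disc g.[z] d `<=` A).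

Lemma invariant_piter n z : A z -> A (piter g n).[z].
Proof.
move=> Az; elim: n => [|n IH]; first by rewrite /piter /= hornerX.
by rewrite horner_piterS; apply: (gA IH); exact: disc_center.
Qed.

(* The maps z -> x_{n+1} + (1 + e) (g(z) - x_{n+1}) still send A to A. *)
Lemma deriv_decay : exists2 q, 0 <= q < 1 & forall n x, disc x d `<=` A ->
 abs (piter g n)^`().[x] <= M / d * q ^+ n.
Proof.
have [[z0 Az0]|noA] := pselect (A !=set0); last first.
 by exists 0 => [|n x dA]; [rewrite lexx ltr01|case: noA; exists x; apply: dA; exact: disc_center].
have M0 : 0 <= M by apply: le_trans (AM Az0); exact: abs_ge0.
pose e := d / (2 * M + 1); have M1 : 0 < 2 * M + 1 by lra.
have e0 : 0 < e by rewrite divr_gt0.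
have eM : e * (2 * M) < d by rewrite /e mulrAC ltr_pdivrMr// ltr_pM2l//; lra.
have e1 : 0 < 1 + e by lra.
exists (1 + e)^-1 => [|n x dA]; first by rewrite invr_ge0 ltW// invf_lt1//; lra.
have Ax : A x by apply: dA; exact: disc_center.
have inv z : A z -> A (perturbed g x (- e) n).[z].
 move=> Az; elim: (n) => [|k IH]; first by rewrite /= hornerX.
 rewrite horner_perturbedS; apply: (gA IH); set y := g.[_]; set b := (piter _ _).[_].
 rewrite /disc /= (_ : _ - y = rc e * (y - b)); last by rewrite rcB rc1 rcN; ring.
 rewrite absM abs_rc gtr0_norm//; apply: le_lt_trans eM; apply: ler_wpM2l; first exact: ltW.
 have Ay : A y by apply: (gA IH); exact: disc_center.
 have := absBD y b; have := AM Ay; have := AM (invariant_piter k.+1 Ax); rewrite -/b; lra.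
rewrite exprVn ler_pdivlMr ?exprn_gt0//.
have := @deriv_bound (perturbed g x (- e) n) x d M d0; rewrite deriv_perturbed_orbit opprK absM absX abs_rc.
by rewrite (gtr0_norm e1) mulrC; apply=> z /dA/inv/AM.
Qed.

(** By [deriv_decay] some iterate has derivative below 1/4 at the points considered, and the second
    order Taylor remainder contributes at most another 1/4 when |v - u| < t. *)
Lemma local_contraction : exists n t, 0 < t /\ forall u v, disc u d `<=` A -> abs (v - u) < t ->
 abs ((piter g n).[v] - (piter g n).[u]) <= 2^-1 * abs (v - u) /\ abs (piter g n)^`().[u] < 1.
Proof.
have [q /andP[q0 q1] hq] := deriv_decay.
have q4 : 0 < (4^-1 : R) by rewrite invr_gt0 ltr0n.
have [n hn] := exists_small_power (M / d) q0 q1 q4.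
pose t := Num.min (d / 2) (d ^+ 2 / (8 * `|M| + 1)).
have M8 : 0 < 8 * `|M| + 1 by have := normr_ge0 M; lra.
exists n, t; split; first by rewrite lt_min !divr_gt0// exprn_gt0.
move=> u v dA; rewrite lt_min => /andP[uv1 uv2]; have du : abs (piter g n)^`().[u] < 4^-1.
 by apply: le_lt_trans (hq n u dA) hn.
split; last by lra.
have M0 : 0 <= M by apply: le_trans (AM (dA u (disc_center u d0))); exact: abs_ge0.
rewrite (ger0_norm M0) in uv2 M8.
set Q := shift_poly u (piter g n); set h := v - u in uv1 uv2 *.
have hQ i : abs Q`_i <= M / d ^+ i by apply: taylor_coef_bound => // z /dA Az; apply/AM/invariant_piter.
have := taylor_tail 2 d0 M0 hQ (ltW uv1); rewrite !big_ord_recr big_ord0 /= add0r expr0 mulr1 expr1.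
rewrite /Q shift_coef0 shift_coef1 horner_shift /h subrK -/h => tail.
have -> : (piter g n).[v] - (piter g n).[u] =
  (piter g n).[v] - ((piter g n).[u] + (piter g n)^`().[u] * h) + (piter g n)^`().[u] * h by ring.
apply: le_trans (absD _ _) _; rewrite absM.
have h0 := abs_ge0 h; have h1 : abs (piter g n)^`().[u] * abs h <= 4^-1 * abs h.
 by apply: ler_wpM2r => //; exact: ltW.
have h2 : 2 * M * (abs h / d) ^+ 2 <= 4^-1 * abs h.
 rewrite expr_div_n expr2 mulrA mulrA -mulrA mulrAC; apply: ler_wpM2r => //.
 rewrite mulrA ler_pdivrMr ?exprn_gt0//.
 by move: uv2; rewrite ltr_pdivlMr//; lra.
rewrite (_ : 2^-1 * abs h = 4^-1 * abs h + 4^-1 * abs h); last by field.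
exact: lerD (le_trans tail h2) h1.
Qed.

(** Orbits of nearby points of B = g(A) merge, and since B is connected all orbits in B merge. A
    cluster point a of the orbit of p is fixed because the orbits of g(p) and g(g(p)) merge. As a
    limit of orbit points it lies in every closed forward invariant set around p. *)
Lemma strict_contraction p : compact A -> connected A -> A p -> exists a,
 [/\ A a, g.[a] = a, abs g^`().[a] < 1, (forall z, A z -> vanishing (fun n => abs ((piter g n).[z] - a))) &
  forall P : set C, closed P -> P p -> (forall z, P z -> P g.[z]) -> P a].
Proof.
move=> cA conA Ap; have [n [t [t0 ht]]] := local_contraction.
pose B := [set g.[z] | z in A]; pose N k := piter g (k * n).
have BA u : B u -> disc u d `<=` A by move=> [z Az <-]; exact: gA.
have BA' u : B u -> A u by move=> Bu; apply: (BA u Bu); exact: disc_center.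
have Biter k u : B u -> B (piter g k).[u].
 elim: k u => [|k IH] u Bu; first by rewrite /piter /= hornerX.
 by rewrite horner_piterSr; apply: IH; exists u => //; exact: BA'.
have conB : connected B.
 exact: connected_horner.
have [clB _] : closed B /\ True.
 split=> //; have /compactC[] // : compact B.
 exact: compact_horner.
have near k u v : B u -> abs (v - u) < t -> abs ((N k).[v] - (N k).[u]) <= 2^-1 ^+ k * abs (v - u).
 move=> Bu uv; elim: k => [|k IH]; first by rewrite /N mul0n /piter /= !hornerX expr0 mul1r.
 have h1 : (2^-1 : R) ^+ k * abs (v - u) <= abs (v - u).
  by rewrite -[leRHS]mul1r; apply: ler_wpM2r; [exact: abs_ge0|apply: exprn_ile1; lra].
 rewrite /N mulSn !horner_piterD.
 have [h2 _] := ht _ _ (BA _ (Biter (k * n)%N u Bu)) (le_lt_trans IH (le_lt_trans h1 uv)).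
 by apply: le_trans h2 _; rewrite exprS -mulrA; apply: ler_wpM2l IH; rewrite invr_ge0.
have half0 : 0 <= (2^-1 : R) by rewrite invr_ge0.
have half1 : (2^-1 : R) < 1 by lra.
have nearv u v : B u -> abs (v - u) < t -> vanishing (fun k => abs ((N k).[v] - (N k).[u])).
 move=> Bu uv e e0; have [k0 hk] := exists_small_power (abs (v - u)) half0 half1 e0; exists k0 => k kk.
 apply: le_lt_trans (near k u v Bu uv) _; apply: le_lt_trans hk; rewrite mulrC.
 by apply: ler_wpM2l; [exact: abs_ge0|apply: ler_wiXn2l => //; exact: ltW].
have all x y : B x -> B y -> vanishing (fun k => abs ((N k).[y] - (N k).[x])).
 move=> Bx By; pose E := [set y | vanishing (fun k => abs ((N k).[y] - (N k).[x]))].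
 have oE : open (\bigcup_(z in B `&` E) disc z (t / 2)) by apply: bigcup_open => z _; exact: open_disc.
 have oE' : open (\bigcup_(z in B `&` ~` E) disc z (t / 2)) by apply: bigcup_open => z _; exact: open_disc.
 have t2 : 0 < t / 2 by rewrite divr_gt0.
 have step u v : B u -> B v -> abs (v - u) < t -> E u -> E v.
  move=> Bu Bv uv Eu; apply: vanishing_le (vanishingD (nearv u v Bu uv) Eu) => k /=; exact: abs_tri.
 have : B `<=` \bigcup_(z in B `&` E) disc z (t / 2).
  apply: (connected_open_split conB oE oE').
  - by move=> z Bz; have [Ez|nE] := pselect (E z); [left|right]; exists z => //; exact: disc_center.
  - move=> z Bz [u [Bu Eu] uz] [v [Bv nEv] vz]; apply: nEv; apply: (step u v) => //.
   by have := abs_tri z v u; rewrite (absB v z); move: uz vz; rewrite /disc /=; lra.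
  - exists x; split=> //; exists x; [split=> //|exact: disc_center].
   by move=> e e0; exists 0%N => k _; rewrite subrr abs0.
 move=> /(_ y By)[u [Bu Eu] uy]; apply: (step u y) => //; move: uy; rewrite /disc /=; lra.
have gp : B g.[p] by exists p.
have [|h hi [a ha]] := @bounded_subsequence (fun k => (N k).[g.[p]]) M.
 by move=> k; apply/AM/BA'/Biter.
have lim (X : set C) : closed X -> (forall k, X (N k).[g.[p]]) -> X a.
 move=> cX hX; apply/cX/closurePC => e /ha[k hk]; exists (N (h k)).[g.[p]]; [exact: hX|exact: hk].
have Ba : B a by apply: lim => // k; exact: Biter.
have ga : g.[a] = a.
 apply/eqP; rewrite -subr_eq0 -abs_eq0; apply: contraT => ne.
 have e2 : 0 < abs (g.[a] - a) / 3 by rewrite divr_gt0// lt_neqAle eq_sym ne abs_ge0.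
 have [r r0 hr] := horner_near g a e2.
 have Bgp : B g.[g.[p]] by exists g.[p] => //; exact: BA'.
 have m0 : 0 < Num.min r (abs (g.[a] - a) / 3) by rewrite lt_min r0.
 have [k1 hk1] := all _ _ gp Bgp _ e2; have [k2 hk2] := ha _ m0; pose k := maxn k1 k2.
 have := hk1 (h k) (leq_trans (leq_maxl k1 k2) (incr_ge _ hi)).
 have := hk2 k (leq_maxr k1 k2); rewrite lt_min => /andP[/hr h1 h2].
 have -> : (N (h k)).[g.[g.[p]]] = g.[(N (h k)).[g.[p]]] by rewrite -horner_piterSr horner_piterS.
 set y := (N _).[_] in h1 h2 *; have := abs_tri g.[y] g.[a] a; have := abs_tri y g.[y] a.
 by rewrite (absB g.[a] g.[y]); lra.
have ga1 : abs g^`().[a] < 1.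
 have aa : abs (a - a) < t by rewrite subrr abs0.
 have [_] := ht a a (BA a Ba) aa; rewrite deriv_piter_fixed// absX ltNge => /negP h1.
 by rewrite ltNge; apply/negP => h2; apply: h1; exact: exprn_ege1.
exists a; split=> // [|z Az|P cP Pp gP]; first exact: BA'.
 have [q [s [q0 q1 s0 hs]]] := attracting_contraction ga ga1.
 have gz : B g.[z] by exists z.
 have [k hk] := vanishing_small s0 (all a g.[z] Ba gz).
 apply: (attracting_vanishing q0 q1 hs (n0 := (k * n).+1)); rewrite horner_piterSr.
 have fixa m : (piter g m).[a] = a by elim: m => [|m IH]; [rewrite /piter /= hornerX|rewrite horner_piterS IH].
 by move: hk; rewrite /N fixa.
apply: lim => // k; rewrite /N; have Pg := gP p Pp.
by elim: (k * n)%N => [|m IH]; [rewrite /piter /= hornerX|rewrite horner_piterS; exact: gP].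
Qed.
End Contraction.

(** * From uniform attraction to the immediate basin *)

Section FilledJuliaBasin.
Implicit Types (a x y w : C) (g : {poly C}).

Lemma interior_filled_piter g n z : (2 <= degree g)%N ->
 (filled_julia g)° (piter g n).[z] -> (filled_julia g)° z.
Proof.
move=> dg /interiorPC[r r0 hr]; apply/interiorPC; have [d d0 hd] := horner_near (piter g n) z r0.
by exists d => // w wz; apply/(filled_julia_piter n _ dg)/hr; exact: hd.
Qed.

Lemma attracting_interior g a : (2 <= degree g)%N -> g.[a] = a -> abs g^`().[a] < 1 ->
 (filled_julia g)° a.
Proof.
move=> dg ga ga1; have [q [s [q0 q1 s0 hs]]] := attracting_contraction ga ga1.
apply/interiorPC; exists s => // z zs; apply/bounded_setC; exists (s + abs a).
move=> _ [p /generated1P[n ->] <-].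
have := contraction_piter n.+1 q0 q1 hs zs; have := abs_lip (piter g n.+1).[z] a.
have : q ^+ n.+1 * abs (z - a) <= abs (z - a).
 by rewrite -[leRHS]mul1r; apply: ler_wpM2r; [exact: abs_ge0|apply: exprn_ile1 => //; exact: ltW].
by move: zs; rewrite /disc /=; lra.
Qed.

Lemma vanishing_cvg g a w : vanishing (fun n => abs ((piter g n).[w] - a)) <->
 (iter n (fun x => g.[x]) w @[n --> \oo] --> a).
Proof.
split=> [h A /nbhsC[r r0 hr]|h e e0].
 by have [N hN] := h r r0; exists N => // n Nn; apply: hr; rewrite -horner_piter; exact: hN.
have [N _ hN] := h _ (nbhs_disc a e0); exists N => n Nn.
by have := hN n Nn; rewrite /= -horner_piter.
Qed.

Lemma filled_julia_immediate_basin g a : (2 <= degree g)%N -> g.[a] = a -> abs g^`().[a] < 1 ->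
 connected (filled_julia g)° ->
 (forall z, (filled_julia g)° z -> vanishing (fun n => abs ((piter g n).[z] - a))) ->
 (filled_julia g)° = immediate_basin g a.
Proof.
move=> dg ga ga1 cK hv; have ia := attracting_interior dg ga ga1.
have BE : [set w | iter n (fun x => g.[x]) w @[n --> \oo] --> a] = (filled_julia g)°.
 apply/seteqP; split=> w; last by move=> /hv/vanishing_cvg.
 move=> /vanishing_cvg h; have [r r0 hr] := (interiorPC _ _).1 ia.
 have [n hn] := vanishing_small r0 h; apply: (interior_filled_piter (n:=n) dg).
 apply/interiorPC.
 exists (r - abs ((piter g n).[w] - a)); first by rewrite subr_gt0.
 move=> u; rewrite /disc /= => ub; apply: hr; rewrite /disc /=.
 by have := abs_tri (piter g n).[w] u a; lra.
rewrite /immediate_basin BE; apply/seteqP; split; last exact: connected_component_sub.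
by apply: connected_component_max.
Qed.

Lemma attracting_unique g a z : (2 <= degree g)%N ->
 (forall z, (filled_julia g)° z -> vanishing (fun n => abs ((piter g n).[z] - a))) ->
 g.[z] = z -> abs g^`().[z] < 1 -> z = a.
Proof.
move=> dg hv gz gz1; have hz := hv z (attracting_interior dg gz gz1).
have pz n : (piter g n).[z] = z.
 by elim: n => [|n IH]; [rewrite /piter /= hornerX|rewrite horner_piterS IH].
apply/eqP; rewrite -subr_eq0 -abs_eq0; apply: contraT => ne.
have za : 0 < abs (z - a) by rewrite lt_neqAle eq_sym ne abs_ge0.
have [n] := vanishing_small za hz.
by rewrite pz ltxx.
Qed.
End FilledJuliaBasin.

(** * Monomials around a point and their action on log-distances *)

Section Monomials.
Variable a : C.
Implicit Types (u : C) (b d : R) (g h v w : {poly C}).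

Definition logdist z : R := ln (abs (z - a)).

(** Circles around a go to circles around a, by an affine rule for the logarithms of the radii; this
    makes the case of a one-point J_min computable. *)
Definition log_affine h b d := forall z, z != a -> h.[z] != a /\ logdist h.[z] = b + d * logdist z.

Lemma expR_logdist z : z != a -> expR (logdist z) = abs (z - a).
Proof. by move=> za; rewrite /logdist lnK// posrE abs_gt0 subr_eq0. Qed.

Lemma log_affineX : log_affine 'X 0 1.
Proof. by move=> z za; rewrite hornerX add0r mul1r. Qed.

Lemma log_affine_comp v w b d b' d' : log_affine v b d -> log_affine w b' d' ->
 log_affine (v \Po w) (b + d * b') (d * d').
Proof.
move=> hv hw z za; have [wa wE] := hw z za; have [va vE] := hv _ wa.
by rewrite horner_comp vE wE; split=> //; ring.
Qed.

Lemma log_affine_piter g b d t n : log_affine g b d -> b + d * t = t ->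
 exists2 b', log_affine (piter g n) b' (d ^+ n) & b' + d ^+ n * t = t.
Proof.
move=> hg gt; elim: n => [|n [b' hb bt]].
 by exists 0; [exact: log_affineX|rewrite expr0 mul1r add0r].
exists (b + d * b'); first by rewrite piterS exprS; exact: log_affine_comp.
by rewrite exprS -mulrA -addrA -mulrDr bt.
Qed.

(** All roots of h - a are equal to a, so h(z) - a = c (z - a)^d. *)
Lemma single_root_affine h : nonconstant h -> (forall z, h.[z] = a -> z = a) -> exists b, log_affine h b (degree h)%:R.
Proof.
move=> nh ha; pose Q := h - a%:P; have nQ : nonconstant Q by exact: nonconstantB.
have Qz z : Q.[z] = h.[z] - a by rewrite /Q hornerD hornerN hornerC.
have Q0 : Q != 0 by rewrite -size_poly_gt0; exact: ltnW.
have root_a z : Q.[z] = 0 -> z = a by rewrite Qz => /subr0_eq/ha.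
have [rs [srs rsE fac]] := roots_factor Q0.
have dQ : (size Q).-1 = degree h by rewrite /Q /degree size_polyDl// size_polyN size_polyC (leq_ltn_trans (leq_b1 _)).
exists (ln (abs (lead_coef Q))) => z za; have za' : z - a != 0 by rewrite subr_eq0.
have E : h.[z] - a = lead_coef Q * (z - a) ^+ degree h.
 rewrite -Qz fac; congr (_ * _); rewrite -dQ -srs.
 rewrite (eq_big_seq (fun=> z - a)) => [|y]; last by rewrite rsE => /rootP/root_a->.
 by rewrite big_const_seq count_predT iter_mulr_1.
have lc0 : 0 < abs (lead_coef Q) by rewrite abs_gt0 lead_coef_eq0.
have lcn : lead_coef Q != 0 by rewrite lead_coef_eq0.
split; first by rewrite -subr_eq0 E; apply: mulf_neq0 => //; exact: expf_neq0.
rewrite /logdist E absM absX lnM ?posrE ?exprn_gt0 ?abs_gt0//.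
by rewrite lnXn ?abs_gt0// mulr_natl.
Qed.

Lemma filled_julia_disc g b d t : log_affine g b d -> 2 <= d -> g.[a] = a -> b + d * t = t ->
 filled_julia g = cdisc a (expR t).
Proof.
move=> hg d2 ga gt; apply/seteqP; split=> z.
 move=> /bounded_setC[M hM]; rewrite /cdisc /=; apply: lerF => zt.
 have za : z != a by rewrite -subr_eq0 -abs_gt0; apply: lt_trans zt; exact: expR_gt0.
 have tz : t < logdist z by rewrite -ltr_expR expR_logdist.
 have [k hk] := exists_pow2 ((`|M| + abs a + `|t|) / (logdist z - t)).
 have [b' hb bt] := log_affine_piter k.+1 hg gt; have [wa wE] := hb z za.
 have := hM (piter g k.+1).[z] (ex_intro2 _ _ (piter g k.+1) ((generated1P g _).2 (ex_intro _ k erefl)) erefl).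
 have := expR_logdist wa; rewrite wE => E.
 have := expR_ge1Dx (b' + d ^+ k.+1 * logdist z); rewrite E.
 have dk : 2 ^+ k.+1 <= d ^+ k.+1 by apply: lerXn2r; rewrite ?nnegrE//; lra.
 have := hk k.+1 (leqnSn k); rewrite ltr_pdivrMr ?subr_gt0// => h1.
 have h2 : 2 ^+ k.+1 * (logdist z - t) <= d ^+ k.+1 * (logdist z - t).
  by apply: ler_wpM2r => //; rewrite subr_ge0 ltW.
 have h3 : d ^+ k.+1 * (logdist z - t) = b' + d ^+ k.+1 * logdist z - t by rewrite mulrBr; lra.
 have := absBD (piter g k.+1).[z] a; have := ler_norm M; have := ler_norm (- t); rewrite normrN.
 by move: h1 h2 h3; clear; lra.
move=> zt; apply/bounded_setC; exists (expR t + abs a) => _ [q /generated1P[n ->] <-].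
have [->|za] := eqVneq z a.
 have -> : (piter g n.+1).[a] = a.
  by elim: (n.+1) => [|m IH]; [rewrite /piter /= hornerX|rewrite horner_piterS IH].
 by rewrite ler_wpDl// ltW// expR_gt0.
have [b' hb bt] := log_affine_piter n.+1 hg gt; have [wa wE] := hb z za.
have := abs_lip (piter g n.+1).[z] a; have : abs ((piter g n.+1).[z] - a) <= expR t; last by lra.
rewrite -expR_logdist// ler_expR wE -[leRHS]bt lerD2l; apply: ler_wpM2l.
 by apply: exprn_ge0; lra.
by rewrite -ler_expR expR_logdist.
Qed.
End Monomials.

(** * Doubly connected plane domains *)

Section Annuli.
Implicit Types (b u v : C) (K A B V W : set C).

Lemma card_II2 T (X : set T) : X #= `I_2 ->
 exists x y, [/\ X x, X y, x <> y & forall o, X o -> o = x \/ o = y].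
Proof.
move=> /card_set_bijP[f [ff fj fs]].
have [x Ax x0] := fs 0%N isT; have [y Ay y1] := fs 1%N isT; exists x, y; split=> //.
 by move=> xy; move: x0; rewrite xy y1.
move=> z Az; have := ff z Az; rewrite /=; case E : (f z) => [|[|n]]// _; [left|right]; apply: fj;
 by rewrite ?inE// E.
Qed.

Lemma component_of_union (T : topologicalType) (X Y : set T) x : closed X -> closed Y -> X `&` Y = set0 ->
 connected X -> X x -> connected_component (X `|` Y) x = X.
Proof.
move=> cX cY XY conX Xx; apply/seteqP; split; last by apply: connected_component_max => // u; left.
apply: (connected_closed_split (@component_connected _ _ x) cX cY).
- exact: connected_component_sub.
- by move=> u _; exact: (disjE XY).
- by exists x; split=> //; apply: connected_component_refl; left.
Qed.

(** Plane form of a doubly connected domain: [A0] is its bounded hole, and [A1] is the other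
    complementary component with infinity removed. *)
Definition annulus V A0 A1 :=
 [/\ [/\ open V, connected V & V !=set0], [/\ connected A0, compact A0 & A0 !=set0],
  [/\ connected A1, closed A1 & exists M, forall z, M < abs z -> A1 z], ~` V = A0 `|` A1 &
  A0 `&` A1 = set0].

Lemma annulus_disjoint V A0 A1 z : annulus V A0 A1 -> A0 z -> A1 z -> False.
Proof. by move=> [_ _ _ _ A01]; exact: disjE A01. Qed.

Lemma annulus_unbounded V A0 A1 A : annulus V A0 A1 -> A1 `<=` A -> ~ bounded_set A.
Proof.
move=> [_ _ [_ _ [M hM]] _ _] sub /bounded_setC[M' hM'].
pose t := rc (`|M| + `|M'| + 1); have at_ : abs t = `|M| + `|M'| + 1 by rewrite abs_rcE ?addr_ge0.
have /sub/hM' : A1 t by apply: hM; rewrite at_; have := ler_norm M; have := normr_ge0 M'; lra.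
by rewrite at_; have := ler_norm M'; have := normr_ge0 M; lra.
Qed.

Lemma annulus_component V A0 A1 B : annulus V A0 A1 ->
 components (~` V) B -> bounded_set B -> B = A0.
Proof.
move=> an; have [_ [cA0 kA0 _] [cA1 kA1 _] VE A01] := an; have clA0 := ((compactC _).1 kA0).1.
move=> [x]; rewrite VE => -[Ax|Ax] <-; first by rewrite component_of_union.
rewrite setUC component_of_union ?(setIC A1)// => bA1.
by case: (annulus_unbounded an (A:=A1)).
Qed.

Lemma surr_annulus V W A0 A1 : annulus W A0 A1 -> surr_le V W <-> V = W \/ V `<=` A0.
Proof.
move=> an; have [_ [cA0 kA0 [x Ax]] [cA1 kA1 _] WE A01] := an; have [clA0 bA0] := (compactC _).1 kA0.
split=> [[->|[B [cB bB VB]]]|[->|VA]]; [by left| |by left|].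
 by right; rewrite -(annulus_component an cB bB).
right; exists A0; split=> //; last exact/bounded_setC.
by exists x; rewrite WE; [left|rewrite component_of_union].
Qed.

Lemma annulus_limit V A0 A1 A A' : annulus V A0 A1 -> ~` V = A `|` A' -> A `&` A' = set0 ->
 closed A -> closed A' -> connected A -> A !=set0 -> A <> setT -> connected (V `|` A).
Proof.
move=> [[oV cV V0] _ _ _ _] VE AA' clA clA' cA nA AT.
have [y [Ay cly]] : exists y, A y /\ closure V y.
 apply: contrapT => no; have opA : open A.
  apply/openPC => y Ay; have nc : ~ closure V y by move=> cl; apply: no; exists y.
  have [r r0 hr] : exists2 r, 0 < r & forall z, abs (z - y) < r -> ~ V z.
   apply: contrapT => no'; apply: nc; apply/closurePC => e e0; apply: contrapT => no''; apply: no'.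
   by exists e => // z zy Vz; apply: no''; exists z.
  have nA' : (~` A') y by move=> A'y; exact: disjE AA' Ay A'y.
  have [r' r'0 hr'] := (openPC _).1 (closed_openC clA') y nA'.
  exists (Num.min r r'); first by rewrite lt_min r0.
  move=> z; rewrite /disc /= lt_min => /andP[z1 z2]; have : (~` V) z by exact: hr.
  by rewrite VE => -[//|/(hr' z z2)].
 have cT : connected [set: C] by exact: (@star_connected _ 0 _).
 apply: AT; apply/seteqP; split=> //; exact: connected_clopen cT opA clA nA.
have -> : V `|` A = (V `|` [set y]) `|` A.
 by apply/seteqP; split=> z; [move=> [?|?]; [left; left|right]|move=> [[?|->]|?]; [left|right|right]].
apply: connectedU => //; first by exists y; split=> //; right.
exact: connected_add_limit.
Qed.

Lemma annulus_outer V A0 A1 : annulus V A0 A1 -> connected (V `|` A1).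
Proof.
move=> an; have [_ [cA0 kA0 [x Ax]] [cA1 kA1 [M hM]] VE A01] := an; have [clA0 _] := (compactC _).1 kA0.
apply: (annulus_limit an (A' := A0)) => //; rewrite 1?setUC 1?setIC//.
 exists (rc (`|M| + 1)); apply: hM; rewrite abs_rcE ?addr_ge0//; have := ler_norm M; lra.
by move=> AT; apply: (annulus_disjoint an Ax); rewrite AT.
Qed.

Lemma annulus_inner V A0 A1 : annulus V A0 A1 -> connected (V `|` A0).
Proof.
move=> an; have [_ [cA0 kA0 nA0] [cA1 kA1 [M hM]] VE A01] := an; have [clA0 _] := (compactC _).1 kA0.
apply: (annulus_limit an (A' := A1)) => // AT.
apply: (annulus_disjoint an (z:=rc (`|M| + 1))); first by rewrite AT.
apply: hM; rewrite abs_rcE ?addr_ge0//; have := ler_norm M; lra.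
Qed.

(** W together with its outer complement is connected, unbounded and disjoint from V, so it lies in
    the outer complement of V; pass to complements. *)
Lemma annulus_trans V A0 A1 W B0 B1 : annulus V A0 A1 -> annulus W B0 B1 -> V `<=` B0 -> A0 `<=` B0.
Proof.
move=> anV anW VB; have [_ _ [cA1 clA1 hA1] VE A01] := anV; have [_ [cB0 kB0 _] [cB1 clB1 hB1] WE B01] := anW.
have [clA0 _] := (compactC _).1 (let: And5 _ (And3 _ k _) _ _ _ := anV in k).
have sub : W `|` B1 `<=` A1.
 apply: (connected_closed_split (annulus_outer anW) clA1 clA0).
 - move=> z Wz; have : (~` V) z.
   move=> /VB B0z; case: Wz => [Wz|B1z]; last exact: annulus_disjoint anW B0z B1z.
   by have : (~` W) z by [rewrite WE; left]; apply.
  by rewrite VE => -[?|?]; [right|left].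
 - by move=> z _ a1 a0; exact: annulus_disjoint anV a0 a1.
 - have [M hM] := hA1; have [M' hM'] := hB1; exists (rc (`|M| + `|M'| + 1)).
  have at_ : abs (rc (`|M| + `|M'| + 1)) = `|M| + `|M'| + 1 by rewrite abs_rcE ?addr_ge0.
  split; [right; apply: hM'|apply: hM]; rewrite at_.
   by have := ler_norm M'; have := normr_ge0 M; lra.
  by have := ler_norm M; have := normr_ge0 M'; lra.
move=> z a0; apply: contrapT => nB0; apply: (annulus_disjoint anV a0); apply: sub.
have [Wz|nW] := pselect (W z); [by left|right].
by have : (~` W) z by []; rewrite WE => -[].
Qed.

(** Each domain lies in one complementary piece of the other. If both were in outer pieces, V with
    its hole would be a connected set missing W and meeting the hole of W at c, so V would lie in
    that hole after all. *)
Lemma annulus_total V A0 A1 W B0 B1 c : annulus V A0 A1 -> annulus W B0 B1 -> V `&` W = set0 ->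
 A0 c -> B0 c -> V `<=` B0 \/ W `<=` A0.
Proof.
move=> anV anW VW A0c B0c.
have side V' A' B' W' : annulus V' A' B' -> connected W' -> V' `&` W' = set0 -> W' `<=` A' \/ W' `<=` B'.
 move=> an cW' VW'; have [_ [_ kA _] [_ clB _] VE AB] := an; have [clA _] := (compactC _).1 kA.
 have sub : W' `<=` A' `|` B'.
  by move=> z Wz; rewrite -VE => Vz; have : (V' `&` W') z by []; rewrite VW'.
 have [[z [Wz Az]]|no] := pselect (W' `&` A' !=set0).
  left; apply: (connected_closed_split cW' clA clB sub); last by exists z.
  by move=> u _ a' b'; exact: annulus_disjoint an a' b'.
 by right=> z Wz; have [Az|//] := sub z Wz; case: no; exists z.
have WV : W `&` V = set0 by rewrite setIC.
have [_ cV _] : [/\ True, connected V & True] by case: anV => -[].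
have [_ cW _] : [/\ True, connected W & True] by case: anW => -[].
have [WA|WB] := side _ _ _ _ anV cW VW; first by right.
have [VB|VB] := side _ _ _ _ anW cV WV; first by left.
have disj V' A' B' W' A'' B'' : annulus V' A' B' -> annulus W' A'' B'' -> W' `<=` B' -> V' `<=` B'' ->
  A' c -> A'' c -> V' `|` A' `<=` A''.
 move=> an an' W'B V'B Ac A''c.
 have d : W' `&` (V' `|` A') = set0.
  apply/seteqP; split=> // z [Wz [Vz|Az]].
   have [_ _ _ WE _] := an'; have : (~` W') z by rewrite WE; right; exact: V'B.
   by apply.
  exact: annulus_disjoint an Az (W'B z Wz).
 have [//|sub] := side _ _ _ _ an' (annulus_inner an) d.
 by case: (annulus_disjoint an' A''c); apply: sub; right.
have s1 := disj _ _ _ _ _ _ anV anW WB VB A0c B0c; left=> z Vz; apply: s1; by left.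
Qed.

(** The complementary component of infinity stays connected without infinity: it contains a
    connected exterior domain, so a split would leave a compact part, which is closed in the
    sphere. *)
Lemma annulus_of_sphere (U : set S) : open U -> connected U -> U !=set0 -> components (~` U) #= `I_2 ->
 ~ U infty -> (exists M, forall z, M < abs z -> ~ U (Some z)) ->
 exists A0 A1, annulus (finite_part U) A0 A1 /\ emb A0 `|` (emb A1 `|` [set infty]) = ~` U.
Proof.
move=> oU cU nU c2 Ui [M hM]; have [X [Y [cX cY XY hXY]]] := card_II2 c2.
have clU : closed (~` U) by exact: open_closedC.
have main X' Y' : components (~` U) X' -> components (~` U) Y' -> X' <> Y' ->
  (forall Z, components (~` U) Z -> Z = X' \/ Z = Y') -> Y' infty ->
  exists A0 A1, annulus (finite_part U) A0 A1 /\ emb A0 `|` (emb A1 `|` [set infty]) = ~` U.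
 move=> [x Ux xX] [y Uy yY] ne hZ Yi.
 have dis (u : S) : X' u -> ~ Y' u.
  rewrite -xX -yY => xu yu; apply: ne; rewrite -xX -yY.
  by rewrite (same_connected_component xu) (same_connected_component yu).
 have UE : ~` U = X' `|` Y'.
  apply/seteqP; split=> u; last by rewrite -xX -yY => -[|]; exact: connected_component_sub.
  move=> Uu; have [E|E] := hZ _ (ex_intro2 _ _ u Uu erefl); [left|right]; rewrite -E;
   exact: connected_component_refl.
 have clX : closed X' by rewrite -xX; exact: component_closed.
 have clY : closed Y' by rewrite -yY; exact: component_closed.
 have conX : connected X' by rewrite -xX; exact: component_connected.
 have conY : connected Y' by rewrite -yY; exact: component_connected.
 have farY z : `|M| < abs z -> Y' (Some z).
  move=> zM; have yi : connected_component (~` U) y infty by rewrite yY.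
  rewrite -yY; apply: connected_component_trans yi _.
  apply: (@connected_component_max _ (~` U) [set x : S | if x is Some z then `|M| < abs z else True]) => //.
   by move=> [v|] //= vM; apply: hM; exact: le_lt_trans (ler_norm M) vM.
  exact: exterior_infty_connected.
 have cont : continuous (Some : C -> S) by exact: one_point_compactification_some_continuous.
 have clf (Z : set S) : closed Z -> closed (finite_part Z).
  by move=> cZ; apply: closed_comp cZ => z _; exact: cont.
 have embX : emb (finite_part X') = X'.
  apply/seteqP; split=> [_ [z Xz <-] //|[z|] Xz]; first by exists z.
  by case: (dis _ Xz).
 have embY : emb (finite_part Y') `|` [set infty] = Y'.
  by apply/seteqP; split=> [_ [[z Yz <-]|->] //|[z|] Yz]; [left; exists z|right].
 exists (finite_part X'), (finite_part Y'); split; last by rewrite embX embY UE.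
 split; last 2 first.
 - by apply/seteqP; split=> z; rewrite /finite_part /= -[~ _]/((~` U) _) UE.
 - by apply/seteqP; split=> // z [/dis].
 - split.
  + by apply: open_comp oU => z _; exact: cont.
  + apply/connected_embP; suff -> : emb (finite_part U) = U by [].
   by apply/seteqP; split=> [_ [z Uz <-] //|[z|] Uz //]; exists z.
  + by have [[z|//] Uz] := nU; exists z.
 - split; first by apply/connected_embP; rewrite embX.
   apply/compactC; split; first exact: clf.
   by exists `|M| => z Xz; apply: lerF => /farY; exact: dis.
  have : X' x by rewrite -xX; exact: connected_component_refl.
  by move=> Xx; have : emb (finite_part X') x; [rewrite embX|move=> [z Xz _]; exists z].
 - split; [|exact: clf|by exists `|M|].
  apply: contrapT => /(not_connected_closed (clf _ clY))[A [B [clA clB YE AB0 [nA nB]]]].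
  have split_absurd A' B' : closed A' -> closed B' -> finite_part Y' = A' `|` B' -> A' `&` B' = set0 ->
    A' !=set0 -> B' !=set0 -> [set z | `|M| < abs z] `<=` A' -> False.
   move=> clA' clB' YE' AB' [u Au] [v Bv] far.
   have kB' : compact B'.
    apply/compactC; split=> //; exists `|M| => z Bz; apply: lerF => /far Az.
    by apply: disjE AB' _ Bz.
   have clA'' : closed (emb A' `|` [set infty] : set S).
    rewrite -[_ `|` _]setCK; apply: open_closedC.
    have -> : ~` (emb A' `|` [set infty]) = emb (~` A').
     apply/seteqP; split=> [[z|] nz|_ [z nz <-] [/embP//|//]]; last by case: nz; right.
     by exists z => // Az; apply: nz; left; exists z.
    by apply: open_emb; exact: closed_openC.
   have : Y' `<=` emb A' `|` [set infty].
    apply: (connected_closed_split conY clA'' (closed_emb kB')).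
    - rewrite -embY YE' => _ [[z [Az|Bz] <-]|->]; [by left; left; exists z|by right; exists z|by left; right].
    - move=> z _ [[a' Aa <-]|->] [b' Bb] // [E]; rewrite E in Bb.
     exact: disjE AB' Aa Bb.
    - by exists infty; split=> //; right.
   have Yv : finite_part Y' v by rewrite YE'; right.
   move=> /(_ (Some v) Yv)[/embP Av|//].
   exact: disjE AB' Av Bv.
  have cE := connected_exterior (normr_ge0 M).
  have EY : [set z | `|M| < abs z] `<=` A `|` B by rewrite -YE.
  have [[z [Ez Az]]|no] := pselect ([set z | `|M| < abs z] `&` A !=set0).
   apply: (split_absurd A B) => //; apply: (connected_closed_split cE clA clB EY); last by exists z.
   by move=> u _; exact: (disjE AB0).
  apply: (split_absurd B A) => //; rewrite 1?setUC 1?setIC//.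
  by move=> z Ez; have [Az|//] := EY z Ez; case: no; exists z.
have [[Yi|Xi]] : (Y infty \/ X infty) /\ True.
- split=> //; have [E|E] := hXY _ (ex_intro2 _ _ infty Ui erefl); [right|left]; rewrite -E;
  exact: connected_component_refl.
- by move=> _; exact: main cX cY XY hXY Yi.
- move=> _; apply: main cY cX (fun E => XY (esym E)) _ Xi => Z /hXY[->|->]; [by right|by left].
Qed.
End Annuli.

(** * Null-homotopies in the plane *)

Section PlaneHomotopy.
Implicit Types (u v : C) (a b : R) (V K : set C) (f g : R -> C).

Definition clamp (a b t : R) : R := Num.max a (Num.min t b).

Lemma clamp_in a b t : a <= b -> a <= clamp a b t <= b.
Proof. by rewrite /clamp => ab; have [h|h] := leP t b; [have [h'|h'] := leP a t|have [h'|h'] := leP a b]; lra. Qed.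

Lemma clamp_id a b t : a <= t <= b -> clamp a b t = t.
Proof. by rewrite /clamp => h; have [h1|h1] := leP t b; [have [h2|h2] := leP a t|have [h2|h2] := leP a b]; lra. Qed.

Lemma clamp_le a b t : a <= b -> t <= a -> clamp a b t = a.
Proof. by rewrite /clamp => ab h; have [h1|h1] := leP t b; [have [h2|h2] := leP a t|have [h2|h2] := leP a b]; lra. Qed.

Lemma clamp_ge a b t : a <= b -> b <= t -> clamp a b t = b.
Proof. by rewrite /clamp => ab h; have [h1|h1] := leP t b; [have [h2|h2] := leP a t|have [h2|h2] := leP a b]; lra. Qed.

Lemma clamp_lip a b t s : `|clamp a b t - clamp a b s| <= `|t - s|.
Proof.
wlog ts : t s / s <= t => [hw|].
 by have [|/ltW] := leP s t; [exact: hw|move=> /hw; rewrite distrC (distrC s)].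
rewrite (ger0_norm (_ : 0 <= t - s)) ?subr_ge0// ler_norml /clamp.
case: (leP t b) => h1; case: (leP s b) => h2.
- by case: (leP a t) => h3; case: (leP a s) => h4; lra.
- by case: (leP a t) => h3; case: (leP a b) => h4; lra.
- by case: (leP a b) => h3; case: (leP a s) => h4; lra.
- by case: (leP a b) => h3; lra.
Qed.

Section Continuity.
Variable T : topologicalType.
Implicit Types (F H : T -> C) (h k : T -> R).

Lemma contD F H : continuous F -> continuous H -> continuous (fun x => F x + H x).
Proof. by move=> cF cH x; apply: cvgD; [exact: cF|exact: cH]. Qed.

Lemma contB F H : continuous F -> continuous H -> continuous (fun x => F x - H x).
Proof. by move=> cF cH x; apply: cvgB; [exact: cF|exact: cH]. Qed.

Lemma contM F H : continuous F -> continuous H -> continuous (fun x => F x * H x).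
Proof. by move=> cF cH x; apply: cvgM; [exact: cF|exact: cH]. Qed.

Lemma contC z : continuous (fun _ : T => z).
Proof. by move=> x; exact: cvg_cst. Qed.

Lemma cont_rc h : continuous h -> continuous (fun x => rc (h x)).
Proof. by move=> ch x; apply: continuous_comp; [exact: ch|exact: rc_continuous]. Qed.

Lemma cont_clamp h a b : continuous h -> continuous (fun x => clamp a b (h x)).
Proof.
move=> ch x; apply/continuousRP => e e0; have := (continuousRP _ _).1 (ch x) e e0.
by apply: filterS => y; apply: le_lt_trans; exact: clamp_lip.
Qed.

Lemma cont_affine h (a b : R) : continuous h -> continuous (fun x => a * h x + b).
Proof. by move=> ch x; apply: cvgD; [apply: cvgM; [exact: cvg_cst|exact: ch]|exact: cvg_cst]. Qed.
End Continuity.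

(** Homotopies are continuous on the whole plane of parameters, with [clamp] supplying the
    extensions; relative continuity appears only in the final transfer to the sphere. *)
Definition nullhom V f := exists H : R * R -> C, [/\ continuous H,
 (forall s t, 0 <= s <= 1 -> 0 <= t <= 1 -> V (H (s, t))),
 (forall t, 0 <= t <= 1 -> H (0, t) = f t /\ H (1, t) = f 0) &
 (forall s, 0 <= s <= 1 -> H (s, 0) = f 0 /\ H (s, 1) = f 0)].

Lemma cont_snd f : continuous f -> continuous (fun p : R * R => f p.2).
Proof. by move=> cf p; apply: continuous_comp; [exact: cvg_snd|exact: cf]. Qed.

Lemma cont_fst : continuous (fun p : R * R => p.1).
Proof. by move=> p; exact: cvg_fst. Qed.

Lemma nullhom_straight V f g : continuous f -> continuous g -> f 0 = g 0 -> f 1 = g 1 ->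
 (forall s t, 0 <= s <= 1 -> 0 <= t <= 1 -> V (f t + rc s * (g t - f t))) ->
 nullhom V g -> nullhom V f.
Proof.
move=> cf cg fg0 fg1 hV [B [cB VB B1 B2]].
(* For s <= 1/2 the homotopy moves f straight to g, afterwards it follows [B]. Both clocks are
   clamped so that one formula covers the two halves. *)
pose sg (p : R * R) := clamp 0 1 (2 * p.1 + 0); pose ta (p : R * R) := clamp 0 1 (2 * p.1 + -1).
have csg : continuous sg by apply: cont_clamp; apply: cont_affine; exact: cont_fst.
have cta : continuous ta by apply: cont_clamp; apply: cont_affine; exact: cont_fst.
have B0 t : 0 <= t <= 1 -> B (0, t) = g t by move=> /B1[].
exists (fun p => f p.2 + rc (sg p) * (g p.2 - f p.2) + B (ta p, p.2) - g p.2); split.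
- apply: contB; last exact: cont_snd.
 apply: contD.
  apply: contD; first exact: cont_snd.
  by apply: contM; [exact: cont_rc|apply: contB; exact: cont_snd].
 move=> p; apply: (@continuous_comp _ _ _ (fun p => (ta p, p.2)) B); last exact: cB.
 apply: (@cvg_pair _ _ _ _ (nbhs (ta p)) (nbhs p.2) _ _ _ ta snd (cta p)).
 exact: cvg_snd.
- move=> s t hs ht; rewrite /sg /ta /=; have [s2|s2] := leP s 2^-1.
  rewrite (clamp_le (t := 2 * s + -1)); [|lra|lra].
  by rewrite B0// addrK; apply: hV => //; apply: clamp_in; lra.
 rewrite (clamp_ge (t := 2 * s + 0)); [|lra|lra].
 rewrite rc1 mul1r addrCA subrr addr0 addrAC subrr add0r; apply: VB => //.
 by apply: clamp_in; lra.
- move=> t ht; rewrite /sg /ta /=; split.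
  have -> : clamp 0 1 (2 * 0 + 0 : R) = 0 by apply: clamp_le; lra.
  have -> : clamp 0 1 (2 * 0 + -1 : R) = 0 by apply: clamp_le; lra.
  by rewrite B0// rc0 mul0r addr0 addrK.
 have -> : clamp 0 1 (2 * 1 + 0 : R) = 1 by apply: clamp_ge; lra.
 have -> : clamp 0 1 (2 * 1 + -1 : R) = 1 by apply: clamp_ge; lra.
 by rewrite rc1 mul1r addrCA subrr addr0 addrAC subrr add0r (B1 t ht).2 fg0.
- move=> s hs; rewrite /= fg0 fg1 !subrr !mulr0 !addr0.
 have hta : 0 <= ta (s, 0) <= 1 by apply: clamp_in; lra.
 have -> : ta (s, 1) = ta (s, 0) by [].
 by rewrite (B2 _ hta).1 (B2 _ hta).2 addrK addrAC subrr add0r.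
Qed.

Lemma nullhom_convex V K f : convexC K -> K `<=` V -> continuous f -> f 0 = f 1 ->
 (forall t, 0 <= t <= 1 -> K (f t)) -> nullhom V f.
Proof.
move=> cK KV cf f01 hK; have K0 : K (f 0) by apply: hK; lra.
exists (fun p => f p.2 + rc p.1 * (f 0 - f p.2)); split.
- apply: contD; first exact: cont_snd.
 apply: contM; first by apply: cont_rc; exact: cont_fst.
 by apply: contB; [exact: contC|exact: cont_snd].
- by move=> s t hs ht; apply: KV; apply: cK => //; exact: hK.
- by move=> t ht; rewrite /= rc0 mul0r addr0 rc1 mul1r addrC subrK.
- by move=> s hs; rewrite /= -f01 subrr mulr0 addr0.
Qed.

(** On [a, b] the path is replaced by the segment between its end values; writing it with [clamp]
    gives continuity without cases. *)
Definition straighten f (a b t : R) : C :=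
 f t - f (clamp a b t) + (f a + rc ((clamp a b t - a) / (b - a)) * (f b - f a)).

Lemma straighten_continuous f a b : continuous f -> continuous (straighten f a b).
Proof.
move=> cf; have cc : continuous (clamp a b) by exact: (@cont_clamp R (fun x => x) a b (fun x => cvg_id)).
apply: contD.
 by apply: contB; [exact: cf|move=> x; apply: continuous_comp; [exact: cc|exact: cf]].
apply: contD; first exact: contC.
apply: contM; last exact: contC.
apply: cont_rc => x; apply: cvgM; last exact: cvg_cst.
by apply: cvgB; [exact: cc|exact: cvg_cst].
Qed.

Lemma straighten_out f a b t : a <= b -> t <= a \/ b <= t -> straighten f a b t = f t.
Proof.
move=> ab [ta|bt]; rewrite /straighten.
 by rewrite clamp_le// subrr mul0r rc0 mul0r addr0 subrK.
rewrite clamp_ge//; have [->|ne] := eqVneq a b; first by rewrite !subrr mulr0 addr0 subrK.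
by rewrite divff ?subr_eq0 1?eq_sym// rc1 mul1r (addrC (f a)) subrK subrK.
Qed.

Lemma straighten_in f K a b t : convexC K -> K (f a) -> K (f b) -> a <= t <= b -> K (straighten f a b t).
Proof.
move=> cK Ka Kb h; rewrite /straighten clamp_id// subrr add0r; apply: cK => //.
have [->|ne] := eqVneq a b; first by rewrite subrr invr0 mulr0; lra.
have ab : 0 < b - a by rewrite subr_gt0 lt_neqAle ne; lra.
by rewrite divr_ge0 ?ler_pdivrMr//; lra.
Qed.

Lemma nullhom_straighten V K f a b : convexC K -> K `<=` V -> continuous f ->
 0 <= a -> a <= b -> b <= 1 -> (forall t, 0 <= t <= 1 -> V (f t)) ->
 (forall t, a <= t <= b -> K (f t)) -> nullhom V (straighten f a b) -> nullhom V f.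
Proof.
move=> cK KV cf a0 ab b1 hV hK; have cs := straighten_continuous (a:=a) (b:=b) cf.
apply: (nullhom_straight cf cs).
- by rewrite straighten_out//; left.
- by rewrite straighten_out//; right.
move=> s t hs ht; have [h|h] := pselect (a <= t <= b).
 apply: KV; apply: (cK) => //; first exact: hK.
 by apply: (straighten_in cK (hK _ _) (hK _ _) h); lra.
rewrite straighten_out//; last by apply/orP; move/negP: h; rewrite negb_and -!ltNge => /orP[/ltW->|/ltW->]; rewrite ?orbT.
by rewrite subrr mulr0 addr0; exact: hV.
Qed.

End PlaneHomotopy.

(** * Rounding to the nearest integer *)

Section Rounding.

Lemma floor_half (x : R) : `|x - (Num.floor (x + 2^-1))%:~R| <= 2^-1.
Proof.
have := real_floor_itv (num_real (x + 2^-1)); rewrite intrD => /andP[h1 h2].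
by rewrite ler_norml; apply/andP; split; lra.
Qed.

(** Cells are closed, so at a common edge both neighbouring roundings are admissible, and off the
    edges the rounding is locally constant. *)
Lemma floor_near (x : R) : exists2 d, 0 < d &
 forall y, `|y - x| < d -> `|x - (Num.floor (y + 2^-1))%:~R| <= 2^-1.
Proof.
have := real_floor_itv (num_real (x + 2^-1)); rewrite intrD; set i := Num.floor _ => /andP[h1 h2].
have main d : 0 < d -> d <= 2^-1 -> d <= i%:~R + 2^-1 - x -> (x = i%:~R - 2^-1 \/ d <= x - (i%:~R - 2^-1)) ->
  forall y, `|y - x| < d -> `|x - (Num.floor (y + 2^-1))%:~R| <= 2^-1.
 move=> d0 d2 dr dl y; rewrite ltr_norml => /andP[y1 y2].
 have := real_floor_itv (num_real (y + 2^-1)); rewrite intrD; set k := Num.floor _ => /andP[k1 k2].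
 have ki : (k <= i)%R.
  have : (k%:~R : R) < (i + 1)%:~R by rewrite intrD; move: k1 y2 dr; clear; lra.
  by rewrite ltr_int; clear; lia.
 case: dl => [xe|dl].
  have : (i - 2)%:~R < (k%:~R : R) by rewrite intrB; move: k2 y1 d2 xe; clear; lra.
  rewrite ltr_int => ik; have [->|->] : k = i \/ k = i - 1 by move: ki ik; clear; lia.
   by rewrite ler_norml; move: h1 h2; clear; lra.
  by rewrite intrB ler_norml; move: h1 xe; clear; lra.
 have : (i - 1)%:~R < (k%:~R : R) by rewrite intrB; move: k2 y1 dl; clear; lra.
 rewrite ltr_int => ik; have -> : k = i by move: ki ik; clear; lia.
 by rewrite ler_norml; move: h1 h2; clear; lra.
have [xe|xe] := eqVneq x (i%:~R - 2^-1).
 have h0 : 0 < (2^-1 : R) by rewrite invr_gt0 ltr0n.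
 exists 2^-1 => //; apply: main => //; last by left.
 by rewrite xe; rewrite opprB addrCA addrAC subrr add0r lerDl ltW.
have xl : i%:~R - 2^-1 < x by rewrite lt_neqAle eq_sym xe; move: h1; clear; lra.
have dd : 0 < Num.min 2^-1 (Num.min (i%:~R + 2^-1 - x) (x - (i%:~R - 2^-1))).
 by rewrite !lt_min; move: h2 xl; clear; lra.
exists (Num.min 2^-1 (Num.min (i%:~R + 2^-1 - x) (x - (i%:~R - 2^-1)))) => //.
apply: main => //.
- by rewrite ge_min lexx.
- by rewrite ge_min; apply/orP; right; rewrite ge_min lexx.
- by right; rewrite ge_min; apply/orP; right; rewrite ge_min lexx orbT.
Qed.

Lemma int_close (x : R) (i j : int) : `|x - i%:~R| <= 5 / 8 -> `|x - j%:~R| <= 5 / 8 -> i <= j + 1.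
Proof.
rewrite !ler_norml => /andP[h1 h2] /andP[h3 h4].
have : (i%:~R : R) < (j + 2)%:~R by rewrite intrD; lra.
by rewrite ltr_int; lia.
Qed.
End Rounding.

(** * Contracting a loop through runs of grid cells *)

Section Grid.
Implicit Types (u v : C) (K : set C) (f g : R -> C) (p q : int * int).
Variables (V : set C) (b : C) (eta : R).
Hypothesis eta0 : 0 < eta.

Definition xc u : R := Re (u - b) / eta.
Definition yc u : R := Im (u - b) / eta.

Lemma xc_seg u v t : xc (u + rc t * (v - u)) = xc u + t * (xc v - xc u).
Proof.
rewrite /xc (_ : u + rc t * (v - u) - b = (u - b) + rc t * ((v - b) - (u - b))); last by ring.
rewrite ReD cReM Re_rc Im_rc mul0r subr0 ReD ReN; field; exact: lt0r_neq0.
Qed.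

Lemma yc_seg u v t : yc (u + rc t * (v - u)) = yc u + t * (yc v - yc u).
Proof.
rewrite /yc (_ : u + rc t * (v - u) - b = (u - b) + rc t * ((v - b) - (u - b))); last by ring.
rewrite ImD cImM Re_rc Im_rc mul0r addr0 ImD ImN; field; exact: lt0r_neq0.
Qed.

Lemma xc_lip u v : `|xc u - xc v| <= abs (u - v) / eta.
Proof.
have e0 : 0 <= eta^-1 by rewrite invr_ge0 ltW.
rewrite /xc -mulrBl normrM (ger0_norm e0); apply: ler_wpM2r => //.
by rewrite -ReN -ReD (_ : u - b + - (v - b) = u - v); [exact: nRe_le_abs|ring].
Qed.

Lemma yc_lip u v : `|yc u - yc v| <= abs (u - v) / eta.
Proof.
have e0 : 0 <= eta^-1 by rewrite invr_ge0 ltW.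
rewrite /yc -mulrBl normrM (ger0_norm e0); apply: ler_wpM2r => //.
by rewrite -ImN -ImD (_ : u - b + - (v - b) = u - v); [exact: nIm_le_abs|ring].
Qed.

Lemma abs_coord u v : abs (u - v) <= eta * (`|xc u - xc v| + `|yc u - yc v|).
Proof.
have e0 : 0 <= eta^-1 by rewrite invr_ge0 ltW.
have -> : `|xc u - xc v| = `|Re (u - v)| / eta.
 rewrite /xc -mulrBl normrM (ger0_norm e0); congr (`|_| / _).
 by rewrite -ReN -ReD; congr (Re _); ring.
have -> : `|yc u - yc v| = `|Im (u - v)| / eta.
 rewrite /yc -mulrBl normrM (ger0_norm e0); congr (`|_| / _).
 by rewrite -ImN -ImD; congr (Im _); ring.
rewrite -mulrDl mulrC divfK ?gt_eqF//; case: (u - v) => x y /=; exact: abs_Complex.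
Qed.

Definition cell p : set C := [set u | `|xc u - p.1%:~R| <= 2^-1 /\ `|yc u - p.2%:~R| <= 2^-1].

(* Runs and their cells are slightly enlarged, so that a short arc stays in the
  box of the cell of its origin, while boxes that meet are still adjacent. *)
Definition box p : set C := [set u | `|xc u - p.1%:~R| <= 5 / 8 /\ `|yc u - p.2%:~R| <= 5 / 8].

Definition rect (s : int * int * int) : set C :=
 [set u | s.1.1%:~R - 5 / 8 <= xc u /\ xc u <= s.1.2%:~R + 5 / 8 /\ `|yc u - s.2%:~R| <= 5 / 8].

Definition kap u : int * int := (Num.floor (xc u + 2^-1), Num.floor (yc u + 2^-1)).

Lemma cell_kap u : cell (kap u) u.
Proof. by split; exact: floor_half. Qed.

Lemma cell_box p : cell p `<=` box p.
Proof. by move=> u [h1 h2]; split; lra. Qed.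

Lemma convex_rect (s : int * int * int) : convexC (rect s).
Proof.
move=> u v t [u1 [u2 u3]] [v1 [v2 v3]] /andP[t0 t1]; rewrite /rect /= xc_seg yc_seg.
have e1 : xc u + t * (xc v - xc u) = (1 - t) * xc u + t * xc v by ring.
have e2 : yc u + t * (yc v - yc u) - s.2%:~R = (1 - t) * (yc u - s.2%:~R) + t * (yc v - s.2%:~R) by ring.
have t1' : 0 <= 1 - t by lra.
rewrite e1 e2; split; [|split].
- by have := ler_wpM2l t1' u1; have := ler_wpM2l t0 v1; lra.
- by have := ler_wpM2l t1' u2; have := ler_wpM2l t0 v2; lra.
- apply: le_trans (ler_normD _ _) _; rewrite !normrM (ger0_norm t0) (ger0_norm t1').
 by have := ler_wpM2l t1' u3; have := ler_wpM2l t0 v3; lra.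
Qed.

Lemma rect_touch (s t : int * int * int) u : rect s u -> rect t u -> touch s t.
Proof.
move=> [u1 [u2 u3]] [v1 [v2 v3]]; split.
- have : (s.1.1%:~R : R) < (t.1.2 + 2)%:~R by rewrite intrD; lra.
 by rewrite ltr_int; lia.
- have : (t.1.1%:~R : R) < (s.1.2 + 2)%:~R by rewrite intrD; lra.
 by rewrite ltr_int; lia.
- exact: int_close u3 v3.
- exact: int_close v3 u3.
Qed.

Lemma rect_box (s : int * int * int) p : inrun s p -> box p `<=` rect s.
Proof.
case: s p => [[l r] j] [p1 p2] [/= /andP[lp pr] ->] u [/= h1 h2]; rewrite /rect /=.
have e1 : (l%:~R : R) <= p1%:~R by rewrite ler_int.
have e2 : (p1%:~R : R) <= r%:~R by rewrite ler_int.
by move: h1; rewrite ler_norml => /andP[h3 h4]; split; [|split]; lra.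
Qed.

Variables (F : int * int -> Prop) (n : int).
Hypothesis F_near : forall p, F p -> ~~ far n p.
Hypothesis F_box : forall p, F p -> box p `<=` V.
Local Notation inside := (inside F n).
Local Notation outside := (outside F n).
Local Notation isrun := (isrun F n).

(** Every cell containing x is off F, since x is not in V. Two such cells share an edge, or share a
    corner with the cell (p.1, q.2), which also contains x and is adjacent to both; so being outside
    spreads from one to the other. *)
Lemma cells_at x p q : cell p x -> cell q x -> ~ V x -> inside p -> inside q.
Proof.
move=> px qx nV ip oq; apply: ip; have nF o : cell o x -> ~ F o by move=> ox Fo; exact: nV (F_box Fo (cell_box ox)).
have [[p1 p2] [q1 q2]] := (px, qx); have [p1' p2'] := cell_box px; have [q1' q2'] := cell_box qx.
pose o : int * int := (p.1, q.2); have ox : cell o x by split.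
have oo : outside o.
 have [e|ne] := eqVneq p.1 q.1; first by rewrite /o e -surjective_pairing.
 apply: outside_step oq _ (nF o ox); right; split=> //=.
 by have := int_close p1' q1'; have := int_close q1' p1'; lia.
have [e|ne] := eqVneq p.2 q.2; first by rewrite [p]surjective_pairing e.
apply: outside_step oo _ (nF p px); left; split=> //=.
by have := int_close p2' q2'; have := int_close q2' p2'; lia.
Qed.

Lemma closed_cell p : closed (cell p).
Proof.
move=> u clu; have [h|h] := pselect (cell p u) => //; exfalso.
have gap (x y : R) (k : int) : ~ (`|x - k%:~R| <= 2^-1) -> `|y - k%:~R| <= 2^-1 -> 0 < `|x - k%:~R| - 2^-1 <= `|x - y|.
 move=> nx hy; have := ler_normD (x - y) (y - k%:~R); rewrite addrA subrK => hh.
 by move/negP: nx; rewrite -ltNge => nx; apply/andP; split; lra.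
have [hx|hx] := pselect (`|xc u - p.1%:~R| <= 2^-1); last first.
 have e0 : 0 < (`|xc u - p.1%:~R| - 2^-1) * eta by apply: mulr_gt0 => //; move/negP: hx; rewrite -ltNge; lra.
 have [v [v1 v2] vu] := (closurePC _ _).1 clu _ e0; have := xc_lip u v; rewrite absB.
 by move/andP: (gap _ _ _ hx v1) => [_]; move: vu; rewrite -ltr_pdivrMr//; lra.
have hy : ~ (`|yc u - p.2%:~R| <= 2^-1) by move=> hy; apply: h.
have e0 : 0 < (`|yc u - p.2%:~R| - 2^-1) * eta by apply: mulr_gt0 => //; move/negP: hy; rewrite -ltNge; lra.
have [v [v1 v2] vu] := (closurePC _ _).1 clu _ e0; have := yc_lip u v; rewrite absB.
by move/andP: (gap _ _ _ hy v2) => [_]; move: vu; rewrite -ltr_pdivrMr//; lra.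
Qed.

Lemma inside_list : exists s : seq (int * int), forall p, inside p -> p \in s.
Proof.
pose rng := [seq (k%:Z - n)%R | k <- iota 0 (absz n).*2.+1].
exists [seq (i, j) | i <- rng, j <- rng] => -[i j] /inside_near; rewrite /far negb_or -!leNgt => /andP[hi hj].
apply/allpairsP; exists (i, j); split=> //; apply/mapP; rewrite /= in hi hj.
 by exists (absz (i + n)%R); [rewrite mem_iota; lia|change (i = (absz (i + n))%:Z - n); lia].
by exists (absz (j + n)%R); [rewrite mem_iota; lia|change (j = (absz (j + n))%:Z - n); lia].
Qed.

(** When V is open, the part of such a set A off V is compact and relatively open in the complement
    of V, that is, a bounded hole; the condition says that there is none. *)
Definition holefree := forall A : set C, compact A ->
 (forall x, A x -> ~ V x -> nbhs x A) -> A `<=` V.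

(** The union of all inside cells is compact and, by [cells_at], a neighbourhood of each of its
    points off V. *)
Lemma inside_cell p : holefree -> inside p -> cell p `<=` V.
Proof.
move=> hV ip; pose A : set C := \bigcup_(q in [set q | inside q]) cell q.
suff : A `<=` V by move=> AV u pu; apply: AV; exists p.
have [s hs] := inside_list.
have AE : A = \bigcup_(q in [set` [seq q <- s | `[< inside q >]]]) cell q.
 apply/seteqP; split=> u [q iq qu]; exists q => //.
  by rewrite /= mem_filter hs// andbT; apply/asboolP.
 by move: iq; rewrite /= mem_filter => /andP[/asboolP].
have cell_bound q u : cell q u -> abs (u - b) <= eta * (`|q.1%:~R| + `|q.2%:~R| + 1).
 move=> [q1 q2]; apply: le_trans (abs_coord u b) _; apply: ler_wpM2l; first exact: ltW.
 have -> : xc b = 0 by rewrite /xc subrr mul0r.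
 have -> : yc b = 0 by rewrite /yc subrr mul0r.
 rewrite !subr0; have := ler_normD (xc u - q.1%:~R) q.1%:~R; have := ler_normD (yc u - q.2%:~R) q.2%:~R.
 by rewrite !subrK; lra.
apply: hV.
 apply/compactC; split; first by rewrite AE; apply: closed_bigcup; [exact: finite_seq|move=> q _; exact: closed_cell].
 exists (eta * (`|n%:~R| + `|n%:~R| + 1) + abs b) => u [q /inside_near iq qu].
 have := cell_bound q u qu; have := abs_lip u b.
 have [h1 h2] : `|q.1%:~R| <= `|n%:~R| :> R /\ `|q.2%:~R| <= `|n%:~R| :> R.
  by move: iq; rewrite /far negb_or -!leNgt -!intr_norm !ler_int => /andP[]; lia.
 have : eta * (`|q.1%:~R| + `|q.2%:~R| + 1) <= eta * (`|n%:~R| + `|n%:~R| + 1).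
  by apply: ler_wpM2l; [exact: ltW|lra].
 lra.
move=> x [q iq qx] nVx; have [d1 d10 h1] := floor_near (xc x); have [d2 d20 h2] := floor_near (yc x).
have dd : 0 < Num.min d1 d2 * eta by rewrite mulr_gt0// lt_min d10.
apply/nbhsC; exists (Num.min d1 d2 * eta) => // v; rewrite /disc /= -ltr_pdivrMr// lt_min => /andP[v1 v2].
exists (kap v); last exact: cell_kap.
apply: cells_at qx _ nVx iq; split.
 by apply: h1; apply: le_lt_trans (xc_lip _ _) v1.
by apply: h2; apply: le_lt_trans (yc_lip _ _) v2.
Qed.

Lemma inside_box p : holefree -> inside p -> box p `<=` V.
Proof.
move=> hV ip u pu; have [pF|nF] := pselect (F p); first exact: F_box pF _ pu.
have := cell_kap u; move: (kap u) => q qu.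
have [q1 q2] := qu; have [p1 p2] := pu; have [q1' q2'] := cell_box qu.
have [iq|/contrapT oq] := pselect (inside q); first exact: inside_cell iq _ qu.
have step o : outside o -> adj4 o p -> False by move=> oo op; exact: ip (outside_step oo op nF).
have h1 := int_close p1 q1'; have h2 := int_close q1' p1; have h3 := int_close p2 q2'; have h4 := int_close q2' p2.
have [e1|e1] := eqVneq p.1 q.1.
 have [e2|e2] := eqVneq p.2 q.2; last by case: (step _ oq); left; split=> //; move/eqP: e2; lia.
 by case: ip; rewrite [p]surjective_pairing e1 e2 -surjective_pairing.
have [e2|e2] := eqVneq p.2 q.2; first by case: (step _ oq); right; split=> //; move/eqP: e1; lia.
have [oF|noF] := pselect (F (p.1, q.2)); first by apply: (F_box oF); split.
case: (@step (p.1, q.2)); last by left; split=> //=; move/eqP: e2; lia.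
by apply: outside_step oq _ noF; right; split=> //=; move/eqP: e1; lia.
Qed.

Lemma rect_sub (s : int * int * int) : holefree -> isrun s -> rect s `<=` V.
Proof.
case: s => [[l r] j] hV [/= lr hs _ _] u [/= u1 [u2 u3]].
pose i := Num.max l (Num.min r (Num.floor (xc u + 2^-1))).
have := floor_half (xc u); rewrite ler_norml => /andP[f1 f2].
have li : l <= i <= r by rewrite /i; lia.
apply: (inside_box hV (hs i li)); split=> //=; rewrite ler_norml; apply/andP.
have [E|[[E h]|[E h]]] : i = Num.floor (xc u + 2^-1) \/ (i = l /\ Num.floor (xc u + 2^-1) < l) \/
  (i = r /\ r < Num.floor (xc u + 2^-1)) by rewrite /i; lia.
- by rewrite E; split; lra.
- have : (Num.floor (xc u + 2^-1) + 1)%:~R <= (l%:~R : R) by rewrite ler_int; lia.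
 by rewrite E intrD => hh; split; lra.
- have : (r + 1)%:~R <= ((Num.floor (xc u + 2^-1))%:~R : R) by rewrite ler_int; lia.
 by rewrite E intrD => hh; split; lra.
Qed.

(* The closed walk of runs followed by a loop lies in a forest, hence can be
  shortened by merging equal neighbours and cutting off backtracks. *)
Lemma run_loop (m : nat) (tau : nat -> R) (s : nat -> int * int * int) f : holefree -> (0 < m)%N ->
 tau 0%N = 0 -> tau m = 1 -> (forall k : nat, (k < m)%N -> tau k <= tau k.+1) ->
 (forall k : nat, (k < m)%N -> isrun (s k)) -> continuous f -> f 0 = f 1 ->
 (forall k : nat, (k < m)%N -> forall t, tau k <= t <= tau k.+1 -> rect (s k) (f t)) -> nullhom V f.
Proof.
move=> hV; elim/ltn_ind: m tau s f => m IH tau s f m0 tau0 taum hmono hrun cf f01 hrect.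
have mono i k : (i <= k)%N -> (k <= m)%N -> tau i <= tau k.
 elim: k => [|k IHk]; first by rewrite leqn0 => /eqP->.
 rewrite leq_eqVlt => /orP[/eqP->//|]; rewrite ltnS => ik km.
 exact: le_trans (IHk ik (ltnW km)) (hmono k km).
(* Two equal consecutive runs are one run over a longer time interval. *)
have merge (s' : nat -> int * int * int) f' : (forall k : nat, (k < m)%N -> isrun (s' k)) -> continuous f' -> f' 0 = f' 1 ->
  (forall k : nat, (k < m)%N -> forall t, tau k <= t <= tau k.+1 -> rect (s' k) (f' t)) ->
  (exists2 k : nat, (k.+1 < m)%N & s' k = s' k.+1) -> nullhom V f'.
 move=> hr' cf' f01' hrect' [k km E].
 pose j i := if (i <= k)%N then i else i.+1.
 have ja i : (i <= k)%N -> j i = i by rewrite /j => ->.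
 have jb i : (k < i)%N -> j i = i.+1 by rewrite /j ltnNge => /negbTE->.
 have jm i : (i < m.-1)%N -> (j i < m)%N by move=> im; have [h|h] := leqP i k; rewrite ?(ja i h) ?(jb i h); lia.
 apply: (IH m.-1 _ (tau \o j) (s' \o j) f') => //=; try lia.
 - by rewrite jb ?prednK//; lia.
 - move=> i im; apply: mono; last by have := jm _ im; have [h|h] := leqP i.+1 k; rewrite ?(ja i.+1 h) ?(jb i.+1 h); lia.
  by have [h|h] := leqP i k; have [h'|h'] := leqP i.+1 k; rewrite ?(ja i h) ?(jb i h) ?(ja i.+1 h') ?(jb i.+1 h'); lia.
 - by move=> i im; apply: hr'; exact: jm.
 - move=> i im t; have [h|[h|h]] : (i < k \/ i = k \/ k < i)%N by lia.
  + by rewrite (ja i (ltnW h)) (ja i.+1 h) => ht; apply: hrect' => //; lia.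
  + rewrite h (ja k (leqnn k)) (jb k.+1 (ltnSn k)) => /andP[t1 t2].
   have [t3|t3] := leP t (tau k.+1); first by apply: hrect'; [lia|rewrite t1].
   by rewrite E; apply: hrect' => //; rewrite ltW.
  + by rewrite (jb i h) (jb i.+1 (leqW h)) => ht; apply: hrect' => //; lia.
have fV t : 0 <= t <= 1 -> V (f t).
 move=> ht; have [k km ht'] : exists2 k : nat, (k < m)%N & tau k <= t <= tau k.+1.
  have ex j : (0 < j)%N -> (j <= m)%N -> t <= tau j -> exists2 k : nat, (k < m)%N & tau k <= t <= tau k.+1.
   elim: j => [//|j IHj] _ jm tj; have [h|h] := leP t (tau j); last by exists j; rewrite // ltW.
   case: j IHj jm tj h => [|j] IHj jm tj h; last by apply: IHj => //; exact: ltnW.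
   by exists 0%N; rewrite // tj andbT tau0; lra.
  by apply: (ex m) => //; rewrite taum; lra.
 exact: (rect_sub hV (hrun k km)) (hrect k km t ht').
have [em|[em|em]] : (m = 1 \/ m = 2 \/ 3 <= m)%N by lia.
- apply: (nullhom_convex (@convex_rect (s 0%N)) (rect_sub hV (hrun 0%N m0)) cf f01) => t ht.
 by apply: hrect => //; rewrite tau0 -em taum.
- have m2 : (1 < m)%N by rewrite em.
 have t01 : 0 <= tau 1%N <= 1 by rewrite -tau0 -taum hmono//=; apply: mono; lia.
 have e1 : rect (s 1%N) (f 1) by apply: hrect => //; rewrite -em taum; lra.
 have e2 : rect (s 1%N) (f (tau 1%N)) by apply: hrect => //; rewrite -em taum; lra.
 have tau01 : 0 <= tau 1%N by lra.
 apply: (nullhom_straighten (a := 0) (b := tau 1%N) (@convex_rect (s 0%N)) (rect_sub hV (hrun 0%N m0)) cf) => //.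
 + by lra.
 + by move=> t ht; apply: hrect => //; rewrite tau0.
 apply: (merge (fun _ => s 1%N)).
 + by move=> k _; exact: hrun.
 + exact: straighten_continuous.
 + by rewrite !straighten_out//; [right; lra|left].
 + move=> [|[|k]] km t ht; last by lia.
   by apply: straighten_in; [exact: convex_rect|rewrite f01|exact: e2|rewrite -tau0].
  by rewrite straighten_out//; [apply: hrect|right; lra].
 + by exists 0%N.
have [[k km E]|no1] := pselect (exists2 k : nat, (k.+1 < m)%N & s k = s k.+1).
 by apply: (merge s) => //; exists k.
(* Without equal neighbours and backtracks the closed walk contradicts [run_walk_absurd]. At a
   backtrack the excursion into [s k.+1] is straightened there; its chord joins two points of the
   convex rectangle of [s k], so the two runs become equal neighbours. *)
have [[k km E]|no2] := pselect (exists2 k : nat, (k.+2 < m)%N & s k = s k.+2); last first.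
 exfalso; have m1 : (m.-1 < m)%N by lia.
 apply: (@run_walk_absurd F n m.-1 s).
 - by lia.
 - by move=> k km; apply: hrun; lia.
 - move=> k km; apply: (rect_touch (u := f (tau k.+1))); apply: hrect; try lia.
   by rewrite lexx andbT; apply: hmono; lia.
  by rewrite lexx /=; apply: hmono; lia.
 - by move=> k km E; apply: no1; exists k => //; lia.
 - by move=> k km E; apply: no2; exists k => //; lia.
 - apply: (rect_touch (u := f 0)).
   by rewrite f01; apply: hrect => //; rewrite prednK// taum lexx andbT -taum; apply: mono; lia.
  by apply: hrect => //; rewrite tau0 lexx /= -tau0; apply: hmono.
have k1 : (k.+1 < m)%N by lia.
have k0 : (k < m)%N by lia.
have a0 : 0 <= tau k.+1 by rewrite -tau0; apply: mono; lia.
have ab : tau k.+1 <= tau k.+2 by exact: hmono.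
have b1 : tau k.+2 <= 1 by rewrite -taum; apply: mono; lia.
have Ka : rect (s k) (f (tau k.+1)) by apply: hrect => //; rewrite lexx andbT; exact: hmono.
have Kb : rect (s k) (f (tau k.+2)) by rewrite E; apply: hrect => //; rewrite lexx /=; exact: hmono.
apply: (nullhom_straighten (@convex_rect (s k.+1)) (rect_sub hV (hrun _ k1)) cf a0 ab b1 fV (hrect _ k1)).
apply: (merge (fun i => if i == k.+1 then s k else s i)).
- by move=> i im; case: ifP => _; exact: hrun.
- exact: straighten_continuous.
- by rewrite !straighten_out//; [right|left].
- move=> i im t ht; case: eqVneq => [e|ne].
  by apply: straighten_in => //; [exact: convex_rect|rewrite -e].
 rewrite straighten_out//; first exact: hrect.
 have [h|h] : (i < k.+1 \/ k.+2 <= i)%N by move/eqP: ne; lia.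
  left; have := mono i.+1 k.+1 h (ltnW k1); lra.
 right; have := mono k.+2 i h (ltnW im); lra.
- by exists k => //; rewrite eqxx; case: eqVneq => //; lia.
Qed.
End Grid.

(** * Loops in a hole-free open set are null-homotopic *)

Section HoleFree.
Implicit Types (u v : C) (a b : R) (V K : set C) (f g : R -> C).

Lemma unit_cluster (t : nat -> R) : (forall n, 0 <= t n <= 1) -> exists2 x, 0 <= x <= 1 &
 forall d N, 0 < d -> exists2 n, (N <= n)%N & `|t n - x| < d.
Proof.
move=> ht; have [|h hi [l hl]] := @bounded_subsequence (fun n => rc (t n)) 1.
 by move=> n; rewrite abs_rc ler_norml; have := ht n; lra.
have key d N : 0 < d -> exists2 n, (N <= n)%N & `|t n - Re l| < d.
 move=> d0; have [N' hN'] := hl _ d0; exists (h (maxn N N')).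
  by apply: leq_trans (incr_ge _ hi); exact: leq_maxl.
 apply: le_lt_trans (hN' _ (leq_maxr N N')); rewrite -{1}(Re_rc (t _)) -ReN -ReD; exact: nRe_le_abs.
exists (Re l) => //; apply/andP; split; apply: lerF => hx.
 have [n _] := key (- Re l) 0%N ltac:(by rewrite oppr_gt0); rewrite ltr_norml; have := ht n; lra.
have [n _] := key (Re l - 1) 0%N ltac:(by rewrite subr_gt0); rewrite ltr_norml; have := ht n; lra.
Qed.

Lemma path_uniform f e : continuous f -> 0 < e -> exists2 d, 0 < d & forall s t,
 0 <= s <= 1 -> 0 <= t <= 1 -> `|s - t| < d -> abs (f s - f t) < e.
Proof.
move=> cf e0; apply: contrapT => no.
have bad (n : nat) : exists p : R * R, [/\ 0 <= p.1 <= 1, `|p.2 - p.1| < n.+1%:R^-1 & e <= abs (f p.2 - f p.1)].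
 apply: contrapT => no'; apply: no; exists n.+1%:R^-1; first by rewrite invr_gt0 ltr0n.
 move=> s t hs ht st; rewrite ltNge; apply/negP => h; apply: no'; exists (t, s); split => //.
have [p hp] := choice bad; have [n|x _ hx] := @unit_cluster (fun n => (p n).1); first by have [] := hp n.
have e2 : 0 < e / 2 by rewrite divr_gt0.
have := (continuousCP _ _).1 (cf x) _ e2; move=> /nbhs_ballP[d /= d0 hd].
have d2 : 0 < d / 2 by rewrite divr_gt0.
have [N hN] := inv_lt_ex d2; have [n Nn xn] := hx _ N d2.
have [_ h2 h3] := hp n; have := hN n Nn => h4.
have h5 : ball x d (p n).1 by rewrite /ball /= distrC; lra.
have h6 : ball x d (p n).2.
 rewrite /ball /= (distrC x); apply: le_lt_trans (ler_distD (p n).1 _ _) _.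
 by rewrite (splitr d); apply: ltrD => //; exact: lt_trans h2 h4.
have h : abs (f (p n).2 - f (p n).1) < e.
 apply: le_lt_trans (abs_tri (f x) _ _) _; rewrite (absB (f x)) (splitr e).
 by apply: ltrD; [exact: hd _ h6|exact: hd _ h5].
by have := lt_le_trans h h3; rewrite ltxx.
Qed.

Lemma path_lebesgue V f : open V -> continuous f -> (forall t, 0 <= t <= 1 -> V (f t)) ->
 exists2 r, 0 < r & forall t, 0 <= t <= 1 -> disc (f t) r `<=` V.
Proof.
move=> oV cf fV; have cI : compact (f @` `[0, 1]%classic).
 by apply: continuous_compact; [exact: continuous_subspaceT|exact: segment_compact].
have [|r r0 hr] := compact_fatten cI oV.
 by move=> _ [t ht <-]; apply: fV; move: ht; rewrite /= in_itv.
by exists r => // t ht; apply: hr; exists t; rewrite //= in_itv.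
Qed.

Lemma bounded_pairs (k : nat -> int * int) (N : nat) : exists n : int, forall i : nat, (i <= N)%N ->
 `|(k i).1| <= n /\ `|(k i).2| <= n.
Proof.
elim: N => [|N [n hn]].
 by exists (`|(k 0%N).1| + `|(k 0%N).2|) => i; rewrite leqn0 => /eqP->; lia.
exists (n + `|(k N.+1).1| + `|(k N.+1).2|) => i; rewrite leq_eqVlt => /orP[/eqP->|/hn]; last by lia.
by have [] := hn 0%N (leq0n _); lia.
Qed.

Theorem nullhom_holefree V f : open V -> holefree V -> continuous f -> f 0 = f 1 ->
 (forall t, 0 <= t <= 1 -> V (f t)) -> nullhom V f.
Proof.
move=> oV hV cf f01 fV; have [r r0 hr] := path_lebesgue oV cf fV.
(* With cells of side eta, a box reaches less than 8 eta from any point of its cell, hence stays in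
   V. The sampling times are so close that f moves by less than eta / 8, the excess of a box over
   its cell. *)
have [eta eta0 re] : exists2 eta, 0 < eta & r = 8 * eta by exists (r / 8); [rewrite divr_gt0|field].
have e8 : 0 < eta / 8 by rewrite divr_gt0.
have [d d0 hd] := path_uniform cf e8; have [N' hN'] := inv_lt_ex d0.
have := hN' N' (leqnn _); move: {hN'}(N'.+1) (ltn0Sn N') => N N0 Nd.
have N0' : 0 < N%:R :> R by rewrite ltr0n.
pose fk (k : nat) := f (k%:R / N%:R); pose kp k := kap (f 0) eta (fk k).
have hk01 (k : nat) : (k <= N)%N -> 0 <= (k%:R / N%:R : R) <= 1.
 by move=> kN; rewrite divr_ge0//= ler_pdivrMr// mul1r ler_nat.
pose F p := exists2 k : nat, (k <= N)%N & p = kp k.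
have [n hn] := bounded_pairs kp N.
have F_near p : F p -> ~~ far n p by move=> [k kN ->]; have [h1 h2] := hn k kN; rewrite /far negb_or -!leNgt h1.
have F_box p : F p -> box (f 0) eta p `<=` V.
 move=> [k kN ->] u [h3 h4]; apply: (hr _ (hk01 k kN)); rewrite /disc /= re -/(fk k).
 have [h1 h2] := cell_kap (f 0) eta (fk k); rewrite -/(kp k) in h1 h2.
 apply: le_lt_trans (abs_coord (f 0) eta0 _ _) _; rewrite mulrC ltr_pM2r//.
 have := ler_distD (kp k).1%:~R (xc (f 0) eta u) (xc (f 0) eta (fk k)).
 have := ler_distD (kp k).2%:~R (yc (f 0) eta u) (yc (f 0) eta (fk k)).
 rewrite (distrC (kp k).1%:~R) (distrC (kp k).2%:~R).
 by move: h1 h2 h3 h4; clear; lra.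
have runs (k : nat) : exists s : int * int * int, isrun F n s /\ inrun s (kp (minn k N)).
 have Fk : F (kp (minn k N)) by exists (minn k N) => //; exact: geq_minr.
 by have [s s1 s2] := run_exists (F_inside F_near Fk); exists s.
have [s hs] := choice runs.
apply: (run_loop (n := n) eta0 F_box (m := N) (tau := fun j => j%:R / N%:R) (s := s) hV) => //.
- by rewrite mul0r.
- by rewrite divff// gt_eqF.
- by move=> k _; rewrite ler_pM2r ?invr_gt0// ler_nat.
- by move=> k _; have [] := hs k.
move=> k kN t /andP[t1 t2]; have [_ ik] := hs k; rewrite (minn_idPl (ltnW kN)) in ik.
have k01 := hk01 k (ltnW kN); have k11 := hk01 k.+1 kN.
have ft : abs (f t - fk k) / eta < 8^-1.
 rewrite ltr_pdivrMr// mulrC; apply: hd => //; first by move: t1 t2 k01 k11; clear; lra.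
 rewrite ger0_norm ?subr_ge0//; apply: le_lt_trans Nd.
 by move: t2; rewrite -natr1 mulrDl mul1r; clear; lra.
have [h1 h2] := cell_kap (f 0) eta (fk k); rewrite -/(kp k) in h1 h2.
have h3 := le_lt_trans (xc_lip (f 0) eta0 (f t) (fk k)) ft.
have h4 := le_lt_trans (yc_lip (f 0) eta0 (f t) (fk k)) ft.
apply: (rect_box ik); split.
 by apply: le_trans (ler_distD (xc (f 0) eta (fk k)) _ _) _; move: h1 h3; clear; lra.
by apply: le_trans (ler_distD (yc (f 0) eta (fk k)) _ _) _; move: h2 h4; clear; lra.
Qed.

End HoleFree.

(** * Path connectedness of plane domains *)

Section PathConnected.
Implicit Types (u v w : C) (V K : set C) (f : R -> C).

Definition joined V x y := exists f, [/\ continuous f, f 0 = x, f 1 = y & forall t, 0 <= t <= 1 -> V (f t)].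

Lemma joined_extend V K x z w : convexC K -> K `<=` V -> K z -> K w -> joined V x z -> joined V x w.
Proof.
move=> cK KV Kz Kw [f [cf f0 f1 fV]].
have cl (a : R) : continuous (fun t : R => clamp 0 1 (2 * t + a)).
 by apply: cont_clamp; apply: cont_affine => t; exact: cvg_id.
exists (fun t => f (clamp 0 1 (2 * t + 0)) + rc (clamp 0 1 (2 * t + -1)) * (w - z)); split.
- apply: contD; last by apply: contM; [apply: cont_rc; exact: cl|exact: contC].
 by move=> t; apply: continuous_comp; [exact: cl|exact: cf].
- have -> : clamp 0 1 (2 * 0 + 0 : R) = 0 by apply: clamp_le; lra.
 have -> : clamp 0 1 (2 * 0 + -1 : R) = 0 by apply: clamp_le; lra.
 by rewrite rc0 mul0r addr0.
- have -> : clamp 0 1 (2 * 1 + 0 : R) = 1 by apply: clamp_ge; lra.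
 have -> : clamp 0 1 (2 * 1 + -1 : R) = 1 by apply: clamp_ge; lra.
 by rewrite f1 rc1 mul1r addrC subrK.
- move=> t ht; have [t2|t2] := leP t 2^-1.
  have -> : clamp 0 1 (2 * t + -1) = 0 by apply: clamp_le; lra.
  by rewrite rc0 mul0r addr0; apply: fV; apply: clamp_in; lra.
 have -> : clamp 0 1 (2 * t + 0) = 1 by apply: clamp_ge; lra.
 by rewrite f1; apply: KV; apply: (cK _ _ _ Kz Kw); apply: clamp_in; lra.
Qed.

Lemma joined_connected V x y : open V -> connected V -> V x -> V y -> joined V x y.
Proof.
move=> oV cV Vx Vy; have oV' := (openPC V).1 oV.
suff : V `<=` [set z | V z /\ joined V x z] by move=> /(_ y Vy)[].
apply: (@connected_open_split _ V _ [set z | V z /\ ~ joined V x z] cV).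
- apply/openPC => z [Vz jz]; have [r r0 hr] := oV' z Vz; exists r => // w wz; split; first exact: hr.
 exact: (joined_extend (@convex_disc z r) hr (disc_center z r0) wz jz).
- apply/openPC => z [Vz jz]; have [r r0 hr] := oV' z Vz; exists r => // w wz; split; first exact: hr.
 by move=> jw; apply: jz; exact: (joined_extend (@convex_disc z r) hr wz (disc_center z r0) jw).
- by move=> z Vz; have [h|h] := pselect (joined V x z); [left|right].
- by move=> z _ [_ h] [_ h'].
- exists x; split=> //; split=> //; exists (fun _ => x); split=> //; exact: contC.
Qed.

End PathConnected.

(** * Transfer to the sphere by inversion *)

Section Inversion.
Implicit Types (u v w : C) (x y : S) (U : set S) (A : set C).
Variable e : C.

(** This chart covers the sphere without the point e and puts infinity at 0, so that a domain around
    infinity missing e becomes a plane domain. *)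
Definition from_chart u : S := if u == 0 then infty else Some (e + u^-1).
Definition to_chart x : C := if x is Some z then (z - e)^-1 else 0.

Lemma from_chartK : cancel from_chart to_chart.
Proof.
move=> u; rewrite /from_chart; case: eqVneq => [->//|u0] /=.
by rewrite addrAC subrr add0r invrK.
Qed.

Lemma to_chartK x : x <> Some e -> from_chart (to_chart x) = x.
Proof.
case: x => [z|] xe; rewrite /from_chart /=; last by rewrite eqxx.
have ze : z - e != 0 by rewrite subr_eq0; apply/eqP => h; apply: xe; rewrite h.
by rewrite invr_eq0 (negPf ze) invrK addrC subrK.
Qed.

Lemma from_chart_neq u : from_chart u <> Some e.
Proof.
rewrite /from_chart; case: eqVneq => // u0 [] h.
have : u^-1 = 0 by apply: (addrI e); rewrite addr0.
by move/eqP; rewrite invr_eq0 (negPf u0).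
Qed.

Lemma inv_near u r : u != 0 -> 0 < r -> \forall v \near u, abs (v^-1 - u^-1) < r.
Proof. by move=> u0 r0; have := (continuousCP _ _).1 (@inv_continuous C u u0) r r0. Qed.

Lemma from_chart_continuous : continuous from_chart.
Proof.
move=> u N; rewrite /from_chart; case: eqVneq => [->|u0] /=.
 move=> /nbhs_infty[Ni [M hM]]; apply/nbhsC.
 have p0 : 0 < `|M| + abs e + 1 by have := abs_ge0 e; have := normr_ge0 M; lra.
 exists (`|M| + abs e + 1)^-1; first by rewrite invr_gt0.
 move=> v; rewrite /disc /= subr0 => hv; case: eqVneq => // v0; apply: hM.
 have hv' : `|M| + abs e + 1 < abs v^-1.
  by rewrite absV -(invrK (`|M| + _ + 1)) ltf_pV2 ?posrE ?invr_gt0// abs_gt0.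
 have := abs_lip v^-1 (e + v^-1); rewrite (_ : v^-1 - (e + v^-1) = - e) ?absN; last by ring.
 by have := ler_norm M; lra.
move=> /nbhs_some[r r0 hr]; apply: filterS2 (inv_near u0 r0) (nbhs_disc u (r := abs u) _); last by rewrite abs_gt0.
move=> v hv; rewrite /disc /= => hv'; case: eqVneq => [v0|v0].
 by move: hv'; rewrite v0 sub0r absN ltxx.
by apply: hr; rewrite (_ : e + v^-1 - (e + u^-1) = v^-1 - u^-1)//; ring.
Qed.

Lemma to_chart_near x (N : set C) : x <> Some e -> nbhs (to_chart x) N -> nbhs x (to_chart @^-1` N).
Proof.
case: x => [z|] xe /nbhsC[r r0 hr].
 have ze : z - e != 0 by rewrite subr_eq0; apply/eqP => h; apply: xe; rewrite h.
 have [d d0 hd] := (nbhsC _ _).1 (inv_near ze r0); apply/nbhs_some; exists d => // w wz.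
 by apply: hr; apply: hd; rewrite /disc /= (_ : w - e - (z - e) = w - z)//; ring.
apply/nbhs_infty; split; first by apply: hr; exact: disc_center.
exists (abs e + r^-1) => w hw; apply: hr; rewrite /disc /= subr0 absV.
have h : r^-1 < abs (w - e) by have := abs_lip w e; lra.
by rewrite -(invrK r) ltf_pV2 ?posrE ?invr_gt0//; apply: lt_trans h; rewrite invr_gt0.
Qed.

Lemma to_chart_continuous x : x <> Some e -> {for x, continuous to_chart}.
Proof. by move=> xe N; exact: to_chart_near. Qed.

Section Chart.
Variable U : set S.
Hypotheses (oU : open U) (cU : connected U) (cE : connected (~` U)) (eU : ~ U (Some e)).
Local Notation V := (from_chart @^-1` U).

Lemma U_neq x : U x -> x <> Some e. Proof. by move=> Ux xe; apply: eU; rewrite -xe. Qed.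

Lemma open_chart : open V.
Proof. by apply: open_comp => // u _; exact: from_chart_continuous. Qed.

Lemma connected_chart : connected V.
Proof.
have -> : V = to_chart @` U.
 apply/seteqP; split=> [u Uu|_ [x Ux <-]]; first by exists (from_chart u) => //; exact: from_chartK.
 by rewrite /= to_chartK//; exact: U_neq.
apply: connected_continuous_connected => //; apply: continuous_in_subspaceT => x /set_mem Ux.
by apply: to_chart_continuous; exact: U_neq.
Qed.

(** A bounded hole in the chart would be a relatively open and closed part of the complement of U
    that misses e. *)
Lemma holefree_chart : holefree V.
Proof.
move=> A cA hA u Au; apply: contrapT => nV.
pose U1 := [set x | x <> Some e /\ A° (to_chart x)]; pose U2 := ~` (from_chart @` A).
have clA : closed (from_chart @` A).
 apply: compact_closed; first exact: hausdorff_sphere.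
 by apply: continuous_compact cA; apply: continuous_subspaceT; exact: from_chart_continuous.
suff : ~` U `<=` U2 by move=> /(_ (from_chart u) nV); apply; exists u.
apply: (@connected_open_split _ (~` U) U2 U1 cE).
- exact: closed_openC.
- rewrite openE => x [xe Ax]; have n1 : nbhs x (to_chart @^-1` A°).
  by apply: to_chart_near xe _; exact: nbhs_interior.
 have n2 : nbhs x (~` [set Some e]); last first.
  by apply: filterS2 n1 n2 => y h1 h2; split; [exact: h2|exact: h1].
 apply: open_nbhs_nbhs; split => //.
 by apply: closed_openC; apply: accessible_closed_set1; apply: hausdorff_accessible; exact: hausdorff_sphere.
- move=> x Ex; have [[v Av vx]|h] := pselect ((from_chart @` A) x); [right|by left].
 rewrite -vx; split; first exact: from_chart_neq.
 by rewrite from_chartK; apply: hA => //; rewrite /= vx.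
- move=> x _ n2 [xe Ax]; apply: n2; exists (to_chart x); last exact: to_chartK.
 exact: interior_subset Ax.
- by exists (Some e); split=> // -[v _]; exact: from_chart_neq.
Qed.

Lemma within_clamp (f : R -> S) : {within `[0, 1]%classic, continuous f} -> continuous (fun t : R => f (clamp 0 1 t)).
Proof.
move=> /subspace_continuousP cf t N hN.
have h01 : `[0, 1]%classic (clamp 0 1 t) by rewrite /= in_itv /=; apply: clamp_in; lra.
have cc := @cont_clamp R (fun t : R => t) 0 1 (fun t : R => @cvg_id _ _).
have h : nbhs t [set s | `[0, 1]%classic (clamp 0 1 s) -> N (f (clamp 0 1 s))] := (cc t _ (cf _ h01 N hN)).
change (nbhs t [set s | N (f (clamp 0 1 s))]); apply: filterS h => s; apply.
by rewrite /= in_itv /=; apply: clamp_in; lra.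
Qed.

Theorem simply_connected_of_chart : U !=set0 -> simply_connected R U.
Proof.
move=> U0; split=> //.
 move=> x y Ux Uy; have ux := U_neq Ux; have uy := U_neq Uy.
 have [||f [cf f0 f1 fV]] := @joined_connected V (to_chart x) (to_chart y) open_chart connected_chart.
 - by rewrite /= to_chartK.
 - by rewrite /= to_chartK.
 exists (from_chart \o f); split; [split| |].
 - by apply: continuous_subspaceT => t; apply: continuous_comp; [exact: cf|exact: from_chart_continuous].
 - by move=> _ [t ht <-]; apply: fV; move: ht; rewrite /= in_itv.
 - by rewrite /= f0 to_chartK.
 - by rewrite /= f1 to_chartK.
move=> f [cf fU] f01; pose F (t : R) := f (clamp 0 1 t).
have h01 (t : R) : 0 <= clamp 0 1 t <= 1 by apply: clamp_in; lra.
have FU t : U (F t) by apply: fU; exists (clamp 0 1 t) => //; rewrite /= in_itv /=.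
have FE t : 0 <= t <= 1 -> F t = f t by move=> ht; rewrite /F clamp_id.
have F0 : F 0 = f 0 by apply: FE; lra.
have F1 : F 1 = f 1 by apply: FE; lra.
have cF : continuous F by exact: within_clamp.
have cT : continuous (to_chart \o F).
 by move=> t; apply: continuous_comp; [exact: cF|apply: to_chart_continuous; exact: U_neq].
have FK t : from_chart (to_chart (F t)) = F t by apply: to_chartK; exact: U_neq.
have [||H [cH HV H1 H2]] := nullhom_holefree open_chart holefree_chart cT.
- by rewrite /= F0 F1 f01.
- by move=> t _; rewrite /= FK.
exists (from_chart \o H); split.
- by apply: continuous_subspaceT => p; apply: continuous_comp; [exact: cH|exact: from_chart_continuous].
- by move=> _ [[s t] [hs ht] <-]; apply: HV; [move: hs|move: ht]; rewrite /= in_itv.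
- move=> t; rewrite in_itv /= => ht; have [-> ->] := H1 t ht.
 by rewrite /= !FK FE// F0.
- move=> s; rewrite in_itv /= => hs; have [-> ->] := H2 s hs.
 by rewrite /= !FK F0.
Qed.

End Chart.
End Inversion.

(** * Filled-in pieces of a semigroup with bounded planar postcritical set *)

Section SemigroupClass.
Implicit Types (a b u v : C) (x y o : S) (p q g f h w Q : {poly C}).
Variable G : set {poly C}.
Hypothesis hG : classG G.
Local Notation P := (finite_postcritical G).
Local Notation J := (julia_set G).
Local Notation comp := (connected_component (julia_set G)).
Local Notation Kh := (Khat G).
Local Notation Finf := (Finfty G).

Lemma class_comp : comp_closed G.
Proof. by have [[A [_ _ ->]] _ _] := hG; exact: generated_comp. Qed.

Lemma class_degree g : G g -> (2 <= degree g)%N.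
Proof. by have [_ h _] := hG; exact: h. Qed.

Lemma class_nonconstant g : G g -> nonconstant g.
Proof. by move=> /class_degree dg; apply: degree_nonconstant; exact: leq_trans dg. Qed.

Lemma postP z : P z <-> forall e, 0 < e -> exists g c,
 [/\ G g, g^`().[c] = 0 & abs (g.[c] - z) < e].
Proof.
split=> [Pz e e0|H B /nbhs_some[r r0 hr]].
 have [|y [[g Gg [x gx <-]] /=]] := Pz [set y | if y is Some w then abs (w - z) < e else False].
  by apply/nbhs_some; exists e.
 by case: x gx => [c|//] gc ec; exists g, c.
have [g [c [Gg gc cz]]] := H r r0; exists (Some g.[c]); split; last exact: hr.
by exists g => //; exists (Some c).
Qed.

Lemma crit_post g c : G g -> g^`().[c] = 0 -> P g.[c].
Proof. by move=> Gg gc; apply/postP => e e0; exists g, c; rewrite subrr abs0. Qed.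

Lemma closed_post : closed P.
Proof.
move=> z clz; apply/postP => e e0; have e2 : 0 < e / 2 by rewrite divr_gt0.
have /closurePC/(_ _ e2)[w /postP/(_ _ e2)[g [c [Gg gc gw]]] wz] := clz.
by exists g, c; split=> //; have := abs_tri w g.[c] z; lra.
Qed.

Lemma critical_point_exists g : (2 <= degree g)%N -> exists c, g^`().[c] = 0.
Proof.
move=> d2; have : size g^`() != 1%N.
 apply/eqP => s1; have /leq_sizeP H : (size g^`() <= 1)%N by rewrite s1.
 have d1 : (0 < degree g)%N by exact: leq_trans d2.
 have := H (degree g).-1 ltac:(by rewrite -ltnS prednK).
 rewrite coef_deriv prednK// => /eqP.
 rewrite mulrn_eq0 -lead_coefE lead_coef_eq0; apply/negP; rewrite negb_or.
 by apply/andP; split; [rewrite -lt0n|apply: contraTneq d2 => ->; rewrite /degree size_poly0].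
by move=> /closed_rootP[c /rootP]; exists c.
Qed.

Lemma class_nonempty : exists g, G g.
Proof.
have [[A [[g Ag] _ ->]] _ _] := hG; exists g; exact: sub_generated.
Qed.

Lemma post_nonempty : exists z, P z.
Proof.
have [g Gg] := class_nonempty; have [c gc] := critical_point_exists (class_degree Gg).
by exists g.[c]; exact: crit_post.
Qed.

Lemma post_horner g z : G g -> P z -> P g.[z].
Proof.
move=> Gg /postP Pz; apply/postP => e e0; have [d d0 hd] := horner_near g z e0.
have [f [c [Gf fc cz]]] := Pz d d0; exists (g \Po f), c; split.
- exact: class_comp.
- by rewrite deriv_comp hornerM fc mulr0.
- by rewrite horner_comp; exact: hd.
Qed.

Lemma post_bound : exists2 M, 0 < M & forall z, P z -> abs z < M.
Proof.
have [_ _ /bounded_setC[M hM]] := hG; exists (`|M| + 1); first by rewrite ltr_wpDl.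
by move=> z /hM; have := ler_norm M; lra.
Qed.

Lemma escape_post h : G h -> exists M, [/\ escape h M, 0 < M & forall z, P z -> abs z < M].
Proof.
move=> Gh; have [M0 M00 hM0] := post_bound; have [M1 [M11 hM1]] := escape_radius (class_degree Gh).
exists (Num.max M0 M1); split.
- split; first by rewrite le_max M11 orbT.
 by move=> z; rewrite ge_max => /andP[_]; exact: hM1.
- by rewrite lt_max M00.
- by move=> z /hM0; rewrite lt_max => ->.
Qed.

Definition Gid w := w = 'X \/ G w.

Lemma gid1 : Gid 'X.
Proof. by left. Qed.

Lemma Gid_comp g w : G g -> Gid w -> G (g \Po w).
Proof. by move=> Gg [->|Gw]; [rewrite comp_polyXr|exact: class_comp]. Qed.

Lemma Gid_compl g w : G g -> Gid w -> G (w \Po g).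
Proof. by move=> Gg [->|Gw]; [rewrite comp_polyX|exact: class_comp]. Qed.

Lemma Gid_nonconstant w : Gid w -> nonconstant w.
Proof. by move=> [->|/class_nonconstant//]; rewrite /nonconstant size_polyX. Qed.

Lemma Gid_post w z : Gid w -> P z -> P w.[z].
Proof. by move=> [->|Gw]; [rewrite hornerX|exact: post_horner]. Qed.

Lemma piter_comp_in h w n : G h -> Gid w -> G (piter h n.+1 \Po w).
Proof. by move=> Gh Gw; apply: Gid_comp => //; apply: piter_in => //; exact: class_comp. Qed.

(* The sets [w^-1(K(h))] and [w^-1(J(h))] are locked: comparing two instances *)
(* of [filled_julia] up to conversion is prohibitively slow.                  *)
Fact piece_key : unit. Proof. exact: tt. Qed.
Definition pc h w : set C := locked_with piece_key [set z | filled_julia h w.[z]].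
Definition bd h w : set C := locked_with piece_key (boundary (pc h w)).

Lemma pc_def h w : pc h w = [set z | filled_julia h w.[z]].
Proof. by rewrite /pc locked_withE. Qed.
Lemma bd_def h w : bd h w = boundary (pc h w).
Proof. by rewrite /bd locked_withE. Qed.

Lemma pcP h w M z : escape h M ->
 pc h w z <-> forall n, abs (piter h n.+1 \Po w).[z] <= M.
Proof.
move=> eM; rewrite pc_def /=; split=> [/(filled_juliaP _ eM) H n|H]; first by rewrite horner_comp; exact: H.
apply/(filled_juliaP _ eM) => -[|n]; last by rewrite -horner_comp.
rewrite hornerX; apply: lerF => Mw; have := H 0%N; rewrite piter1 horner_comp.
by have := eM.2 _ (ltW Mw); have := eM.1; lra.
Qed.

Section Piece.
Variables h w : {poly C}.
Hypotheses (Gh : G h) (Gw : Gid w).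

Lemma closed_pc : closed (pc h w).
Proof.
rewrite pc_def; apply: (@closed_comp _ _ (fun z : C => w.[z]) (filled_julia h)) => [z _|].
 exact: horner_continuousC.
exact: closed_filled_julia (class_degree Gh).
Qed.

Lemma bdE z : bd h w z <-> boundary (filled_julia h) w.[z].
Proof.
have ck := closed_filled_julia (class_degree Gh).
rewrite bd_def (boundaryE closed_pc) (boundaryE ck) pc_def.
split=> -[pz nz]; (split; first exact: pz); move=> /interiorPC[r r0 hr]; apply: nz; apply/interiorPC.
 have [d d0 hd] := horner_near w z r0; exists d; first exact: d0.
 by move=> u uz; apply: hr; exact: hd.
have [d d0 hd] := horner_open_mapping z (Gid_nonconstant Gw) r0; exists d; first exact: d0.
by move=> u /hd[v vz <-]; exact: hr.
Qed.

Lemma compact_pc : compact (pc h w).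
Proof.
have [M [eM _ _]] := escape_post Gh; apply/compactC; split; first exact: closed_pc.
have [B hB] := @sublevel_bounded (piter h 1 \Po w) M (class_nonconstant (piter_comp_in 0 Gh Gw)).
by exists B => z /(pcP _ _ eM)/(_ 0%N)/hB.
Qed.

Lemma post_pc : P `<=` pc h w.
Proof.
move=> z Pz; have [M [eM _ hM]] := escape_post Gh; apply/(pcP _ _ eM) => n.
by apply/ltW/hM/post_horner => //; exact: piter_comp_in.
Qed.

Lemma bd_pc z : bd h w z -> pc h w z.
Proof. by rewrite bd_def (boundaryE closed_pc); case. Qed.

Lemma level_pc M : escape h M -> forall O, open O -> pc h w `<=` O -> exists N, forall n,
 (N <= n)%N -> [set z | abs (piter h n.+1 \Po w).[z] <= M] `<=` O.
Proof.
move=> eM O oO pO.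
apply: (@nested_compact_subset _ (fun n => [set z | abs (piter h n.+1 \Po w).[z] <= M])) => //.
- move=> n; apply/compactC; split; first exact: closed_sublevel.
 by apply: sublevel_bounded; apply: class_nonconstant; exact: piter_comp_in.
- move=> n z /=; rewrite piterS !horner_comp => h1; apply: lerF => h2.
 by have := eM.2 _ (ltW h2); have := eM.1; lra.
- by move=> z H; apply: pO; apply/(pcP _ _ eM) => n; exact: H.
Qed.

(** The piece is the decreasing intersection of the lemniscates |h^(n+1) o w| <= M. Their critical
    values lie in P*(G), inside the disc of radius M, so each lemniscate is connected. *)
Lemma connected_pc : connected (pc h w).
Proof.
have [M [eM M0 hM]] := escape_post Gh.
have -> : pc h w = \bigcap_n [set z | abs (piter h n.+1 \Po w).[z] <= M].
 apply/seteqP; split=> z; first by move/(pcP _ _ eM) => H n _; exact: H.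
 by move=> H; apply/(pcP _ _ eM) => n; exact: H.
apply: connected_nestedC => n.
- apply/compactC; split; first exact: closed_sublevel.
 by apply: sublevel_bounded; apply: class_nonconstant; exact: piter_comp_in.
- move=> z /=; rewrite piterS !horner_comp => h1; apply: lerF => h2.
 by have := eM.2 _ (ltW h2); have := eM.1; lra.
- have Gn := piter_comp_in n Gh Gw; apply: connected_lemniscate => //.
  exact: class_nonconstant.
 by move=> c /(crit_post Gn)/hM.
Qed.

Lemma bd_far a e : bd h w a -> 0 < e -> exists2 z, abs (z - a) < e & ~ pc h w z.
Proof.
rewrite bd_def (boundaryE closed_pc).
move=> [_ ni] e0; apply: contrapT => no; apply: ni; apply/interiorPC; exists e => // z za.
by apply: contrapT => nz; apply: no; exists z.
Qed.

(** The level curves |h^(n+1) o w| = M are connected, miss the piece, approach every boundary point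
    and end up in any neighbourhood of the piece. A separation of the boundary would separate one of
    them. *)
Lemma connected_bd : connected (bd h w).
Proof.
have [M [eM M0 hM]] := escape_post Gh.
pose L n : set C := [set z | abs (piter h n.+1 \Po w).[z] = M].
have cL n : connected (L n).
 have Gn := piter_comp_in n Gh Gw; apply: connected_level => //.
  exact: class_nonconstant.
 by move=> c /(crit_post Gn)/hM.
have LK n z : L n z -> ~ pc h w z.
 rewrite /L /= horner_comp => Lz /(pcP _ _ eM)/(_ n.+1); rewrite horner_comp horner_piterS.
 by have := eM.2 (piter h n.+1).[w.[z]]; rewrite Lz lexx => /(_ isT); lra.
have Lnear a e : bd h w a -> 0 < e -> exists N, forall n, (N <= n)%N -> exists2 z, L n z & abs (z - a) < e.
 move=> ba e0; have [b be nb] := bd_far ba e0.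
 have nb' : ~ filled_julia h w.[b] by move: nb; rewrite pc_def.
 have [N hN] := not_filled_far M (class_degree Gh) nb'; exists N => n Nn.
 have aM : abs (piter h n.+1 \Po w).[a] <= M by apply: (pcP _ _ eM).1; exact: bd_pc.
 have bM : M <= abs (piter h n.+1 \Po w).[b] by rewrite horner_comp; apply: hN; exact: leqW.
 have [z ze zM] := connected_IVT (@connected_disc a e) (@abs_horner_continuous _)
  (disc_center a e0) (be : disc a e b) aM bM.
 by exists z.
have cb : closed (bd h w) by rewrite bd_def; exact: closed_boundary.
apply: contrapT => /(not_connected_closed cb)[A [B [cA cB E AB0 [[a Aa] [b Bb]]]]].
have kA : compact A by apply: subclosed_compact cA compact_pc _ => u Au; apply: bd_pc; rewrite E; left.
have [U [V [oU oV AU BV UV0]]] := separate_compactC kA cB AB0.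
have [N hN] : exists N, forall n, (N <= n)%N -> L n `<=` U `|` V.
 have oO : open ((pc h w)° `|` (U `|` V)) by apply: openU; [exact: open_interior|exact: openU].
 have [|N hN] := level_pc eM oO.
  move=> z pz; have [iz|nz] := pselect ((pc h w)° z); [by left|right].
  have : bd h w z by rewrite bd_def (boundaryE closed_pc).
  by rewrite E => -[/AU|/BV]; [left|right].
 exists N => n /hN H z Lz; case: (H z); [by rewrite /= Lz|move=> /interior_subset|by []].
 by move/(LK _ _ Lz).
have ba : bd h w a by rewrite E; left.
have bb : bd h w b by rewrite E; right.
have /openPC/(_ a (AU a Aa))[r1 r10 h1] := oU.
have /openPC/(_ b (BV b Bb))[r2 r20 h2] := oV.
have [N1 hN1] := Lnear a r1 ba r10; have [N2 hN2] := Lnear b r2 bb r20.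
pose n := maxn N (maxn N1 N2).
have [z1 Lz1 z1a] := hN1 n ltac:(by rewrite !leq_max leqnn !orbT).
have [z2 Lz2 z2b] := hN2 n ltac:(by rewrite !leq_max leqnn !orbT).
have LU : L n `<=` U.
 apply: (connected_open_split (cL n) oU oV); first by apply: hN; rewrite leq_max leqnn.
  by move=> u _; exact: (disjE UV0).
 by exists z1; split=> //; exact: h1.
have : (U `&` V) z2 by split; [exact: LU|exact: h2].
by rewrite UV0.
Qed.

Lemma bd_nonempty : bd h w !=set0.
Proof.
apply/set0P/eqP => b0; have [z Pz] := post_nonempty; have [B hB] := ((compactC _).1 compact_pc).2.
have cT : connected [set: C] by apply: (@star_connected _ 0).
have /(_ (rc (`|B| + 1)) I)/interior_subset/hB : [set: C] `<=` (pc h w)°.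
 apply: (boundary_crossing cT); last by rewrite setTI -bd_def.
 by exists z; split=> //; exact: post_pc.
rewrite abs_rcE ?addr_ge0//.
by have := ler_norm B; lra.
Qed.

Lemma bd_julia z : bd h w z -> J (Some z).
Proof.
move=> /bdE bz Fz; have d2 := class_degree Gh.
have : julia1 h (Some w.[z]) by rewrite (julia1E d2); exists w.[z].
apply; apply: (fatou_mono (generated1_sub class_comp Gh)).
case: Gw bz => [->|Gw'] bz; first by rewrite hornerX.
by apply: fatou_horner => //; [exact: class_comp|exact: class_nonconstant].
Qed.

Lemma compact_in_pc (K : set C) : compact K -> boundary K `<=` pc h w -> K `<=` pc h w.
Proof.
move=> cK bK z Kz; have [M [eM _ _]] := escape_post Gh; apply/(pcP _ _ eM) => n.
by apply: (maximum_principle cK) => // u /bK/(pcP _ _ eM).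
Qed.

End Piece.

Lemma bd_comp h w g z : G h -> Gid w -> G g -> bd h (w \Po g) z <-> bd h w g.[z].
Proof.
move=> Gh Gw Gg; have Gwg : Gid (w \Po g) by right; exact: Gid_compl.
by split=> [/(bdE Gh Gwg)|/(bdE Gh Gw) H]; [rewrite horner_comp => /(bdE Gh Gw)|apply/(bdE Gh Gwg); rewrite horner_comp].
Qed.

(** If the second boundary misses the first piece, this piece, which meets the second one in P*(G),
    lies in its interior. Otherwise the second boundary lies inside the first piece, and the maximum
    principle carries the whole second piece along. *)
Lemma pc_nested h w h' w' : G h -> Gid w -> G h' -> Gid w' ->
 bd h w `&` bd h' w' = set0 -> pc h w `<=` (pc h' w')° \/ pc h' w' `<=` (pc h w)°.
Proof.
move=> Gh Gw Gh' Gw' b0; have [p Pp] := post_nonempty.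
have [[z [bz pz]]|no] := pselect (bd h' w' `&` pc h w !=set0); last first.
 left; apply: (boundary_crossing (connected_pc Gh Gw)).
  by exists p; split; exact: post_pc.
 apply: contrapT => /eqP/set0P[z [pz bz]]; apply: no; rewrite -bd_def in bz.
 by exists z.
right; have bi : bd h' w' `<=` (pc h w)°.
 apply: boundary_crossing; [exact: connected_bd|by exists z|].
 by rewrite -bd_def setIC.
have sub : pc h' w' `<=` pc h w.
 apply: compact_in_pc => //; [exact: compact_pc|rewrite -bd_def].
 by move=> u /bi/interior_subset.
move=> u pu; have [iu|nu] := pselect ((pc h' w')° u); last first.
 by apply: bi; rewrite bd_def boundaryE; [split|exact: closed_pc].
by apply: interiorS iu.
Qed.

Lemma julia1_bd h : G h -> julia1 h = emb (bd h 'X).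
Proof.
move=> Gh; rewrite (julia1E (class_degree Gh)) bd_def pc_def.
by congr (emb (boundary _)); apply/seteqP; split=> z; rewrite /= hornerX.
Qed.

Lemma closed_julia : closed J.
Proof. by apply: open_closedC; exact: open_fatou. Qed.

Definition jsplit (F1 F2 : set S) :=
 [/\ closed F1, closed F2, J = F1 `|` F2 & F1 `&` F2 = set0].

Lemma jsplitC F1 F2 : jsplit F1 F2 -> jsplit F2 F1.
Proof. by move=> [a b c d]; split=> //; [rewrite setUC|rewrite setIC]. Qed.

Lemma jsplit_connected F1 F2 (A : set S) : jsplit F1 F2 -> connected A -> A `<=` J ->
 A `&` F1 !=set0 -> A `<=` F1.
Proof.
move=> [c1 c2 JE F0] cA AJ AF; apply: (connected_closed_split cA c1 c2) => //.
 by rewrite -JE.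
by move=> u _; exact: (disjE F0).
Qed.

Lemma jsplit_bd F1 F2 h w z : jsplit F1 F2 -> G h -> Gid w -> bd h w z -> F1 (Some z) ->
 emb (bd h w) `<=` F1.
Proof.
move=> s12 Gh Gw bz Fz; apply: (jsplit_connected s12).
- by apply: connected_emb; exact: connected_bd.
- by move=> _ [u bu <-]; exact: bd_julia bu.
- by exists (Some z); split=> //; exists z.
Qed.

Lemma julia_separate x y : J x -> J y ->
 ~ comp x y -> exists F1 F2, jsplit F1 F2 /\ (F1 x /\ F2 y).
Proof.
move=> Jx Jy nxy.
have [F1 [F2 [a b c d [e f]]]] :=
 @quasi_component R _ (@hausdorff_sphere) (@compact_sphere) _ _ _ closed_julia Jx Jy nxy.
by exists F1, F2.
Qed.

Lemma jsplit_component F1 F2 x y : jsplit F1 F2 -> F1 x ->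
 comp x y -> F1 y.
Proof.
move=> s12 Fx; apply: (jsplit_connected s12); first exact: component_connected.
 exact: connected_component_sub.
exists x; split=> //; apply: connected_component_refl.
by have [_ _ -> _] := s12; left.
Qed.

Lemma julia_near h x (N : set S) : G h -> J x -> nbhs x N ->
 exists w z, [/\ G w, N (Some z) & bd h w z].
Proof.
move=> Gh; have d2 := class_degree Gh; case: x => [a|] Jx; last first.
 move=> /nbhs_infty[_ [M hM]].
 have [w [z [Gw Mz bz]]] := julia_approx_infty M d2 class_nonconstant Jx.
 move/(bdE Gh (or_intror Gw)) in bz; exists w, z; split=> //; exact: hM.
move=> /nbhs_some[r r0 hr]; have [w [z [Gw za bz]]] := julia_approx d2 Jx r0.
move/(bdE Gh (or_intror Gw)) in bz; exists w, z; split=> //; exact: hr.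
Qed.

(** Near the Julia point a there is a point z of some [bd g w]. It has preimages near x and near y,
    all of them in the connected set [bd g (w \Po g)], so no splitting of J(G) separates x from
    y. *)
Lemma fiber g (x y : C) a : G g -> J (Some a) ->
 g.[x] = a -> g.[y] = a -> comp (Some x) (Some y).
Proof.
move=> Gg Ja gx gy.
have JF u : g.[u] = a -> J (Some u).
 move=> gu Fu; apply: Ja; rewrite -gu; apply: fatou_horner => //; first exact: class_comp.
 exact: class_nonconstant.
apply: contrapT => nxy.
have [F1 [F2 [s12 [F1x F2y]]]] := julia_separate (JF x gx) (JF y gy) nxy.
have [c1 c2 JE F0] := s12.
have [U [V [oU oV FU FV UV0]]] := separate_closed R (@hausdorff_sphere) (@compact_sphere) c1 c2 F0.
have [r1 r10 h1] := open_some oU (FU _ F1x).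
have [r2 r20 h2] := open_some oV (FV _ F2y).
have ncg := class_nonconstant Gg.
have [d1 d10 hd1] := horner_open_mapping x ncg r10.
have [d2 d20 hd2] := horner_open_mapping y ncg r20.
have m0 : 0 < Num.min d1 d2 by rewrite lt_min d10.
have [w [z [Gw za bz]]] := julia_approx (class_degree Gg) Ja m0.
move: za; rewrite lt_min => /andP[za1 za2].
have [x' x'x gx'] : exists2 z', abs (z' - x) < r1 & g.[z'] = z by apply: hd1; rewrite gx.
have [y' y'y gy'] : exists2 z', abs (z' - y) < r2 & g.[z'] = z by apply: hd2; rewrite gy.
have Gwg : Gid (w \Po g) by right; exact: class_comp.
move/(bdE Gg (or_intror Gw)) in bz.
have bw u : g.[u] = z -> bd g (w \Po g) u by move=> gu; apply/bd_comp; rewrite ?gu//; right.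
have inF (F F' W W' : set S) u : jsplit F F' -> F' `<=` W' -> W `&` W' = set0 -> W (Some u) ->
  bd g (w \Po g) u -> F (Some u).
 move=> [_ _ JE' _] FW WW Wu bu; have : J (Some u) by exact: bd_julia bu.
 rewrite JE' => -[//|/FW W'u]; have : (W `&` W') (Some u) by [].
 by rewrite WW.
have F1x' : F1 (Some x') by apply: (inF F1 F2 U V) => //; [exact: h1|exact: bw].
have F2y' : F2 (Some y').
 by apply: (inF F2 F1 V U) => //; [exact: jsplitC|rewrite setIC|exact: h2|exact: bw].
have := jsplit_bd s12 Gg Gwg (bw _ gx') F1x' (ex_intro2 _ _ y' (bw _ gy') erefl).
by move=> F1y'; apply: disjE F0 F1y' _.
Qed.

Lemma sphere_map_continuous g : nonconstant g -> continuous (sphere_map g : S -> S).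
Proof.
move=> ncg [a|] A /=.
 move=> /nbhs_some[r r0 hr]; have [d d0 hd] := horner_near g a r0.
 by apply/nbhs_some; exists d => // w /hd/hr.
move=> /nbhs_infty[Ai [M hM]]; have [r _ hr] := horner_unbounded (M + 1) ncg.
apply/nbhs_infty; split=> //; exists r => w rw; apply: hM.
by have := hr w (ltW rw); lra.
Qed.

Lemma sphere_map_julia g x : G g -> J (sphere_map g x) -> J x.
Proof.
case: x => [a|//] Gg Jg Fa; apply: Jg; apply: fatou_horner => //; first exact: class_comp.
exact: class_nonconstant.
Qed.

Lemma sphere_map_surj g x : nonconstant g -> exists y, sphere_map g y = x.
Proof.
case: x => [a|] ncg; last by exists infty.
by have [z <-] := horner_surj a ncg; exists (Some z).
Qed.

Lemma sphere_fiber g x y : G g -> J (sphere_map g x) -> sphere_map g x = sphere_map g y ->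
 comp x y.
Proof.
move=> Gg; case: x y => [a|] [b|]//= Jx E; last exact: connected_component_refl.
by apply: (fiber Gg Jx) => //; case: E.
Qed.

(** If F1, F2 split J(G) between x and y, their images under g are closed, cover J(G), and are
    disjoint on it because a fibre lies in one component; the component of g(x) cannot meet both. *)
Lemma pullback g x y : G g -> J (sphere_map g x) ->
 comp (sphere_map g x) (sphere_map g y) ->
 comp x y.
Proof.
move=> Gg Jgx cxy; have Jgy := connected_component_sub cxy.
have [Jx Jy] := (sphere_map_julia Gg Jgx, sphere_map_julia Gg Jgy).
apply: contrapT => nxy; have [F1 [F2 [s12 [F1x F2y]]]] := julia_separate Jx Jy nxy.
have [c1 c2 JE F0] := s12; have ncg := class_nonconstant Gg.
have cI F : closed F -> closed (sphere_map g @` F).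
 move=> cF; apply: (compact_closed (@hausdorff_sphere)); apply: continuous_compact.
  by apply: continuous_subspaceT; exact: sphere_map_continuous.
 by apply: subclosed_compact (@compact_sphere) _.
have sub : comp (sphere_map g x) `<=` sphere_map g @` F1.
 apply: (@connected_closed_split S _ _ (sphere_map g @` F2)); [exact: component_connected|exact: cI|exact: cI| | |].
 - move=> o /connected_component_sub Jo; have [q gq] := sphere_map_surj o ncg.
  have : J q by apply: (sphere_map_julia Gg); rewrite gq.
  by rewrite JE => -[?|?]; [left|right]; exists q.
 - move=> o Jo [b1 F1o o1E] [b2 F2o o2E].
  have {}Jo := connected_component_sub Jo.
  have : comp b1 b2.
   by apply: (sphere_fiber Gg); rewrite o1E// o2E.
  move=> /(jsplit_component s12 F1o) F1b2.
  by apply: disjE F0 _ F2o.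
 - by exists (sphere_map g x); split; [exact: connected_component_refl|exists x].
have [b F1o oE] := sub _ cxy.
have : comp b y by apply: (sphere_fiber Gg) => //; rewrite oE.
move=> /(jsplit_component s12 F1o) F1y.
by have : (F1 `&` F2) y by []; rewrite F0.
Qed.

(** A component that contains J(h) is backward invariant under h, by [pullback] and the invariance
    of J(h). Here this holds for all generators, hence for G, and backward images of J(h) are dense
    in J(G). *)
Lemma julia_single_component A x0 : G = generated A -> J x0 ->
 (forall h, A h -> julia1 h `<=` comp x0) -> connected J.
Proof.
move=> GA Jx0 hA; set J0 := comp x0.
have AG h : A h -> G h by rewrite GA; exact: sub_generated.
have inv g : G g -> sphere_map g @^-1` J0 `<=` J0.
 rewrite {1}GA; move: g; apply: (@generated_ind A [set g | sphere_map g @^-1` J0 `<=` J0]).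
  move=> h Ah y J0y; have Gh := AG h Ah; have [z bz] := bd_nonempty Gh gid1.
  have J0z : J0 (Some z) by apply: (hA h Ah); rewrite julia1_bd//; exists z.
  have J0hz : J0 (Some h.[z]).
   apply: (hA h Ah); rewrite (julia1_bd Gh); exists h.[z] => //.
   apply/(bd_comp _ Gh gid1 Gh); rewrite comp_polyX.
   move: bz; rewrite !bd_def !pc_def.
   rewrite (_ : [set u | filled_julia h ('X : {poly C}).[u]] = [set u | filled_julia h h.[u]])//.
   by apply/seteqP; split=> u /=; rewrite hornerX => /(filled_julia_horner _ (class_degree Gh)).
  apply: connected_component_trans J0z _; apply: (pullback Gh); first exact: connected_component_sub J0hz.
  apply: connected_component_trans J0y; exact: connected_component_sym.
 move=> p q hp hq y /= J0y; apply: hq => /=; apply: hp => /=.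
 by move: J0y; case: y => [z|] //=; rewrite horner_comp.
suff -> : J = J0 by exact: component_connected.
apply/seteqP; split; last exact: connected_component_sub.
have [h [Ah Gh]] : exists h, A h /\ G h.
 have [A0|/set0P[h Ah]] := eqVneq A set0; last by exists h; split=> //; exact: AG.
 have [g] := class_nonempty; rewrite GA A0 => /generated_ind h; exfalso.
 by apply: (h set0) => //; move=> ? ? [].
have cJ0 : closed J0 by apply: component_closed; exact: closed_julia.
move=> x Jx; rewrite (closure_id J0).1// => N xN.
have [w [z [Gw Nz bz]]] := julia_near Gh Jx xN; exists (Some z); split=> //.
apply: (inv w Gw) => /=; apply: (hA h Ah); rewrite julia1_bd//; exists w.[z] => //.
by apply/(bd_comp _ Gh gid1 Gw); rewrite comp_polyX.
Qed.

Lemma jsplit_nbhd x N : J x -> open N -> comp x `<=` N ->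
 exists F1 F2, [/\ jsplit F1 F2, F2 x & F2 `<=` N].
Proof.
move=> Jx oN cN.
have [F1 [F2 [a b c d [e f]]]] :=
 @component_nbhd R _ (@hausdorff_sphere) (@compact_sphere) _ _ _ (@closed_julia) Jx oN cN.
by exists F1, F2.
Qed.

Lemma bd_comp_eq h w a b : G h -> Gid w -> bd h w a -> bd h w b -> comp (Some a) (Some b).
Proof.
move=> Gh Gw ba bb.
apply: (@connected_component_max _ J (emb (bd h w))).
- by exists a.
- by move=> _ [u bu <-]; exact: (bd_julia Gh Gw).
- by apply: connected_emb; exact: (connected_bd Gh Gw).
- by exists b.
Qed.

(** * Disconnected J(G): nested generators and the component of infinity *)

Hypothesis ncJ : ~ connected J.

Lemma two_generators A : G = generated A -> exists f g a b,
 [/\ A f, A g, bd f 'X a, bd g 'X b & ~ comp (Some a) (Some b)].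
Proof.
move=> GA; have AG h : A h -> G h by rewrite GA; exact: sub_generated.
have [f Af] : exists f, A f.
 apply: contrapT => no; have [g] := class_nonempty; rewrite GA => /generated_ind h.
 by apply: (h set0) => // q Aq; apply: no; exists q.
have [a ba] := bd_nonempty (AG f Af) gid1.
have Ja := bd_julia (AG f Af) gid1 ba.
apply: contrapT => no; apply: ncJ; apply: (julia_single_component GA Ja) => g Ag.
rewrite (julia1_bd (AG g Ag)) => _ [b bb <-]; apply: contrapT => nab.
by apply: no; exists f, g, a, b.
Qed.

Lemma comp_bd_disjoint f g a b : G f -> G g -> bd f 'X a -> bd g 'X b ->
 ~ comp (Some a) (Some b) -> bd f 'X `&` bd g 'X = set0.
Proof.
move=> Gf Gg ba bb nab; apply: disjI => c fc gc; apply: nab.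
apply: connected_component_trans (_ : comp _ (Some c)) _.
 exact: (bd_comp_eq Gf gid1).
exact: (bd_comp_eq Gg gid1).
Qed.

Lemma nested_generators A : G = generated A -> exists f g a b,
 [/\ A f /\ A g, bd f 'X a, bd g 'X b, ~ comp (Some a) (Some b) & pc f 'X `<=` (pc g 'X)°].
Proof.
move=> GA; have AG h : A h -> G h by rewrite GA; exact: sub_generated.
have [f [g [a [b [Af Ag ba bb nab]]]]] := two_generators GA.
have b0 := comp_bd_disjoint (AG f Af) (AG g Ag) ba bb nab.
have [fg|gf] := pc_nested (AG f Af) gid1 (AG g Ag) gid1 b0.
 by exists f, g, a, b.
by exists g, f, b, a; split=> //; move/connected_component_sym.
Qed.

Lemma generated_self : G = generated G.
Proof.
apply/seteqP; split; first exact: sub_generated.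
by apply: generated_ind => //; exact: class_comp.
Qed.

(** Backward orbits of u stay bounded. Near a cluster point off K(g) all points would escape
    uniformly, yet g^n brings some of them to u. *)
Lemma backward_limit g u : G g -> exists k : nat -> C, exists p : C, exists f : nat -> nat,
 [/\ forall n, (piter g n).[k n] = u, incr f,
   forall e, 0 < e -> exists N, forall n, (N <= n)%N -> abs (k (f n) - p) < e & pc g 'X p].
Proof.
move=> Gg; have d2 := class_degree Gg; have [M eM] := escape_radius d2.
have ncp n : nonconstant (piter g n).
 by apply: degree_nonconstant; rewrite degree_piter expn_gt0 (leq_trans _ d2).
have [k kP] : exists k : nat -> C, forall n, (piter g n).[k n] = u.
 by have [k] := choice (fun n => horner_surj u (ncp n)); exists k.
have kB n : abs (k n) <= M + abs u.
 apply: lerF => h; have Mk : M <= abs (piter g 0).[k n].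
  by rewrite hornerX; have := abs_ge0 u; lra.
 have := escape_iter n eM Mk; rewrite addn0 kP hornerX.
 have : 1 <= (2 : R) ^+ n by rewrite exprn_ege1// ler1n.
 by have := eM.1; have := abs_ge0 u; nra.
have [f fi [p hp]] := bounded_subsequence kB.
exists k, p, f; split=> //; rewrite pc_def /= hornerX; apply: contrapT => np.
have /openPC/(_ p np)[r r0 hr] : open (~` filled_julia g).
 by apply: closed_openC; exact: closed_filled_julia.
have cc : compact (cdisc p (r / 2)) by exact: compact_cdisc.
have dis : cdisc p (r / 2) `&` filled_julia g = set0.
 apply: disjI => w wa fw; apply: (hr w) fw.
 by move: wa; rewrite /cdisc /disc /=; lra.
have [N hN] := uniform_escape (abs u + 1) d2 cc dis.
have [N' hN'] := hp (r / 2) ltac:(lra); pose n := maxn N N'.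
have Nf : (N <= f n)%N by apply: leq_trans (leq_maxl N N') (incr_ge n fi).
have := hN (f n) Nf (k (f n)); rewrite kP => H.
suff : abs u + 1 <= abs u by lra.
apply: H; rewrite /cdisc /= ltW//; apply: hN'; exact: leq_maxr.
Qed.

(** If infinity were joined to a finite u, backward orbits of u under g would stay in that component
    and accumulate in K(g); the component misses J(g), so it would be contained in K(g). *)
Lemma infty_component g b : G g -> J infty -> bd g 'X b -> ~ comp infty (Some b) ->
 forall u, ~ comp infty (Some u).
Proof.
move=> Gg Ji bb nb u cu.
have [k [p [f [kP fi hp pp]]]] := backward_limit u Gg.
have pull n (y : C) : comp infty (Some (piter g n).[y]) -> comp infty (Some y).
 elim: n y => [|n IH] y; first by rewrite hornerX.
 rewrite horner_piterSr => /IH h; apply: (@pullback g infty (Some y)) => //.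
have cp : comp infty (Some p).
 have cl : closed (comp infty) by apply: component_closed; exact: closed_julia.
 rewrite (closure_id (comp infty)).1// => N /nbhs_some[r r0 hr]; have [n hn] := hp r r0.
 exists (Some (k (f n))); split; last by apply: hr; exact: hn.
 by apply: (pull (f n)); rewrite kP.
have : comp infty `<=` emb (pc g 'X)°.
 apply: connected_avoid_emb.
 - exact: (compact_pc Gg gid1).
 - exact: component_connected.
 - apply: disjI => x cv [v bv vx]; rewrite -bd_def in bv; rewrite -vx in cv; apply: nb.
  exact: connected_component_trans cv (bd_comp_eq Gg gid1 bv bb).
 - by exists (Some p); split=> //; exists p.
by move=> /(_ infty (connected_component_refl Ji))[].
Qed.

Lemma infty_split : J infty -> exists g F1 F2,
 [/\ G g, jsplit F1 F2 /\ F2 infty, F2 `<=` connected_component (~` F1) infty,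
   emb (bd g 'X) `<=` F1 & P `<=` (pc g 'X)°].
Proof.
move=> Ji; have [f [g [a [b [[Gf Gg] ba bb nab fg]]]]] := nested_generators generated_self.
have ci : comp infty `<=` [set infty].
 have [h [d [Gh bh nh]]] : exists h d, [/\ G h, bd h 'X d & ~ comp infty (Some d)].
  have [ca|?] := pselect (comp infty (Some a)); last by exists f, a.
  exists g, b; split=> // cb; apply: nab; exact: connected_component_trans (connected_component_sym ca) cb.
 by move=> [u /(infty_component Gh Ji bh nh)//|].
have [_ [r hr]] := (compactC _).1 (compact_pc Gg gid1).
pose N : set S := ~` emb (cdisc 0 r).
have oN : open N by apply: closed_openC; apply: closed_emb; exact: compact_cdisc.
have cN : comp infty `<=` N by move=> x /ci -> [].
have [A [B [[cA cB JE AB0] Bi BN]]] := jsplit_nbhd Ji oN cN.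
have oA : open (~` A) by exact: closed_openC.
pose W := connected_component (~` A) infty.
have oW : open W by exact: component_open_sphere.
have BA : B `<=` ~` A by move=> x Bx Ax; exact: disjE AB0 Ax Bx.
have Wi : W infty by apply: connected_component_refl; exact: BA.
(* The part of [B] that the domain [W] of infinity does not reach is moved to the other side, which
   puts F2 inside the domain of infinity off F1. *)
pose F1 := A `|` (B `\` W); pose F2 := B `&` W.
have dF : F1 `&` F2 = set0.
 by apply: disjI => x [Ax|[Bx nW]] [Bx' Wx]; [exact: BA Bx' Ax|].
have WF1 : W `<=` connected_component (~` F1) infty.
 apply: connected_component_max => //; last exact: component_connected.
 by move=> x Wx [Ax|[_ //]]; have := connected_component_sub Wx.
exists g, F1, F2; split=> //.
- split=> //; split=> //.
 + by apply: closedU => //; rewrite setDE; apply: closedI => //; exact: open_closedC.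
 + move=> x clx; have Bx : B x.
   by rewrite (closure_id B).1//; apply: closureS clx; exact: subIsetl.
  split=> //; apply: component_closure_sphere => //; last exact: BA.
  by apply: closureS clx; exact: subIsetr.
 + rewrite JE; apply/seteqP; split=> x; last by move=> [[Ax|[Bx _]]|[Bx _]]; [left|right|right].
  move=> [Ax|Bx]; first by left; left.
  by have [Wx|nW] := pselect (W x); [right|left; right].
- by move=> x [_ /WF1].
- move=> _ [u bu <-]; have : J (Some u) by exact: (bd_julia Gg gid1).
 rewrite JE => -[Au|/BN nu]; first by left.
 by case: nu; exists u => //; rewrite /cdisc /= subr0; apply: hr; exact: (bd_pc Gg bu).
- by move=> z Pz; apply: fg; exact: (post_pc Gf gid1).
Qed.

(** * Infinity belongs to the Fatou set *)

Section Contradiction.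
Variables (g : {poly C}) (F1 F2 : set S).
Hypotheses (Gg : G g) (s12 : jsplit F1 F2) (F2i : F2 infty).
Let Om := connected_component (~` F1) infty.
Hypotheses (F2O : F2 `<=` Om) (gF1 : emb (bd g 'X) `<=` F1) (Pg : P `<=` (pc g 'X)°).

Let oF : open (~` F1). Proof. by have [c1 _ _ _] := s12; exact: closed_openC. Qed.
Let oO : open Om. Proof. exact: component_open_sphere. Qed.
Let Oi : Om infty. Proof. exact: F2O. Qed.
Let cO : connected Om. Proof. exact: component_connected. Qed.
Let OF x : Om x -> ~ F1 x. Proof. by move=> /connected_component_sub. Qed.

Let Wset w := G w /\ emb (bd g w) `<=` F1.

Let O_pc w z : Gid w -> emb (bd g w) `<=` F1 -> Om (Some z) -> ~ pc g w z.
Proof.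
move=> Gw wF Oz pz; have : Om `<=` emb (pc g w)°.
 apply: connected_avoid_emb => //; first exact: (compact_pc Gg Gw).
  rewrite -bd_def; apply: disjI => x Ox /wF Fx.
  exact: OF Ox Fx.
 by exists (Some z); split=> //; exists z.
by move=> /(_ _ Oi)[].
Qed.

(** A growth rate at z uniform in w: log|g^j(w(z))| is eventually at least ln(3/2) / (m + 1) times
    the degree of g^j o w. It holds with m = 0 near infinity, and Harnack's inequality spreads it
    over [Om] at the cost of larger m. *)
Let Phi m z := forall w, Wset w -> exists N, forall j, (N <= j)%N ->
 (3 / 2) ^+ (degree g ^ j * degree w) <= abs (piter g j).[w.[z]] ^+ m.+1.

(** The preimages under g^j o w of a fixed point p of g have modulus at most r0. Moving from radius
    r0 to l r0 with l >= 2 multiplies the distance of the image to p by at least ((l + 1) / 2)^deg,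
    hence by (3/2)^deg. *)
Let Phi_far : exists r, forall z, r <= abs z -> Phi 0 z.
Proof.
have d2 := class_degree Gg; have [p hp] := fixed_point_exists d2.
have [M hM] := open_infty oO Oi.
pose r0 := `|M| + 1; have r00 : 0 < r0 by rewrite ltr_wpDl.
have Mr : M < r0 by rewrite /r0; have := ler_norm M; lra.
exists (2 * r0) => z zr w [Gw wF]; pose l := abs z / r0.
have l2 : 2 <= l by rewrite ler_pdivlMr.
have l0 : 0 < l by lra.
pose u := rc l^-1 * z; have zu : z = rc l * u by rewrite /u mulrA -rcM divff ?gt_eqF// rc1 mul1r.
have az : 0 < abs z by apply: lt_le_trans zr; rewrite mulr_gt0.
have au : abs u = r0.
 rewrite /u absM abs_rc gtr0_norm ?invr_gt0// /l; field.
 by rewrite !gt_eqF.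
have Gw' : Gid w by right.
have nu : ~ pc g w u by apply: O_pc => //; apply: hM; rewrite au.
have {}nu : ~ filled_julia g w.[u] by move: nu; rewrite pc_def.
have [N hN] := not_filled_far (1 + 2 * abs p) d2 nu.
exists N => j Nj; rewrite expr1; have hj := hN j Nj.
pose Q := (piter g j \Po w) - p%:P.
have dg : (0 < degree (piter g j \Po w))%N.
 rewrite degree_comp degree_piter muln_gt0 expn_gt0 (leq_trans _ d2)//=.
 exact: nonconstant_degree (class_nonconstant Gw).
have dQ : degree Q = (degree g ^ j * degree w)%N.
 rewrite -degree_piter -degree_comp /Q /degree size_polyDl// size_polyN.
 by apply: leq_ltn_trans (size_polyC_leq1 _) _; exact: degree_nonconstant dg.
have rootsQ a : root Q a -> abs a <= abs u.
 rewrite rootE /Q hornerD hornerN hornerC horner_comp subr_eq0 => /eqP ga.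
 rewrite leNgt au; apply/negP => aM; apply: (@O_pc w a) => //.
  by apply: hM; exact: lt_trans Mr aM.
 rewrite pc_def /=; apply/(filled_julia_piter j _ d2); rewrite ga; exact: filled_julia_fixed.
have l1 : 1 <= l by lra.
have := radial_growth rootsQ l1; rewrite -zu -/(degree Q) dQ.
rewrite /Q !hornerD !hornerN !hornerC !horner_comp.
set D := (_ * degree w)%N; set qu := (piter g j).[w.[u]] in hj *; set qz := (piter g j).[w.[z]].
have hu : 1 + abs p <= abs (qu - p) by have := abs_lip qu p; lra.
have h1 : (3 / 2) ^+ D <= ((l + 1) / 2) ^+ D by apply: lerXn2r; rewrite ?nnegrE; lra.
have h2 : 1 <= (3 / 2 : R) ^+ D by apply: exprn_ege1; lra.
have h3 : abs (qz - p) <= abs qz + abs p by exact: absBD.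
move=> h4; exact: radial_arith hu h1 h2 h3 (abs_ge0 p) h4.
Qed.

(** The exponent 5 of [harnack_pow] turns m + 1 into 5 (m + 1). *)
Let Phi_step m a z r : 0 < r -> (forall u, abs (u - a) < r -> Om (Some u)) ->
 abs (z - a) <= r / 16 -> (Phi m a -> Phi (5 * m + 4) z) /\ (Phi m z -> Phi (5 * m + 4) a).
Proof.
move=> r0 hr za; have d2 := class_degree Gg.
have key w : Wset w -> exists N, forall j, (N <= j)%N ->
  abs (piter g j).[w.[z]] <= abs (piter g j).[w.[a]] ^+ 5 /\
  abs (piter g j).[w.[a]] <= abs (piter g j).[w.[z]] ^+ 5.
 move=> [Gw wF]; pose K := [set w.[u] | u in cdisc a (r / 2)].
 have cK : compact K.
  apply: continuous_compact; last exact: compact_cdisc.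
  by exact: horner_within.
 have K0 : K `&` filled_julia g = set0.
  apply/seteqP; split=> // _ [[u ua <-]] fu; apply: (@O_pc w u) => //; first by right.
   by apply: hr; move: ua; rewrite /cdisc /=; lra.
  by rewrite pc_def.
 have [N hN] := uniform_escape 1 d2 cK K0; exists N => j Nj.
 have := @harnack_pow (piter g j \Po w) a (r / 2) 1 z.
 rewrite !horner_comp !divr1; apply => //; [by rewrite divr_gt0| |lra].
 by move=> u ua; rewrite horner_comp; apply: hN => //; exists u.
split=> Pm w Ww; have [N hN] := Pm w Ww; have [N' hN'] := key w Ww;
 exists (maxn N N') => j; rewrite geq_max => /andP[Nj N'j];
 apply: le_trans (hN j Nj) _; rewrite (_ : (5 * m + 4).+1 = 5 * m.+1)%N ?exprM; try lia; apply: lerXn2r; rewrite ?nnegrE ?exprn_ge0 ?abs_ge0//.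
 exact: (hN' j N'j).2.
exact: (hN' j N'j).1.
Qed.

Let Phi_mono m m' z : (m <= m')%N -> Phi m z -> Phi m' z.
Proof.
move=> mm Pm w Ww; have [N hN] := Pm w Ww; exists N => j /hN h.
apply: le_trans (h) _; apply: ler_weXn2l => //; apply: lerF => lt1.
have h1 : 1 <= (3 / 2 : R) ^+ (degree g ^ j * degree w) by apply: exprn_ege1; lra.
have : abs (piter g j).[w.[z]] ^+ m.+1 < 1 by rewrite exprn_ilt1// abs_ge0.
by rewrite ltNge (le_trans h1 h).
Qed.

Let Phi_ex z : Om (Some z) -> exists m, Phi m z.
Proof.
have [r hr] := Phi_far.
pose A : set S := [set x | Om x /\ if x is Some z then exists m, Phi m z else True].
pose B : set S := [set x | Om x /\ if x is Some z then ~ exists m, Phi m z else False].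
have nb u : Om (Some u) -> exists2 d, 0 < d & forall v, abs (v - u) < d -> Om (Some v).
 by move=> Ou; have [d d0 hd] := open_some oO Ou; exists d.
have oA : open A.
 rewrite openE => -[u [Ou [m Pm]]|_].
  have [d d0 hd] := nb u Ou; apply/nbhs_some; exists (d / 16); first by rewrite divr_gt0.
  move=> v vu; split; first by apply: hd; lra.
  by exists (5 * m + 4)%N; apply: (Phi_step m d0 hd (ltW vu)).1.
 have [M hM] := open_infty oO Oi.
 apply/nbhs_infty; split=> //; exists (Num.max M r) => v; rewrite gt_max => /andP[Mv rv].
 by split; [exact: hM|exists 0%N; apply: hr; exact: ltW].
have oB : open B.
 rewrite openE => -[u [Ou nPm]|[]//].
 have [d d0 hd] := nb u Ou; apply/nbhs_some; exists (d / 16); first by rewrite divr_gt0.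
 move=> v vu; split; first by apply: hd; lra.
 move=> [m Pm]; apply: nPm; exists (5 * m + 4)%N; exact: (Phi_step m d0 hd (ltW vu)).2.
have OA : Om `<=` A.
 apply: (connected_open_split cO oA oB).
 - move=> [u|] Ou; last by left.
  by have [h|h] := pselect (exists m, Phi m u); [left|right].
 - by move=> -[u|] _ [_ h] [_ h'].
 - by exists infty.
by move=> /OA[].
Qed.

Let Phi_uniform : exists m, forall z, F2 (Some z) -> Phi m z.
Proof.
have [r hr] := Phi_far; have [_ c2 _ _] := s12.
have cF2 : compact F2 by apply: subclosed_compact (@compact_sphere) _.
have := (compact_near_coveringP F2).1 cF2 nat \oo
 (fun m x => if x is Some z then Phi m z else True) _.
case=> [[a|] Fa|N _ hN]; last by exists N => z Fz; exact: (hN N (leqnn N) (Some z) Fz).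
 have [m Pm] := Phi_ex (F2O Fa).
 have [d d0 hd] := open_some oO (F2O Fa).
 exists ([set x | if x is Some z then abs (z - a) < d / 16 else False], [set n | (5 * m + 4 <= n)%N]) => /=.
  split; last by exists (5 * m + 4)%N.
  by apply/nbhs_some; exists (d / 16) => //; rewrite divr_gt0.
 move=> [[z|//] n] /= [za mn]; apply: (Phi_mono mn).
 exact: (Phi_step m d0 hd (ltW za)).1.
exists ([set x | if x is Some z then r < abs z else True], setT) => /=.
 by split; [apply/nbhs_infty; split=> //; exists r|exists 0%N].
move=> [[z|//] n] /= [rz _]; apply: (Phi_mono (leq0n n)); apply: hr; exact: ltW.
Qed.

(** At a boundary point a of [Om] in F1, take w with [bd g w] in F1 passing very close to a. For
    some k, [bd g (W k \Po w)] is in F2 while the next one is in F1 and passes close to a, at s.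
    Then g(w(s)) = w(z) with z in F2, so [Phi] forces growth at the rate 3/2. But s is extremely
    close to the connected set [pc g w], where the iterates are bounded and which reaches as far as
    p, so [connected_growth] allows only the rate 5/4. *)
Lemma infty_split_contradiction : False.
Proof.
have d2 := class_degree Gg; have [c1 c2 JE F0] := s12.
have [b' bb'] := bd_nonempty Gg gid1.
have [|bO|al clal nal] := @open_frontier _ Om (Some b') (@connected_sphere) oO; first by exists infty.
 by apply: (connected_component_sub bO); apply: gF1; exists b'.
have Fal : F1 al.
 by apply: contrapT => nF; apply: nal; exact: component_closure_sphere.
case: al clal nal Fal => [a|//] clal nal Fal.
have nin : ~ (pc g 'X)° a.
 move=> ia; have nb : nbhs (Some a : S) (emb (pc g 'X)°).
  by apply: open_nbhs_nbhs; split; [apply: open_emb; exact: open_interior|exists a].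
 have [y [Ou [u iu ue]]] := clal _ nb; rewrite -ue in Ou.
 by apply: (O_pc gid1 gF1 Ou); exact: interior_subset.
have [p Pp] := post_nonempty.
have pa : 0 < abs (p - a).
 by rewrite abs_gt0 subr_eq0; apply/eqP => pa; apply: nin; rewrite -pa; exact: Pg.
have [m Pm] := Phi_uniform.
(* The factor [degree g] pays for the extra application of g between s and z, and m + 1 is the power
   in [Phi]. *)
have [t [t0 t1 ht]] := near_one_power (degree g * m.+1).
set rho := abs (p - a) in pa.
pose h := Num.sqrt (rho / 2); pose e0 := h * (t / 4).
have h0 : 0 < h by rewrite sqrtr_gt0 divr_gt0.
have h2 : h ^+ 2 = rho / 2 by rewrite sqr_sqrtr// divr_ge0// ltW.
have e00 : 0 < e0 by rewrite mulr_gt0// divr_gt0.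
have e0h : e0 < h by rewrite /e0 gtr_pMr//; lra.
have e02 : e0 ^+ 2 <= rho / 2 by rewrite -h2; apply: lerXn2r; rewrite ?nnegrE ltW.
pose e := e0 ^+ 2 / 2; have ee : 0 < e by rewrite divr_gt0// exprn_gt0.
have q1 : (h + e0) / (h - e0) <= 1 + t.
 exact: ratio_le.
have [d [d0 de hd]] : exists d, [/\ 0 < d, d <= e & forall z, abs (z - a) < d -> ~ F2 (Some z)].
 have nF2 : (~` F2) (Some a) := disjE F0 Fal.
 have [d d0 hd] := open_some (closed_openC c2) nF2.
 exists (Num.min d e); split; [by rewrite lt_min d0|by rewrite ge_min lexx orbT|].
 by move=> z; rewrite lt_min => /andP[/hd].
have Ja : J (Some a) by rewrite JE; left.
have nd : nbhs (Some a : S) (emb (disc a d)).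
 by apply/nbhs_some; exists d => // z zd; exists z.
have [w [z0 [Gw /embP z0a bz0]]] := julia_near Gg Ja nd.
have Gw' : Gid w by right.
have inF1 h' w' z : G h' -> Gid w' -> bd h' w' z -> ~ F2 (Some z) -> emb (bd h' w') `<=` F1.
 move=> Gh' Gw'' bz nz; apply: (jsplit_bd s12 Gh' Gw'' bz).
 by have : J (Some z) by [exact: (bd_julia Gh' Gw'')]; rewrite JE => -[].
have Ww : Wset w by split=> //; apply: inF1 bz0 _ => //; exact: hd.
have [wG wF] := Ww.
have Ji : J infty by rewrite JE; right.
have F21 x : F2 x -> ~ F1 x by move=> F2x F1x; exact: disjE F0 F1x F2x.
have JF2 z : J (Some z) -> ~ F1 (Some z) -> F2 (Some z) by rewrite JE => -[].
(* Infinity is in J(G), so some [bd g b] has a point so large that its preimages under w are near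
   infinity too, where J(G) consists of F2 only. *)
have [b [Gb bF2]] : exists b : {poly C}, G b /\ emb (bd g (b \Po w)) `<=` F2.
 have [M1 hM1] := open_infty oF (F21 _ F2i).
 have [k k1 hk] := horner_growth_upper w; pose B1 := Num.max 1 M1; pose B := k * B1 ^+ (size w).-1.
 have nB : nbhs (infty : S) [set x | if x is Some z then B < abs z else True].
  by apply/nbhs_infty; split=> //; exists B.
 have [b [z [Gb /= zB bz]]] := julia_near Gg Ji nB; exists b; split=> //.
 have [y wy] := horner_surj z (class_nonconstant Gw).
 have Gbw : Gid (b \Po w) by right; exact: class_comp.
 have by_ : bd g (b \Po w) y by apply/(bd_comp y Gg (or_intror Gb) Gw); rewrite wy.
 apply: (jsplit_bd (jsplitC s12) Gg Gbw by_); apply: JF2; first exact: (bd_julia Gg Gbw by_).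
 apply: hM1; rewrite ltNge; apply/negP => yM; move: zB; rewrite -wy ltNge => /negP; apply.
 by apply: hk; rewrite le_max ?lexx// yM orbT.
pose W k := b \Po piter g k.
have GW k : G (W k).
 apply: (Gid_comp Gb); case: k => [|k]; first by left.
 by right; apply: piter_in => //; exact: class_comp.
have GWw k : Gid (W k \Po w) by right; exact: class_comp.
have W0 : W 0%N = b by rewrite /W comp_polyXr.
have bdW k z : bd g (W k \Po w) z <-> bd g (W k) w.[z].
 exact: (bd_comp z Gg (or_intror (GW k)) Gw).
have bdWS k u : bd g (W k.+1) u <-> bd g (W k) g.[u].
 by rewrite /W piterSr comp_polyA; exact: (bd_comp u Gg (or_intror (GW k)) Gg).
(* Otherwise all these boundaries are in F2. Backward orbits under g of a point of [bd g b]
   accumulate in K(g), and pulling back by w gives a point of F2 in [pc g w], although [Om] misses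
   that piece. *)
have [k [kF2 kF1]] : exists k, emb (bd g (W k \Po w)) `<=` F2 /\ emb (bd g (W k.+1 \Po w)) `<=` F1.
 apply: contrapT => no.
 have all2 k : emb (bd g (W k \Po w)) `<=` F2.
  elim: k => [|k IH]; first by rewrite W0.
  have [u bu] := bd_nonempty Gg (GWw k.+1).
  apply: (jsplit_bd (jsplitC s12) Gg (GWw k.+1) bu); apply: contrapT => nF.
  apply: no; exists k; split=> //; exact: inF1 bu nF.
 have [u bu] := bd_nonempty Gg (or_intror Gb).
 have [k [v [f [kP fi hv pv]]]] := backward_limit u Gg.
 have [y wy] := horner_surj v (class_nonconstant Gw).
 have bk n z : (piter g n).[z] = u -> bd g (W n) z.
  elim: n z => [|n IH] z; first by rewrite hornerX W0 => ->.
  by rewrite horner_piterSr => /IH; apply: (bdWS n z).2.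
 have F2y : F2 (Some y).
  apply: (c2 (Some y)) => N /nbhs_some[r r0 hr].
  have [d' d'0 hd'] := horner_open_mapping y (class_nonconstant Gw) r0.
  have [n hn] := hv _ d'0; have := hn n (leqnn n); rewrite -wy => /hd'[y' y'y wy'].
  exists (Some y'); split; last exact: hr.
  by apply: (all2 (f n)); exists y' => //; apply/bdW; rewrite wy'; exact: bk.
 apply: (O_pc Gw' wF (F2O F2y)).
 by move: pv; rewrite !pc_def /= hornerX wy.
have sub0 : pc g w `<=` pc g (b \Po w).
 have Gbw : Gid (b \Po w) by rewrite -W0.
 have b0 : bd g (b \Po w) `&` bd g w = set0.
  apply: disjI => u bu1 bu; have F2u : F2 (Some u) by apply: bF2; exists u.
  by case: (F21 _ F2u); apply: wF; exists u.
 have [bw|wb] := pc_nested Gg Gbw Gg Gw' b0; last by move=> u /wb/interior_subset.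
 have [u bu] := bd_nonempty Gg Gbw; exfalso.
 have F2u : F2 (Some u) by apply: bF2; exists u.
 apply: (O_pc Gw' wF (F2O F2u)); apply: interior_subset; apply: bw; exact: (bd_pc Gg bu).
have z0T : pc g (W k.+1 \Po w) z0.
 have : pc g w z0 by exact: (bd_pc Gg bz0).
 rewrite pc_def /= => fz0; have [v wv] := horner_surj (piter g k.+1).[w.[z0]] (class_nonconstant Gw).
 have : pc g w v by rewrite pc_def /= wv; apply/(filled_julia_piter k.+1 _ d2).
 have E : (W k.+1 \Po w).[z0] = (b \Po w).[v].
  by rewrite /W (horner_comp _ w) (horner_comp b) (horner_comp b w) wv.
 by move=> /sub0; rewrite !pc_def /= E.
have [x [Ox [y1 y1a y1x]]] := clal _ nd; rewrite -y1x in Ox.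
(* Near a there are both z0, which is in this piece, and a point of [Om], which is not; the boundary
   passes between them. *)
have [s [sa bs]] : exists s : C, abs (s - a) < d /\ bd g (W k.+1 \Po w) s.
 apply: contrapT => no; apply: (O_pc (GWw k.+1) kF1 Ox); apply: interior_subset.
 apply: (@boundary_crossing _ _ (disc a d) (@connected_disc a d)) => //.
  by exists z0.
 by rewrite -bd_def; apply: disjI => u ua bu; apply: no; exists u.
have [z wz] := horner_surj g.[w.[s]] (class_nonconstant Gw).
have F2z : F2 (Some z).
 by apply: kF2; exists z => //; apply/bdW; rewrite wz; apply/bdWS; apply/bdW.
have [N hN] := Pm z F2z w Ww.
have [Mg eM] := escape_radius d2; have M1 := eM.1.
pose q := (h + e0) / (h - e0).
have q0 : 0 <= q by apply: divr_ge0; [apply: addr_ge0|rewrite subr_ge0]; apply: ltW.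
have grow j : abs (piter g j).[w.[z]] <= Mg * q ^+ (degree g * (degree g ^ j * degree w)).
 have := @connected_growth (piter g j.+1 \Po w) (pc g w) s Mg e0 h (connected_pc Gg Gw').
 rewrite -/(degree _) degree_comp degree_piter expnS mulnA horner_comp horner_piterSr wz; apply => //.
 - by move=> u /(pcP w u eM); apply.
 - exists z0; first exact: (bd_pc Gg bz0).
  by move: z0a; rewrite /disc /= => z0a; have := abs_tri a z0 s; rewrite (absB a s) /e in de *; lra.
 - exists p; first exact: (post_pc Gg Gw').
  by have := abs_tri s p a; rewrite -/rho h2 /e in de *; lra.
 - exact: ltW.
have qq : q ^+ (degree g * m.+1) <= 5 / 4.
 by apply: le_trans ht; apply: lerXn2r; rewrite ?nnegrE// addr_ge0// ltW.
have [n hn] := @exists_small_power (5 / 6) (Mg ^+ m.+1) 1 ltac:(lra) ltac:(lra) ltr01.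
pose j := maxn N n; set D := (degree g ^ j * degree w)%N.
have nD : (n <= D)%N.
 apply: leq_trans (leq_maxr N n) _; apply: leq_trans (ltnW (ltn_expl j (ltnSn 1))) _.
 apply: (@leq_trans (degree g ^ j)); first by case: (j) => // j'; rewrite leq_exp2r.
 by rewrite leq_pmulr//; exact: nonconstant_degree (class_nonconstant Gw).
have h3 := hN j (leq_maxl N n); have h4 := grow j; rewrite -/D in h3 h4.
have h5 : (3 / 2) ^+ D <= Mg ^+ m.+1 * (5 / 4) ^+ D.
 apply: le_trans h3 _; apply: (@le_trans _ _ ((Mg * q ^+ (degree g * D)) ^+ m.+1)).
  have Mg0 : 0 <= Mg * q ^+ (degree g * D).
   by apply: mulr_ge0; [exact: le_trans ler01 M1|exact: exprn_ge0].
  by apply: lerXn2r => //; rewrite nnegrE ?abs_ge0.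
 rewrite exprMn -exprM -mulnA (mulnC D) mulnA exprM.
 apply: ler_wpM2l; first by apply: exprn_ge0; exact: le_trans ler01 M1.
 by apply: lerXn2r => //; rewrite nnegrE; [exact: exprn_ge0|lra].
have h6 : (5 / 4 : R) ^+ D = (3 / 2) ^+ D * (5 / 6) ^+ D by rewrite -exprMn; congr (_ ^+ D); field.
have h7 : 0 < (3 / 2 : R) ^+ D by apply: exprn_gt0; lra.
have h8 : 1 <= Mg ^+ m.+1 * (5 / 6) ^+ D.
 by rewrite -(ler_pM2l h7) mulr1 mulrCA -h6.
have h9 : (5 / 6 : R) ^+ D <= (5 / 6) ^+ n by apply: ler_wiXn2l => //; lra.
have h10 : 0 <= Mg ^+ m.+1 by apply: exprn_ge0; exact: le_trans ler01 M1.
have := ler_wpM2l h10 h9; rewrite leNgt => /negP; apply; exact: lt_le_trans hn h8.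
Qed.
End Contradiction.

Theorem fatou_infty : fatou_set G infty.
Proof.
apply: contrapT => Ji.
have [g [F1 [F2 [Gg [s12 F2i] F2O gF1 Pg]]]] := infty_split Ji.
exact: (infty_split_contradiction Gg s12 F2i F2O gF1 Pg).
Qed.

(** * The domain of infinity and the greatest component *)

Lemma open_Finfty : open Finf.
Proof. by apply: component_open_sphere; exact: open_fatou. Qed.

Lemma Finfty_infty : Finf infty.
Proof. by apply: connected_component_refl; exact: fatou_infty. Qed.

Lemma connected_Finfty : connected Finf. Proof. exact: component_connected. Qed.

Lemma Finfty_julia x : Finf x -> ~ J x.
Proof. by move=> /connected_component_sub Fx; apply. Qed.

Lemma Finfty_boundary x : closure Finf x -> ~ Finf x -> J x.
Proof. by move=> cx nx Fx; apply: nx; apply: component_closure_sphere => //; exact: open_fatou. Qed.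

Lemma Finfty_pc h w z : G h -> Gid w -> pc h w z -> ~ Finf (Some z).
Proof.
move=> Gh Gw pz Fz; have : Finf `<=` emb (pc h w)°.
 apply: connected_avoid_emb.
 - exact: (compact_pc Gh Gw).
 - exact: connected_Finfty.
 - rewrite -bd_def; apply: disjI => x Fx [u bu ux]; rewrite -ux in Fx.
  by case: (Finfty_julia Fx); exact: (bd_julia Gh Gw).
 - by exists (Some z); split=> //; exists z.
by move=> /(_ _ Finfty_infty)[].
Qed.

Lemma Finfty_far : exists M, forall z, M < abs z -> Finf (Some z).
Proof. by have [M hM] := open_infty open_Finfty Finfty_infty; exists M. Qed.

Lemma julia_bound : exists M, (forall z, J (Some z) -> abs z <= M) /\
 (forall h w z, G h -> Gid w -> pc h w z -> abs z <= M).
Proof.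
have [M hM] := Finfty_far; exists M; split=> [z Jz|h w z Gh Gw pz]; apply: lerF => /hM.
 by move=> /Finfty_julia.
exact: Finfty_pc pz.
Qed.

Lemma julia_finite x : J x -> exists a, x = Some a.
Proof. by case: x => [a _|Ji]; [exists a|case: Ji; exact: fatou_infty]. Qed.

Lemma avoid_closed (F : set S) a : closed F -> ~ F (Some a) ->
 exists2 e, 0 < e & forall z, abs (z - a) < e -> ~ F (Some z).
Proof.
move=> cF nF; have nF' : (~` F) (Some a) by [].
by have [e e0 he] := open_some (closed_openC cF) nF'; exists e.
Qed.

Lemma julia_near_disc h a e : G h -> J (Some a) -> 0 < e ->
 exists w (s : C), [/\ G w, abs (s - a) < e & bd h w s].
Proof.
move=> Gh Ja e0; have nd : nbhs (Some a : S) (emb (disc a e)).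
 by apply/nbhs_some; exists e => // z zd; exists z.
by have [w [s [Gw /embP sa bs]]] := julia_near Gh Ja nd; exists w, s.
Qed.

Lemma pc_cross h w a e u v : G h -> abs (u - a) < e -> pc h w u -> abs (v - a) < e ->
 ~ pc h w v -> exists2 s, abs (s - a) < e & bd h w s.
Proof.
move=> Gh ua pu va nv; apply: contrapT => no; apply: nv; apply: interior_subset.
apply: (@boundary_crossing _ _ (disc a e) (@connected_disc a e)) => //.
 by exists u.
by rewrite -bd_def; apply: disjI => s sa bs; apply: no; exists s.
Qed.

Lemma pc_interior_or_bd h w z : G h -> pc h w z -> (pc h w)° z \/ bd h w z.
Proof.
move=> Gh pz; have [iz|nz] := pselect ((pc h w)° z); [by left|right].
by rewrite bd_def boundaryE; [split|exact: closed_pc].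
Qed.

Lemma jsplit_bd_or F1 F2 h w : jsplit F1 F2 -> G h -> Gid w ->
 emb (bd h w) `<=` F1 \/ emb (bd h w) `<=` F2.
Proof.
move=> s12 Gh Gw; have [u bu] := bd_nonempty Gh Gw.
have : J (Some u) by exact: (bd_julia Gh Gw).
have [_ _ JE _] := s12; rewrite JE => -[Fu|Fu].
 by left; apply: (jsplit_bd s12 Gh Gw bu).
by right; apply: (jsplit_bd (jsplitC s12) Gh Gw bu).
Qed.

Lemma jsplit_bd_disjoint F1 F2 h w h' w' : jsplit F1 F2 ->
 emb (bd h w) `<=` F1 -> emb (bd h' w') `<=` F2 -> bd h w `&` bd h' w' = set0.
Proof.
move=> [_ _ _ F0] s1 s2; apply: disjI => u b1 b2.
have : (F1 `&` F2) (Some u) by split; [apply: s1|apply: s2]; exists u.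
by rewrite F0.
Qed.

Lemma closure_Finfty_pc h w a : G h -> Gid w -> closure Finf (Some a) -> ~ (pc h w)° a.
Proof.
move=> Gh Gw cla ia; have nb : nbhs (Some a : S) (emb (pc h w)°).
 by apply: open_nbhs_nbhs; split; [apply: open_emb; exact: open_interior|exists a].
have [y [Fy [u iu uy]]] := cla _ nb; rewrite -uy in Fy.
exact: (Finfty_pc Gh Gw (interior_subset iu) Fy).
Qed.

(** Let F1, F2 split J(G) between a and b. A piece with boundary in F1 passing near a does not
    contain b. A piece with boundary in F2 passing close enough to b must then contain the first
    one, but it does not contain a; so its boundary also passes near a, where there is no point of
    F2. *)
Lemma Finfty_boundary_comp a b : closure Finf (Some a) -> ~ Finf (Some a) ->
 closure Finf (Some b) -> ~ Finf (Some b) -> comp (Some a) (Some b).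
Proof.
move=> cla na clb nb; have Ja := Finfty_boundary cla na; have Jb := Finfty_boundary clb nb.
apply: contrapT => nab; have [F1 [F2 [s12 [F1a F2b]]]] := julia_separate Ja Jb nab.
have [c1 c2 JE F0] := s12; have [h Gh] := class_nonempty.
have F12 := disjE F0.
have [e1 e10 he1] := avoid_closed c2 (F12 _ F1a).
have [w [e0 [Gw e0a be0]]] := julia_near_disc Gh Ja e10.
have Gw' : Gid w by right.
have wF : emb (bd h w) `<=` F1.
 have [//|wF2] := jsplit_bd_or s12 Gh Gw'.
 by case: (he1 e0 e0a); apply: wF2; exists e0.
have npb : ~ pc h w b.
 move=> /(pc_interior_or_bd Gh)[ib|bb]; first exact: closure_Finfty_pc ib.
 by apply: (F12 (Some b)) => //; apply: wF; exists b.
have /openPC/(_ b npb)[d1 d10 hd1] : open (~` pc h w) by apply: closed_openC; exact: closed_pc.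
have [d2 d20 hd2] := avoid_closed c1 (fun F1b => F12 _ F1b F2b).
have dd : 0 < Num.min d1 d2 by rewrite lt_min d10.
have [w2 [s2 [Gw2 s2b bs2]]] := julia_near_disc Gh Jb dd.
move: s2b; rewrite lt_min => /andP[s2b1 s2b2].
have Gw2' : Gid w2 by right.
have w2F : emb (bd h w2) `<=` F2.
 have [w2F1|//] := jsplit_bd_or s12 Gh Gw2'.
 by case: (hd2 s2 s2b2); apply: w2F1; exists s2.
have [w12|w21] := pc_nested Gh Gw' Gh Gw2' (jsplit_bd_disjoint s12 wF w2F); last first.
 by apply: (hd1 s2 s2b1); apply: interior_subset; apply: w21; exact: bd_pc.
have npa : ~ pc h w2 a.
 move=> /(pc_interior_or_bd Gh)[ia|ba]; first exact: closure_Finfty_pc ia.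
 by apply: (F12 (Some a)) => //; apply: w2F; exists a.
have pe0 : pc h w2 e0 by apply: interior_subset; apply: w12; exact: bd_pc.
have aa : abs (a - a) < e1 by rewrite subrr abs0.
have [s sa bs] := pc_cross Gh e0a pe0 aa npa.
by apply: (he1 s sa); apply: w2F; exists s.
Qed.

Definition Gcf x : set C := finite_part (comp x).

Local Notation cf b := (Gcf (Some b)).

Lemma emb_cf x : emb (Gcf x) = comp x.
Proof.
apply/seteqP; split=> [_ [u cu <-] //|y cy].
by have [u E] := julia_finite (connected_component_sub cy); exists u; rewrite // /Gcf /finite_part /= -E.
Qed.

Lemma JsetP K : Jset G K <-> exists2 a, J (Some a) & K = Gcf (Some a).
Proof.
split=> [[x Jx xK]|[a Ja ->]]; last by exists (Some a) => //; rewrite emb_cf.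
have [a xa] := julia_finite Jx; exists a; first by rewrite -xa.
apply/seteqP; split=> u; rewrite /Gcf /finite_part /= -xa xK; first by exists u.
by move=> /embP.
Qed.

Lemma cf_refl a : J (Some a) -> Gcf (Some a) a.
Proof. by move=> Ja; exact: connected_component_refl. Qed.

Lemma connected_cf x : connected (Gcf x).
Proof. by apply/connected_embP; rewrite emb_cf; exact: component_connected. Qed.

Lemma compact_cf x : compact (Gcf x).
Proof.
apply/compactC; split.
 apply: (@closed_comp _ _ (Some : C -> S)) => [z _|].
  exact: one_point_compactification_some_continuous.
 by apply: component_closed; exact: closed_julia.
by have [M [hM _]] := julia_bound; exists M => z /connected_component_sub/hM.
Qed.

Lemma cf_eq a b : comp (Some a) (Some b) -> Gcf (Some a) = Gcf (Some b).
Proof. by move=> /same_connected_component; rewrite /Gcf => ->. Qed.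

Lemma cf_disjoint a b : Gcf (Some a) <> Gcf (Some b) -> Gcf (Some a) `&` Gcf (Some b) = set0.
Proof.
move=> ne; apply: disjI => u ua ub; apply: ne; apply: cf_eq.
by apply: connected_component_trans ua _; exact: connected_component_sym.
Qed.

Lemma Jset_anti K1 K2 : Jset G K1 -> Jset G K2 -> surr_le K1 K2 -> surr_le K2 K1 -> K1 = K2.
Proof.
move=> /JsetP[a Ja ->] /JsetP[b Jb ->]; apply: surr_le_anti; try exact: compact_cf.
 by exists a; exact: cf_refl.
by exists b; exact: cf_refl.
Qed.

Lemma exists_Finfty_boundary : exists2 a, closure Finf (Some a) & ~ Finf (Some a).
Proof.
have [h Gh] := class_nonempty; have [b bb] := bd_nonempty Gh gid1.
have [|/Finfty_julia|x clx nx] := @open_frontier _ Finf (Some b) (@connected_sphere) open_Finfty.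
- by exists infty; exact: Finfty_infty.
- by apply; exact: (bd_julia Gh gid1).
by have [a xa] := julia_finite (Finfty_boundary clx nx); exists a; rewrite -xa.
Qed.

Lemma boundary_FinftyP x : boundary Finf x <-> closure Finf x /\ ~ Finf x.
Proof. by rewrite /boundary ((interior_id _).1 open_Finfty). Qed.

Lemma part1_max : exists Jmax : set C,
 [/\ Jset G Jmax,
   (forall K, Jset G K -> (boundary Finf `<=` emb K <-> K = Jmax)) &
   (forall K, is_greatest_component G K <-> K = Jmax)].
Proof.
have [a cla na] := exists_Finfty_boundary; have Ja := Finfty_boundary cla na.
pose Jm := Gcf (Some a); have JJm : Jset G Jm by apply/JsetP; exists a.
have bJ : boundary Finf `<=` emb Jm.
 move=> x /boundary_FinftyP[clx nx]; rewrite emb_cf.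
 have [b xb] := julia_finite (Finfty_boundary clx nx); rewrite xb in clx nx *.
 exact: (Finfty_boundary_comp cla na clx nx).
have great K : Jset G K -> surr_le K Jm.
 move=> /JsetP[b Jb ->]; have [->|ne] := pselect (Gcf (Some b) = Jm); first by left.
 have dis := cf_disjoint ne.
 apply: (surr_leI (@connected_cf (Some b)) (cf_refl Jb) dis).
 have [M hM] := Finfty_far; apply/bounded_setC; exists M => z cz; apply: lerF => /hM Fz.
 have nJb : ~ Jm b.
  by move=> Jmb; have : (Gcf (Some b) `&` Gcf (Some a)) b by [split=> //; exact: cf_refl]; rewrite dis.
 (* To meet the domain of infinity, this component would have to cross its boundary, which is
    contained in [Jm]. Staying away from it, the component is bounded. *)
 have : emb (connected_component (~` Jm) b) `<=` ~` closure Finf.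
  apply: (@connected_open_split S _ _ Finf).
  - by apply: connected_emb; exact: component_connected.
  - by apply: closed_openC; exact: closed_closure.
  - exact: open_Finfty.
  - move=> _ [u cu <-]; have [Fu|nFu] := pselect (Finf (Some u)); [by right|left=> clu].
   have /bJ/embP Jmu : boundary Finf (Some u) by apply/boundary_FinftyP.
   exact: (connected_component_sub cu Jmu).
  - move=> x _ ncl Fx; apply: ncl; exact: subset_closure.
  - exists (Some b); split; first by exists b => //; apply: connected_component_refl.
   move=> clb; have nFb : ~ Finf (Some b) by move=> /Finfty_julia.
   by apply: nJb; apply/embP; apply: bJ; apply/boundary_FinftyP.
 move=> /(_ (Some z) (ex_intro2 _ _ z cz erefl)); apply; exact: subset_closure.
exists Jm; split=> // K.
 move=> JK; split=> [bK|->//]; apply/esym; move/JsetP: JK bK => [b Jb ->] bK.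
 apply/esym; apply: cf_eq; have : emb (Gcf (Some b)) (Some a) by apply: bK; apply/boundary_FinftyP.
 by rewrite emb_cf.
split=> [[JK hK]|->]; last by split.
by apply: Jset_anti => //; [exact: great|exact: hK].
Qed.

Lemma Jhat_emb : Jhat G = [set emb K | K in Jset G].
Proof.
apply/seteqP; split=> [_ [x Jx <-]|_ [K JK <-] //].
have [a xa] := julia_finite Jx; exists (Gcf x); last by rewrite emb_cf.
by apply/JsetP; exists a; rewrite -?xa.
Qed.

(** * The smallest filled-in Julia set and the least component *)

Lemma KhatP h z : G h -> Kh z <-> forall w, Gid w -> pc h w z.
Proof.
move=> Gh; have [M eM] := escape_radius (class_degree Gh); split.
 move=> /bounded_setC[B hB] w Gw; rewrite pc_def /=; apply/bounded_setC; exists B.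
 move=> _ [q /generated1P[n ->] <-]; apply: hB; exists (piter h n.+1 \Po w).
  exact: (piter_comp_in n Gh Gw).
 by rewrite horner_comp.
move=> H; apply/bounded_setC; exists M => _ [g Gg <-].
by have := H g (or_intror Gg); rewrite pc_def /= => /(filled_juliaP _ eM)/(_ 0%N); rewrite hornerX.
Qed.

Lemma Khat_pc h w : G h -> Gid w -> Kh `<=` pc h w.
Proof. by move=> Gh Gw z /(KhatP z Gh); apply. Qed.

Lemma compact_Khat : compact Kh.
Proof.
have [h Gh] := class_nonempty.
have E : Kh = \bigcap_(w in Gid) pc h w by apply/seteqP; split=> z /(KhatP z Gh).
apply/compactC; split.
 by rewrite E; apply: closed_bigI => w _; exact: closed_pc.
have [M [_ hM]] := julia_bound; exists M => z /(KhatP z Gh)/(_ 'X gid1).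
by apply: hM => //; left.
Qed.

Lemma post_Khat : P `<=` Kh.
Proof.
have [h Gh] := class_nonempty; move=> z Pz; apply/(KhatP z Gh) => w Gw.
exact: post_pc.
Qed.

Lemma Khat_horner g z : G g -> Kh z -> Kh g.[z].
Proof.
move=> Gg; have [h Gh] := class_nonempty; move=> /(KhatP _ Gh) H; apply/(KhatP _ Gh) => w Gw.
have := H (w \Po g) (or_intror (Gid_compl Gg Gw)).
by rewrite !pc_def /= horner_comp.
Qed.

Lemma boundary_KhatP a : boundary Kh a <-> Kh a /\ ~ Kh° a.
Proof. by rewrite boundaryE //; have /compactC[] := compact_Khat. Qed.

Lemma Khat_boundary_julia a : boundary Kh a -> J (Some a).
Proof.
move=> /boundary_KhatP[Ka nia] Fa; apply: nia.
have /bounded_setC[M hM] := Ka; pose M' := `|M| + 1.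
have M'0 : 0 <= M' by rewrite addr_ge0.
have e0 : 0 < (2 * (1 + M'))^-1 by rewrite invr_gt0 mulr_gt0// ltr_pwDl.
have [d d0 hd] := equicont_of_fatou Fa e0; apply/interiorPC; exists d => // z zd.
apply/bounded_setC; exists (2 * M' + 1) => _ [g Gg <-]; apply: lerF => h.
have := hd g Gg z zd; rewrite ltNge => /negP; apply; apply: dst_far_ge => //; last exact: ltW.
have : abs g.[a] <= M by apply: hM; exists g.
by rewrite /M'; have := ler_norm M; lra.
Qed.

Lemma Khat_boundary_near h a e : G h -> boundary Kh a -> 0 < e ->
 exists w (s : C), [/\ Gid w, abs (s - a) < e & bd h w s].
Proof.
move=> Gh /boundary_KhatP[Ka nia] e0.
have [u ua nu] : exists2 u, abs (u - a) < e & ~ Kh u.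
 apply: contrapT => no; apply: nia; apply/interiorPC; exists e => // z za.
 by apply: contrapT => nz; apply: no; exists z.
have [w [Gw nw]] : exists w, Gid w /\ ~ pc h w u.
 apply: contrapT => no; apply: nu; apply/(KhatP u Gh) => w Gw.
 by apply: contrapT => nw; apply: no; exists w.
have aa : abs (a - a) < e by rewrite subrr abs0.
by have [s sa bs] := pc_cross Gh aa (Khat_pc Gh Gw Ka) ua nw; exists w, s.
Qed.

(** Both pieces used contain Kh, hence a and b. The piece with boundary in F2 near b cannot be the
    larger, since its boundary point lies in the other. If it is the smaller, it contains a but not
    a boundary point of the other one close to a, so its boundary passes near a, where there is no
    point of F2. *)
Lemma Khat_boundary_comp a b : boundary Kh a -> boundary Kh b -> comp (Some a) (Some b).
Proof.
move=> ba bb; have Ja := Khat_boundary_julia ba; have Jb := Khat_boundary_julia bb.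
have [Ka _] := (boundary_KhatP a).1 ba; have [Kb _] := (boundary_KhatP b).1 bb.
apply: contrapT => nab; have [F1 [F2 [s12 [F1a F2b]]]] := julia_separate Ja Jb nab.
have [c1 c2 JE F0] := s12; have [h Gh] := class_nonempty.
have F12 := disjE F0.
have [e1 e10 he1] := avoid_closed c2 (F12 _ F1a).
have [w [e0 [Gw e0a be0]]] := Khat_boundary_near Gh ba e10.
have wF : emb (bd h w) `<=` F1.
 have [//|wF2] := jsplit_bd_or s12 Gh Gw.
 by case: (he1 e0 e0a); apply: wF2; exists e0.
have ib : (pc h w)° b.
 have [//|bb'] := pc_interior_or_bd Gh (Khat_pc Gh Gw Kb).
 by case: (F12 (Some b)) => //; apply: wF; exists b.
have [d1 d10 hd1] := (interiorPC _ _).1 ib.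
have [d2 d20 hd2] := avoid_closed c1 (fun F1b => F12 _ F1b F2b).
have dd : 0 < Num.min d1 d2 by rewrite lt_min d10.
have [w2 [s2 [Gw2 s2b bs2]]] := Khat_boundary_near Gh bb dd.
move: s2b; rewrite lt_min => /andP[s2b1 s2b2].
have w2F : emb (bd h w2) `<=` F2.
 have [w2F1|//] := jsplit_bd_or s12 Gh Gw2.
 by case: (hd2 s2 s2b2); apply: w2F1; exists s2.
have notint h' w' (s : C) : G h' -> bd h' w' s -> ~ (pc h' w')° s.
 by move=> Gh'; rewrite bd_def boundaryE; [case|exact: closed_pc].
have [w12|w21] := pc_nested Gh Gw Gh Gw2 (jsplit_bd_disjoint s12 wF w2F).
 by apply: (notint _ _ _ Gh bs2); apply: w12; apply: hd1.
have ne0 : ~ pc h w2 e0 by move=> /w21; exact: notint be0.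
have aa : abs (a - a) < e1 by rewrite subrr abs0.
have [s sa bs] := pc_cross Gh aa (Khat_pc Gh Gw2 Ka) e0a ne0.
by apply: (he1 s sa); apply: w2F; exists s.
Qed.

Lemma exists_Khat_boundary : exists a, boundary Kh a.
Proof.
apply: contrapT => no; have [p Pp] := post_nonempty.
have cT : connected [set: C] by exact: (@star_connected _ 0 _).
have [_ [B hB]] := (compactC _).1 compact_Khat.
have /(_ (rc (`|B| + 1)) I)/interior_subset/hB : [set: C] `<=` Kh°.
 apply: (boundary_crossing cT); first by exists p; split=> //; exact: post_Khat.
 by rewrite setTI; apply/seteqP; split=> // u bu; apply: no; exists u.
by rewrite abs_rcE ?addr_ge0//; have := ler_norm B; lra.
Qed.

Lemma jsplit_trivial : jsplit set0 J.
Proof.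
by split; [exact: closed0|exact: closed_julia|rewrite set0U|rewrite set0I].
Qed.

Lemma jsplitI A B A' B' : jsplit A B -> jsplit A' B' -> jsplit (A `|` A') (B `&` B').
Proof.
move=> [a b c d] [a' b' c' d']; split; [exact: closedU|exact: closedI| |].
- apply/seteqP; split=> x.
  move=> Jx; have : (A `|` B) x by rewrite -c.
  have : (A' `|` B') x by rewrite -c'.
  by move=> [?|?] [?|?]; [left; left|left; right|left; left|right].
 by move=> [[Ax|Ax]|[Bx _]]; [rewrite c; left|rewrite c'; left|rewrite c; right].
- apply: disjI => x [Ax|Ax] [Bx B'x].
  exact: disjE d Ax Bx.
 exact: disjE d' Ax B'x.
Qed.

Lemma unbounded_component_split b (U : set C) M : (forall z, J (Some z) -> abs z <= M) -> J (Some b) ->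
 open U -> connected U -> U `&` Gcf (Some b) = set0 -> ~ bounded_set U ->
 forall a, U a -> exists F1 F2 (L : set C), [/\ jsplit F1 F2, F2 (Some b), connected L /\ L a,
  (forall z, L z -> ~ F2 (Some z)) & exists2 z, L z & M < abs z].
Proof.
move=> hM Jb oU cU U0 ub.
pose good (x : C) := exists F1 F2 (L : set C), [/\ jsplit F1 F2, F2 (Some b), connected L /\ L x,
  (forall z, L z -> ~ F2 (Some z)) & exists2 z, L z & M < abs z].
have uni (L : set C) (z x : C) r : connected L -> L z -> abs (z - x) < r -> connected (L `|` disc x r).
 move=> cL Lz zx; have -> : L `|` disc x r = \bigcup_(i in [set: bool]) (if i then L else disc x r).
  apply/seteqP; split=> u; first by move=> [Lu|du]; [exists true|exists false].
  by move=> [[] _ ?]; [left|right].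
 apply: bigcup_connected; first by exists z => -[] _.
 by move=> [] _ //; exact: connected_disc.
have oA : open [set x | U x /\ good x].
 apply/openPC => x [Ux [F1 [F2 [L [s12 Fb [cL Lx] LF [y Ly My]]]]]].
 have [r1 r10 h1] := (openPC _).1 oU x Ux.
 have [_ c2 _ _] := s12; have [r2 r20 h2] := avoid_closed c2 (LF x Lx).
 exists (Num.min r1 r2); first by rewrite lt_min r10.
 have xx : abs (x - x) < Num.min r1 r2 by rewrite subrr abs0 lt_min r10.
 move=> v vx; move: (vx); rewrite /disc /= lt_min => /andP[v1 v2]; split; first exact: h1.
 exists F1, F2, (L `|` disc x (Num.min r1 r2)); split=> //.
 - by split; [exact: (uni _ x)|right].
 - by move=> z [/LF//|]; rewrite /disc /= lt_min => /andP[_ /h2].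
 - by exists y => //; left.
have oB : open [set x | U x /\ ~ good x].
 apply/openPC => x [Ux ngx]; have [r r0 hr] := (openPC _).1 oU x Ux.
 pose N : set S := ~` emb (cdisc x (r / 2)).
 have oN : open N by apply: closed_openC; apply: closed_emb; exact: compact_cdisc.
 have cN : comp (Some b) `<=` N.
  move=> y cy [u ux uy]; have : (U `&` Gcf (Some b)) u.
   split; last by rewrite /Gcf /finite_part /= uy.
   by apply: hr; move: ux; rewrite /cdisc /disc /=; lra.
  by rewrite U0.
 have [F1' [F2' [s12' F2'b F2'N]]] := jsplit_nbhd Jb oN cN.
 have r2 : 0 < r / 2 by rewrite divr_gt0.
 exists (r / 2) => // v vx; split; first by apply: hr; move: vx; rewrite /disc /=; lra.
 move=> [F1 [F2 [L [s12 Fb [cL Lv] LF [y Ly My]]]]]; apply: ngx.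
 exists (F1 `|` F1'), (F2 `&` F2'), (L `|` disc x (r / 2)); split=> //.
 - exact: jsplitI.
 - by split; [exact: (uni _ v)|right; exact: disc_center].
 - move=> z [/LF nF [/nF//]|zx [_ /F2'N]]; apply; exists z => //.
  exact: ltW.
 - by exists y => //; left.
have sub : U `<=` [set x | U x /\ good x].
 apply: (connected_open_split cU oA oB).
 - by move=> x Ux; have [g|g] := pselect (good x); [left|right].
 - by move=> x _ [_ g] [_ ng].
 - have [z Uz Mz] : exists2 z, U z & M < abs z.
   apply: contrapT => no; apply: ub; apply/bounded_setC; exists M => z Uz.
   by apply: lerF => h; apply: no; exists z.
  exists z; split=> //; split=> //; exists set0, J, [set z]; split=> //.
  + exact: jsplit_trivial.
  + by split=> //; exact: connected1.
  + by move=> _ -> /hM; rewrite leNgt Mz.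
  + by exists z.
by move=> a /sub[].
Qed.

(** If the component of b did not surround a, a connected set L from a to beyond M would avoid a
    clopen part F2 of J(G) around b. A piece with boundary in F2 contains a, as it contains Kh,
    hence all of L, although pieces are bounded by M. *)
Lemma part2_min : exists2 a, boundary Kh a & forall K, Jset G K -> surr_le (Gcf (Some a)) K.
Proof.
have [a ba] := exists_Khat_boundary; exists a => //; have Ja := Khat_boundary_julia ba.
have [M [hM hM2]] := julia_bound; have [h Gh] := class_nonempty.
have [Ka _] := (boundary_KhatP a).1 ba.
move=> K /JsetP[b Jb ->]; have [->|ne] := pselect (Gcf (Some a) = Gcf (Some b)); first by left.
have dis := cf_disjoint ne.
apply: (surr_leI (@connected_cf (Some a)) (cf_refl Ja) dis); apply: contrapT => ub.
have oC : open (~` Gcf (Some b)) by apply: closed_openC; have /compactC[] := @compact_cf (Some b).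
have na : (~` Gcf (Some b)) a.
 by move=> ca; have : (Gcf (Some a) `&` Gcf (Some b)) a by [split=> //; exact: cf_refl]; rewrite dis.
have U0 : connected_component (~` Gcf (Some b)) a `&` Gcf (Some b) = set0.
 by apply/seteqP; split=> // u [/connected_component_sub].
have [F1 [F2 [L [s12 F2b [cL La] LF [z Lz Mz]]]]] := unbounded_component_split hM Jb
 (component_openC oC) (@component_connected _ _ a) U0 ub (connected_component_refl na).
have [c1 _ JE F0] := s12.
have nF1b : ~ F1 (Some b) by move=> F1b; apply: disjE F0 F1b _.
have [e e0 he] := avoid_closed c1 nF1b.
have [w [s [Gw sb bs]]] := julia_near_disc Gh Jb e0.
have Gw' : Gid w by right.
have wF : emb (bd h w) `<=` F2.
 have [wF1|//] := jsplit_bd_or s12 Gh Gw'.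
 by case: (he s sb); apply: wF1; exists s.
have : L `<=` (pc h w)°.
 apply: (boundary_crossing cL); first by exists a; split=> //; exact: (Khat_pc Gh Gw' Ka).
 by rewrite -bd_def; apply: disjI => u Lu bu; apply: (LF u Lu); apply: wF; exists u.
by move=> /(_ z Lz)/interior_subset/(hM2 h w z Gh Gw'); rewrite leNgt Mz.
Qed.

Variable a0 : C.
Hypothesis ba0 : boundary Kh a0.
Local Notation Jm := (cf a0).

Lemma Jm_julia z : Jm z -> J (Some z).
Proof. exact: connected_component_sub. Qed.

Lemma Jm_a0 : Jm a0.
Proof. by apply: cf_refl; exact: Khat_boundary_julia. Qed.

Lemma Khat_a0 : Kh a0.
Proof. exact: ((boundary_KhatP a0).1 ba0).1. Qed.

Lemma boundary_Khat_Jm : boundary Kh `<=` Jm.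
Proof. by move=> z bz; exact: (Khat_boundary_comp ba0 bz). Qed.

Lemma Khat_interior_or z : Kh z -> Kh° z \/ Jm z.
Proof.
move=> Kz; have [?|ni] := pselect (Kh° z); [by left|right].
exact: (boundary_Khat_Jm ((boundary_KhatP z).2 (conj Kz ni))).
Qed.

Lemma Khat_unbounded (D : set C) : components (~` Jm) D -> ~ bounded_set D -> Kh `<=` ~` D.
Proof.
move=> [x nx <-] ub z Kz Dz; apply: ub.
have [_ [M hM]] := (compactC _).1 compact_Khat.
apply/bounded_setC; exists M => u Du; apply: hM; apply: interior_subset.
apply: (boundary_crossing (@component_connected _ _ x)) Du; first by exists z.
apply: disjI => v Dv bv; exact: (connected_component_sub Dv (boundary_Khat_Jm bv)).
Qed.

Lemma pcX h : pc h 'X = filled_julia h.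
Proof. by apply/seteqP; split=> z; rewrite pc_def /= hornerX. Qed.

(** * Elements whose Julia set misses J_min *)

Section Avoiding.
Variable g : {poly C}.
Hypothesis Gg : G g.
Hypothesis gJ : julia1 g `&` emb Jm = set0.
Local Notation K := (filled_julia g).

Lemma bd_avoid z : bd g 'X z -> ~ Jm z.
Proof.
move=> bz Jz; have : (julia1 g `&` emb Jm) (Some z).
 by split; [rewrite (julia1_bd Gg)|]; exists z.
by rewrite gJ.
Qed.

Lemma Khat_interior : Kh `<=` K°.
Proof.
move=> z Kz; have Kgz : pc g 'X z := Khat_pc Gg gid1 Kz.
have [h|/bd_avoid nJ] := pc_interior_or_bd Gg Kgz; first by rewrite -pcX.
by have [h|//] := Khat_interior_or Kz; rewrite -pcX; apply: interiorS h; exact: (Khat_pc Gg gid1).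
Qed.

Lemma Jm_interior : Jm `<=` K°.
Proof.
apply: (boundary_crossing (@connected_cf (Some a0))).
 by exists a0; split; [exact: Jm_a0|apply: interior_subset; apply: Khat_interior; exact: Khat_a0].
apply/seteqP; split=> // z [Jz]; rewrite -pcX -bd_def => /bd_avoid; exact.
Qed.

(** Split J(G) between a0 and J(g) and take a piece whose boundary lies on the side of a0 and passes
    inside K(g); nestedness leaves only the interior of K(g) for it. *)
Lemma inner_piece : exists w, [/\ Gid w, pc g w `<=` K° &
 forall c b, bd g w c -> bd g 'X b -> ~ comp (Some c) (Some b)].
Proof.
have [b bb] := bd_nonempty Gg gid1.
have Ja : J (Some a0) := (Jm_julia Jm_a0).
have Jb : J (Some b) by exact: (bd_julia Gg gid1).
have [F1 [F2 [s12 [F1a F2b]]]] := julia_separate Ja Jb (fun hc => bd_avoid bb hc).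
have [c1 c2 JE F0] := s12.
have F12 := disjE F0.
have [e1 e10 he1] := avoid_closed c2 (F12 _ F1a).
have [e2 e20 he2] := (interiorPC _ _).1 (Khat_interior Khat_a0).
have e0 : 0 < Num.min e1 e2 by rewrite lt_min e10.
have [w [s [Gw sa bs]]] := Khat_boundary_near Gg ba0 e0.
move: sa; rewrite lt_min => /andP[s1 s2].
have wF : emb (bd g w) `<=` F1.
 have [//|wF2] := jsplit_bd_or s12 Gg Gw.
 by case: (he1 s s1); apply: wF2; exists s.
have XF : emb (bd g 'X) `<=` F2 := jsplit_bd (jsplitC s12) Gg gid1 bb F2b.
exists w; split=> // [|c b' bc bb' cb].
 have [wX|Xw] := pc_nested Gg Gw Gg gid1 (jsplit_bd_disjoint s12 wF XF).
  by rewrite -pcX.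
 have := Xw s; rewrite pcX => /(_ (he2 s s2)); move: bs.
 by rewrite bd_def boundaryE; [case|exact: closed_pc].
have F1c : F1 (Some c) by apply: wF; exists c.
apply: (@F12 (Some b')); last by apply: XF; exists b'.
apply: (connected_closed_split (@component_connected _ J (Some c)) c1 c2 _ _ _ cb).
- by rewrite -JE; exact: connected_component_sub.
- by move=> u _; exact: (disjE F0).
- by exists (Some c); split=> //; apply: connected_component_refl; rewrite JE; left.
Qed.

(* If g^n(D) avoids A = pc g w for all n on a disc D about a point of J(g), then
  Harnack's inequality bounds the iterates on a smaller disc. *)
Lemma inner_piece_hit w b r : Gid w -> pc g w `<=` K° -> bd g 'X b -> 0 < r ->
 exists n z, abs (z - b) <= r /\ bd g w (piter g n).[z].
Proof.
move=> Gw wK bb r0; apply: contrapT => no; have dg := class_degree Gg.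
have [M eM] := escape_radius dg; have [p Pp] := post_nonempty.
have [Kb nKb] : K b /\ ~ K° b.
 by move: bb; rewrite bd_def boundaryE; [rewrite pcX|exact: closed_pc].
have [t t0 ht] := (interiorPC _ _).1 (Khat_interior (post_Khat (Gid_post Gw Pp))).
have [m m0 hm] := horner_near w p t0.
have {}hm u : abs (u - p) < m -> pc g w u by move=> /hm/ht; rewrite pc_def.
have out n z : abs (z - b) <= r -> ~ pc g w (piter g n).[z].
 have cI : connected [set (piter g n).[z] | z in cdisc b r].
  apply: connected_continuous_connected; first exact: connected_cdisc.
  by exact: horner_within.
 move=> zb hz; have : [set (piter g n).[z] | z in cdisc b r] `<=` (pc g w)°.
  apply: (boundary_crossing cI); first by exists (piter g n).[z]; split=> //; exists z.
  by rewrite -bd_def; apply: disjI => _ [u ub <-] bu; apply: no; exists n, u.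
 move=> /(_ (piter g n).[b]) /= h; apply: nKb; apply: (interior_filled_piter (n:=n) dg).
 apply: wK; apply: interior_subset; apply: h; exists b => //; rewrite /cdisc /= subrr abs0; exact: ltW.
apply: nKb; apply/interiorPC; exists (r / 8); first by rewrite divr_gt0.
move=> z zb; apply/bounded_setC.
pose B := m * (((M + abs p) / m) ^+ 5) + abs p; exists B => _ [q /generated1P[n ->] <-].
have low u : abs (u - b) <= r -> m <= abs (piter g n.+1 - p%:P).[u].
 by move=> ub; rewrite !hornerE; apply: lerF => h; apply: (out n.+1 u ub); exact: hm.
have [h _] := harnack_pow r0 m0 low (ltW zb).
have h1 : abs (piter g n.+1 - p%:P).[b] / m <= (M + abs p) / m.
 rewrite ler_pM2r ?invr_gt0// !hornerE; apply: le_trans (absBD _ _) _; rewrite lerD2r.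
 exact: (filled_juliaP b eM).1.
have h2 : abs (piter g n.+1 - p%:P).[z] <= m * ((M + abs p) / m) ^+ 5.
 rewrite mulrC -ler_pdivrMr//; apply: (le_trans h).
 have [m1 M1] := (ltW m0, le_trans ler01 eM.1).
 by apply: lerXn2r h1; rewrite nnegrE divr_ge0 ?addr_ge0 ?abs_ge0.
by apply: le_trans (abs_lip _ p) _; rewrite addrC /B lerD2r; move: h2; rewrite !hornerE.
Qed.

(** The preimage of the piece under g is the piece of [w \Po g]. If it were inside the piece, or if
    the two boundaries met, then the piece, respectively the component of a common boundary point,
    would be a closed backward invariant set missing a point of J(g), against [inner_piece_hit]. The
    remaining nesting gives the claim because g is open. *)
Lemma inner_piece_invariant : exists w, [/\ Gid w, pc g w `<=` K° &
 forall z, pc g w z -> (pc g w)° g.[z]].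
Proof.
have [w [Gw wK sep]] := inner_piece; exists w; split=> //.
have Gwg : Gid (w \Po g) by right; exact: (Gid_compl Gg Gw).
have gE z : pc g (w \Po g) z <-> pc g w g.[z] by rewrite !pc_def /= horner_comp.
have [b bb] := bd_nonempty Gg gid1.
have nKb : ~ K° b by move: bb; rewrite bd_def boundaryE; [rewrite pcX => -[]|exact: closed_pc].
have clw := closed_pc Gg (w:=w).
have absurd (X : set C) : closed X -> ~ X b -> bd g w `<=` X -> (forall z, X g.[z] -> X z) -> False.
 move=> cX nX bX Xg; have [r r0 hr] := (openPC _).1 (closed_openC cX) b nX.
 have r2 : 0 < r / 2 by rewrite divr_gt0.
 have [n [z [zb bz]]] := inner_piece_hit Gw wK bb r2.
 have : ~ X z by apply: hr; rewrite /disc /=; lra.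
 by apply; move: (bX _ bz); elim: (n) (z) => [|k IH] u; [rewrite /piter /= hornerX|rewrite horner_piterSr => /IH/Xg].
have [b0|/set0P[c [bc bc']]] := eqVneq (bd g w `&` bd g (w \Po g)) set0; last first.
 exfalso; have Jc : J (Some c) := bd_julia Gg Gw bc.
 apply: (absurd (Gcf (Some c))).
 - by have [] := (compactC _).1 (compact_cf (x:=Some c)).
 - by move=> cb; exact: (sep c b bc bb cb).
 - by move=> u bu; exact: (bd_comp_eq Gg Gw bc bu).
 - move=> z cz; have bgc : bd g w g.[c] by have [h _] := bd_comp c Gg Gw Gg; exact: h.
  apply: (pullback (x:=Some c) (y:=Some z) Gg); first exact: (bd_julia Gg Gw bgc).
  apply: connected_component_trans (_ : comp _ (Some c)) cz.
  exact: (bd_comp_eq Gg Gw bgc bc).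
have [wg|gw] := pc_nested Gg Gw Gg Gwg b0.
 move=> z /wg/interiorPC[r r0 hr]; apply/interiorPC.
 have [k k0 hk] := horner_open_mapping z (class_nonconstant Gg) r0; exists k => // u /hk[v vz <-].
 by apply/gE; exact: hr.
exfalso; apply: (absurd (pc g w)).
- exact: clw.
- by move=> /wK.
- by move=> u; rewrite bd_def boundaryE// => -[].
- by move=> z /gE/gw/interior_subset.
Qed.

(** Contraction on the piece gives a. Since P*(G) is closed, forward invariant and inside the piece,
    it contains a, and all critical values are attracted, as [interior_filled_julia_basin] requires.
    The basin is a union of connected preimages of the piece with a common point. *)
Lemma basin_avoiding : exists a, [/\ P a, g.[a] = a, abs g^`().[a] < 1, connected K° &
 forall z, K° z -> vanishing (fun n => abs ((piter g n).[z] - a))].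
Proof.
have dg := class_degree Gg; have [M eM] := escape_radius dg.
have [w [Gw wK gw]] := inner_piece_invariant; have [p Pp] := post_nonempty.
have PA : P `<=` pc g w := post_pc Gg Gw.
have cA := compact_pc Gg Gw; have [_ [B hB]] := (compactC _).1 cA.
have [d d0 hd] : exists2 d, 0 < d & forall z, pc g w z -> disc g.[z] d `<=` pc g w.
 have cgA : compact [set g.[z] | z in pc g w].
  exact: compact_horner.
 have [|d d0 h] := compact_fatten cgA (@open_interior _ (pc g w)); first by move=> _ [z Az <-]; exact: gw.
 by exists d => // z Az; apply: subset_trans (h _ (ex_intro2 _ _ z Az erefl)) (@interior_subset _ _).
have [a [Aa ga ga1 hv aP]] := strict_contraction d0 hB hd cA (connected_pc Gg Gw) (PA p Pp).
have Pa : P a by apply: aP (@closed_post) Pp (fun z => post_horner Gg (z:=z)).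
pose W := [set z | exists n, (pc g w)° (piter g n).[z]].
have oW : open W.
 apply/openPC => z [n /interiorPC[r r0 hr]]; have [t t0 ht] := horner_near (piter g n) z r0.
 exists (t / 2); first by rewrite divr_gt0.
 move=> u uz; exists n; apply/interiorPC.
 have ut : 0 < r - abs ((piter g n).[u] - (piter g n).[z]).
  by rewrite subr_gt0; apply: ht; move: uz; rewrite /disc /=; lra.
 exists (r - abs ((piter g n).[u] - (piter g n).[z])) => // v vu; apply: hr; move: vu; rewrite /disc /=.
 by have := abs_tri (piter g n).[u] v (piter g n).[z]; lra.
have AW z : pc g w z -> W z by move=> Az; exists 1%N; rewrite piter1; exact: gw.
have Wv z : W z -> vanishing (fun n => abs ((piter g n).[z] - a)).
 move=> [k /interior_subset/hv h] e /h[N hN]; exists (N + k)%N => n Nn.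
 have kn : (k <= n)%N by apply: leq_trans Nn; exact: leq_addl.
 by rewrite -(subnK kn) horner_piterD; apply: hN; rewrite leq_subRL// addnC.
have KW : K° `<=` W.
 apply: (interior_filled_julia_basin dg eM oW (AW a Aa) ga ga1).
  by move=> c c0; apply: Wv; exists 2%N; rewrite horner_piterS piter1; exact/gw/PA/(crit_post Gg c0).
 by move=> z [n h]; exists n.+1; rewrite horner_piterSr.
have KE : K° = W.
 apply/seteqP; split=> // z [n /interior_subset/wK]; exact: (interior_filled_piter (n:=n) dg).
have cW : connected W.
 have -> : W = \bigcup_(n : nat) [set z | pc g w (piter g n).[z]].
  apply/seteqP; split=> z [n]; first by move=> /interior_subset h; exists n.
  by move=> _ /= h; exists n.+1; rewrite horner_piterS; exact: gw.
 apply: bigcup_connected; first by exists p => n _ /=; apply: PA; elim: n => [|n IH];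
  [rewrite /piter /= hornerX|rewrite horner_piterS; exact: (post_horner Gg)].
 move=> n _; have -> : [set z | pc g w (piter g n).[z]] = pc g (w \Po piter g n).
  by rewrite !pc_def; apply/seteqP; split=> z; rewrite /= horner_comp.
 apply: (connected_pc Gg); case: n => [|n]; first by rewrite /piter /= comp_polyXr.
 by right; apply: (Gid_compl _ Gw); apply: piter_in => //; exact: class_comp.
by exists a; rewrite KE; exact: (And5 Pa ga ga1 cW Wv).
Qed.

Lemma part4 : exists zg : C, [/\ attracting_fixed_point g zg,
 (filled_julia g)° = immediate_basin g zg & Jm `<=` (filled_julia g)°].
Proof.
have [a [_ ga ga1 cK hv]] := basin_avoiding; exists a; split; last exact: Jm_interior.
- by split=> //; rewrite normE -rc1 -[rc (abs _)]/((_)%:C)%C ltcR.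
- exact: (filled_julia_immediate_basin (class_degree Gg) ga ga1 cK hv).
Qed.

End Avoiding.

Lemma least_iff : (forall K, Jset G K -> surr_le Jm K) ->
 forall K, is_least_component G K <-> K = Jm.
Proof.
move=> least K; have JJ : Jset G Jm by apply/JsetP; exists a0 => //; exact: Jm_julia Jm_a0.
split=> [[JK hK]|->]; last by split.
by apply: Jset_anti => //; [exact: hK|exact: least].
Qed.

Lemma part2_domain : exists D : set C, [/\ (forall D', components (~` Jm) D' /\ ~ bounded_set D' <-> D' = D),
 P `<=` Kh, Kh `<=` ~` D & boundary Kh `<=` Jm].
Proof.
have [D [[cD uD] hD]] := unique_unbounded_component (compact_cf (x:=Some a0)).
exists D; split.
- by move=> D'; split=> [/hD|->].
- exact: post_Khat.
- exact: Khat_unbounded cD uD.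
- exact: boundary_Khat_Jm.
Qed.

(** * Excluding a one-point J_min *)

Section DegenerateLeast.
Variable g : {poly C}.
Hypothesis Gg : G g.
Hypothesis gJ : julia1 g `&` emb Jm = set0.
Hypothesis Ja0 : forall z, Jm z -> z = a0.

Lemma singleton_Khat z : Kh z -> z = a0.
Proof.
move=> Kz; have := @maximum_principle ('X - a0%:P) Kh 0 compact_Khat _ z Kz; rewrite !hornerE => h.
apply/eqP; rewrite -subr_eq0 -abs_eq0 eq_le abs_ge0 andbT; apply: h => u bu.
by rewrite !hornerE (Ja0 (boundary_Khat_Jm bu)) subrr abs0.
Qed.

Lemma singleton_fixed h : G h -> h.[a0] = a0.
Proof. by move=> Gh; apply: singleton_Khat; apply: Khat_horner => //; exact: Khat_a0. Qed.

Lemma singleton_affine h : G h -> exists b : R, log_affine a0 h b (degree h)%:R.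
Proof.
move=> Gh; have ha := singleton_fixed Gh; have Ja := Jm_julia Jm_a0.
apply: single_root_affine => [|z hz]; first exact: class_nonconstant.
by apply: Ja0; apply: (pullback (x:=Some a0) (y:=Some z) Gh); rewrite /= ?ha ?hz//; exact: connected_component_refl.
Qed.

(** Every element acts affinely on log-distances to a0, and K(g) is the disc of radius exp(t). [E]
    contains s when some element maps the circle of radius exp(s) into J(g), so that this circle is
    in J(G). [E] is dense below t; hence the whole disc is in J(G) and joins a0 to J(g), which
    misses J_min. *)
Lemma singleton_absurd : False.
Proof.
have [bg hg] := singleton_affine Gg; set d := (degree g)%:R in hg.
have d2 : 2 <= d by rewrite ler_nat; exact: (class_degree Gg).
pose t := bg / (1 - d); have gt : bg + d * t = t.
 by rewrite /t; field; rewrite subr_eq0 eq_sym gt_eqF//; lra.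
have KE : filled_julia g = cdisc a0 (expR t) := filled_julia_disc hg d2 (singleton_fixed Gg) gt.
pose E s := exists (u : {poly C}) (b D : R), [/\ G u, log_affine a0 u b D, 1 <= D & b + D * s = t].
have Edeg h : G h -> (1 : R) <= (degree h)%:R by move=> Gh; rewrite ler1n; exact: ltnW (class_degree Gh).
have bdg (u : {poly C}) z : Gid u -> bd g u z -> abs (u.[z] - a0) = expR t.
 by move=> Gu /(bdE Gg Gu); rewrite KE; exact: boundary_cdisc.
have low M : exists2 s, E s & s < M.
 have Ja : J (Some a0) := Jm_julia Jm_a0.
 have [w [z [Gw za bz]]] := julia_near_disc Gg Ja (expR_gt0 M).
 have wz := bdg w z (or_intror Gw) bz; have [b hb] := singleton_affine Gw.
 have za0 : z != a0.
  apply/eqP => z0; move: wz; rewrite z0 (singleton_fixed Gw) subrr abs0 => /esym/eqP.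
  by rewrite gt_eqF// expR_gt0.
 exists (logdist a0 z); last by rewrite -ltr_expR expR_logdist.
 exists w, b, (degree w)%:R; split=> //; first exact: Edeg.
 have [wa <-] := hb z za0; apply: expR_inj; rewrite expR_logdist//.
have Et : E t by exists g, bg, d; split=> //; lra.
(* From s one can descend within [E] by an amount between e / d and e. For an element w belonging to
   a very low level s1, the composition w o g^(i+1) o u belongs to s - X / d^(i+1) with X = (t - s1)
   / D, and i is chosen so that X / d^(i+1) <= e < X / d^i. *)
have step s e : E s -> 0 < e -> exists2 s', E s' & s - e <= s' <= s - e / d.
 move=> [u [b [D [Gu hu D1 us]]]] e0.
 have [s1 [w [bw [Dw [Gw hw Dw1 ws]]]] s1t] := low (t - D * e).
 pose X := (t - s1) / D; have Xe : e < X by rewrite ltr_pdivlMr; lra.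
 have dV : 0 <= d^-1 by rewrite invr_ge0; lra.
 have dV1 : d^-1 < 1 by rewrite invf_lt1; lra.
 have [n hn] := exists_small_power X dV dV1 e0.
 have [i ie ei] : exists2 i, X * d^-1 ^+ i.+1 <= e & e < X * d^-1 ^+ i.
  elim: n {hn}(ltW hn) => [|n IH] hn; first by move: hn; rewrite expr0 mulr1 leNgt Xe.
  by have [/IH//|h] := leP (X * d^-1 ^+ n) e; exists n.
 have d0 : d != 0 by rewrite gt_eqF//; lra.
 have D0 : D != 0 by rewrite gt_eqF//; lra.
 exists (s - X * d^-1 ^+ i.+1).
  have [b' hb bt] := log_affine_piter i.+1 hg gt.
  exists (w \Po (piter g i.+1 \Po u)), (bw + Dw * (b' + d ^+ i.+1 * b)), (Dw * (d ^+ i.+1 * D)); split.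
  - by apply: class_comp => //; apply: class_comp => //; apply: piter_in => //; exact: class_comp.
  - by apply: log_affine_comp hw _; exact: log_affine_comp hb hu.
  - have d1 : 1 <= d ^+ i.+1 by apply: exprn_ege1; lra.
   by apply: (mulr_ege1 Dw1); exact: mulr_ege1.
  - have XY : d ^+ i.+1 * D * (X * d^-1 ^+ i.+1) = t - s1.
    by rewrite /X exprVn; field; rewrite D0 expf_neq0.
   have -> : Dw * (d ^+ i.+1 * D) * (s - X * d^-1 ^+ i.+1) = Dw * (d ^+ i.+1 * D * s - (t - s1)).
    by rewrite -XY; ring.
   have -> : b = t - D * s by rewrite -us addrK.
   have -> : b' = t - d ^+ i.+1 * t by rewrite -[X in X - _]bt addrK.
   by rewrite -[RHS]ws; ring.
 rewrite lerD2l lerN2 ie /= lerD2l lerN2 exprS mulrCA mulrC.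
 by apply: ler_wpM2l => //; exact: ltW.
have dense (x0 e : R) : x0 < t -> 0 < e -> exists2 s, E s & x0 - e < s <= x0.
 move=> xt e0; apply: contrapT => no.
 pose B := [set s | E s /\ x0 <= s]; have hB : has_inf B.
  by split; [exists t; split=> //; exact: ltW|exists x0 => s []].
 have d0 : 0 < d by lra.
 have [c [Ec xc] cb] : exists2 c, B c & c < inf B + e / d by apply: inf_adherent; rewrite // divr_gt0.
 have [s' Es' /andP[s1 s2]] := step c e Ec e0.
 have [xs|xs] := leP x0 s'.
  have : inf B <= s' by apply: ge_inf => //; exact: hB.2.
  by rewrite leNgt => /negP; apply; lra.
 move: xc s1; rewrite le_eqVlt => /orP[/eqP xc|xc] s1; last first.
  by apply: no; exists s'; rewrite // ltW// andbT; lra.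
 by apply: no; exists c; rewrite // -xc lexx andbT; lra.
have bd_of z s : z != a0 -> E s -> logdist a0 z = s -> J (Some z).
 move=> za [u [b [D [Gu hu _ us]]]] zs; apply: (bd_julia Gg (or_intror Gu)).
 have [ua uE] := hu z za; rewrite zs us in uE.
 have uzt := expR_logdist ua; rewrite uE in uzt.
 apply/(bdE Gg (or_intror Gu)); rewrite KE boundaryE; last exact: closed_cdisc.
 split; first by rewrite /cdisc /= -uzt.
 move=> /interiorPC[r r0 hr]; pose q := r / 2 / expR t.
 have et0 := expR_gt0 t; have q0 : 0 < q by rewrite !divr_gt0.
 have E1 : a0 + rc (1 + q) * (u.[z] - a0) - u.[z] = rc q * (u.[z] - a0) by rewrite rcD rc1; ring.
 have /hr : disc u.[z] r (a0 + rc (1 + q) * (u.[z] - a0)).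
  by rewrite /disc /= E1 absM abs_rc gtr0_norm// -uzt /q divfK ?gt_eqF//; lra.
 rewrite /cdisc /= addrAC subrr add0r absM abs_rc gtr0_norm; last by lra.
 by rewrite -uzt; nra.
have all z : z != a0 -> logdist a0 z < t -> J (Some z).
 move=> za zt; apply: contrapT => nJ.
 have [e e0 he] := avoid_closed (@closed_julia) nJ.
 have z0 : 0 < abs (z - a0) by rewrite abs_gt0 subr_eq0.
 have [s Es /andP[s1 s2]] := dense _ _ zt (divr_gt0 e0 z0).
 pose k := s - logdist a0 z; pose z' := a0 + rc (expR k) * (z - a0).
 have z'a : z' - a0 = rc (expR k) * (z - a0) by rewrite /z' addrAC subrr add0r.
 have z'0 : z' != a0 by rewrite -subr_eq0 z'a -abs_gt0 absM abs_rc gtr0_norm ?expR_gt0// mulr_gt0 ?expR_gt0.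
 apply: (he z'); last first.
  apply: bd_of Es _ => //; rewrite /logdist z'a absM abs_rc gtr0_norm ?expR_gt0//.
  by rewrite lnM ?posrE ?expR_gt0// expRK /k -/(logdist a0 z) subrK.
 have -> : z' - z = rc (expR k - 1) * (z - a0) by rewrite /z' rcB rc1; ring.
 rewrite absM abs_rc -ltr_pdivlMr// ltr_norml.
 have := expR_ge1Dx k; have : expR k <= 1 by rewrite -expR0 ler_expR /k; lra.
 by rewrite /k; move: s1; set ez := e / _ => s1 h1 h2; lra.
have [b bb] := bd_nonempty Gg gid1.
have bE := bdg 'X b gid1 bb; rewrite hornerX in bE.
have cl : cdisc a0 (expR t) `<=` [set z | J (Some z)].
 move=> z zt; have [->|za] := eqVneq z a0; first exact: (Jm_julia Jm_a0).
 have [lt|ge] := ltP (logdist a0 z) t; first exact: all.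
 apply: bd_of Et _ => //; apply/eqP; rewrite eq_le ge andbT.
 by rewrite -ler_expR expR_logdist.
have : comp (Some a0) (Some b).
 apply: (@connected_component_max _ J (emb (cdisc a0 (expR t)))).
 - by exists a0 => //; rewrite /cdisc /= subrr abs0 ltW// expR_gt0.
 - by move=> _ [z /cl Jz <-].
 - by apply: connected_emb; exact: connected_cdisc.
 - by exists b => //; rewrite /cdisc /= bE.
by move=> cb; exact: (bd_avoid Gg gJ bb cb).
Qed.

End DegenerateLeast.

Hypothesis least : forall K, Jset G K -> surr_le Jm K.

Lemma Jset_cf b : J (Some b) -> Jset G (Gcf (Some b)).
Proof. by move=> Jb; apply/JsetP; exists b. Qed.

(** * Images of J_min and of the smallest filled-in Julia set *)

Section AvoidingLeast.
Variable g : {poly C}.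
Hypothesis Gg : G g.
Hypothesis gJ : julia1 g `&` emb Jm = set0.
Local Notation K := (filled_julia g).

(** Otherwise J_min is backward invariant. Its points then have preimages of all orders in J_min,
    where attraction is uniform, so each equals the attracting fixed point, and [singleton_absurd]
    applies. *)
Lemma not_backward_invariant z : Jm z -> ~ Jm g.[z].
Proof.
move=> Jz Jgz; have [a [Pa ga ga1 cK hv]] := basin_avoiding Gg gJ.
have pull (y : C) : Jm g.[y] -> Jm y.
 move=> Jgy; apply: connected_component_trans Jz _.
 apply: (pullback (x:=Some z) (y:=Some y) Gg); first exact: (Jm_julia Jgz).
 exact: connected_component_trans (connected_component_sym Jgz) Jgy.
have allz (y : C) : Jm y -> y = a.
 move=> Jy; apply/eqP; rewrite -subr_eq0 -abs_eq0; apply: contraT => ne.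
 have e0 : 0 < abs (y - a) by rewrite lt_neqAle eq_sym ne abs_ge0.
 have [N hN] := attracting_uniform ga ga1 (compact_cf (x:=Some a0)) e0
  (fun u Ju => hv u (Jm_interior Gg gJ Ju)).
 have [v [Jv vy]] : exists v, Jm v /\ (piter g N).[v] = y.
  elim: (N) => [|n [v [Jv vy]]]; first by exists y; rewrite /piter /= hornerX.
  have [v' v'v] := horner_surj v (class_nonconstant Gg).
  by exists v'; split; [apply: pull; rewrite v'v|rewrite horner_piterSr v'v].
 by have := hN N (leqnn N) v Jv; rewrite vy ltxx.
have a0a := allz _ Jm_a0.
by apply: (singleton_absurd Gg gJ) => y /allz; rewrite a0a.
Qed.

(** Suppose g sends J_min into a component K2, which then differs from J_min and surrounds it. A
    component lying over J_min differs from J_min, and the domain off J_min around it is mapped by g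
    into a bounded domain off K2, hence is bounded; this puts a component below J_min. *)
Lemma Jm_fatou z : Jm z -> ~ J (Some g.[z]).
Proof.
move=> Jz Jgz; have nJ := not_backward_invariant Jz.
have [y gy] := horner_surj a0 (class_nonconstant Gg).
have Jgy : Jm g.[y] by rewrite gy; exact: Jm_a0.
have nJy : ~ Jm y by move=> /not_backward_invariant.
have Jy : J (Some y) by apply: (sphere_map_julia (x:=Some y) Gg); exact: (Jm_julia Jgy).
pose K2 := Gcf (Some g.[z]).
have ne2 : Jm <> K2 by move=> E; apply: nJ; rewrite E; exact: cf_refl.
have pull u : K2 g.[u] -> Jm u.
 by move=> Ku; apply: connected_component_trans Jz _; exact: (pullback (x:=Some z) (y:=Some u) Gg).
have [|[B [[x nx xB] bB JB]]] := least (Jset_cf Jgz) => //.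
have U0 : Gcf (Some y) `&` Jm = set0.
 apply: cf_disjoint => E; apply: nJy; rewrite -E; exact: cf_refl.
have le : surr_le (Gcf (Some y)) Jm.
 apply: (surr_leI (connected_cf (x:=Some y)) (cf_refl Jy) U0).
 have [_ [M hM]] := (compactC _).1 (compact_cf (x:=Some a0)).
 apply: contrapT => ub; move/bounded_setC: bB => [M' hM']; apply: ub.
 have [r r1 hr] := horner_unbounded (`|M'| + 1) (class_nonconstant Gg).
 pose D := connected_component (~` Jm) y.
 have cgD : connected [set g.[u] | u in D].
  apply: connected_continuous_connected; first exact: component_connected.
  by exact: horner_within.
 have gDB : [set g.[u] | u in D] `<=` B.
  rewrite -xB; have Bgy : connected_component (~` K2) x g.[y] by rewrite xB; exact: JB.
  move=> u Du; apply: connected_component_trans Bgy _.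
  apply: (@connected_component_max _ (~` K2) [set g.[u] | u in D]) => //.
  - by exists y => //; apply: connected_component_refl.
  - by move=> _ [v Dv <-] /pull; exact: (connected_component_sub Dv).
 apply/bounded_setC; exists r => u Du; apply: lerF => ru.
 have := hr u (ltW ru); have := hM' g.[u] (gDB _ (ex_intro2 _ _ u Du erefl)).
 by have := ler_norm M'; lra.
apply: nJy; rewrite (Jset_anti _ _ (least (Jset_cf Jy)) le) //; first exact: cf_refl.
- exact: (Jset_cf (Jm_julia Jm_a0)).
- exact: Jset_cf.
Qed.

Lemma image_Khat z : Kh z -> Kh° g.[z].
Proof.
move=> Kz; have Kgz := Khat_horner Gg Kz.
have [//|Jgz] := Khat_interior_or Kgz.
have [iz|Jz] := Khat_interior_or Kz; last by case: (Jm_fatou Jz (Jm_julia Jgz)).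
apply/interiorPC; have [r r0 hr] := (interiorPC _ _).1 iz.
have [d d0 hd] := horner_open_mapping z (class_nonconstant Gg) r0.
by exists d => // w /hd[y yz <-]; apply: (Khat_horner Gg); exact: hr.
Qed.

Lemma image_Jm z : Jm z -> Kh° g.[z].
Proof.
have cgJ : connected [set g.[u] | u in Jm].
 apply: connected_continuous_connected; first exact: (connected_cf (x:=Some a0)).
 by exact: horner_within.
move=> Jz; apply: (boundary_crossing cgJ); last by exists z.
 exists g.[a0]; split; first by exists a0 => //; exact: Jm_a0.
 by apply: interior_subset; apply: image_Khat; exact: Khat_a0.
apply: disjI => _ [u Ju <-] bu; apply: (Jm_fatou Ju).
exact: (Jm_julia (boundary_Khat_Jm bu)).
Qed.

Lemma part5b : [/\ (exists K2 : set C, (forall K', is_pullback_component G g (emb Jm) K' <-> K' = emb K2) /\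
   surr_lt Jm K2),
  sphere_map g @^-1` J `&` emb Jm = set0,
  [set g.[z] | z in Kh `|` Jm] `<=` Kh° &
  (exists zg : C, (forall z, attracting_fixed_point g z <-> z = zg) /\ Kh° zg)].
Proof.
have [a [Pa ga ga1 cK hv]] := basin_avoiding Gg gJ.
have [y gy] := horner_surj a0 (class_nonconstant Gg).
have Jgy : Jm g.[y] by rewrite gy; exact: Jm_a0.
have Jy : J (Some y) by apply: (sphere_map_julia (x:=Some y) Gg); exact: (Jm_julia Jgy).
have att z : attracting_fixed_point g z <-> g.[z] = z /\ abs g^`().[z] < 1.
 by rewrite /attracting_fixed_point normE -rc1 rc_lt.
split.
- exists (Gcf (Some y)); split; last first.
  split; first exact: least (Jset_cf Jy).
  by move=> E; apply: (not_backward_invariant (z:=y)) Jgy; rewrite E; exact: cf_refl.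
 move=> K'; rewrite /is_pullback_component !emb_cf//; split=> [[[x Jx xK] sub]|->].
  have xy : comp x (Some y) by rewrite xK; apply: sub; exact: Jgy.
  by rewrite -xK; exact: same_connected_component.
 split; first by exists (Some y).
 move=> x Ju; apply: (pullback (x:=Some y) (y:=x) Gg); first exact: (Jm_julia Jgy).
 exact: connected_component_trans (connected_component_sym Jgy) Ju.
- by apply: disjI => x Jx [u Ju ux]; rewrite -ux in Jx; exact: (Jm_fatou Ju Jx).
- by move=> _ [z [Kz|Jz] <-]; [exact: image_Khat|exact: image_Jm].
- exists a; split=> [z|]; last by rewrite -ga; apply: image_Khat; exact: post_Khat.
 rewrite att; split=> [[gz gz1]|->]; last by split.
 exact: (attracting_unique (class_degree Gg) hv gz gz1).
Qed.
End AvoidingLeast.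

Lemma exists_avoiding A : G = generated A -> exists2 g, A g & julia1 g `&` emb Jm = set0.
Proof.
move=> GA; apply: contrapT => no; apply: ncJ.
have Ja : J (Some a0) := Jm_julia Jm_a0.
apply: (julia_single_component GA Ja) => h Ah x hx; apply: contrapT => nx.
have Gh : G h by rewrite GA; exact: sub_generated.
apply: no; exists h => //; apply: disjI => y hy [u Ju uy]; apply: nx.
have cb := connected_bd Gh gid1.
move: hx hy; rewrite (julia1_bd Gh) -uy => -[v bv vx] /embP bu; rewrite -vx.
apply: connected_component_trans Ju _.
apply: (@connected_component_max _ J (emb (bd h 'X))).
- by exists u.
- by move=> _ [z bz <-]; exact: (bd_julia Gh gid1).
- exact: connected_emb.
- by exists v.
Qed.

Lemma class_generated : exists A, G = generated A.
Proof. by have [[A [_ _ ->]] _ _] := hG; exists A. Qed.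

Lemma Khat_interior_nonempty : exists2 a, Kh° a & ~ Jm a.
Proof.
have [A GA] := class_generated; have [g Ag gJ] := exists_avoiding GA.
have Gg : G g by rewrite GA; exact: sub_generated.
have [a [Pa ga ga1 cK hv]] := basin_avoiding Gg gJ.
exists a; first by rewrite -ga; apply: (image_Khat Gg gJ); exact: post_Khat.
by move=> Ja; apply: (not_backward_invariant Gg gJ Ja); rewrite ga.
Qed.

Lemma complement_Jm : ~ connected (~` Jm).
Proof.
move=> cJ; have [a ia na] := Khat_interior_nonempty.
have [_ [M hM]] := (compactC _).1 (compact_cf (x:=Some a0)).
have [_ [M' hM']] := (compactC _).1 compact_Khat.
have sub : ~` Jm `<=` Kh°.
 apply: (boundary_crossing cJ); first by exists a; split=> //; exact: interior_subset.
 by apply: disjI => u nu bu; apply: nu; exact: (boundary_Khat_Jm bu).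
pose t := rc (`|M| + `|M'| + 1); have at_ : abs t = `|M| + `|M'| + 1 by rewrite abs_rcE ?addr_ge0.
have /sub/interior_subset/hM' : (~` Jm) t.
 by move=> /hM; rewrite at_; have := ler_norm M; have := normr_ge0 M'; lra.
by rewrite at_; have := ler_norm M'; have := normr_ge0 M; lra.
Qed.

Lemma connected_punctured b : connected (~` [set b]).
Proof.
have -> : ~` [set b] = [set v + b | v in [set v : C | 0 < abs v]].
 apply/seteqP; split=> [u ub|_ [v v0 <-] E].
  by exists (u - b); rewrite /= ?subrK// abs_gt0 subr_eq0; apply/eqP.
 by move: v0; rewrite /= (_ : v = 0) ?abs0 ?ltxx//; apply: (addIr b); rewrite add0r.
apply: connected_continuous_connected; first exact: connected_exterior.
apply: continuous_subspaceT => u; apply/continuousCP => e e0; apply/nbhsC; exists e => // v.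
by rewrite /disc /= opprD addrACA subrr addr0.
Qed.

(** A single point does not disconnect the plane, so it can neither be J_min, whose complement is
    disconnected, nor surround J_min. *)
Lemma cf_two_points b : J (Some b) -> exists2 c, Gcf (Some b) c & c <> b.
Proof.
move=> Jb; apply: contrapT => no.
have E : Gcf (Some b) = [set b].
 apply/seteqP; split=> u; last by move=> ->; exact: cf_refl.
 by move=> Ju; apply: contrapT => ne; apply: no; exists u.
have [EJ|[B [[x nx xB] bB JB]]] := least (Jset_cf Jb).
 by apply: complement_Jm; rewrite EJ E; exact: connected_punctured.
move: bB => /bounded_setC[M hM]; rewrite E in nx xB.
have := hM (rc (`|M| + abs b + 1)).
have big : abs (rc (`|M| + abs b + 1)) = `|M| + abs b + 1.
 by rewrite abs_rcE ?addr_ge0 ?abs_ge0.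
have bnb : rc (`|M| + abs b + 1) <> b.
 by move=> E'; have := big; rewrite E'; have := normr_ge0 M; lra.
rewrite big -xB; have cc : connected_component (~` [set b]) x = ~` [set b].
 apply/seteqP; split; first exact: connected_component_sub.
 by apply: connected_component_max => //; exact: connected_punctured.
rewrite cc => /(_ bnb); have := ler_norm M; have := abs_ge0 b; lra.
Qed.

Lemma Jhat_card (K : set S) : Jhat G K -> `I_2 #<= K.
Proof.
move=> [x Jx <-]; have [b xb] := julia_finite Jx; rewrite xb in Jx *.
have [c Jc cb] := cf_two_points Jx.
pose f (n : nat) : S := if n is 0%N then Some b else Some c.
have finj : {in `I_2 &, injective f}.
 move=> m n; rewrite !inE /=; case: m n => [|[|m]] [|[|n]]//= _ _ [] E; by case: cb.
apply: card_le_trans (subset_card_le (A:=f @` `I_2) _); last first.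
 move=> _ [[|n] _ <-] /=; [exact: connected_component_refl|exact: Jc].
by have /card_eqPle[] := inj_card_eq finj.
Qed.

Lemma julia1_cf g b : G g -> bd g 'X b -> julia1 g `<=` emb (cf b).
Proof.
move=> Gg bb; rewrite emb_cf// (julia1_bd Gg).
apply: connected_component_max.
- by exists b.
- by move=> _ [z bz <-]; exact: (bd_julia Gg gid1).
- by apply: connected_emb; exact: (connected_bd Gg gid1).
Qed.

Lemma iter_sphere_map g n x : iter n (sphere_map g) x = sphere_map (piter g n) x.
Proof.
elim: n => [|n IH]; first by case: x => //= z; rewrite /piter /= hornerX.
by rewrite /= IH; case: x {IH} => //= z; rewrite horner_piterS.
Qed.

(* A component J2 meeting its own image under q would be backward invariant,
  so that every point of J2 has arbitrarily long backward orbits in J2. *)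
Lemma backward_orbit q b z : G q -> J (Some b) -> cf b z -> cf b q.[z] ->
 forall (y : C) k, cf b y -> exists2 v, cf b v & (piter q k).[v] = y.
Proof.
move=> Gq Jb Jz Jqz y k Jy; elim: k => [|k [v Jv vy]]; first by exists y; rewrite // /piter /= hornerX.
have [v' v'v] := horner_surj v (class_nonconstant Gq).
exists v'; last by rewrite horner_piterSr v'v.
apply: connected_component_trans Jz _; apply: (pullback (x:=Some z) (y:=Some v') Gq) => /=.
 exact: (connected_component_sub Jqz).
by rewrite v'v; apply: connected_component_trans Jv; exact: connected_component_sym.
Qed.

(** * Two generators with nested filled-in Julia sets *)

Section Nested.
Variables (f g : {poly C}) (a b : C).
Hypotheses (Gf : G f) (Gg : G g) (ba : bd f 'X a) (bb : bd g 'X b).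
Hypothesis nab : ~ comp (Some a) (Some b).
Hypothesis fg : pc f 'X `<=` (pc g 'X)°.

Let Ja : J (Some a). Proof. exact: (bd_julia Gf gid1 ba). Qed.
Let Jb : J (Some b). Proof. exact: (bd_julia Gg gid1 bb). Qed.

Lemma cf_neq : cf b <> cf a.
Proof. by move=> E; apply: nab; have : cf a b by rewrite -E; exact: cf_refl. Qed.

Lemma bd_g_cf z : bd g 'X z -> cf b z.
Proof.
move=> bz; have : emb (cf b) (Some z) by apply: (julia1_cf Gg bb); rewrite (julia1_bd Gg); exists z.
by move=> /embP.
Qed.

Lemma bd_f_cf z : bd f 'X z -> cf a z.
Proof.
move=> bz; have : emb (cf a) (Some z) by apply: (julia1_cf Gf ba); rewrite (julia1_bd Gf); exists z.
by move=> /embP.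
Qed.

Lemma cf_disj z : cf a z -> cf b z -> False.
Proof. by move=> az bz; exact: disjE (cf_disjoint cf_neq) bz az. Qed.

Lemma cf_inside : cf a `<=` (filled_julia g)°.
Proof.
apply: (boundary_crossing (connected_cf (x:=Some a))).
 exists a; split; first exact: cf_refl.
 by apply: interior_subset; rewrite -pcX; apply: fg; exact: (bd_pc Gf ba).
by apply/seteqP; split=> // z [az]; rewrite -pcX -bd_def => /bd_g_cf; exact: cf_disj.
Qed.

Lemma cf_outside z : cf b z -> ~ filled_julia f z.
Proof.
move=> bz fz; have : cf b `<=` (filled_julia f)°.
 apply: (boundary_crossing (connected_cf (x:=Some b))); first by exists z.
 by apply/seteqP; split=> // u [bu]; rewrite -pcX -bd_def => /bd_f_cf au; exact: cf_disj au bu.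
move=> /(_ b (cf_refl Jb))/interior_subset; rewrite -pcX => /fg.
by move: bb; rewrite bd_def boundaryE; [case|exact: (closed_pc Gg)].
Qed.

(** If J(g) met J_min, the component of b would be J_min and that of a would surround it, reaching
    farther out than J(g). But the component of a lies in K(g), where the maximum principle bounds
    moduli by those on J(g). *)
Lemma nested_avoid : julia1 g `&` emb Jm = set0.
Proof.
apply: disjI => y gy [u Ju uy]; exfalso.
have Jub : cf b = Jm.
 have : emb (cf b) (Some u) by apply: (julia1_cf Gg bb); rewrite uy.
 move=> /embP bu; apply: cf_eq; exact: connected_component_trans bu (connected_component_sym Ju).
have neq : Jm <> cf a by rewrite -Jub; exact: cf_neq.
have [z az hz] := surr_lt_far (compact_cf (x:=Some a0)) (ex_intro _ a0 Jm_a0)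
 (compact_cf (x:=Some a)) (least (Jset_cf Ja)) neq.
have Kz : filled_julia g z by apply: interior_subset; exact: cf_inside.
have [y' [by' hy']] : exists y' : C, bd g 'X y' /\ abs z <= abs y'.
 apply: contrapT => no; have [w bw] := bd_nonempty Gg gid1.
 have h1 u' : boundary (filled_julia g) u' -> abs 'X.[u'] < abs z.
  rewrite hornerX -pcX -bd_def => bu; rewrite ltNge; apply/negP => h; apply: no; by exists u'.
 have cb : compact (boundary (filled_julia g)).
  have [cl [M hM]] := (compactC _).1 (compact_filled_julia (class_degree Gg)).
  apply/compactC; split; first exact: closed_boundary.
  by exists M => u' bu; apply: hM; move: bu; rewrite boundaryE; [case|].
 have [w' bw' hw'] : exists2 w', boundary (filled_julia g) w' &
   forall u', boundary (filled_julia g) u' -> abs u' <= abs w'.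
  by apply: compact_abs_max => //; [exists w; rewrite -pcX -bd_def|exact: abs_continuous].
 have : abs 'X.[z] <= abs w'.
  apply: (maximum_principle (compact_filled_julia (class_degree Gg))) Kz => u' bu.
  by rewrite hornerX; exact: hw'.
 by have := h1 w' bw'; rewrite !hornerX ltNge => /negP.
have := hz y'; rewrite -Jub => /(_ (bd_g_cf by')); by rewrite ltNge hy'.
Qed.

(** A return would give the points of the component of a backward orbits of any length inside it,
    while iterates of g contract it uniformly to the fixed point; the component would be a single
    point. *)
Lemma no_return_f n z : cf a z -> ~ cf a (piter g n.+1).[z].
Proof.
move=> az agz; have [z1 [Pz gz1 gz11 cK hv]] := basin_avoiding Gg nested_avoid.
have Gn : G (piter g n.+1) by apply: piter_in => //; exact: class_comp.
have allz (y : C) : cf a y -> y = z1.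
 move=> ay; apply/eqP; rewrite -subr_eq0 -abs_eq0; apply: contraT => ne.
 have e0 : 0 < abs (y - z1) by rewrite lt_neqAle eq_sym ne abs_ge0.
 have [N hN] := attracting_uniform gz1 gz11 (compact_cf (x:=Some a)) e0
  (fun u au => hv u (cf_inside au)).
 have [v av vy] := backward_orbit Gn Ja az agz N ay.
 have pp k u : (piter (piter g n.+1) k).[u] = (piter g (n.+1 * k)).[u].
  elim: k u => [|k IH] u; first by rewrite muln0.
  by rewrite horner_piterS IH mulnS horner_piterD.
 have : (N <= n.+1 * N)%N by rewrite leq_pmull.
 by move=> /hN/(_ v av); rewrite -pp vy ltxx.
have [c ac ca] := cf_two_points Ja.
by apply: ca; rewrite (allz c ac) (allz a)//; exact: cf_refl.
Qed.

(** A return would give backward orbits of any length inside the component of b, which lies outside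
    K(f) and escapes uniformly under f. *)
Lemma no_return_g n z : cf b z -> ~ cf b (piter f n.+1).[z].
Proof.
move=> bz bfz; have Gn : G (piter f n.+1) by apply: piter_in => //; exact: class_comp.
have K0 : cf b `&` filled_julia f = set0 by apply/seteqP; split=> // u [/cf_outside].
have [N hN] := uniform_escape (abs b + 1) (class_degree Gf) (compact_cf (x:=Some b)) K0.
have [v bv vb] := backward_orbit Gn Jb bz bfz N (cf_refl Jb).
have pp k u : (piter (piter f n.+1) k).[u] = (piter f (n.+1 * k)).[u].
 elim: k u => [|k IH] u; first by rewrite muln0.
 by rewrite horner_piterS IH mulnS horner_piterD.
have : (N <= n.+1 * N)%N by rewrite leq_pmull.
by move=> /hN/(_ v bv); rewrite -pp vb; lra.
Qed.

Lemma nested_disjoint n : (0 < n)%N ->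
 iter n (sphere_map g) @^-1` julia1 f `&` julia1 f = set0 /\
 iter n (sphere_map f) @^-1` julia1 g `&` julia1 g = set0.
Proof.
case: n => // n _; split; apply/seteqP; split=> // x [].
 rewrite /= -[sphere_map g _]/(iter n.+1 (sphere_map g) x) iter_sphere_map => h /(julia1_cf Gf ba)[z az zx].
 move: h; rewrite -zx => /(julia1_cf Gf ba)/embP; exact: no_return_f.
rewrite /= -[sphere_map f _]/(iter n.+1 (sphere_map f) x) iter_sphere_map => h /(julia1_cf Gg bb)[z bz zx].
move: h; rewrite -zx => /(julia1_cf Gg bb)/embP; exact: no_return_g.
Qed.

Lemma nested_attracting : exists z1 : C, [/\ attracting_fixed_point g z1,
 (filled_julia g)° = immediate_basin g z1, filled_julia f `<=` (filled_julia g)° &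
 (filled_julia f)° z1].
Proof.
have [z1 [Pz gz1 gz11 cK hv]] := basin_avoiding Gg nested_avoid.
exists z1; split.
- by split=> //; rewrite normE -rc1 rc_lt.
- exact: (filled_julia_immediate_basin (class_degree Gg) gz1 gz11 cK hv).
- by move=> z; rewrite -!pcX; exact: fg.
- have pz : pc f 'X z1 := (post_pc Gf gid1 Pz).
 have [|/bd_f_cf az] := pc_interior_or_bd Gf pz; first by rewrite pcX.
 by case: (no_return_f (n:=0) az); rewrite piter1 gz1.
Qed.
End Nested.

Lemma part3 (Lambda : Type) (h : Lambda -> {poly C}) : G = generated (range h) ->
 exists l1 l2 : Lambda,
  [/\ (exists J1 J2 : set C, [/\ Jset G J1, Jset G J2, J1 <> J2,
     julia1 (h l1) `<=` emb J1 & julia1 (h l2) `<=` emb J2]),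
    julia1 (h l1) `&` emb Jm = set0,
    (forall n : nat, (0 < n)%N ->
      iter n (sphere_map (h l1)) @^-1` julia1 (h l2) `&` julia1 (h l2) = set0 /\
      iter n (sphere_map (h l2)) @^-1` julia1 (h l1) `&` julia1 (h l1) = set0) &
    (exists z1 : C, [/\ attracting_fixed_point (h l1) z1,
       (filled_julia (h l1))° = immediate_basin (h l1) z1,
       filled_julia (h l2) `<=` (filled_julia (h l1))° &
       (filled_julia (h l2))° z1])].
Proof.
move=> GA; have [f [g [a [b [[[l2 _ fE] [l1 _ gE]] ba bb nab fg]]]]] := nested_generators GA.
have Gf : G f by rewrite GA; apply: sub_generated; exists l2.
have Gg : G g by rewrite GA; apply: sub_generated; exists l1.
exists l1, l2; rewrite fE gE; split.
- exists (cf b), (cf a); split.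
 + exact: (Jset_cf (bd_julia Gg gid1 bb)).
 + exact: (Jset_cf (bd_julia Gf gid1 ba)).
 + exact: cf_neq Gg bb nab.
 + exact: julia1_cf.
 + exact: julia1_cf.
- exact: nested_avoid Gf Gg ba bb nab fg.
- by move=> n; exact: nested_disjoint Gf Gg ba bb nab fg n.
- exact: nested_attracting Gf Gg ba bb nab fg.
Qed.

(** * Simple connectivity at infinity and doubly connected Fatou components *)

Lemma connected_complement_Finfty : connected (~` Finf).
Proof.
have oF := @open_Finfty; have clE : closed (~` Finf) by exact: open_closedC.
have [h Gh] := class_nonempty; have [p Pp] := post_nonempty.
apply: contrapT => /(not_connected_closed clE)[A [B [clA clB EAB AB0 [nA nB]]]].
have FE x : ~ Finf x -> A x \/ B x by move=> nx; have : (~` Finf) x by []; rewrite EAB.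
(* All pieces contain p, so by density J(G) lies on the side of p. The other side then consists of
   whole Fatou components and is open and closed in the connected sphere. *)
have absurd A' B' : closed A' -> closed B' -> ~` Finf = A' `|` B' -> A' `&` B' = set0 ->
  A' !=set0 -> B' !=set0 -> A' (Some p) -> False.
 move=> clA' clB' E' AB' nA' [x0 Bx0] A'p.
 have pcA w : Gid w -> emb (pc h w) `<=` A'.
  move=> Gw; apply: (connected_closed_split (connected_emb (connected_pc Gh Gw)) clA' clB').
  - by rewrite -E' => _ [z pz <-]; exact: (Finfty_pc Gh Gw pz).
  - by move=> u _; exact: (disjE AB').
  - by exists (Some p); split=> //; exists p => //; exact: (post_pc Gh Gw Pp).
 have JA : J `<=` A'.
  move=> x Jx; apply: clA' => N xN; have [w [z [Gw Nz bz]]] := julia_near Gh Jx xN.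
  exists (Some z); split=> //; apply: (pcA w (or_intror Gw)); exists z => //.
  exact: (bd_pc Gh bz).
 have oB' : open B'.
  rewrite openE => x Bx; have nFx : (~` Finf) x by rewrite E'; right.
  have Fx : fatou_set G x.
   by apply: contrapT => /JA Ax; exact: disjE AB' Ax Bx.
  apply: (@filterS _ _ _ (connected_component (fatou_set G) x)); last first.
   apply: open_nbhs_nbhs; split; last exact: connected_component_refl.
   by apply: component_open_sphere; exact: open_fatou.
  apply: (connected_closed_split (@component_connected _ _ x) clB' clA').
  - rewrite setUC -E' => y xy Fy; apply: nFx; apply: connected_component_trans Fy _.
   exact: connected_component_sym.
  - by move=> u _ bu au; exact: disjE AB' au bu.
  - by exists x; split=> //; exact: connected_component_refl.
 have [x Ax] := nA'; apply: disjE AB' Ax _.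
 exact: (connected_clopen (@connected_sphere) oB' clB' (ex_intro _ _ Bx0)).
have [Ap|Bp] : A (Some p) \/ B (Some p).
 apply: FE; exact: (Finfty_pc Gh gid1 (post_pc Gh gid1 Pp)).
- exact: absurd clA clB EAB AB0 nA nB Ap.
- by apply: (absurd B A) => //; rewrite 1?setUC 1?setIC.
Qed.

Lemma doubly_connected_finite U : doubly_connected_fatou_components G U -> ~ U infty.
Proof.
move=> [[x Fx xU] [oU cU c2]] Ui.
have UE : U = Finf by rewrite -xU; apply: same_connected_component; rewrite xU.
have [X [Y [[y ny yX] [z nz zY] XY _]]] := card_II2 c2; apply: XY.
have full (u : S) : (~` U) u -> connected_component (~` U) u = ~` U.
 move=> nu; apply/seteqP; split; first exact: connected_component_sub.
 by apply: connected_component_max => //; rewrite UE; exact: connected_complement_Finfty.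
by rewrite -yX -zY !full.
Qed.

Lemma doubly_connected_annulus U : doubly_connected_fatou_components G U ->
 exists A0 A1, annulus (finite_part U) A0 A1 /\ emb A0 `|` (emb A1 `|` [set infty]) = ~` U.
Proof.
move=> dU; have Ui := doubly_connected_finite dU; have [[x Fx xU] [oU cU c2]] := dU.
apply: annulus_of_sphere => //; first by exists x; rewrite -xU; exact: connected_component_refl.
have [M hM] := Finfty_far; exists M => z /hM Fz Uz; apply: Ui.
rewrite -xU in Uz *; apply: connected_component_trans Uz _; exact: connected_component_sym.
Qed.

(** The hole contains a point of J(G), since otherwise it would be open. The component of this point
    lies in the hole and is J_min or surrounds it, which prevents J_min from lying in the connected
    unbounded outer piece. *)
Lemma annulus_around U A0 A1 : doubly_connected_fatou_components G U ->
 annulus (finite_part U) A0 A1 -> emb A0 `|` (emb A1 `|` [set infty]) = ~` U -> A0 a0.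
Proof.
move=> dU an UE; have [[x Fx xU] [oU cU c2]] := dU.
have [[oV cV nV] [cA0 kA0 nA0] [cA1 clA1 hA1] VE A01] := an; have [clA0 _] := (compactC _).1 kA0.
have UJ y : U y -> ~ J y by rewrite -xU => /connected_component_sub Fy; apply.
have [b [A0b Jb]] : exists b, A0 b /\ J (Some b).
 apply: contrapT => no; have opA : open A0.
  apply/openPC => y Ay; have Fy : fatou_set G (Some y) by apply: contrapT => Jy; apply: no; exists y.
  have nUy : ~ U (Some y) by rewrite -[~ _]/((~` U) _) -UE; left; exists y.
  have [r r0 hr] : exists2 r, 0 < r & forall z, abs (z - y) < r -> ~ U (Some z).
   have nb : nbhs (Some y : S) (connected_component (fatou_set G) (Some y)).
    apply: open_nbhs_nbhs; split; last exact: connected_component_refl.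
    by apply: component_open_sphere; exact: open_fatou.
   have [r r0 hr] := (nbhs_some _ _).1 nb; exists r => // z zy Uz; apply: nUy.
   rewrite -xU in Uz *; apply: connected_component_trans Uz _; apply: connected_component_sym.
   exact: hr.
  have nA1 : (~` A1) y by move=> A1y; exact: annulus_disjoint an Ay A1y.
  have [r' r'0 hr'] := (openPC _).1 (closed_openC clA1) y nA1.
  exists (Num.min r r'); first by rewrite lt_min r0.
  move=> z; rewrite /disc /= lt_min => /andP[z1 z2]; have : (~` finite_part U) z by exact: hr.
  by rewrite VE => -[//|/(hr' z z2)].
 have cT : connected [set: C] by exact: (@star_connected _ 0 _).
 have TA := connected_clopen cT opA clA0 nA0.
 have [M hM] := hA1; apply: (annulus_disjoint an (TA (rc (`|M| + 1)) I)); apply: hM.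
 by rewrite abs_rcE ?addr_ge0//; have := ler_norm M; lra.
have sides d : J (Some d) -> cf d `<=` A0 \/ cf d `<=` A1.
 move=> Jd; have sub : cf d `<=` A0 `|` A1.
  by move=> z /connected_component_sub Jz; rewrite -VE => /UJ.
 have [[z [dz Az]]|no] := pselect (cf d `&` A0 !=set0).
  left; apply: (connected_closed_split (connected_cf (x:=Some d)) clA0 clA1 sub); last by exists z.
  by move=> u _; exact: (disjE A01).
 by right=> z dz; have [Az|//] := sub z dz; case: no; exists z.
have Ja := Jm_julia Jm_a0.
have bA0 : cf b `<=` A0.
 by have [//|sub] := sides b Jb; case: (annulus_disjoint an A0b); apply: sub; exact: cf_refl.
have [sub|sub] := sides a0 Ja; first by apply: sub; exact: cf_refl.
have A1a : A1 a0 by apply: sub; exact: cf_refl.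
have [E|[B [[y ny yB] bB JB]]] := least (Jset_cf Jb).
 by case: (annulus_disjoint an (z:=b)) => //; apply: sub; rewrite E; exact: cf_refl.
case: (annulus_unbounded an (A:=B)) => //; rewrite -yB.
have ya : connected_component (~` cf b) y a0 by rewrite yB; apply: JB; exact: cf_refl.
move=> z A1z; apply: connected_component_trans ya _.
apply: (@connected_component_max _ (~` cf b) A1) => // u A1u /bA0 A0u.
exact: annulus_disjoint an A0u A1u.
Qed.

Lemma part6 : \bigcup_(U in doubly_connected_fatou_components G) U `<=` emb setT /\
 totally_ordered [set finite_part U | U in doubly_connected_fatou_components G] (@surr_le R).
Proof.
split.
 by move=> [z|] [U dU Uz]; [exists z|case: (doubly_connected_finite dU)].
have an U : doubly_connected_fatou_components G U -> exists A0 A1, annulus (finite_part U) A0 A1 /\ A0 a0.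
 move=> dU; have [A0 [A1 [anU UE]]] := doubly_connected_annulus dU.
 by exists A0, A1; split=> //; exact: annulus_around dU anU UE.
have trans U V W : doubly_connected_fatou_components G U -> doubly_connected_fatou_components G V ->
  doubly_connected_fatou_components G W -> surr_le (finite_part U) (finite_part V) ->
  surr_le (finite_part V) (finite_part W) -> surr_le (finite_part U) (finite_part W).
 move=> /an[A0 [A1 [anU _]]] /an[B0 [B1 [anV _]]] /an[D0 [D1 [anW _]]].
 move=> /(surr_annulus _ anV)[->//|UV] /(surr_annulus _ anW)[<-|VW].
  by apply/(surr_annulus _ anV); right.
 apply/(surr_annulus _ anW); right; apply: subset_trans UV _; exact: annulus_trans anV anW VW.
split.
- by move=> _ [U dU <-]; left.
- move=> _ _ [U /an[A0 [A1 [anU _]]] <-] [V /an[B0 [B1 [anV _]]] <-].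
 move=> /(surr_annulus _ anV)[//|UV] /(surr_annulus _ anU)[//|VU].
 have sub := annulus_trans anV anU VU; have [[_ _ [z Uz]] _ _ UE _] := anU.
 by have : (~` finite_part U) z by [rewrite UE; left; apply: sub; exact: UV]; case.
- by move=> _ _ _ [U dU <-] [V dV <-] [W dW <-]; exact: trans.
- move=> _ _ [U dU <-] [V dV <-].
 have [E|ne] := pselect (finite_part U = finite_part V); first by left; left.
 have [A0 [A1 [anU A0a]]] := an U dU; have [B0 [B1 [anV B0a]]] := an V dV.
 have UV : finite_part U `&` finite_part V = set0.
  apply: disjI => z Uz Vz; apply: ne; congr (finite_part _).
  have [[x Fx xU] _] := dU; have [[y Fy yV] _] := dV; rewrite /finite_part /= -xU in Uz.
  rewrite /finite_part /= -yV in Vz; rewrite -xU -yV.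
  by rewrite (same_connected_component Uz) (same_connected_component Vz).
 have [sub|sub] := annulus_total anU anV UV A0a B0a; [left|right].
  by apply/(surr_annulus _ anV); right.
 by apply/(surr_annulus _ anU); right.
Qed.

Lemma simply_connected_Finfty : simply_connected R Finf.
Proof.
have [h Gh] := class_nonempty; have [p Pp] := post_nonempty.
apply: (@simply_connected_of_chart p).
- exact: open_Finfty.
- exact: connected_Finfty.
- exact: connected_complement_Finfty.
- exact: (Finfty_pc Gh gid1 (post_pc Gh gid1 Pp)).
- by exists infty; exact: Finfty_infty.
Qed.

End SemigroupClass.

(** * A semigroup with different attracting fixed points *)

Section Example.
Implicit Types (u : C) (p q g f h w : {poly C}).

Lemma boundary_cdiscE (a : C) r z : 0 < r -> abs (z - a) = r -> boundary (cdisc a r) z.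
Proof.
move=> r0 zr; rewrite boundaryE; last exact: closed_cdisc.
split; first by rewrite /cdisc /= zr.
move=> /interiorPC[e e0 he]; pose t := e / 2 / r; have t0 : 0 < t by rewrite !divr_gt0.
have E1 : a + rc (1 + t) * (z - a) - z = rc t * (z - a) by rewrite rcD rc1; ring.
have /he : disc z e (a + rc (1 + t) * (z - a)).
 by rewrite /disc /= E1 absM abs_rc gtr0_norm// zr /t divfK ?gt_eqF//; lra.
rewrite /cdisc /= addrAC subrr add0r absM abs_rc gtr0_norm; last by lra.
by rewrite zr; nra.
Qed.

(** The factor 1/1000 makes the filled-in Julia set the disc of radius 10 around the superattracting
    fixed point a. *)
Definition quartic (a : C) : {poly C} := a%:P + (rc (10 ^- 3)) *: ('X - a%:P) ^+ 4.

Lemma quarticE a z : (quartic a).[z] = a + rc (10 ^- 3) * (z - a) ^+ 4.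
Proof. by rewrite /quartic !hornerE. Qed.

Lemma abs_quarticB a z : abs ((quartic a).[z] - a) = abs (z - a) ^+ 4 / 10 ^+ 3.
Proof.
rewrite quarticE addrAC subrr add0r absM absX abs_rcE ?invr_ge0 ?exprn_ge0//.
exact: mulrC.
Qed.

Lemma quartic_fixed a : (quartic a).[a] = a.
Proof. by rewrite quarticE subrr expr0n mulr0 addr0. Qed.

Lemma rc10 : rc (10 ^- 3) != 0.
Proof. by rewrite -abs_gt0 abs_rc normr_gt0 invr_eq0 expf_neq0// pnatr_eq0. Qed.

Lemma deriv_quartic a z : (quartic a)^`().[z] = rc (10 ^- 3) * (4 * (z - a) ^+ 3).
Proof.
rewrite /quartic derivD derivC add0r derivZ deriv_exp derivXsubC mul1r.
by rewrite hornerZ hornerMn horner_exp hornerXsubC mulr_natl.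
Qed.

Lemma degree_quartic a : degree (quartic a) = 4.
Proof.
have s4 : size (('X - a%:P) ^+ 4) = 5 by rewrite size_exp_XsubC.
rewrite /degree /quartic addrC size_polyDl size_scale ?rc10// s4//.
by rewrite size_polyC (leq_ltn_trans (leq_b1 _)).
Qed.

Lemma quartic_affine a : log_affine a (quartic a) (- 3 * ln 10) 4.
Proof.
move=> z za; have za0 : 0 < abs (z - a) by rewrite abs_gt0 subr_eq0.
have v0 : 0 < abs ((quartic a).[z] - a).
 by rewrite abs_quarticB divr_gt0 ?exprn_gt0.
split; first by rewrite -subr_eq0 -abs_gt0.
have t0 : 0 < 10 :> R by rewrite ltr0n.
rewrite /logdist abs_quarticB ln_div ?posrE; [|exact: exprn_gt0|exact: exprn_gt0].
rewrite (@lnXn R 4 _ za0) (@lnXn R 3 _ t0); ring.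
Qed.

Lemma filled_julia_quartic a : filled_julia (quartic a) = cdisc a 10.
Proof.
have h2 : (2 : R) <= 4 by lra.
have ht : - 3 * ln 10 + 4 * ln 10 = ln 10 :> R by ring.
have t0 : (10 : R) \is Num.pos by rewrite posrE ltr0n.
by have := filled_julia_disc (quartic_affine (a:=a)) h2 (quartic_fixed a) ht; rewrite lnK.
Qed.

Lemma filled_julia_square : filled_julia 'X^2 = cdisc 0 1 :> set C.
Proof.
rewrite -[1 in RHS](@expR0 R); apply: (@filled_julia_disc 0 'X^2 0 2); first last.
- by rewrite add0r mulr0.
- by rewrite hornerXn expr0n.
- by [].
move=> z z0; rewrite hornerXn expf_eq0 /= z0 add0r /logdist !subr0 absX lnXn ?abs_gt0//.
by rewrite mulr_natl.
Qed.

Definition example_generators : set {poly C} :=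
 [set g | g = 'X^2 \/ exists2 a : C, abs a <= 4^-1 & g = quartic a].

(** An invariant disc with the critical values, an invariant neighbourhood of infinity, and an
    annulus that is sent into one of the two: (17/5)^2 > 11 for the square, and 1/4 + (18/5 + 1/4)^4
    / 1000 < 1/2 for the quartics. These conditions are stable under composition, and the annulus
    separates J(G). *)
Definition example_bounds g := [/\ (forall c, g^`().[c] = 0 -> abs g.[c] <= 2^-1),
 (forall z, abs z <= 2^-1 -> abs g.[z] <= 2^-1),
 (forall z, 11 <= abs z -> 11 <= abs g.[z]) &
 (forall z, 17 / 5 <= abs z -> abs z <= 18 / 5 -> abs g.[z] <= 2^-1 \/ 11 <= abs g.[z])].

Lemma pow4_le (x y : R) : 0 <= x -> x <= y -> x ^+ 4 <= y ^+ 4.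
Proof. by move=> x0 xy; apply: lerXn2r; rewrite ?nnegrE// (le_trans x0). Qed.

Lemma quartic_bounds a : abs a <= 4^-1 -> example_bounds (quartic a).
Proof.
move=> a4; have qa z := abs_quarticB a z.
have near z M : abs z <= M -> abs (quartic a).[z] <= 4^-1 + (M + 4^-1) ^+ 4 / 10 ^+ 3.
 move=> zM; apply: le_trans (abs_lip _ a) _; apply: lerD => //; rewrite qa.
 apply: ler_wpM2r; first by rewrite invr_ge0 exprn_ge0.
 by apply: pow4_le; [exact: abs_ge0|apply: le_trans (absBD z a) _; exact: lerD].
split.
- move=> c /eqP; rewrite deriv_quartic mulf_eq0 (negPf rc10) mulf_eq0 pnatr_eq0 /= expf_eq0 /= subr_eq0.
 by move=> /eqP->; rewrite quartic_fixed; lra.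
- by move=> z /near; lra.
- move=> z z11; have h : 10 + 3 / 4 <= abs (z - a) by have := abs_lip z a; lra.
 have := abs_lip ((quartic a).[z] - a) (quartic a).[z].
 rewrite addrAC subrr add0r absN qa.
 have := pow4_le (_ : 0 <= 10 + 3 / 4) h; move=> /(_ ltac:(lra)).
 by move: (abs (z - a) ^+ 4) => x; lra.
- by move=> z _ /near; left; lra.
Qed.

Lemma square_bounds : example_bounds 'X^2.
Proof.
split=> [c|z|z|z].
- rewrite derivXn hornerMn expr1 hornerX => /eqP; rewrite mulrn_eq0 /= => /eqP->.
 by rewrite hornerXn expr0n abs0; lra.
- by rewrite hornerXn absX => h; have := abs_ge0 z; nra.
- by rewrite hornerXn absX => h; nra.
- by rewrite hornerXn absX => h _; right; nra.
Qed.

Lemma example_boundsM p q : example_bounds p -> example_bounds q -> example_bounds (p \Po q).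
Proof.
move=> [p1 p2 p3 p4] [q1 q2 q3 q4]; split=> [c|z|z|z].
- rewrite deriv_comp hornerM !horner_comp => /eqP; rewrite mulf_eq0 => /orP[/eqP/p1//|/eqP/q1]; exact: p2.
- by rewrite horner_comp => /q2/p2.
- by rewrite horner_comp => /q3/p3.
- by rewrite horner_comp => z1 z2; have [/p2|/p3] := q4 z z1 z2; [left|right].
Qed.

Local Notation G := (generated example_generators).

Lemma example_boundsP g : G g -> example_bounds g.
Proof.
move: g; apply: generated_ind => [g [->|[a a4 ->]]|]; [exact: square_bounds|exact: quartic_bounds|].
exact: example_boundsM.
Qed.

Lemma example_degree g : G g -> (2 <= degree g)%N.
Proof.
move: g; apply: generated_ind => [g [->|[a a4 ->]]|p q dp dq].
- by rewrite /degree size_polyXn.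
- by rewrite degree_quartic.
- by rewrite degree_comp; apply: leq_trans dp _; rewrite leq_pmulr// (ltnW dq).
Qed.

Lemma example_class : classG G.
Proof.
split; last 1 first.
- apply/bounded_setC; exists 2^-1 => z Pz.
 have cl : closed (emb (cdisc 0 2^-1) `|` [set infty] : set S).
  rewrite -[_ `|` _]setCK; apply: open_closedC.
  have -> : ~` (emb (cdisc 0 2^-1) `|` [set infty]) = emb (~` cdisc 0 2^-1) :> set S.
   apply/seteqP; split=> [[v|] nv|_ [v nv <-] [/embP//|//]]; last by case: nv; right.
   by exists v => // Av; apply: nv; left; exists v.
  by apply: open_emb; apply: closed_openC; exact: closed_cdisc.
 have : (emb (cdisc 0 2^-1) `|` [set infty] : set S) (Some z).
  apply: cl; apply: closureS Pz => y [g Gg [[c|] gc <-]]; last by right.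
  left; exists g.[c] => //; rewrite /cdisc /= subr0.
  by have [h _ _ _] := example_boundsP Gg; exact: h.
 by case=> [/embP|//]; rewrite /cdisc /= subr0.
- exists example_generators; split=> //; first by exists 'X^2; left.
 by move=> g Ag; apply: ltnW; apply: example_degree; exact: sub_generated.
- exact: example_degree.
Qed.

Lemma example_fatou z : 17 / 5 < abs z -> abs z < 18 / 5 -> ~ julia_set G (Some z).
Proof.
move=> z1 z2; apply; pose r := Num.min (abs z - 17 / 5) (18 / 5 - abs z) / 2.
have r0 : 0 < r by rewrite divr_gt0// lt_min !subr_gt0 z1.
have r1 : 2 * r <= abs z - 17 / 5 by rewrite mulrC divfK// ge_min lexx.
have r2 : 2 * r <= 18 / 5 - abs z by rewrite mulrC divfK// ge_min lexx orbT.
apply: (fatou_of_equicont r0) => b bz; apply: (@equicont_avoid G 'X^2 b r) => // [|g Gg u ub].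
 by rewrite /degree size_polyXn.
rewrite filled_julia_square => /boundary_cdisc; rewrite subr0 => g1.
have [_ _ _ h] := example_boundsP Gg; have zub := abs_tri b z u; have zu := abs_tri b u z.
by have [|||] := h u; have := abs_lip z u; have := abs_lip u z; rewrite (absB z u); lra.
Qed.

Lemma example_side (K : set S) z (w : C) : connected K -> K `<=` julia_set G -> K (Some z) -> K (Some w) ->
 abs z < 7 / 2 -> abs w < 7 / 2.
Proof.
move=> cK KJ Kz Kw z7; have : K `<=` emb (disc 0 (7 / 2)).
 apply: (connected_open_split cK (open_emb (@open_disc 0 (7 / 2)))
  (closed_openC (closed_emb (@compact_cdisc 0 (7 / 2))))).
 - move=> [v|] Kv; last by right=> /not_emb_infty.
  have [v7|v7] := ltP (abs v) (7 / 2); first by left; exists v => //; rewrite /disc /= subr0.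
  right=> /embP; rewrite /cdisc /= subr0 => v7'; apply: (@example_fatou v); [lra|lra|exact: KJ].
 - move=> x _ [v vd <-]; apply; exists v => //.
  by move: vd; rewrite /disc /cdisc /= => /ltW.
 - by exists (Some z); split=> //; exists z => //; rewrite /disc /= subr0.
by move=> /(_ _ Kw)/embP; rewrite /disc /= subr0.
Qed.

Lemma example_square : G 'X^2. Proof. by apply: sub_generated; left. Qed.

Lemma example_quartic a : abs a <= 4^-1 -> G (quartic a).
Proof. by move=> a4; apply: sub_generated; right; exists a. Qed.

Lemma julia_one : julia_set G (Some 1).
Proof.
apply: (bd_julia example_class example_square (gid1 _)).
rewrite bd_def pcX filled_julia_square; apply: boundary_cdiscE => //.
by rewrite subr0 abs1.
Qed.

Lemma julia_quartic (a : C) (z : S) : abs a <= 4^-1 -> julia1 (quartic a) z -> exists2 u, z = Some u & 9 <= abs u.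
Proof.
move=> a4; rewrite (julia1_bd example_class (example_quartic a4)) => -[u bu <-]; exists u => //.
move: bu; rewrite bd_def pcX filled_julia_quartic => /boundary_cdisc h.
by have := absBD u a; lra.
Qed.

Lemma example_dis : classGdis G.
Proof.
split; first exact: example_class.
move=> cJ; have a0 : abs (0 : C) <= 4^-1 by rewrite abs0; lra.
have J10 : julia_set G (Some (rc 10)).
 apply: (bd_julia example_class (example_quartic a0) (gid1 _)).
 by rewrite bd_def pcX filled_julia_quartic; apply: boundary_cdiscE => //; rewrite subr0 abs_rcE.
have := @example_side _ 1 (rc 10) cJ (@subset_refl _ _) julia_one J10.
by rewrite abs1 abs_rcE//; lra.
Qed.

(** The quartics centred at 0 and 1/4. Their Julia sets lie in |z| >= 9, while the component of the
    point 1 stays in |z| < 7/2 and J_min, being at most that component, does not reach farther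
    out. *)
Lemma note4 : exists (G' : set {poly C}) (Jmin' : set C) (g f : {poly C}) (zg zf : C),
  [/\ classGdis G' /\ is_least_component G' Jmin',
    [/\ G' g, julia1 g `&` emb Jmin' = set0, attracting_fixed_point g zg &
      (filled_julia g)° = immediate_basin g zg],
    [/\ G' f, julia1 f `&` emb Jmin' = set0, attracting_fixed_point f zf &
      (filled_julia f)° = immediate_basin f zf] &
    zg <> zf].
Proof.
have hG := example_class; have ncJ := example_dis.2.
have [b0 ba0 least] := part2_min hG ncJ.
have JJ : Jset G (Gcf G (Some b0)) := Jset_cf hG ncJ (Jm_julia (Jm_a0 hG ncJ ba0)).
have avoid a : abs a <= 4^-1 -> julia1 (quartic a) `&` emb (Gcf G (Some b0)) = set0.
 move=> a4; apply: disjI => y /(julia_quartic a4)[u -> u9] /embP Ju.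
 have neq : Gcf G (Some b0) <> Gcf G (Some 1).
  move=> E; have : abs u < 7 / 2; last by lra.
  apply: (@example_side (connected_component (julia_set G) (Some 1)) 1 u).
  - exact: component_connected.
  - exact: connected_component_sub.
  - exact: (cf_refl julia_one).
  - by rewrite -[connected_component _ _ _]/(Gcf G (Some 1) u) -E.
  - by rewrite abs1; lra.
 have [z J1z hz] := surr_lt_far (compact_cf hG ncJ (x:=Some b0)) (ex_intro _ b0 (Jm_a0 hG ncJ ba0))
  (compact_cf hG ncJ (x:=Some 1)) (least _ (Jset_cf hG ncJ julia_one)) neq.
 have : abs z < 7 / 2; last by have := hz u Ju; lra.
 apply: (@example_side (connected_component (julia_set G) (Some 1)) 1 z) => //.
 - exact: component_connected.
 - exact: connected_component_sub.
 - exact: (cf_refl julia_one).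
 - by rewrite abs1; lra.
have main a : abs a <= 4^-1 -> [/\ G (quartic a), julia1 (quartic a) `&` emb (Gcf G (Some b0)) = set0,
  attracting_fixed_point (quartic a) a & (filled_julia (quartic a))° = immediate_basin (quartic a) a].
 move=> a4; have Gq := example_quartic a4; have av := avoid a a4.
 have [z [Pz gz gz1 cK hv]] := basin_avoiding hG ncJ ba0 Gq av.
 have qa : (quartic a).[a] = a := quartic_fixed a.
 have qa1 : abs (quartic a)^`().[a] < 1 by rewrite deriv_quartic subrr expr0n !mulr0 abs0.
 have az := attracting_unique (class_degree hG Gq) hv qa qa1.
 split=> //; first by split=> //; rewrite normE -rc1 rc_lt.
 by have := filled_julia_immediate_basin (class_degree hG Gq) gz gz1 cK hv; rewrite -az.
exists G, (Gcf G (Some b0)), (quartic 0), (quartic (rc 4^-1)), 0, (rc 4^-1); split.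
- by split; [exact: example_dis|split].
- by apply: main; rewrite abs0; lra.
- by apply: main; rewrite abs_rcE; lra.
- by move=> /(congr1 abs); rewrite abs0 abs_rcE; lra.
Qed.
End Example.

End Development.

Theorem theorem2p20 (R : realType) (G : set {poly Cplx R}) (hG : classGdis G) :
  (* 1 *)
  [/\ fatou_set G infty,
      Jhat G = [set emb K | K in Jset G],
      simply_connected R (Finfty G) &
      exists Jmax : set (Cplx R),
        [/\ Jset G Jmax,
            (forall J, Jset G J ->
               (boundary (Finfty G) `<=` emb J <-> J = Jmax)) &
            (forall J, is_greatest_component G J <-> J = Jmax)]]
  /\
  (exists Jmin : set (Cplx R),
    (* 2 *)
    [/\ (forall J, is_least_component G J <-> J = Jmin),
        (exists D : set (Cplx R),
          [/\ (forall D', components (~` Jmin) D' /\ ~ bounded_set D' <->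
                 D' = D),
              finite_postcritical G `<=` Khat G,
              Khat G `<=` ~` D &
              boundary (Khat G) `<=` Jmin]),
    (* 3 *)
        (forall (Lambda : Type) (h : Lambda -> {poly Cplx R}),
          G = generated (range h) ->
          exists l1 l2 : Lambda,
            [/\ (exists J1 J2 : set (Cplx R),
                  [/\ Jset G J1, Jset G J2, J1 <> J2,
                      julia1 (h l1) `<=` emb J1 &
                      julia1 (h l2) `<=` emb J2]),
                julia1 (h l1) `&` emb Jmin = set0,
                (forall n : nat, (0 < n)%N ->
                   iter n (sphere_map (h l1)) @^-1` julia1 (h l2)
                     `&` julia1 (h l2) = set0 /\
                   iter n (sphere_map (h l2)) @^-1` julia1 (h l1)
                     `&` julia1 (h l1) = set0) &
                (exists z1 : Cplx R,
                  [/\ attracting_fixed_point (h l1) z1,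
                      (filled_julia (h l1))° = immediate_basin (h l1) z1,
                      filled_julia (h l2) `<=` (filled_julia (h l1))° &
                      (filled_julia (h l2))° z1])]),
    (* 4 *)
        (forall g, G g -> julia1 g `&` emb Jmin = set0 ->
          exists zg : Cplx R,
            [/\ attracting_fixed_point g zg,
                (filled_julia g)° = immediate_basin g zg &
                Jmin `<=` (filled_julia g)°]) &
    (* 5 *)
        [/\ (Khat G)° !=set0,
            ~ connected (~` Jmin),
            (forall J, Jhat G J -> `I_2 #<= J) &
            (forall g, G g -> julia1 g `&` emb Jmin = set0 ->
              [/\ (exists K : set (Cplx R),
                    (forall K', is_pullback_component G g (emb Jmin) K' <->
                       K' = emb K) /\
                    surr_lt Jmin K),
                  sphere_map g @^-1` julia_set G `&` emb Jmin = set0,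
                  [set g.[z] | z in Khat G `|` Jmin] `<=` (Khat G)° &
                  (exists zg : Cplx R,
                    (forall z, attracting_fixed_point g z <-> z = zg) /\
                    (Khat G)° zg)])]])
  /\
  (* the note in 4 *)
  (exists (G' : set {poly Cplx R}) (Jmin' : set (Cplx R))
          (g f : {poly Cplx R}) (zg zf : Cplx R),
    [/\ classGdis G' /\ is_least_component G' Jmin',
        [/\ G' g, julia1 g `&` emb Jmin' = set0,
            attracting_fixed_point g zg &
            (filled_julia g)° = immediate_basin g zg],
        [/\ G' f, julia1 f `&` emb Jmin' = set0,
            attracting_fixed_point f zf &
            (filled_julia f)° = immediate_basin f zf] &
        zg <> zf])
  /\
  (* 6 *)
  (\bigcup_(U in doubly_connected_fatou_components G) U `<=` emb setT /\
   totally_ordered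
     [set finite_part U | U in doubly_connected_fatou_components G]
     (@surr_le R)).
Proof.
case: hG => cG ncJ; have [a0 ba0 least] := part2_min cG ncJ.
split.
 split; [exact: fatou_infty|exact: Jhat_emb|exact: simply_connected_Finfty|exact: part1_max].
split.
 exists (Gcf G (Some a0)); split.
 - exact: least_iff.
 - exact: part2_domain.
 - by move=> Lambda h GE; exact: (part3 cG ncJ ba0 least GE).
 - by move=> g Gg gJ; exact: (part4 cG ncJ ba0 Gg gJ).
 - split.
  + by have [a ia _] := Khat_interior_nonempty cG ncJ ba0 least; exists a.
  + exact: complement_Jm.
  + by move=> J; exact: (Jhat_card cG ncJ ba0 least).
  + by move=> g Gg gJ; exact: (part5b cG ncJ ba0 least Gg gJ).
split; first exact: note4.
exact: (part6 cG ncJ ba0 least).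
Qed.
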